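(* Let $K$ be a kernel on $\mathbb R^n\setminus\{0\}$ such that $\int_{\varepsilon<|x|<R}K(x)\,dx=0$ for all $0<\varepsilon<R<\infty$ and $|K(x)|\le C_K|x|^{-n}$ for all $x\ne0$. Let $\phi\in C_0^\infty(\mathbb R^n)$ be a non-negative radial function supported in $\{|x|\le 1/4\}$ with $\int\phi=1$, put $\phi_k(x)=2^{-kn}\phi(2^{-k}x)$ and $K_k=K\chi_{\{|\cdot|\le2^k\}}$ for $k\in\mathbb Z$, and let $Uf=\big(\sum_{k\in\mathbb Z}|\phi_k\ast K_k\ast f|^2\big)^{1/2}$. Then the following hold. (1) Size condition: for $x\in\mathbb R^n\setminus\{0\}$ and $k\in\mathbb Z$, $$|\phi_k\ast K_k(x)|\le c_n\frac{C_K}{2^{kn}} .$$ Lipschitz condition: for some exponent $\gamma\in(0,1]$ and all $0<2|y|\le|x|$, $$\sum_{k\in\mathbb Z}|\phi_k\ast K_k(x-y)-\phi_k\ast K_k(x)|\le c_nC_K\frac{|y|^\gamma}{|x|^{n+\gamma}} .$$ (2) $L^2$ boundedness: $\|Uf\|_{L^2}\le c_nC_K\|f\|_{L^2}$. Weak type $(1,1)$ boundedness: $\|Uf\|_{L^{1,\infty}}\le c_nC_K\|f\|_{L^1}$. Weak type $(1,1)$ boundedness of the grand maximal truncated operator: $\|\mathcal M_Uf\|_{L^{1,\infty}}\le c_nC_K\|f\|_{L^1}$. (3) Weighted norm inequalities: for all $1<p<\infty$, $w\in A_p$ and $f\in L^p(w)$, $$\|Uf\|_{L^p(w)}\le c_{p,n}\,C_K\,\{w\}_{A_p}\|f\|_{L^p(w)}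 .$$
   Context: The function $\phi$ is fixed; the constants $c_n$, $c_{p,n}$ depend only on the indicated parameters (and on the fixed $\phi$). The convolution $\phi_k\ast K_k$ is understood in the principal value sense, $\phi_k\ast K_k(x)=\lim_{\varepsilon\to0}\int_{\varepsilon<|z|\le2^k}\phi_k(x-z)K(z)\,dz$. $\|g\|_{L^{1,\infty}}=\sup_{\alpha>0}\alpha|\{|g|>\alpha\}|$. Grand maximal truncated operator of a sublinear operator $U$: $$\mathcal M_Uf(x)=\sup_{Q\ni x}\ \operatorname*{ess\,sup}_{\xi\in Q}|U(f\chi_{\mathbb R^n\setminus3Q})(\xi)|,$$ the supremum being over all cubes $Q\subset\mathbb R^n$ containing $x$; $3Q$ is the concentric cube with three times the side length. Weights: a weight is a non-negative locally integrable function $w$ on $\mathbb R^n$; $\|f\|_{L^p(w)}=(\int|f|^pw)^{1/p}$; $p'=p/(p-1)$. For $1<p<\infty$, $w\in A_p$ means $$[w]_{A_p}=\sup_Q\Big(\frac1{|Q|}\int_Qw\Big)\Big(\frac1{|Q|}\int_Qw^{1-p'}\Big)^{p-1}<\infty,$$ and $[w]_{A_\infty}=\sup_Q\frac1{w(Q)}\int_QM(w\chi_Q)\,dx$, where $w(Q)=\int_Q w$, $M$ is the Hardy–Littlewood maximal operator and $Q$ ranges over cubes with edges parallel to the axes. Moreover $\{w\}_{A_p}=[w]_{A_p}^{1/p}\max\{[w]_{A_\infty}^{1/p'},[w^{1-p'}]_{A_\infty}^{1/p}\}$. *)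

(* Defs.v *)
From HB Require Import structures.
From mathcomp Require Import all_boot all_order all_algebra.
From mathcomp Require Import all_classical all_reals all_analysis.
From mathcomp Require Import ess_sup_inf complex.
Set Implicit Arguments.
Unset Strict Implicit.
Unset Printing Implicit Defensive.
Import Order.TTheory GRing.Theory Num.Theory.
Import numFieldNormedType.Exports.
Local Open Scope classical_set_scope.
Local Open Scope ring_scope.

Definition rV_display : measure_display. Proof. exact. Qed.

Section rV_measurable.
Context {R : realType} {n : nat}.

(* Product sigma-algebra on R^n; it coincides with the Borel sigma-algebra. *)
Definition rV_coord (i : 'I_n) (x : 'rV[R]_n) : measurableTypeR R := x ord0 i.

Definition rV_measurable : set (set 'rV[R]_n) := g_sigma_preimage rV_coord.

Let rV_set0 : rV_measurable set0.
Proof. exact: sigma_algebra0. Qed.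

Let rV_setC A : rV_measurable A -> rV_measurable (~` A).
Proof. exact: sigma_algebraC. Qed.

Let rV_bigcup (F : _^nat) : (forall i, rV_measurable (F i)) ->
  rV_measurable (\bigcup_i F i).
Proof. exact: sigma_algebra_bigcup. Qed.

HB.instance Definition _ := @isMeasurable.Build rV_display 'rV[R]_n
  rV_measurable rV_set0 rV_setC rV_bigcup.

End rV_measurable.

Section rV_cons.
Context {R : realType}.

Definition rV_cons {n} (p : measurableTypeR R * 'rV[R]_n) : 'rV[R]_n.+1 :=
  \row_i (if unlift ord0 i is Some j then p.2 ord0 j else p.1).

Lemma measurable_rV_coord n (i : 'I_n) :
  measurable_fun setT (@rV_coord R n i).
Proof.
move=> _ Y mY; rewrite setTI; apply: sub_sigma_algebra => /=.
rewrite -bigcup_seq/=; exists i => /=; first by rewrite mem_index_enum.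
by exists Y => //; rewrite setTI.
Qed.

Lemma measurable_rV d (T : measurableType d) n (f : T -> 'rV[R]_n) :
  (forall i, measurable_fun setT (@rV_coord R n i \o f)) ->
  measurable_fun setT f.
Proof.
move=> mf.
suff prefS : g_sigma_preimage (fun i => @rV_coord R n i \o f) `<=` measurable.
  rewrite g_sigma_preimage_comp in prefS.
  by move=> _ A mA; apply: prefS; exists A.
apply: smallest_sub; first exact: sigma_algebra_measurable.
case: n => [|n] in f mf *; first by rewrite big_ord0.
rewrite -bigcup_mkord_ord; apply: bigcup_sub => i Ii.
by move=> A [B mB <-]; exact: mf.
Qed.

Lemma measurable_rV_cons n : measurable_fun setT (@rV_cons n).
Proof.
apply: measurable_rV => i.
case: (unliftP ord0 i) => [j|] ->.
  rewrite (_ : _ \o _ = @rV_coord R n j \o snd); last first.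
    by apply/funext => x /=; rewrite /rV_coord mxE liftK.
  by apply: measurableT_comp => //; exact: measurable_rV_coord.
rewrite (_ : _ \o _ = fst) //.
by apply/funext => x /=; rewrite /rV_coord mxE unlift_none.
Qed.


Definition rV_uncons {n} (x : 'rV[R]_n.+1) : measurableTypeR R * 'rV[R]_n :=
  (x ord0 ord0, \row_j x ord0 (lift ord0 j)).

Lemma rV_consK n : cancel (@rV_cons n) rV_uncons.
Proof.
move=> [a v]; rewrite /rV_uncons /rV_cons mxE unlift_none; congr (_, _).
by apply/rowP => j; rewrite !mxE liftK.
Qed.

Lemma measurable_rV_uncons n : measurable_fun setT (@rV_uncons n).
Proof.
apply: measurable_fun_pair; first exact: measurable_rV_coord.
apply: measurable_rV => i.
rewrite (_ : _ \o _ = @rV_coord R n.+1 (lift ord0 i)).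
  exact: measurable_rV_coord.
by apply/funext => x; rewrite /rV_coord /= mxE.
Qed.

End rV_cons.

Section rV_lebesgue_succ.
Context {R : realType} {n : nat}.
Variable m : {sigma_finite_measure set 'rV[R]_n -> \bar R}.
Local Open Scope ereal_scope.

Definition rV_lebesgue_succ : set 'rV[R]_n.+1 -> \bar R :=
  pushforward (@lebesgue_measure R \x m) rV_cons.

Let pm : {measure set (measurableTypeR R * 'rV[R]_n)%type -> \bar R} :=
  @lebesgue_measure R \x m.

Let succ0 : rV_lebesgue_succ set0 = 0.
Proof. exact: (measure0 pm). Qed.

Let succ_ge0 A : 0 <= rV_lebesgue_succ A.
Proof. exact: (measure_ge0 pm). Qed.

Let succ_sigma_additive : semi_sigma_additive rV_lebesgue_succ.
Proof.
have mc A : measurable A -> measurable (@rV_cons R n @^-1` A).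
  by move=> mA; rewrite -[X in measurable X]setTI; exact: measurable_rV_cons.
move=> F mF tF mUF; rewrite /rV_lebesgue_succ /pushforward preimage_bigcup.
apply: (@measure_semi_sigma_additive _ _ _ pm).
- by move=> k; exact: mc.
- apply/trivIsetP => /= i j _ _ ij; rewrite -preimage_setI.
  by move/trivIsetP : tF => /(_ _ _ _ _ ij) ->//; rewrite preimage_set0.
- by rewrite -preimage_bigcup; exact: mc.
Qed.

HB.instance Definition _ := isMeasure.Build _ _ _ rV_lebesgue_succ
  succ0 succ_ge0 succ_sigma_additive.

Let succ_sigma_finite : sigma_finite setT rV_lebesgue_succ.
Proof.
have /sigma_finiteP[F [FT Fnd Foo]] := sigma_finiteT (@lebesgue_measure R).
have /sigma_finiteP[G [GT Gnd Goo]] := sigma_finiteT m.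
exists (fun k => rV_uncons @^-1` (F k `*` G k)).
  rewrite -preimage_bigcup; apply/esym/seteqP; split => // x _.
  have [i _ Fi] : (\bigcup_k F k) (rV_uncons x).1 by rewrite -FT.
  have [j _ Gj] : (\bigcup_k G k) (rV_uncons x).2 by rewrite -GT.
  exists (maxn i j) => //; split => /=.
    by move: Fi; exact/subsetPset/Fnd/leq_maxl.
  by move: Gj; exact/subsetPset/Gnd/leq_maxr.
move=> k; have [mF Fk] := Foo k; have [mG Gk] := Goo k.
have mFG : measurable (F k `*` G k) by exact: measurableX.
split.
  by rewrite -[X in measurable X]setTI; exact: measurable_rV_uncons.
rewrite /rV_lebesgue_succ /pushforward -comp_preimage.
rewrite (_ : _ \o _ = id); last by rewrite funeqE => p /=; rewrite rV_consK.
by rewrite preimage_id product_measure1E// lte_mul_pinfty// ge0_fin_numE.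
Qed.

HB.instance Definition _ := Measure_isSigmaFinite.Build _ _ _ rV_lebesgue_succ
  succ_sigma_finite.

End rV_lebesgue_succ.

(* n-dimensional Lebesgue measure on Borel sets; see [rV_lebesgue_box]. *)
Fixpoint rV_lebesgue {R : realType} (n : nat) :
    {sigma_finite_measure set 'rV[R]_n -> \bar R} :=
  match n with
  | 0 => \d_(0 : 'rV[R]_0)
  | n'.+1 => rV_lebesgue_succ (rV_lebesgue n')
  end.

Lemma rV_lebesgue_box {R : realType} n (a b : 'rV[R]_n) :
  (forall i, a ord0 i <= b ord0 i) ->
  rV_lebesgue n [set x | forall i, a ord0 i < x ord0 i < b ord0 i] =
  (\prod_(i < n) (b ord0 i - a ord0 i))%:E.
Proof.
elim: n a b => [|n ih] a b ab.
  rewrite big_ord0 /= diracE mem_set //.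
  by move=> [].
set a' : 'rV[R]_n := \row_j a ord0 (lift ord0 j).
set b' : 'rV[R]_n := \row_j b ord0 (lift ord0 j).
rewrite /= /rV_lebesgue_succ /pushforward.
rewrite (_ : _ @^-1` _ = `]a ord0 ord0, b ord0 ord0[%classic `*`
   [set x : 'rV[R]_n | forall i, a' ord0 i < x ord0 i < b' ord0 i]); last first.
  apply/seteqP; split => -[t x] /=.
    move=> H; split.
      by have := H ord0; rewrite /rV_cons mxE unlift_none in_itv.
    by move=> i; have := H (lift ord0 i); rewrite !mxE liftK.
  move=> [H0 H1] i; case: (unliftP ord0 i) => [j|] ->.
    by have := H1 j; rewrite !mxE liftK.
  by rewrite mxE unlift_none; rewrite /= in_itv in H0.
rewrite product_measure1E //; last first.
  rewrite (_ : mkset _ = \big[setI/setT]_(i < n)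
      (@rV_coord R n i @^-1` `]a' ord0 i, b' ord0 i[%classic)).
    apply: bigsetI_measurable => i _; rewrite -[X in measurable X]setTI.
    exact: measurable_rV_coord.
  rewrite -bigcap_seq; apply/seteqP; split => x /= H.
    by move=> i _ /=; rewrite in_itv /=; exact: H.
  by move=> i; have := H i (mem_index_enum _); rewrite /= in_itv.
rewrite ih; last by move=> i; rewrite !mxE.
rewrite /= (lebesgue_measure_itv `]a ord0 ord0, b ord0 ord0[) /= lte_fin.
rewrite big_ord_recl.
have -> : \prod_(i < n) (b' ord0 i - a' ord0 i) =
  \prod_(i < n) (b ord0 (lift ord0 i) - a ord0 (lift ord0 i)).
  by apply: eq_bigr => i _; rewrite !mxE.
case: ltP => h.
  by rewrite -EFinB -EFinM.
have -> : b ord0 ord0 - a ord0 ord0 = 0.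
  by apply/eqP; rewrite subr_eq0 eq_le h ab.
by rewrite mul0r mul0e.
Qed.

Section euclidean.
Context {R : realType} {n : nat}.
Implicit Types (x c : 'rV[R]_n) (r : R).

(* The library norm [`|x|] on row vectors is the maximum norm. *)
Definition enorm x : R := Num.sqrt (\sum_(i < n) x ord0 i ^+ 2).

(* Open axis-parallel cube with center c and side length 2r, so that the
   concentric cube with three times the side length is [cube c (3 * r)]. *)
Definition cube c r : set 'rV[R]_n :=
  [set x | forall i, `|x ord0 i - c ord0 i| < r].

(* Lebesgue measurability: equality a.e. to a Borel function.  The library
   integral with respect to Borel Lebesgue measure is a supremum over Borel
   simple functions from below, so it agrees on such functions with the
   integral for the completed measure. *)
Definition lebesgue_measurable (f : 'rV[R]_n -> R) :=
  exists2 g : 'rV[R]_n -> R,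
    measurable_fun setT g & \forall x \ae rV_lebesgue n, f x = g x.

Definition clebesgue_measurable (f : 'rV[R]_n -> R[i]) :=
  lebesgue_measurable (fun x => complex.Re (f x)) /\
  lebesgue_measurable (fun x => complex.Im (f x)).

Definition cintegral (D : set 'rV[R]_n) (f : 'rV[R]_n -> R[i]) : R[i] :=
  ((\int[rV_lebesgue n]_(x in D) complex.Re (f x))
    +i* (\int[rV_lebesgue n]_(x in D) complex.Im (f x)))%C.

Fixpoint iter_partial (s : seq 'I_n) (f : 'rV[R]_n -> R) : 'rV[R]_n -> R :=
  match s with
  | [::] => f
  | i :: s' => fun x => 'D_(delta_mx ord0 i) (iter_partial s' f) x
  end.

Definition smooth (f : 'rV[R]_n -> R) :=
  forall s : seq 'I_n, continuous (iter_partial s f) /\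
    forall (i : 'I_n) x, derivable (iter_partial s f) x (delta_mx ord0 i).

Definition radial (f : 'rV[R]_n -> R) :=
  forall x y, enorm x = enorm y -> f x = f y.

End euclidean.

Section square_function.
Context {R : realType} {n : nat}.
Variables (phi : 'rV[R]_n -> R) (K : 'rV[R]_n -> R[i]).
Implicit Types (k : int) (x : 'rV[R]_n) (e : R) (f : 'rV[R]_n -> R[i]).

Definition dilate k x : R := 2 ^ (- (k * n%:Z)) * phi (2 ^ (- k) *: x).

Definition pv_trunc k x e : R[i] :=
  cintegral [set z | e < enorm z <= 2 ^ k]
    (fun z => (dilate k (x - z))%:C%C * K z).

(* The principal value phi_k * K_k; only the values of K off 0 matter. *)
Definition pv_conv k x : R[i] :=
  ((lim (complex.Re (pv_trunc k x e) @[e --> 0^'+]))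
    +i* (lim (complex.Im (pv_trunc k x e) @[e --> 0^'+])))%C.

Definition pv_conv_exists k x :=
  cvg (complex.Re (pv_trunc k x e) @[e --> 0^'+]) /\
  cvg (complex.Im (pv_trunc k x e) @[e --> 0^'+]).

Definition conv_op k f x : R[i] :=
  cintegral setT (fun y => pv_conv k (x - y) * f y).

Definition square_fun f x : \bar R :=
  ((\esum_(k in [set: int]) (Normc.normc (conv_op k f x) ^+ 2)%:E) `^ 2^-1)%E.

End square_function.

Section maximal_weights.
Context {R : realType} {n : nat}.
Local Notation mu := (rV_lebesgue n).
Local Open Scope ereal_scope.
Implicit Types (g v : 'rV[R]_n -> \bar R) (w : 'rV[R]_n -> R) (p : R).

Definition cabs (f : 'rV[R]_n -> R[i]) : 'rV[R]_n -> \bar R :=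
  fun x => (Normc.normc (f x))%:E.

Definition weakL1_norm g : \bar R :=
  ereal_sup [set a%:E * mu [set x | a%:E < `|g x|] | a in [set a : R | (0 < a)%R]].

(* As the function is non-negative, its essential supremum over Q is the
   global essential supremum of its extension by 0 outside Q. *)
Definition grand_maximal (U : ('rV[R]_n -> R[i]) -> 'rV[R]_n -> \bar R)
    (f : 'rV[R]_n -> R[i]) (x : 'rV[R]_n) : \bar R :=
  ereal_sup [set s | exists c r, [/\ (0 < r)%R, cube c r x &
    s = ess_sup mu (patch (fun=> 0) (cube c r)
          (fun xi => `|U (patch (fun=> 0%R) (~` cube c (3 * r)%R) f) xi|))]].

Definition average (Q : set 'rV[R]_n) v : \bar R :=
  (mu Q)^-1 * \int[mu]_(x in Q) v x.

Definition HL_max v (x : 'rV[R]_n) : \bar R :=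
  ereal_sup [set s | exists c r, [/\ (0 < r)%R, cube c r x &
    s = average (cube c r) (fun y => `|v y|)]].

Definition weight w :=
  [/\ forall x, (0 <= w x)%R, lebesgue_measurable w &
    forall D : set 'rV[R]_n, compact D -> \int[mu]_(x in D) (w x)%:E < +oo].

Definition conj_exp p : R := (p / (p - 1))%R.

(* w^(1-p'); the exponent is negative, so the value is +oo where w vanishes
   (whereas the library real power has 0 `^ a = 0 for a < 0). *)
Definition dual_weight p w : 'rV[R]_n -> \bar R :=
  fun x => if w x == 0%R then +oo else (w x `^ (1 - conj_exp p))%:E.

Definition Ap_const p w : \bar R :=
  ereal_sup [set s | exists c r, (0 < r)%R /\
    s = average (cube c r) (EFin \o w) *
        average (cube c r) (dual_weight p w) `^ (p - 1)].

Definition Ap p w := weight w /\ Ap_const p w < +oo.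

Definition Ainfty_const v : \bar R :=
  ereal_sup [set s | exists c r, (0 < r)%R /\
    s = (\int[mu]_(x in cube c r) v x)^-1 *
        \int[mu]_(x in cube c r) HL_max (patch (fun=> 0) (cube c r) v) x].

Definition mixed_Ap_const p w : \bar R :=
  Ap_const p w `^ p^-1 *
  maxe (Ainfty_const (EFin \o w) `^ (conj_exp p)^-1)
       (Ainfty_const (dual_weight p w) `^ p^-1).

Definition weighted_norm p w g : \bar R :=
  (\int[mu]_x (`|g x| `^ p * (w x)%:E)) `^ p^-1.

End maximal_weights.

(* Main.v *)
(* With gamma = 1 everything reduces to real kernels psi_k at the scales
   q = 2^k, supported in |x| <= 2q, bounded by q^-n, Lipschitz with constant
   q^-(n+1) and of mean zero: since K has mean zero over annuli, phi_k * K_k is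
   the absolutely convergent integral of (phi_k(x - z) - phi_k(x)) K_k(z), and
   phi is Lipschitz together with its first differences.  Only these
   properties are used afterwards.

   L2: Cotlar's argument, since T_j T_k^* gains a factor 2^-|j - k|.
   Weak (1,1): a Calderon-Zygmund decomposition by dyadic conditional
   expectations; the bad part is estimated through the Lipschitz bound of the
   kernels, so that no differentiation theorem is needed.  The grand maximal
   operator is dominated by U and the Hardy-Littlewood maximal function.
   Weights: finitely many scales of U are dominated pointwise, in the square,
   by sparse sums over finitely many shifted dyadic grids; each sparse sum is
   transferred to a finite tree, where the mixed A_p - A_infinity bound is
   proved stratum by stratum according to the size of the joint average
   <w> <sigma>^(p-1), from Kolmogorov's inequality and a Carleson embedding. *)

Require Import Defs.
From HB Require Import structures.
From mathcomp Require Import all_boot all_order all_algebra.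
From mathcomp Require Import all_classical all_reals all_analysis.
From mathcomp Require Import measurable_realfun ess_sup_inf complex zify ring lra.
Set Implicit Arguments.
Unset Strict Implicit.
Unset Printing Implicit Defensive.
Import Order.TTheory GRing.Theory Num.Theory.
Import numFieldNormedType.Exports.
Local Open Scope classical_set_scope.
Local Open Scope ring_scope.

(** * Borel structure and Lebesgue measure of R^n *)

(** No constant may depend on the number of scales: the estimates are proved for a finite window of
    scales and monotone convergence removes the window. The finest scale is a floor below which
    nothing is resolved; averages over its cells replace point values, so that stopping arguments,
    sparse families and weights become finite objects. The square sum is dominated by squared means
    over selected cells, hence by the square of a linear sparse sum. The loss is harmless because
    [mixed_Ap_const] is the constant of linear sparse sums: if D bounds the joint averages and A, B
    the A_infinity constants of the weight and its dual, the p-th power of the norm costs D (B +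
    A^(p-1)), and the p-th root of this is comparable to the mixed constant. Data are only a.e.
    equal to Borel functions, and maximal operators are suprema over uncountable families. The
    exceptional sets tied to them are unions of open cubes or of grid cells, and integrals are
    compared by monotonicity without measurability. Complex objects are split into real and
    imaginary parts, and the kernel constant is divided out, to come back as a scalar factor. *)

Section rV_borel.
Context {R : realType} {n : nat}.
Local Notation V := 'rV[R]_n.
Implicit Types (x y c : V) (r : R).

Lemma norm_rV_lt x r : 0 < r -> (`|x| < r) = [forall i, `|x ord0 i| < r].
Proof.
move=> r0; rewrite /Num.norm/= mx_normrE; apply/idP/forallP.
  by move=> /bigmax_ltP[_ H] i; exact: (H (ord0, i)).
by move=> H; apply/bigmax_ltP; split=> // -[i j] _ /=; rewrite ord1; exact: H.
Qed.

Lemma norm_coord x i : `|x ord0 i| <= `|x|.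
Proof.
rewrite {2}/Num.norm/= mx_normrE.
exact: (@le_bigmax _ _ _ 0 (fun ij : 'I_1 * 'I_n => `|x ij.1 ij.2|) (ord0, i)).
Qed.

Lemma norm_rV_le x r : 0 <= r -> (forall i, `|x ord0 i| <= r) -> `|x| <= r.
Proof.
move=> r0 H; rewrite /Num.norm/= mx_normrE.
by apply/bigmax_leP; split=> // -[i j] _ /=; rewrite ord1; exact: H.
Qed.

Lemma cubeE c r x : 0 < r -> cube c r x <-> `|x - c| < r.
Proof.
move=> r0; rewrite norm_rV_lt//; split=> [H|/forallP H i].
  by apply/forallP => i; have := H i; rewrite !mxE.
by have := H i; rewrite !mxE.
Qed.

Lemma cube_ball c r : 0 < r -> cube c r = ball c r.
Proof.
move=> r0; apply/seteqP; split => x.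
  by move/(cubeE c x r0); rewrite -ball_normE/= distrC.
by rewrite -ball_normE/= distrC => /(cubeE c x r0).
Qed.

Lemma open_cube c r : 0 < r -> open (cube c r).
Proof. by move=> r0; rewrite cube_ball//; exact: ball_open. Qed.

Lemma measurable_coord (i : 'I_n) :
  measurable_fun setT (fun x : V => x ord0 i : measurableTypeR R).
Proof. exact: measurable_rV_coord. Qed.

Lemma measurable_cube c r : measurable (cube c r).
Proof.
rewrite (_ : cube c r = \big[setI/setT]_(i < n)
    ((fun x : V => x ord0 i : measurableTypeR R) @^-1` `](c ord0 i - r), (c ord0 i + r)[%classic)).
  apply: bigsetI_measurable => i _; rewrite -[X in measurable X]setTI.
  exact: measurable_coord.
rewrite -bigcap_seq; apply/seteqP; split => x /= H.
  move=> i _ /=; rewrite in_itv/=; have := H i; rewrite ltr_distl.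
  by rewrite ltrBlDr.
move=> i; have := H i (mem_index_enum _); rewrite /= in_itv/=.
by rewrite ltr_distl ltrBlDr.
Qed.

(** The cubes with rational centre and radius [1 / (m + 1)] that lie in [A] cover it. This countable
    union ties the norm topology to the product sigma-algebra. *)
Lemma open_rV_measurable (A : set V) : open A -> measurable A.
Proof.
move=> oA.
pose F (p : 'rV[rat]_n * nat) : set V :=
  let B := cube (map_mx ratr p.1) (p.2.+1%:R^-1) in
  if `[< B `<=` A >] then B else set0.
rewrite (_ : A = \bigcup_p F p).
  apply: countable_bigcupT_measurable; first exact: countableP.
  by move=> p; rewrite /F; case: ifP => _; [exact: measurable_cube|exact: measurable0].
apply/seteqP; split => x.
  move=> Ax; have /nbhs_ballP[e /= e0 eA] := open_nbhs_nbhs (conj oA Ax).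
  (* Half of [e] suffices: [x] and any point of the cube are both within [1 / (m + 1)] of its
     centre. *)
  have [m me] : exists m : nat, m.+1%:R^-1 < e / 2.
    exists (Num.truncn (2 / e)); rewrite -[_ / 2]invrK ltf_pV2 ?posrE ?invr_gt0 ?divr_gt0//.
    by rewrite invf_div; apply: truncnS_gt.
  have H i : {q : rat | `|x ord0 i - ratr q| < m.+1%:R^-1}.
    apply/cid; have : x ord0 i - m.+1%:R^-1 < x ord0 i + m.+1%:R^-1.
      by rewrite ltrBlDr -addrA ltrDl addr_gt0// invr_gt0.
    move=> /rat_in_itvoo[q]; rewrite in_itv/= => /andP[q1 q2].
    by exists q; rewrite distrC ltr_distl q1 q2.
  exists (\row_i projT1 (H i), m) => //; rewrite /F/=.
  set B := cube _ _.
  have BA : B `<=` A.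
    move=> y By; apply: eA; rewrite -ball_normE/= norm_rV_lt//.
    apply/forallP => i; rewrite !mxE.
    have := By i; rewrite !mxE => B1; have B2 := projT2 (H i).
    move: B1 B2; set q := ratr _ => B1 B2.
    rewrite (_ : x ord0 i - y ord0 i = (x ord0 i - q) - (y ord0 i - q)); last by ring.
    apply: le_lt_trans (ler_normB _ _) _.
    rewrite (splitr e); apply: ltrD; [exact: lt_trans B2 me|exact: lt_trans B1 me].
  rewrite asboolT// => i; rewrite !mxE; exact: (projT2 (H i)).
move=> [p _]; rewrite /F; case: asboolP => //; exact.
Qed.

Lemma continuous_rV_measurable (f : V -> R) :
  continuous f -> measurable_fun setT f.
Proof.
move=> /continuousP cf; apply: (measurability _ (RGenOInfty.measurableE R)).
move=> /= _ [_ [x ->] <-]; apply: open_rV_measurable; rewrite setTI.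
by apply: cf; exact: interval_open.
Qed.

Lemma measurable_rV_sub : measurable_fun setT (fun p : V * V => p.1 - p.2).
Proof.
apply: measurable_rV => i.
rewrite (_ : _ \o _ = (fun p : V * V => p.1 ord0 i - p.2 ord0 i)); last first.
  by apply/funext => p; rewrite /rV_coord/= !mxE.
have m1 := measurableT_comp (measurable_coord i) (@measurable_fst _ _ V V).
have m2 := measurableT_comp (measurable_coord i) (@measurable_snd _ _ V V).
exact: (measurable_funB m1 m2).
Qed.

Lemma measurable_rV_subl x : measurable_fun setT (fun y : V => x - y).
Proof.
apply: measurable_rV => i.
rewrite (_ : _ \o _ = (fun p : V => x ord0 i - p ord0 i)); last first.
  by apply/funext => p; rewrite /rV_coord/= !mxE.
exact: (measurable_funB (measurable_cst _) (measurable_coord i)).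
Qed.

Lemma measurable_rV_addr x : measurable_fun setT (fun y : V => y + x).
Proof.
apply: measurable_rV => i.
rewrite (_ : _ \o _ = (fun p : V => p ord0 i + x ord0 i)); last first.
  by apply/funext => p; rewrite /rV_coord/= !mxE.
exact: (measurable_funD (measurable_coord i) (measurable_cst _)).
Qed.

Lemma measurable_rV_opp : measurable_fun setT (fun y : V => - y).
Proof.
have := measurable_rV_subl 0; rewrite (_ : (fun y : V => _) = -%R)//.
by apply/funext => y; rewrite sub0r.
Qed.

Lemma measurable_rV_norm : measurable_fun setT (fun y : V => `|y|).
Proof. by apply: continuous_rV_measurable => x; exact: norm_continuous. Qed.

Lemma enorm_ge0 x : 0 <= enorm x. Proof. exact: sqrtr_ge0. Qed.

Lemma norm_le_enorm x : `|x| <= enorm x.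
Proof.
apply: norm_rV_le => [|i]; first exact: enorm_ge0.
rewrite -sqrtr_sqr ler_sqrt ?sumr_ge0// => [|j _]; last exact: sqr_ge0.
by rewrite (bigD1 i)//= lerDl sumr_ge0// => j _; exact: sqr_ge0.
Qed.

Lemma enorm_le_norm x : enorm x <= Num.sqrt n%:R * `|x|.
Proof.
rewrite -[X in _ * X]ger0_norm// -sqrtr_sqr -sqrtrM// ler_sqrt ?mulr_ge0 ?sqr_ge0//.
apply: (@le_trans _ _ (\sum_(i < n) `|x| ^+ 2)).
  apply: ler_sum => i _; rewrite -[leLHS]ger0_norm ?sqr_ge0// normrX.
  by rewrite lerXn2r ?nnegrE// norm_coord.
by rewrite big_const_ord iter_addr_0 mulr_natl.
Qed.

Lemma measurable_enorm : measurable_fun setT (@enorm R n).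
Proof.
apply: measurableT_comp; first by apply: continuous_measurable_fun; exact: sqrt_continuous.
by apply: measurable_sum => i; apply: measurable_funX; exact: measurable_coord.
Qed.

Lemma rV_lebesgue_cube c r : 0 <= r ->
  rV_lebesgue n (cube c r) = ((2 * r) ^+ n)%:E.
Proof.
move=> r0; pose a : V := \row_i (c ord0 i - r); pose b : V := \row_i (c ord0 i + r).
have -> : cube c r = [set x | forall i, a ord0 i < x ord0 i < b ord0 i].
  by apply/seteqP; split => x /= H i; have := H i; rewrite !mxE ltr_distl ltrBlDr.
rewrite rV_lebesgue_box; last by move=> i; rewrite !mxE; lra.
congr EFin; rewrite (eq_bigr (fun=> 2 * r)) ?prodr_const ?card_ord// => i _.
by rewrite !mxE; ring.
Qed.

End rV_borel.

(** * Translation and reflection invariance of the integral *)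

Section rV_integral.
Context {R : realType}.
Local Open Scope ereal_scope.
Local Notation mu := (rV_lebesgue _).

(** Tonelli for the recursively defined measure: the first coordinate is split off. It drives the
    inductions on the dimension. *)
Lemma rV_integral_succ n (f : 'rV[R]_n.+1 -> \bar R) :
  measurable_fun setT f -> (forall x, 0 <= f x) ->
  \int[rV_lebesgue n.+1]_x f x =
  \int[@lebesgue_measure R]_t \int[rV_lebesgue n]_v f (rV_cons (t, v)).
Proof.
move=> mf f0.
have mfc : measurable_fun setT (f \o @rV_cons R n).
  by apply: measurableT_comp => //; exact: measurable_rV_cons.
rewrite -(@fubini_tonelli1 _ _ _ _ _ _ _ (f \o @rV_cons R n))//; last by move=> x /=.
pose pm : {measure set (measurableTypeR R * 'rV[R]_n)%type -> \bar R} :=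
  @lebesgue_measure R \x rV_lebesgue n.
transitivity (\int[pm]_(x in @rV_cons R n @^-1` setT) (f \o @rV_cons R n) x); last first.
  by rewrite preimage_setT.
rewrite -(ge0_integral_pushforward (@measurable_rV_cons R n))//.
Qed.

(** The shifted measure agrees with Lebesgue measure on half-open intervals, and uniqueness extends
    this to all Borel sets. *)
Lemma ge0_integral_shift1 (f : R -> \bar R) (a : R) :
  measurable_fun setT f -> (forall x, 0 <= f x) ->
  \int[@lebesgue_measure R]_t f (t + a)%R = \int[@lebesgue_measure R]_t f t.
Proof.
move=> mf f0.
have ms : measurable_fun setT ((fun t => t + a)%R : measurableTypeR R -> measurableTypeR R).
  by apply: measurable_funD => //; exact: measurable_cst.
transitivity (\int[@lebesgue_measure R]_(x in (fun t => t + a)%R @^-1` setT)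
   (f \o (fun t => t + a)%R) x); first by rewrite preimage_setT.
rewrite -(ge0_integral_pushforward ms)//.
apply: eq_measure_integral => //= A mA _; apply/esym.
apply: lebesgue_measure_unique => //= _ [[b c]] _ <- /=.
rewrite /pushforward (_ : _ @^-1` _ = `](b - a)%R, (c - a)%R]%classic).
  rewrite !lebesgue_measure_itv/= !lte_fin ltrD2r.
  by case: ifPn => // _; congr EFin; ring.
apply/seteqP; split => x /=; rewrite !in_itv/=; lra.
Qed.

Lemma ge0_integral_opp1 (f : R -> \bar R) :
  measurable_fun setT f -> (forall x, 0 <= f x) ->
  \int[@lebesgue_measure R]_t f (- t)%R = \int[@lebesgue_measure R]_t f t.
Proof.
move=> mf f0.
have ms : measurable_fun setT (-%R : measurableTypeR R -> measurableTypeR R).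
  by apply: measurable_funN; exact: measurable_id.
transitivity (\int[@lebesgue_measure R]_(x in -%R @^-1` setT)
   (f \o -%R) x); first by rewrite preimage_setT.
rewrite -(ge0_integral_pushforward ms)//.
by apply: eq_measure_integral => //= A mA _; exact: lebesgue_measureN.
Qed.

Let meas_cons n (f : 'rV[R]_n.+1 -> \bar R) : measurable_fun setT f ->
  measurable_fun setT (fun p : measurableTypeR R * 'rV[R]_n => f (rV_cons p)).
Proof. by move=> mf; apply: measurableT_comp => //; exact: measurable_rV_cons. Qed.

(** Induction on the dimension: the first coordinate is shifted on the line, the others by the
    induction hypothesis under the inner integral. *)
Lemma ge0_integral_rV_shift n (f : 'rV[R]_n -> \bar R) (a : 'rV[R]_n) :
  measurable_fun setT f -> (forall x, 0 <= f x) ->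
  \int[rV_lebesgue n]_x f (x + a)%R = \int[rV_lebesgue n]_x f x.
Proof.
elim: n f a => [|n ih] f a mf f0.
  by apply: eq_integral => x _; congr f; apply/rowP => -[].
have mfa : measurable_fun setT (fun x : 'rV[R]_n.+1 => f (x + a)%R).
  by apply: measurableT_comp => //; exact: measurable_rV_addr.
apply: (etrans (rV_integral_succ mfa (fun=> f0 _))).
apply/esym; apply: (etrans (rV_integral_succ mf f0)); apply/esym.
pose F t := \int[rV_lebesgue n]_v f (rV_cons (t, v)).
rewrite -/F -(@ge0_integral_shift1 F (a ord0 ord0)); last 2 first.
- exact: (@measurable_fun_fubini_tonelli_F _ _ _ _ _ _ (fun p => f (rV_cons p)) (meas_cons mf)).
- by move=> t; apply: integral_ge0.
apply: eq_integral => t _; rewrite /F.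
rewrite -(ih (fun v => f (rV_cons ((t + a ord0 ord0)%R, v))) (\row_j a ord0 (lift ord0 j)))//.
  apply: eq_integral => v _; congr f; apply/rowP => i; rewrite !mxE.
  by case: unliftP => [j ->|->]//=; rewrite !mxE.
apply: (measurableT_comp (meas_cons mf)); exact: measurable_pair1.
Qed.

Lemma ge0_integral_rV_opp n (f : 'rV[R]_n -> \bar R) :
  measurable_fun setT f -> (forall x, 0 <= f x) ->
  \int[rV_lebesgue n]_x f (- x)%R = \int[rV_lebesgue n]_x f x.
Proof.
elim: n f => [|n ih] f mf f0.
  by apply: eq_integral => x _; congr f; apply/rowP => -[].
have mfa : measurable_fun setT (fun x : 'rV[R]_n.+1 => f (- x)%R).
  by apply: measurableT_comp => //; exact: measurable_rV_opp.
apply: (etrans (rV_integral_succ mfa (fun=> f0 _))).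
apply/esym; apply: (etrans (rV_integral_succ mf f0)); apply/esym.
pose F t := \int[rV_lebesgue n]_v f (rV_cons (t, v)).
rewrite -/F -(@ge0_integral_opp1 F); last 2 first.
- exact: (@measurable_fun_fubini_tonelli_F _ _ _ _ _ _ (fun p => f (rV_cons p)) (meas_cons mf)).
- by move=> t; apply: integral_ge0.
apply: eq_integral => t _; rewrite /F.
rewrite -(ih (fun v => f (rV_cons ((- t)%R, v))))//.
  apply: eq_integral => v _; congr f; apply/rowP => i; rewrite !mxE.
  by case: unliftP => [j _|_]//=; rewrite !mxE.
apply: (measurableT_comp (meas_cons mf)); exact: measurable_pair1.
Qed.

Lemma ge0_integral_rV_subl n (f : 'rV[R]_n -> \bar R) (a : 'rV[R]_n) :
  measurable_fun setT f -> (forall x, 0 <= f x) ->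
  \int[rV_lebesgue n]_x f (a - x)%R = \int[rV_lebesgue n]_x f x.
Proof.
move=> mf f0; rewrite -(ge0_integral_rV_shift a mf f0).
rewrite -(@ge0_integral_rV_opp n (fun x => f (x + a)%R))//.
  by apply: eq_integral => x _; rewrite addrC.
by apply: measurableT_comp => //; exact: measurable_rV_addr.
Qed.

Lemma ge0_integral_rV_subr n (f : 'rV[R]_n -> \bar R) (a : 'rV[R]_n) :
  measurable_fun setT f -> (forall x, 0 <= f x) ->
  \int[rV_lebesgue n]_x f (x - a)%R = \int[rV_lebesgue n]_x f x.
Proof. by move=> mf f0; exact: ge0_integral_rV_shift. Qed.

End rV_integral.

(** * Comparison of integrals without measurability *)

Section integral_no_measurability.
Context d (T : measurableType d) {R : realType} (mu : {measure set T -> \bar R}).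
Local Open Scope ereal_scope.
Import HBNNSimple.

(** The integral of a non-negative function is a supremum over the simple functions below it, and
    enlarging the function enlarges this family. Being free of measurability, the comparison also
    applies to maximal functions. *)
Lemma ge0_le_integralT (D : set T) (f g : T -> \bar R) :
  (forall x, D x -> 0 <= f x) -> (forall x, D x -> f x <= g x) ->
  \int[mu]_(x in D) f x <= \int[mu]_(x in D) g x.
Proof.
move=> f0 fg; have g0 x : D x -> 0 <= g x by move=> Dx; rewrite (le_trans (f0 _ Dx))// fg.
rewrite !ge0_integralE//; apply: ub_ereal_sup => /= _ [h hf <-].
apply: ereal_sup_ubound; exists h => // x; apply: le_trans (hf x) _.
rewrite /patch; case: ifPn => // /set_mem; exact: fg.
Qed.

Let ge0_ae_eq_integral0 (f g : T -> \bar R) :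
  (forall x, 0 <= f x) -> (forall x, 0 <= g x) -> measurable_fun setT g ->
  (\forall x \ae mu, f x = g x) -> \int[mu]_x f x = \int[mu]_x g x.
Proof.
move=> f0 g0 mg [N [mN N0 fgN]].
have fg x : ~ N x -> f x = g x.
  by move=> Nx; apply: contrapT => h; apply: Nx; exact: fgN.
have gN : \int[mu]_x g x = \int[mu]_(x in ~` N) g x.
  by rewrite (@ge0_negligible_integral _ _ _ mu setT N g)// setTD.
have fN : \int[mu]_(x in ~` N) g x = \int[mu]_(x in ~` N) f x.
  by apply: eq_integral => x /set_mem /fg.
apply/eqP; rewrite eq_le; apply/andP; split; last first.
  rewrite gN fN integral_mkcond; apply: ge0_le_integralT => x _.
    by rewrite /patch; case: ifP.
  by rewrite /patch; case: ifP.
rewrite ge0_integralTE//; apply: ub_ereal_sup => /= _ [h hf <-].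
rewrite -integralT_nnsfun (@ge0_negligible_integral _ _ _ mu setT N (EFin \o h))//; last 2 first.
- by apply/measurable_EFinP.
- by move=> x _; rewrite /= lee_fin.
rewrite setTD gN; apply: ge0_le_integralT => x; first by rewrite /= lee_fin.
by move=> /fg <-; rewrite hf.
Qed.

(* No measurability of [f] is needed: the integral is a supremum over simple
   functions below the integrand, and these may be cut off on a null set. *)
Lemma ae_eq_integralT (D : set T) (f g : T -> \bar R) :
  measurable D -> measurable_fun D g ->
  (\forall x \ae mu, D x -> f x = g x) ->
  \int[mu]_(x in D) f x = \int[mu]_(x in D) g x.
Proof.
move=> mD mg fg; rewrite (integralE mu D f) (integralE mu D g).
have aep (h : (T -> \bar R) -> T -> \bar R) :
    (forall x, f x = g x -> h f x = h g x) ->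
    \forall x \ae mu, (h f \_ D) x = (h g \_ D) x.
  move=> hfg; apply: filterS fg => x fgx; rewrite /patch; case: ifPn => // /set_mem Dx.
  exact/hfg/fgx.
rewrite !(integral_mkcond D); congr (_ - _); apply: ge0_ae_eq_integral0.
- by move=> x; rewrite /patch; case: ifP => // _; exact: funepos_ge0.
- by move=> x; rewrite /patch; case: ifP => // _; exact: funepos_ge0.
- by apply/(measurable_restrictT _ _).1 => //; exact: measurable_funepos.
- by apply: (aep (@funepos T R)) => x /= e; rewrite !funeposE e.
- by move=> x; rewrite /patch; case: ifP => // _; exact: funeneg_ge0.
- by move=> x; rewrite /patch; case: ifP => // _; exact: funeneg_ge0.
- by apply/(measurable_restrictT _ _).1 => //; exact: measurable_funeneg.
- by apply: (aep (@funeneg T R)) => x /= e; rewrite !funenegE e.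
Qed.

End integral_no_measurability.

(** * Integrals over cubes as symmetric kernels *)

Section cube_integrals.
Context {R : realType} {n : nat}.
Local Notation V := 'rV[R]_n.
Local Notation mu := (rV_lebesgue n).
Local Open Scope ereal_scope.
Implicit Types (x y c : V) (r : R) (g h : V -> \bar R).

Definition cubeint r h x : \bar R := \int[mu]_(y in cube x r) h y.

Lemma cube_sym r x y : cube x r y <-> cube y r x.
Proof. by split => H i; have := H i; rewrite distrC. Qed.

Lemma measurable_near r : measurable [set p : V * V | cube p.1 r p.2].
Proof.
rewrite (_ : mkset _ = \big[setI/setT]_(i < n)
   ((fun p : V * V => `|p.2 ord0 i - p.1 ord0 i|%R) @^-1` `]-oo, r[%classic)).
  apply: bigsetI_measurable => i _; rewrite -[X in measurable X]setTI.
  have m1 := measurableT_comp (@measurable_coord R n i) (@measurable_fst _ _ V V).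
  have m2 := measurableT_comp (@measurable_coord R n i) (@measurable_snd _ _ V V).
  by apply: (measurableT_comp _ (measurable_funB m2 m1)) => //; exact: normr_measurable.
rewrite -bigcap_seq; apply/seteqP; split => p /= H.
  by move=> i _ /=; rewrite in_itv/=; exact: H.
by move=> i; have := H i (mem_index_enum _); rewrite /= in_itv/=.
Qed.

Section symmetric_relation.
Variable E : set (V * V).
Hypotheses (mE : measurable E) (symE : forall x y, E (x, y) -> E (y, x)).

(** Common form of two averages: nearness [|x - y| < r] gives [cubeint], and lying in the same grid
    cell gives conditional expectations. *)
Definition relint h x : \bar R := \int[mu]_(y in [set y | E (x, y)]) h y.

Lemma relintE h x : relint h x = \int[mu]_y ((\1_E (x, y))%:E * h y).
Proof.
rewrite /relint integral_mkcond; apply: eq_integral => y _.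
rewrite /patch indicE; case: ifPn => [/set_mem H|H].
  by rewrite mem_set// mul1e.
by rewrite memNset ?mul0e// => H'; move/negP : H; apply; exact: mem_set.
Qed.

Let mk : measurable_fun setT (fun p : V * V => (\1_E p : R)%:E).
Proof. by apply/measurable_EFinP/measurable_indic. Qed.

Lemma measurable_relint h : measurable_fun setT h -> (forall x, 0 <= h x) ->
  measurable_fun setT (relint h).
Proof.
move=> mh h0; rewrite (funext (relintE h)).
apply: (@measurable_fun_fubini_tonelli_F _ _ _ _ _ _ (fun p : V * V =>
  (\1_E p)%:E * h p.2)).
  apply: emeasurable_funM; first exact: mk.
  exact: measurableT_comp mh (@measurable_snd _ _ V V).
by move=> p; rewrite mule_ge0// lee_fin.
Qed.

(** Averaging is self-adjoint: Tonelli, with the symmetric indicator of [E] as kernel. *)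
Lemma relint_swap g h : measurable_fun setT g -> measurable_fun setT h ->
  (forall x, 0 <= g x) -> (forall x, 0 <= h x) ->
  \int[mu]_x (g x * relint h x) = \int[mu]_y (h y * relint g y).
Proof.
move=> mg mh g0 h0.
pose k (p : V * V) : \bar R := (\1_E p)%:E.
have k0 p : 0 <= k p by rewrite lee_fin.
have mF : measurable_fun setT (fun p : V * V => k p * (g p.1 * h p.2)).
  apply: emeasurable_funM; first exact: mk.
  apply: emeasurable_funM; first exact: measurableT_comp mg (@measurable_fst _ _ V V).
  exact: measurableT_comp mh (@measurable_snd _ _ V V).
transitivity (\int[mu]_x \int[mu]_y (k (x, y) * (g x * h y))).
  apply: eq_integral => x _; rewrite relintE -ge0_integralZl//.
  - by apply: eq_integral => y _; rewrite muleCA.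
  - by apply: emeasurable_funM => //; exact: measurableT_comp mk (measurable_pair1 x).
  - by move=> y _; rewrite mule_ge0// k0.
rewrite (fubini_tonelli (fun p : V * V => k p * (g p.1 * h p.2)))//; last first.
  by move=> p; rewrite !mule_ge0.
have ks x y : k (x, y) = k (y, x).
  rewrite /k !indicE; congr (nat_of_bool _)%:R%:E.
  by apply/idP/idP => /set_mem/= H; apply/mem_set/symE.
apply: eq_integral => y _; rewrite relintE -ge0_integralZl//.
- by apply: eq_integral => x _; rewrite ks muleA muleC.
- by apply: emeasurable_funM => //; exact: measurableT_comp mk (measurable_pair1 y).
- by move=> x _; rewrite mule_ge0// k0.
Qed.

End symmetric_relation.

Lemma measurable_cubeint r h : measurable_fun setT h -> (forall x, 0 <= h x) ->
  measurable_fun setT (cubeint r h).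
Proof. exact: (measurable_relint (measurable_near r)). Qed.

Lemma cubeint_ge0 r h x : (forall x, 0 <= h x) -> 0 <= cubeint r h x.
Proof. by move=> h0; apply: integral_ge0. Qed.

Lemma cubeint_swap r g h : measurable_fun setT g -> measurable_fun setT h ->
  (forall x, 0 <= g x) -> (forall x, 0 <= h x) ->
  \int[mu]_x (g x * cubeint r h x) = \int[mu]_y (h y * cubeint r g y).
Proof.
by apply: (relint_swap (measurable_near r)) => x y /cube_sym.
Qed.

Lemma cubeint_cst r c (a : R) : (0 <= r)%R -> (0 <= a)%R ->
  cubeint r (cst a%:E) c = (a * (2 * r) ^+ n)%:E.
Proof.
move=> r0 a0; by rewrite EFinM -(rV_lebesgue_cube c r0); apply: integral_cst; exact: measurable_cube.
Qed.

Lemma integral_cubeint r h : (0 <= r)%R -> measurable_fun setT h -> (forall x, 0 <= h x) ->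
  \int[mu]_x cubeint r h x = ((2 * r) ^+ n)%:E * \int[mu]_x h x.
Proof.
move=> r0 mh h0.
transitivity (\int[mu]_x (cst 1 x * cubeint r h x)).
  by apply: eq_integral => x _; rewrite mul1e.
rewrite cubeint_swap// -ge0_integralZl//; last by rewrite lee_fin exprn_ge0// mulr_ge0.
by apply: eq_integral => x _; rewrite (cubeint_cst _ r0 ler01) mul1r muleC.
Qed.

Lemma cubeint_le_integral r h x : measurable_fun setT h -> (forall x, 0 <= h x) ->
  cubeint r h x <= \int[mu]_y h y.
Proof. by move=> mh h0; apply: ge0_subset_integral => //; exact: measurable_cube. Qed.

Lemma cubeS x y r s : (`|x - y| + r <= s)%R -> cube x r `<=` cube y s.
Proof.
move=> H z Hz i; apply: lt_le_trans H.
have -> : (z ord0 i - y ord0 i = (x - y) ord0 i + (z ord0 i - x ord0 i))%R by rewrite !mxE; ring.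
apply: le_lt_trans (ler_normD _ _) _; apply: ler_ltD; first exact: norm_coord.
exact: Hz.
Qed.

Lemma le_cubeint x y r s h : measurable_fun setT h -> (forall x, 0 <= h x) ->
  (`|x - y| + r <= s)%R -> cubeint r h x <= cubeint s h y.
Proof.
move=> mh h0 H; apply: ge0_subset_integral => //; try exact: measurable_cube.
- exact: measurable_funS mh.
- exact: cubeS.
Qed.

(** Cauchy-Schwarz against the constant one: [2 t |f| <= t^2 + f^2] is integrated and optimised in
    [t], a form that also settles infinite integrals. *)
Lemma abs_integral_sq (E : set V) (f : V -> R) (v : R) : measurable E ->
  mu E = v%:E -> (0 < v)%R -> measurable_fun setT f ->
  (\int[mu]_(x in E) `|f x|%:E) * (\int[mu]_(x in E) `|f x|%:E) <=
  v%:E * \int[mu]_(x in E) (f x ^+ 2)%:E.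
Proof.
move=> mE muE v0 mf.
set m := \int[mu]_(x in E) `|f x|%:E; set S := \int[mu]_(x in E) (f x ^+ 2)%:E.
have m0 : 0 <= m by apply: integral_ge0 => x _; rewrite lee_fin.
have S0 : 0 <= S by apply: integral_ge0 => x _; rewrite lee_fin sqr_ge0.
have mabs : measurable_fun setT (fun x => `|f x|%:E).
  by apply/measurable_EFinP; exact: measurableT_comp.
have msq : measurable_fun setT (fun x => (f x ^+ 2)%:E).
  by apply/measurable_EFinP; exact: measurable_funX.
have key (t : R) : (0 < t)%R -> (2 * t)%:E * m <= (t ^+ 2 * v)%:E + S.
  move=> t0.
  have -> : (t ^+ 2 * v)%:E = \int[mu]_(x in E) (t ^+ 2)%:E.
    by rewrite EFinM -muE; apply/esym; exact: integral_cst.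
  rewrite /m /S -ge0_integralZl//; last 2 first.
  - exact: measurable_funTS.
  - by rewrite lee_fin mulr_ge0// ltW.
  rewrite -ge0_integralD//; last 3 first.
  - by move=> x _; rewrite lee_fin sqr_ge0.
  - by move=> x _; rewrite lee_fin sqr_ge0.
  - exact: measurable_funTS.
  apply: ge0_le_integralT => x _.
    by rewrite -EFinM lee_fin mulr_ge0// mulr_ge0// ltW.
  rewrite -EFinM -EFinD lee_fin -(real_normK (num_real (f x))).
  rewrite -subr_ge0 (_ : _ - _ = (t - `|f x|) ^+ 2)%R ?sqr_ge0//; ring.
move: S0 key; case: S => [S||]//; last first.
  by move=> _ _; rewrite mulry gtr0_sg// mul1e leey.
move=> S0 key; move: m0 key; case: m => [m||]//; last first.
  by move=> _ /(_ _ ltr01); rewrite mulry gtr0_sg// mul1e.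
move=> m0 key; rewrite -!EFinM lee_fin.
move: m0; rewrite lee_fin le_eqVlt => /predU1P[<-|m0].
  by rewrite mul0r mulr_ge0// ltW.
(* The optimal [t] is the mean of [|f|] over [E]. *)
have := key (m / v)%R (divr_gt0 m0 v0); rewrite -EFinM -EFinD lee_fin => h.
have e1 : (2 * (m / v) * m = 2 * (m * m / v))%R by ring.
have e2 : ((m / v) ^+ 2 * v = m * m / v)%R by field; rewrite gt_eqF.
by move: h; rewrite e1 e2 -ler_pdivrMl// => h; rewrite mulrC; lra.
Qed.

Lemma cubeint_sq r (f : V -> R) x : (0 < r)%R -> measurable_fun setT f ->
  cubeint r (fun y => `|f y|%:E) x * cubeint r (fun y => `|f y|%:E) x <=
  ((2 * r) ^+ n)%:E * cubeint r (fun y => (f y ^+ 2)%:E) x.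
Proof.
move=> r0 mf; apply: abs_integral_sq => //; first exact: measurable_cube.
  by rewrite rV_lebesgue_cube// ltW.
by rewrite exprn_gt0// mulr_gt0.
Qed.

End cube_integrals.

(** * Locally integrable functions and convolutions *)

Section convolution.
Context {R : realType} {n : nat}.
Local Notation V := 'rV[R]_n.
Local Notation mu := (rV_lebesgue n).
Implicit Types (x y c : V) (r : R) (f k psi : V -> R).

Definition locint f := measurable_fun setT f /\
  forall c r, (cubeint r (fun y => `|f y|%:E) c < +oo)%E.

Definition conv psi f x : R := (\int[mu]_y (psi (x - y) * f y))%R.

Lemma measurable_absE f : measurable_fun setT f ->
  measurable_fun setT (fun x => `|f x|%:E).
Proof. by move=> mf; apply/measurable_EFinP; exact: measurableT_comp. Qed.

Lemma locint_integrable f : mu.-integrable setT (EFin \o f) -> locint f.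
Proof.
move=> /integrableP[mf fi]; have mf' : measurable_fun setT f by apply/measurable_EFinP.
split=> // c r; apply: le_lt_trans fi; apply: cubeint_le_integral => //.
exact: measurable_absE.
Qed.

Lemma locint_patch f (A : set V) : measurable A -> locint f -> locint (patch (fun=> 0) A f).
Proof.
move=> mA [mf fl]; split; first exact/(measurable_restrictT _ _).1/measurable_funTS.
move=> c r; apply: le_lt_trans (fl c r); apply: ge0_le_integralT => // y _.
by rewrite lee_fin /patch; case: ifP => //; rewrite normr0.
Qed.

Lemma kernel_bound k f x r (a : R) : locint f -> measurable_fun setT k -> 0 <= a ->
  (forall y, `|k y| <= a * \1_(cube x r) y) ->
  mu.-integrable setT (EFin \o (fun y => k y * f y)) /\
  ((`|\int[mu]_y (k y * f y)|)%:E <= a%:E * cubeint r (fun y => `|f y|%:E) x)%E.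
Proof.
move=> [mf fl] mk a0 ka.
have B : (\int[mu]_y `|(k y * f y)%:E| <= a%:E * cubeint r (fun y => `|f y|%:E) x)%E.
  rewrite /cubeint -ge0_integralZl//; last 2 first.
  - exact: measurable_cube.
  - by apply: measurable_funTS; exact: measurable_absE.
  rewrite [leRHS]integral_mkcond; apply: ge0_le_integralT => y _ //.
  rewrite abse_EFin normrM /patch; have := ka y; rewrite indicE; case: ifP => _.
    by rewrite mulr1 -EFinM lee_fin => h; rewrite ler_wpM2r.
  rewrite mulr0 lee_fin => h.
  by rewrite (le_anti (introT andP (conj h (normr_ge0 _)))) mul0r.
have I : mu.-integrable setT (EFin \o (fun y => k y * f y)).
  apply/integrableP; split; first by apply/measurable_EFinP; exact: measurable_funM.
  by apply: le_lt_trans B _; rewrite lte_mul_pinfty.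
split => //; rewrite EFin_normr_Rintegral//.
by apply: le_trans B; apply: le_abse_integral => //; case/integrableP : I.
Qed.

Lemma measurable_kernel psi x : measurable_fun setT psi ->
  measurable_fun setT (fun y => psi (x - y)).
Proof. by move=> m; apply: measurableT_comp => //; exact: measurable_rV_subl. Qed.

(** Tonelli treats the positive and the negative part separately, and [fine] is then applied to
    their difference, whether or not it is finite. *)
Lemma measurable_Rint2 (F : V * V -> R) : measurable_fun setT F ->
  measurable_fun setT (fun x : V => \int[mu]_y F (x, y)).
Proof.
move=> mF; apply: measurableT_comp; first exact: fine_measurable.
rewrite (_ : (fun x : V => _) = (fun x => \int[mu]_y (EFin \o F)^\+ (x, y) -
   \int[mu]_y (EFin \o F)^\- (x, y))%E); last first.
  apply/funext => x; rewrite integralE; congr (_ - _)%E.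
    by apply: eq_integral => y _; rewrite !funeposE.
  by apply: eq_integral => y _; rewrite !funenegE.
apply: emeasurable_funB.
  apply: (measurable_fun_fubini_tonelli_F (EFin \o F)^\+%E).
    by apply: measurable_funepos; apply/measurable_EFinP.
  by move=> p; exact: funepos_ge0.
apply: (measurable_fun_fubini_tonelli_F (EFin \o F)^\-%E).
  by apply: measurable_funeneg; apply/measurable_EFinP.
by move=> p; exact: funeneg_ge0.
Qed.

Lemma measurable_conv psi f : measurable_fun setT psi -> measurable_fun setT f ->
  measurable_fun setT (conv psi f).
Proof.
move=> mp mf; apply: (@measurable_Rint2 (fun p => psi (p.1 - p.2) * f p.2)).
apply: measurable_funM; first exact: measurableT_comp mp measurable_rV_sub.
exact: measurableT_comp mf (@measurable_snd _ _ V V).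
Qed.

End convolution.

(** * Littlewood-Paley kernels and the L2 bound *)

Section square_integrable.
Context {R : realType} {n : nat}.
Local Notation V := 'rV[R]_n.
Local Notation mu := (rV_lebesgue n).
Implicit Types (x y c : V) (r : R) (f g h psi : V -> R).

Definition sqint f := measurable_fun setT f /\ (\int[mu]_x (f x ^+ 2)%:E < +oo)%E.
Definition ip f g : R := \int[mu]_x (f x * g x).

Lemma measurable_sqE f : measurable_fun setT f -> measurable_fun setT (fun x => (f x ^+ 2)%:E).
Proof. by move=> mf; apply/measurable_EFinP; exact: measurable_funX. Qed.

Lemma sqint_mul f g : sqint f -> sqint g -> mu.-integrable setT (EFin \o (fun x => f x * g x)).
Proof.
move=> [mf f2] [mg g2]; apply/integrableP; split; first by apply/measurable_EFinP; exact: measurable_funM.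
apply: (@le_lt_trans _ _ (\int[mu]_x ((f x ^+ 2)%:E + (g x ^+ 2)%:E))%E).
  apply: ge0_le_integralT => // x _.
  rewrite /= lee_fin normrM -(real_normK (num_real (f x))) -(real_normK (num_real (g x))).
  have := sqr_ge0 (`|f x| - `|g x|); have := normr_ge0 (f x); have := normr_ge0 (g x); nra.
rewrite ge0_integralD//; first exact: lte_add_pinfty.
- by move=> x _; rewrite lee_fin sqr_ge0.
- exact: measurable_sqE.
- by move=> x _; rewrite lee_fin sqr_ge0.
- exact: measurable_sqE.
Qed.

Lemma ipE f : sqint f -> (ip f f)%:E = (\int[mu]_x (f x ^+ 2)%:E)%E.
Proof.
move=> [mf f2]; rewrite /ip /Rintegral fineK.
  by apply: eq_integral => x _; rewrite expr2.
rewrite ge0_fin_numE; last by apply: integral_ge0 => x _; rewrite lee_fin -expr2 sqr_ge0.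
by under eq_integral do rewrite -expr2.
Qed.

Lemma ip_ge0 f : 0 <= ip f f.
Proof. by apply: Rintegral_ge0 => x _; rewrite -expr2 sqr_ge0. Qed.

Lemma ipC f g : ip f g = ip g f.
Proof. by apply: eq_Rintegral => x _; rewrite mulrC. Qed.

Lemma sqint_add f g : sqint f -> sqint g -> sqint (fun x => f x + g x).
Proof.
move=> [mf f2] [mg g2]; split; first exact: measurable_funD.
apply: (@le_lt_trans _ _ (\int[mu]_x (2%:E * ((f x ^+ 2)%:E + (g x ^+ 2)%:E)))%E).
  apply: ge0_le_integralT => [x _|x _]; first by rewrite lee_fin sqr_ge0.
  rewrite -EFinD -EFinM lee_fin; have := sqr_ge0 (f x - g x); nra.
rewrite ge0_integralZl//; last 2 first.
- by apply: emeasurable_funD; exact: measurable_sqE.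
- by move=> x _; rewrite -EFinD lee_fin addr_ge0// sqr_ge0.
rewrite lte_mul_pinfty// ge0_integralD//; first exact: lte_add_pinfty.
- by move=> x _; rewrite lee_fin sqr_ge0.
- exact: measurable_sqE.
- by move=> x _; rewrite lee_fin sqr_ge0.
- exact: measurable_sqE.
Qed.

Lemma sqint0 : sqint (fun=> 0).
Proof.
split; first exact: measurable_cst.
by rewrite (eq_integral (cst 0%E)) ?integral0// => x _; rewrite expr0n.
Qed.

Lemma sqint_sum (I : Type) (s : seq I) (F : I -> V -> R) : (forall i, sqint (F i)) ->
  sqint (fun x => \sum_(i <- s) F i x).
Proof.
move=> HF; elim: s => [|i s ih].
  by under eq_fun do rewrite big_nil; exact: sqint0.
by under eq_fun do rewrite big_cons; exact: sqint_add.
Qed.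

Lemma ip_sumr (I : Type) (s : seq I) g (F : I -> V -> R) : sqint g -> (forall i, sqint (F i)) ->
  ip g (fun x => \sum_(i <- s) F i x) = \sum_(i <- s) ip g (F i).
Proof.
move=> Hg HF; elim: s => [|i s ih].
  rewrite big_nil /ip (eq_Rintegral _ _ (g := fun=> 0)); last first.
    by move=> x _; rewrite big_nil mulr0.
  by rewrite /Rintegral integral0.
rewrite big_cons -ih /ip -RintegralD//; last 2 first.
- exact: sqint_mul.
- by apply: sqint_mul => //; exact: sqint_sum.
by apply: eq_Rintegral => x _; rewrite big_cons mulrDr.
Qed.

Lemma ip_young f g (e : R) : 0 < e -> sqint f -> sqint g ->
  2 * ip f g <= e * ip f f + e^-1 * ip g g.
Proof.
move=> e0 Hf Hg; rewrite /ip -!RintegralZl//; [|exact: sqint_mul..].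
have I1 := integrableZl measurableT e (sqint_mul Hf Hf).
have I2 := integrableZl measurableT e^-1 (sqint_mul Hg Hg).
have I3 := integrableZl measurableT 2 (sqint_mul Hf Hg).
rewrite -RintegralD//; apply: le_Rintegral => //.
  by have := integrableD measurableT I1 I2.
move=> x _; rewrite -subr_ge0.
have -> : e * (f x * f x) + e^-1 * (g x * g x) - 2 * (f x * g x) =
  e * (f x - e^-1 * g x) ^+ 2 by field; rewrite gt_eqF.
by rewrite mulr_ge0 ?sqr_ge0// ltW.
Qed.

Lemma sqint_locint f : sqint f -> locint f.
Proof.
move=> [mf f2]; split => // c r.
have mabs := measurable_absE mf; have msq := measurable_sqE mf.
(* [Num.max r 1] makes the radius positive, as [r] is arbitrary; on the larger cube [|f| <= 1 + f^2]
   is integrated. *)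
apply: (@le_lt_trans _ _ (cubeint (Num.max r 1) (fun x => 1 + (f x ^+ 2)%:E)%E c)).
  apply: (@le_trans _ _ (cubeint (Num.max r 1) (fun x => `|f x|%:E) c)).
    by apply: le_cubeint => //; rewrite subrr normr0 add0r le_max lexx.
  apply: ge0_le_integralT => // x _; rewrite -EFinD lee_fin.
  rewrite -(real_normK (num_real (f x))); have := sqr_ge0 (`|f x| - 1); nra.
have mc : measurable (cube c (Num.max r 1)) by exact: measurable_cube.
rewrite /cubeint ge0_integralD//; last 2 first.
- by move=> x _; rewrite lee_fin sqr_ge0.
- exact: measurable_funTS.
apply: lte_add_pinfty.
  have := @cubeint_cst R n (Num.max r 1) c 1; rewrite /cubeint => ->//; first exact: ltry.
  by rewrite le_max ler01 orbT.
apply: le_lt_trans f2; apply: cubeint_le_integral => // x.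
by rewrite lee_fin sqr_ge0.
Qed.

End square_integrable.

(** * Normalised kernels and their convolutions *)

Section LP_kernels.
Context {R : realType} {n : nat}.
Local Notation V := 'rV[R]_n.
Local Notation mu := (rV_lebesgue n).
Implicit Types (x y z c : V) (r q : R) (f g h psi : V -> R) (k : int).

(** All constants are one: the kernels of the operator are a scalar times such functions, and the
    scalar alone carries the dependence on [phi] and on the bound for [K]. *)
Definition LPker q psi := [/\ measurable_fun setT psi,
  forall x, `|psi x| <= q ^- n,
  forall x, 2 * q <= `|x| -> psi x = 0,
  forall x y, `|psi x - psi y| <= q ^- n.+1 * `|x - y| &
  \int[mu]_x psi x = 0].

Lemma LPker_cube q psi x y : 0 < q -> LPker q psi ->
  `|psi (x - y)| <= q ^- n * \1_(cube x (2 * q)) y.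
Proof.
move=> q0 [_ sz sp _ _]; rewrite indicE; case: (boolP (y \in _)) => yc.
  by rewrite mulr1.
rewrite mulr0 sp ?normr0// leNgt distrC; apply/negP => h.
by move/negP : yc; apply; apply/mem_set/cubeE => //; rewrite mulr_gt0.
Qed.

Lemma LPker_integrable q psi x f : 0 < q -> LPker q psi -> locint f ->
  mu.-integrable setT (EFin \o (fun y => psi (x - y) * f y)).
Proof.
move=> q0 LP Lf; have [mp _ _ _ _] := LP.
apply: (kernel_bound (x := x) (r := 2 * q) (a := q ^- n) Lf _ _ _).1.
- exact: measurable_kernel.
- by rewrite invr_ge0 exprn_ge0// ltW.
- by move=> y; exact: LPker_cube.
Qed.

Lemma conv_le q psi x f : 0 < q -> LPker q psi -> locint f ->
  ((`|conv psi f x|)%:E <= (q ^- n)%:E * cubeint (2 * q) (fun y => `|f y|%:E) x)%E.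
Proof.
move=> q0 LP Lf; have [mp _ _ _ _] := LP.
apply: (kernel_bound (x := x) (r := 2 * q) (a := q ^- n) Lf _ _ _).2.
- exact: measurable_kernel.
- by rewrite invr_ge0 exprn_ge0// ltW.
- by move=> y; exact: LPker_cube.
Qed.

(** Both translates of the kernel live in [cube x s], and their difference is bounded by the
    Lipschitz condition. *)
Lemma conv_lip q psi x x' s f : 0 < q -> LPker q psi -> locint f ->
  `|x' - x| + 2 * q <= s ->
  ((`|conv psi f x' - conv psi f x|)%:E <=
   (q ^- n.+1 * `|x' - x|)%:E * cubeint s (fun y => `|f y|%:E) x)%E.
Proof.
move=> q0 LP Lf xs; have [mp sz sp lip _] := LP.
rewrite /conv -RintegralB//; [|exact: LPker_integrable q0 LP Lf..].
rewrite (eq_Rintegral _ _ (g := fun y => (psi (x' - y) - psi (x - y)) * f y)); last first.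
  by move=> y _; rewrite mulrBl.
apply: (kernel_bound _ _ _ _).2 => //.
- by apply: measurable_funB; exact: measurable_kernel.
- by rewrite mulr_ge0// invr_ge0 exprn_ge0// ltW.
- move=> y; rewrite indicE; case: (boolP (y \in _)) => yc.
    rewrite mulr1; apply: le_trans (lip _ _) _.
    by rewrite (_ : x' - y - (x - y) = x' - x)// opprB addrA subrK.
  have s0 : 0 < s by apply: lt_le_trans xs; rewrite ltr_wpDl// mulr_gt0.
  have yx : s <= `|x - y|.
    rewrite leNgt distrC; apply/negP => h; move/negP : yc; apply; apply/mem_set.
    exact/cubeE.
  rewrite mulr0 (sp (x - y)); last by apply: le_trans yx; apply: le_trans xs; rewrite lerDr.
  rewrite (sp (x' - y)) ?subrr ?normr0//.
  by have := ler_distD x' x y; move: xs yx; rewrite (distrC x' x); lra.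
Qed.

Lemma LPker_opp q psi : LPker q psi -> LPker q (fun x => psi (- x)).
Proof.
move=> [mp sz sp lip i0]; split.
- by apply: measurableT_comp => //; exact: measurable_rV_opp.
- by move=> x; exact: sz.
- by move=> x; rewrite -normrN; exact: sp.
- by move=> x y; apply: le_trans (lip _ _) _; rewrite -opprD normrN.
- rewrite -i0 /Rintegral; congr fine; rewrite [LHS]integralE [RHS]integralE.
  have mE : measurable_fun setT (EFin \o psi) by apply/measurable_EFinP.
  rewrite -(ge0_integral_rV_opp (measurable_funepos mE))//.
  rewrite -(ge0_integral_rV_opp (measurable_funeneg mE))//.
  congr (_ - _)%E; apply: eq_integral => x _; first by rewrite !funeposE.
  by rewrite !funenegE.
Qed.

Lemma Rint_subl psi x : measurable_fun setT psi ->
  \int[mu]_y psi (x - y) = \int[mu]_y psi y.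
Proof.
move=> mp; rewrite /Rintegral; congr fine; rewrite [LHS]integralE [RHS]integralE.
have mE : measurable_fun setT (EFin \o psi) by apply/measurable_EFinP.
rewrite -(ge0_integral_rV_subl x (measurable_funepos mE))//.
rewrite -(ge0_integral_rV_subl x (measurable_funeneg mE))//.
congr (_ - _)%E; apply: eq_integral => y _; first by rewrite !funeposE.
by rewrite !funenegE.
Qed.

End LP_kernels.

(** * Almost orthogonality of two scales *)

Section L2_bound.
Context {R : realType} {n : nat}.
Local Notation V := 'rV[R]_n.
Local Notation mu := (rV_lebesgue n).
Implicit Types (x y z c : V) (r q p : R) (f g h psi : V -> R).

Lemma measurable_patch0 (A : set V) f : measurable A -> measurable_fun setT f ->
  measurable_fun setT (patch (fun=> 0) A f).
Proof. by move=> mA mf; exact/(measurable_restrictT _ _).1/measurable_funTS. Qed.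

Lemma locint_bounded f (M : R) : measurable_fun setT f -> (forall x, `|f x| <= M) -> locint f.
Proof.
move=> mf fM; split=> // c r.
have M0 : 0 <= M by apply: le_trans (fM 0).
apply: (@le_lt_trans _ _ (cubeint (Num.max r 1) (cst M%:E) c)).
  apply: (@le_trans _ _ (cubeint (Num.max r 1) (fun x => `|f x|%:E) c)).
    apply: le_cubeint => //; first exact: measurable_absE.
    by rewrite subrr normr0 add0r le_max lexx.
  by apply: ge0_le_integralT => // z _; rewrite lee_fin.
by rewrite cubeint_cst ?ltry// le_max ler01 orbT.
Qed.

Lemma locint_conv q psi f : 0 < q -> LPker q psi -> locint f -> locint (conv psi f).
Proof.
move=> q0 LP Lf; have [mp _ _ _ _] := LP; have [mf _] := Lf.
have mG : measurable_fun setT (conv psi f) by exact: measurable_conv.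
split => // c r.
pose s : R := Num.max r 1; have r1 : 0 < s by rewrite lt_max ltr01 orbT.
have [t t0 tE] : exists2 t, 0 <= t & (cubeint (s + 2 * q) (fun y => `|f y|%:E) c = t%:E)%E.
  have : (cubeint (s + 2 * q) (fun y => `|f y|%:E) c < +oo)%E by exact: Lf.2.
  have : (0 <= cubeint (s + 2 * q) (fun y => `|f y|%:E) c)%E by exact: cubeint_ge0.
  by case: cubeint => // t t0 _; exists t.
apply: (@le_lt_trans _ _ (cubeint (s) (cst (q ^- n * t)%:E) c)).
  apply: (@le_trans _ _ (cubeint (s) (fun x => `|conv psi f x|%:E) c)).
    apply: le_cubeint => //; first exact: measurable_absE.
    by rewrite subrr normr0 add0r le_max lexx.
  apply: ge0_le_integralT => // z zc.
  apply: le_trans (conv_le z q0 LP Lf) _; rewrite EFinM -tE; apply: lee_wpmul2l.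
    by rewrite lee_fin invr_ge0 exprn_ge0// ltW.
  apply: le_cubeint => //; first exact: measurable_absE.
  by rewrite lerD2r; apply/ltW/cubeE.
rewrite cubeint_cst ?ltry//; first exact: ltW.
by rewrite mulr_ge0// invr_ge0 exprn_ge0// ltW.
Qed.

(** Cauchy-Schwarz on each cube, then integration over the centres: each of the two steps yields one
    factor [(2 * r) ^+ n]. *)
Lemma sq_le_cubeint f (F : V -> R) (a r : R) : measurable_fun setT f -> measurable_fun setT F ->
  0 <= a -> 0 < r ->
  (forall x, (`|F x|%:E <= a%:E * cubeint r (fun y => `|f y|%:E) x)%E) ->
  (\int[mu]_x (F x ^+ 2)%:E <= ((a * (2 * r) ^+ n) ^+ 2)%:E * \int[mu]_x (f x ^+ 2)%:E)%E.
Proof.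
move=> mf mF a0 r0 H.
set v := (2 * r) ^+ n; have v0 : 0 <= v by rewrite exprn_ge0// mulr_ge0// ltW.
have msq := measurable_sqE mf.
have sq0 x : (0 <= (f x ^+ 2)%:E)%E by rewrite lee_fin sqr_ge0.
apply: (@le_trans _ _ (\int[mu]_x ((a ^+ 2 * v)%:E * cubeint r (fun y => (f y ^+ 2)%:E) x))%E).
  apply: ge0_le_integralT => [x _|x _]; first by rewrite lee_fin sqr_ge0.
  have abs0 : (0 <= cubeint r (fun y => `|f y|%:E) x)%E by apply: cubeint_ge0.
  apply: (@le_trans _ _ ((a%:E * cubeint r (fun y => `|f y|%:E) x) *
     (a%:E * cubeint r (fun y => `|f y|%:E) x))%E).
    rewrite -(real_normK (num_real (F x))) expr2 EFinM.
    by apply: lee_pmul.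
  rewrite muleACA -EFinM -expr2 [(a ^+ 2 * v)%:E]EFinM -[leRHS]muleA.
  by apply: lee_wpmul2l; [rewrite lee_fin sqr_ge0|exact: cubeint_sq].
rewrite ge0_integralZl//; last 3 first.
- exact: measurable_cubeint.
- by move=> x _; exact: cubeint_ge0.
- by rewrite lee_fin mulr_ge0// sqr_ge0.
rewrite integral_cubeint//; last exact: ltW.
by rewrite muleA -EFinM -/v (_ : a ^+ 2 * v * v = (a * v) ^+ 2)//; ring.
Qed.

Lemma conv_sq q psi f : 0 < q -> LPker q psi -> sqint f ->
  (\int[mu]_x (conv psi f x ^+ 2)%:E <= (16 ^+ n)%:E * \int[mu]_x (f x ^+ 2)%:E)%E.
Proof.
move=> q0 LP Hf; have [mf _] := Hf; have [mp _ _ _ _] := LP.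
have := @sq_le_cubeint f (conv psi f) (q ^- n) (2 * q).
have -> : (q ^- n * (2 * (2 * q)) ^+ n) ^+ 2 = 16 ^+ n.
  have -> : q ^- n * (2 * (2 * q)) ^+ n = 4 ^+ n.
    rewrite (_ : 2 * (2 * q) = 4 * q); last by ring.
    by rewrite exprMn mulrCA mulVf ?mulr1// expf_neq0// gt_eqF.
  by rewrite -exprM mulnC exprM; congr (_ ^+ _); rewrite -natrX.
apply => //; first exact: measurable_conv.
- by rewrite invr_ge0 exprn_ge0// ltW.
- by rewrite mulr_gt0.
- by move=> x; exact: conv_le (sqint_locint Hf).
Qed.

Lemma sqint_conv q psi f : 0 < q -> LPker q psi -> sqint f -> sqint (conv psi f).
Proof.
move=> q0 LP Hf; have [mf f2] := Hf; have [mp _ _ _ _] := LP.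
split; first exact: measurable_conv.
apply: le_lt_trans (conv_sq q0 LP Hf) _; rewrite lte_mul_pinfty//.
Qed.

(** Fubini. The inner integral of absolute values is at most [|g|] times a cube integral of [|f|],
    and the latter is again square integrable, so the double integral converges absolutely. *)
Lemma ip_conv q psi f g : 0 < q -> LPker q psi -> sqint f -> sqint g ->
  ip (conv psi f) g = ip f (conv (fun x => psi (- x)) g).
Proof.
move=> q0 LP Hf Hg; have [mf f2] := Hf; have [mg g2] := Hg; have [mp _ _ _ _] := LP.
pose F (w : V * V) : \bar R := (psi (w.1 - w.2) * f w.2 * g w.1)%:E.
have mF : measurable_fun setT F.
  apply/measurable_EFinP; apply: measurable_funM; first apply: measurable_funM.
  - exact: measurableT_comp mp measurable_rV_sub.
  - exact: measurableT_comp mf (@measurable_snd _ _ V V).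
  - exact: measurableT_comp mg (@measurable_fst _ _ V V).
have inn x : (\int[mu]_y `|F (x, y)| <= `|g x|%:E * ((q ^- n)%:E * cubeint (2 * q) (fun y => `|f y|%:E) x))%E.
  have qn0 : 0 <= q ^- n by rewrite invr_ge0 exprn_ge0// ltW.
  rewrite /cubeint -!ge0_integralZl//; last 5 first.
  - exact: measurable_cube.
  - by apply: emeasurable_funM => //; apply: measurable_funTS; exact: measurable_absE.
  - by move=> y _; rewrite mule_ge0.
  - exact: measurable_cube.
  - by apply: measurable_funTS; exact: measurable_absE.
  rewrite [leRHS]integral_mkcond; apply: ge0_le_integralT => // y _.
  rewrite /F/= !normrM /patch; have := LPker_cube x y q0 LP; rewrite indicE.
  case: ifP => _; rewrite ?mulr1 ?mulr0 => h.
    by rewrite -!EFinM lee_fin mulrC ler_wpM2l// ler_wpM2r.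
  by rewrite (le_anti (introT andP (conj h (normr_ge0 _)))) !mul0r.
have I : (mu \x mu)%E.-integrable setT F.
  apply/integrable12ltyP => //.
  pose G x : R := q ^- n * fine (cubeint (2 * q) (fun y => `|f y|%:E) x).
  have GE x : (G x)%:E = ((q ^- n)%:E * cubeint (2 * q) (fun y => `|f y|%:E) x)%E.
    rewrite /G EFinM fineK// ge0_fin_numE; last exact: cubeint_ge0.
    exact: (sqint_locint Hf).2.
  have SG : sqint G.
    split.
      apply: measurable_funM => //; apply: measurableT_comp; first exact: fine_measurable.
      by apply: measurable_cubeint => //; exact: measurable_absE.
    have mG : measurable_fun setT G.
      apply: measurable_funM => //; apply: measurableT_comp; first exact: fine_measurable.
      by apply: measurable_cubeint => //; exact: measurable_absE.
    apply: le_lt_trans (@sq_le_cubeint f G (q ^- n) (2 * q) mf mG _ _ _) _.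
    - by rewrite invr_ge0 exprn_ge0// ltW.
    - by rewrite mulr_gt0.
    - by move=> x; rewrite -GE lee_fin ger0_norm// -lee_fin GE mule_ge0 ?cubeint_ge0// lee_fin invr_ge0 exprn_ge0// ltW.
    - by rewrite lte_mul_pinfty// lee_fin sqr_ge0.
  have /integrableP[_] := sqint_mul Hg SG; apply: le_lt_trans.
  apply: ge0_le_integralT => [x _|x _]; first exact: integral_ge0.
  apply: le_trans (inn x) _; rewrite -GE -EFinM /= lee_fin normrM.
  by rewrite ler_wpM2l// ler_norm.
rewrite /ip /Rintegral; congr fine.
transitivity (\int[mu]_x \int[mu]_y F (x, y))%E.
  apply: eq_integral => x _; rewrite /conv mulrC -RintegralZl//; last first.
    exact: LPker_integrable q0 LP (sqint_locint Hf).
  rewrite /Rintegral fineK.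
    by apply: eq_integral => y _; rewrite /F/= mulrC.
  apply: integrable_fin_num => //.
  have := integrableZl measurableT (g x) (LPker_integrable x q0 LP (sqint_locint Hf)).
  by [].
rewrite (Fubini I); apply: eq_integral => y _.
rewrite /conv -RintegralZl//; last first.
  exact: LPker_integrable q0 (LPker_opp LP) (sqint_locint Hg).
rewrite /Rintegral fineK.
  by apply: eq_integral => x _; rewrite /F/= opprB mulrA (mulrC (f y)).
apply: integrable_fin_num => //.
have := integrableZl measurableT (f y) (LPker_integrable y q0 (LPker_opp LP) (sqint_locint Hg)).
by [].
Qed.

(* The mean-zero kernel at the finer scale sees only the variation of the
   coarser average, whence the gain [p / q]. *)
Lemma conv_conv_le p q a b h x : 0 < p -> p <= q -> LPker p a -> LPker q b -> locint h ->
  ((`|conv a (conv b h) x|)%:E <=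
    (4 ^+ n * (2 * p) * q ^- n.+1)%:E * cubeint (4 * q) (fun y => `|h y|%:E) x)%E.
Proof.
move=> p0 pq La Lb Lh; have q0 := lt_le_trans p0 pq.
have [ma _ spa _ ia] := La; have [mb _ _ _ _] := Lb; have [mh _] := Lh.
pose G := conv b h.
have mG : measurable_fun setT G by exact: measurable_conv.
pose M : R := fine (cubeint (4 * q) (fun y => `|h y|%:E) x).
have M0 : 0 <= M by rewrite fine_ge0// cubeint_ge0.
have ME : (M%:E = cubeint (4 * q) (fun y => `|h y|%:E) x)%E.
  by rewrite fineK// ge0_fin_numE ?cubeint_ge0//; exact: Lh.2.
pose F := patch (fun=> 0) (cube x (2 * p)) (fun z => G z - G x).
have mF : measurable_fun setT F.
  by apply: measurable_patch0; [exact: measurable_cube|exact: measurable_funB].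
have FM z : `|F z| <= 2 * p * q ^- n.+1 * M.
  have p2 : 0 < 2 * p by rewrite mulr_gt0.
  rewrite /F /patch; case: ifPn => [/set_mem/(cubeE x z p2) zx|_]; last first.
    by rewrite normr0 !mulr_ge0// ?invr_ge0 ?exprn_ge0// ltW.
  have : (`|G z - G x|%:E <= (q ^- n.+1 * `|z - x|)%:E * M%:E)%E.
    rewrite ME; apply: conv_lip => //; lra.
  rewrite -EFinM lee_fin => /le_trans; apply; rewrite ler_wpM2r//.
  by rewrite mulrC ler_wpM2r ?invr_ge0 ?exprn_ge0// ltW.
have LF : locint F by apply: locint_bounded FM.
have LG : locint G by exact: (locint_conv q0 Lb Lh).
have -> : conv a (conv b h) x = \int[mu]_y (a (x - y) * F y).
  have I1 := LPker_integrable x p0 La LG.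
  have I2 : mu.-integrable setT (EFin \o (fun y => a (x - y) * G x)).
    apply: (LPker_integrable x p0 La (f := fun=> G x)).
    by apply: (@locint_bounded _ `|G x|) => //; exact: measurable_cst.
  have I3 : mu.-integrable setT (EFin \o (fun y => a (x - y))).
    have : mu.-integrable setT (EFin \o (fun y => a (x - y) * 1)).
      apply: (LPker_integrable x p0 La (f := fun=> 1)).
      by apply: (@locint_bounded _ 1) => // y; rewrite normr1.
    by apply: eq_integrable => // y _; rewrite /= mulr1.
  transitivity (\int[mu]_y (a (x - y) * G y - a (x - y) * G x)).
    by rewrite RintegralB// RintegralZr// Rint_subl// ia mul0r subr0.
  apply: eq_Rintegral => y _; rewrite -mulrBr /F /patch; case: ifPn => // yc.
  rewrite spa ?mul0r// leNgt distrC; apply/negP => yx; move/negP : yc; apply.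
  by apply/mem_set/cubeE => //; rewrite mulr_gt0.
apply: le_trans (kernel_bound (x := x) (r := 2 * p) (a := p ^- n) LF _ _ _).2 _.
- exact: measurable_kernel.
- by rewrite invr_ge0 exprn_ge0// ltW.
- by move=> y; exact: LPker_cube.
apply: (@le_trans _ _ ((p ^- n)%:E * cubeint (2 * p) (cst (2 * p * q ^- n.+1 * M)%:E) x)%E).
  apply: lee_wpmul2l; first by rewrite lee_fin invr_ge0 exprn_ge0// ltW.
  by apply: ge0_le_integralT => // z _; rewrite lee_fin.
have c0 : 0 <= 2 * p * q ^- n.+1 * M.
  by rewrite !mulr_ge0// ?invr_ge0 ?exprn_ge0// ltW.
rewrite cubeint_cst//; last by rewrite mulr_ge0// ltW.
rewrite -ME -!EFinM lee_fin le_eqVlt; apply/orP; left; apply/eqP.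
have -> : (2 * (2 * p)) ^+ n = 4 ^+ n * p ^+ n by rewrite -exprMn mulrA -natrM.
field; rewrite ?expf_neq0 ?gt_eqF//.
Qed.

Lemma sqint_conv_conv p q a b h : 0 < p -> p <= q -> LPker p a -> LPker q b -> sqint h ->
  sqint (conv a (conv b h)) /\
  ip (conv a (conv b h)) (conv a (conv b h)) <= (2 * 32 ^+ n * (p / q)) ^+ 2 * ip h h.
Proof.
move=> p0 pq La Lb Hh; have q0 := lt_le_trans p0 pq.
have S : sqint (conv a (conv b h)) by exact: sqint_conv p0 La (sqint_conv q0 Lb Hh).
split => //; have [mc _] := S; have [mh _] := Hh.
rewrite -lee_fin EFinM !ipE//.
have := @sq_le_cubeint h (conv a (conv b h)) (4 ^+ n * (2 * p) * q ^- n.+1) (4 * q) mh mc.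
have -> : 4 ^+ n * (2 * p) * q ^- n.+1 * (2 * (4 * q)) ^+ n = 2 * 32 ^+ n * (p / q).
  have -> : (32 : R) ^+ n = 4 ^+ n * 8 ^+ n by rewrite -exprMn -natrM.
  have -> : (2 * (4 * q)) ^+ n = 8 ^+ n * q ^+ n by rewrite -exprMn mulrA -natrM.
  by rewrite exprS; field; rewrite expf_neq0 gt_eqF.
apply.
- by rewrite !mulr_ge0// ?invr_ge0 ?exprn_ge0// ltW.
- by rewrite mulr_gt0.
- by move=> x; apply: conv_conv_le => //; exact: sqint_locint.
Qed.

End L2_bound.

(** * Geometric sums over scales *)

Section geometric.
Context {R : realType}.
Implicit Types (s r : R).

Lemma sum_half M : \sum_(k < M) (2 ^+ k)^-1 <= 2 :> R.
Proof.
suff H : \sum_(k < M) (2 ^+ k)^-1 + 2 * (2 ^+ M)^-1 <= 2 :> R.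
  apply: le_trans H; rewrite lerDl mulr_ge0// invr_ge0 exprn_ge0//.
elim: M => [|M ih]; first by rewrite big_ord0 expr0 invr1; lra.
rewrite big_ord_recr/= exprS; apply: le_trans ih; rewrite -addrA lerD2l.
by rewrite le_eqVlt; apply/orP; left; apply/eqP; field; rewrite expf_neq0.
Qed.

(** Scales below [r] contribute nothing; they are peeled off until the first one reaches [r], and
    from there on the terms are at most [2 ^- k]. *)
Lemma geo_sum_up M s r : 0 < s -> 0 <= r ->
  \sum_(k < M) (if r <= s * 2 ^+ k then r / (s * 2 ^+ k) else 0) <= 2.
Proof.
move=> + r0; elim: M s => [|M ih] s s0; first by rewrite big_ord0.
have [rs|sr] := leP r s.
  apply: (@le_trans _ _ (\sum_(k < M.+1) (2 ^+ k)^-1)); last exact: sum_half.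
  apply: ler_sum => k _; case: ifP => _; last by rewrite invr_ge0 exprn_ge0.
  by rewrite ler_pdivrMr ?mulr_gt0 ?exprn_gt0// mulrCA mulVf ?mulr1// expf_neq0.
rewrite big_ord_recl/= expr0 mulr1 (lt_geF sr) add0r.
apply: le_trans (ih (s * 2) _); last by rewrite mulr_gt0.
by apply: ler_sum => k _; rewrite /= /bump add1n exprS mulrA.
Qed.

Lemma geo_sum_down M s r : 0 < s -> 0 < r ->
  \sum_(k < M) (if s * 2 ^+ k <= r then (s * 2 ^+ k) / r else 0) <= 2.
Proof.
move=> s0 r0; elim: M => [|M ih]; first by rewrite big_ord0.
rewrite big_ord_recr/=; case: ifPn => [sr|_]; last by rewrite addr0.
suff H : \sum_(k < M.+1) s * 2 ^+ k <= 2 * (s * 2 ^+ M).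
  apply: (@le_trans _ _ ((\sum_(k < M.+1) s * 2 ^+ k) / r)).
    rewrite big_ord_recr/= mulrDl lerD2r mulr_suml; apply: ler_sum => k _.
    by case: ifP => // _; rewrite divr_ge0 ?mulr_ge0 ?exprn_ge0// ltW.
  by rewrite ler_pdivrMr//; apply: le_trans H _; rewrite ler_pM2l.
elim: M {ih sr} => [|M ih]; first by rewrite big_ord_recl big_ord0 expr0; lra.
by rewrite big_ord_recr/= exprS; move: ih; lra.
Qed.

End geometric.

(** * Cotlar's argument *)

Section L2_square.
Context {R : realType} {n : nat}.
Local Notation V := 'rV[R]_n.
Local Notation mu := (rV_lebesgue n).
Implicit Types (f g h : V -> R).
Variables (M : nat) (s : R) (psi : 'I_M -> V -> R).
Hypothesis s0 : 0 < s.
Let q (i : nat) : R := s * 2 ^+ i.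
Hypothesis LP : forall i : 'I_M, LPker (q i) (psi i).
Let C : R := 2 * 32 ^+ n.

Let q0 i : 0 < q i. Proof. by rewrite mulr_gt0// exprn_gt0. Qed.

(** The smaller scale over the larger, counted twice when they agree; as a sum of two one-sided
    ratios it is controlled directly by the two geometric sums. *)
Let ratio (i k : nat) : R := (if q i <= q k then q i / q k else 0) + (if q k <= q i then q k / q i else 0).

Let ratio_sum (i : 'I_M) : \sum_(k < M) ratio i k <= 4.
Proof.
rewrite big_split/=; have := geo_sum_up M s0 (ltW (q0 i)).
have := geo_sum_down M s0 (q0 i); rewrite -/(q _); move=> *.
by rewrite (_ : 4 = 2 + 2)//; first exact: lerD; ring.
Qed.

Let psit i (x : V) := psi i (- x).

(** The pairing is [<f, T_i T_k^* g>]. Young's inequality with parameter [e = C * (q i / q k)] is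
    balanced, because [T_i T_k^*] has norm at most [e]. *)
Let cross (i k : 'I_M) f g : q i <= q k -> sqint f -> sqint g ->
  2 * ip (conv (psit i) f) (conv (psit k) g) <= C * ratio i k * (ip f f + ip g g).
Proof.
move=> ik Hf Hg.
have H1 := sqint_conv (q0 k) (LPker_opp (LP k)) Hg.
have E : (fun x : V => psit i (- x)) = psi i by apply/funext => x; rewrite /psit opprK.
have := ip_conv (q0 i) (LPker_opp (LP i)) Hf H1; rewrite -/(psit i) E => ->.
have [H2 H3] := sqint_conv_conv (q0 i) ik (LP i) (LPker_opp (LP k)) Hg.
have e0 : 0 < C * (q i / q k) by rewrite !mulr_gt0// ?invr_gt0 ?exprn_gt0.
apply: le_trans (ip_young e0 Hf H2) _.
apply: (@le_trans _ _ (C * (q i / q k) * (ip f f + ip g g))).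
  rewrite mulrDr lerD2l ler_pdivrMl//.
  by apply: le_trans H3 _; rewrite -/C expr2 -mulrA.
rewrite ler_wpM2r ?addr_ge0 ?ip_ge0// ler_pM2l ?mulr_gt0 ?exprn_gt0//.
rewrite /ratio ik lerDl; case: ifP => // _.
by rewrite divr_ge0// ltW.
Qed.

(** With [h] the sum of the [T_i^* T_i f], the left side [S] equals [<f, h>], and almost
    orthogonality gives [<h, h> <= 4 C S]. Young with parameter [4 C] yields
    [2 S <= 4 C <f, f> + S], where the finite [S] is absorbed. *)
Lemma sum_ip_conv_le f : sqint f ->
  \sum_(i < M) ip (conv (psi i) f) (conv (psi i) f) <= 4 * C * ip f f.
Proof.
move=> Hf; pose g i := conv (psi i) f.
have Hg i : sqint (g i) by exact: sqint_conv (q0 i) (LP i) Hf.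
have Ht i : sqint (conv (psit i) (g i)) by exact: sqint_conv (q0 i) (LPker_opp (LP i)) (Hg i).
pose h x := \sum_(i < M) conv (psit i) (g i) x.
have Hh : sqint h by exact: sqint_sum.
set S := \sum_(i < M) _.
have SE : S = ip f h.
  apply/esym; apply: (etrans (ip_sumr (index_enum _) Hf Ht)); apply: eq_bigr => i _.
  exact/esym/(ip_conv (q0 i) (LP i) Hf (Hg i)).
have C0 : 0 < C by rewrite mulr_gt0// exprn_gt0.
have hh : ip h h <= 4 * C * S.
  rewrite {2}/h ip_sumr//.
  have -> : \sum_(i < M) ip h (conv (psit i) (g i)) =
     \sum_(i < M) \sum_(k < M) ip (conv (psit i) (g i)) (conv (psit k) (g k)).
    by apply: eq_bigr => i _; rewrite ipC ip_sumr.
  rewrite -(ler_pM2l (ltr0n R 2)) mulr_sumr.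
  apply: (@le_trans _ _ (\sum_(i < M) \sum_(k < M) C * ratio i k * (ip (g i) (g i) + ip (g k) (g k)))).
    apply: ler_sum => i _; rewrite mulr_sumr; apply: ler_sum => k _.
    have [ik|/ltW ki] := leP (q i) (q k); first exact: cross.
    have -> : ratio i k = ratio k i by rewrite /ratio addrC.
    by rewrite ipC (addrC (ip (g i) _)); exact: cross.
  have -> : \sum_(i < M) \sum_(k < M) C * ratio i k * (ip (g i) (g i) + ip (g k) (g k)) =
    2 * \sum_(i < M) C * ip (g i) (g i) * \sum_(k < M) ratio i k.
    have E1 : \sum_(i < M) \sum_(k < M) C * ratio i k * ip (g i) (g i) =
        \sum_(i < M) C * ip (g i) (g i) * \sum_(k < M) ratio i k.
      by apply: eq_bigr => i _; rewrite mulr_sumr; apply: eq_bigr => k _; ring.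
    have E2 : \sum_(i < M) \sum_(k < M) C * ratio i k * ip (g k) (g k) =
        \sum_(i < M) C * ip (g i) (g i) * \sum_(k < M) ratio i k.
      rewrite exchange_big/=; apply: eq_bigr => i _; rewrite mulr_sumr; apply: eq_bigr => k _.
      by rewrite (_ : ratio k i = ratio i k); [ring|rewrite /ratio addrC].
    rewrite mulr2n mulrDl mul1r -{1}E1 -E2 -big_split/=; apply: eq_bigr => i _.
    by rewrite -big_split/=; apply: eq_bigr => k _; rewrite mulrDr.
  rewrite ler_pM2l// /S mulr_sumr; apply: ler_sum => i _.
  rewrite (_ : 4 * C * _ = C * ip (g i) (g i) * 4); last by rewrite /g; ring.
  by apply: ler_wpM2l; [rewrite mulr_ge0 ?ip_ge0// ltW|exact: ratio_sum].
have e0 : 0 < 4 * C by rewrite mulr_gt0.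
have := ip_young e0 Hf Hh; rewrite -SE => Y.
have : (4 * C)^-1 * ip h h <= S by rewrite ler_pdivrMl.
by move: Y; lra.
Qed.

End L2_square.

(** * Dyadic grids and stopping cubes *)

Section grid.
Context {R : realType} {n : nat}.
Local Notation V := 'rV[R]_n.
Local Notation mu := (rV_lebesgue n).
Implicit Types (x y v c : V) (s r : R).

(** Half-open cells of side [s], shifted by [v], are encoded by their integer index; there are
    countably many. *)
Definition cell v s x : 'rV[int]_n := \row_i Num.floor ((x ord0 i - v ord0 i) / s).

Definition cellmate v s : set (V * V) := [set p | cell v s p.1 = cell v s p.2].

Lemma cellmate_sym v s x y : cellmate v s (x, y) -> cellmate v s (y, x).
Proof. by move=> /esym. Qed.

Lemma cellmate_trans v s x y z :
  cellmate v s (x, y) -> cellmate v s (y, z) -> cellmate v s (x, z).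
Proof. by rewrite /cellmate/= => ->. Qed.

Lemma cell_itv v s x (m : 'rV[int]_n) : 0 < s -> cell v s x = m <->
  forall i, (m ord0 i)%:~R * s <= x ord0 i - v ord0 i < (m ord0 i)%:~R * s + s.
Proof.
have e (a : R) : a * s + s = (a + 1) * s by rewrite mulrDl mul1r.
move=> s0; split => [<- i|H].
  rewrite mxE e -ler_pdivlMr// -ltr_pdivrMr//.
  have := floorD1_gt ((x ord0 i - v ord0 i) / s).
  by rewrite floor_le ?num_real// rmorphD rmorph1.
apply/rowP => i; rewrite mxE; apply/eqP; rewrite floor_eq rmorphD rmorph1.
by have := H i; rewrite e ler_pdivlMr// ltr_pdivrMr.
Qed.

Lemma cell_bounds v s x i : 0 < s ->
  (cell v s x ord0 i)%:~R * s <= x ord0 i - v ord0 i < (cell v s x ord0 i)%:~R * s + s.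
Proof. by move=> s0; have /(cell_itv v x _ s0) := erefl (cell v s x); exact. Qed.

Lemma cellmate_near v s x y : 0 < s -> cellmate v s (x, y) -> cube x s y.
Proof.
move=> s0 xy i; have := cell_bounds v x i s0; have := cell_bounds v y i s0.
rewrite (xy : cell v s x = cell v s y) ltr_distl; lra.
Qed.

Lemma cellmate_double v s x y : 0 < s -> cellmate v s (x, y) -> cellmate v (2 * s) (x, y).
Proof.
move=> s0 xy; have s20 : 0 < 2 * s by rewrite mulr_gt0.
apply/(cell_itv v x _ s20) => i.
have := cell_bounds v x i s0; rewrite (xy : cell v s x = cell v s y).
have := cell_bounds v y i s0; have := cell_bounds v y i s20.
move: (cell v s y ord0 i) (cell v (2 * s) y ord0 i) (x ord0 i - v ord0 i) (y ord0 i - v ord0 i).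
move=> a b t u /andP[u1 u2] /andP[u3 u4] /andP[t3 t4].
(* The real bounds on [y] force [2 b <= a <= 2 b + 1] for the integer indices at the two levels. *)
have h1 : ((b + b)%:~R : R) < (a + 1)%:~R.
  by rewrite -(ltr_pM2r s0) !rmorphD rmorph1 !mulrDl mul1r; lra.
have h2 : (a%:~R : R) < (b + b + 1 + 1)%:~R.
  by rewrite -(ltr_pM2r s0) !rmorphD !rmorph1 !mulrDl !mul1r; lra.
move: h1 h2; rewrite !ltr_int => h1 h2.
have h1' : (b + b <= a) by rewrite -ltzD1.
have h2' : (a + 1 <= b + b + 1 + 1) by rewrite lezD1.
have := h1'; rewrite -(ler_int R) -(ler_pM2r s0) !rmorphD !mulrDl => g1.
have := h2'; rewrite -(ler_int R) -(ler_pM2r s0) !rmorphD !rmorph1 !mulrDl !mul1r => g2.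
by apply/andP; split; lra.
Qed.

Lemma cellmate_pow v s k x y : 0 < s -> cellmate v s (x, y) -> cellmate v (s * 2 ^+ k) (x, y).
Proof.
move=> s0 xy; elim: k => [|k ih]; first by rewrite expr0 mulr1.
by rewrite exprS mulrCA; apply: cellmate_double ih; rewrite mulr_gt0// exprn_gt0.
Qed.

Lemma measurable_cell (P : 'rV[int]_n -> Prop) v s : measurable [set x : V | P (cell v s x)].
Proof.
rewrite (_ : mkset _ = \bigcup_(m : 'rV[int]_n)
   (if `[< P m >] then [set x : V | cell v s x = m] else set0)); last first.
  apply/seteqP; split => x /=.
    by move=> Px; exists (cell v s x) => //; rewrite asboolT.
  by move=> [m _]; case: asboolP => // Pm /= ->.
apply: countable_bigcupT_measurable; first exact: countableP.
move=> m; case: ifP => _ //.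
rewrite (_ : mkset _ = \big[setI/setT]_(i < n) (fun x : V => (x ord0 i - v ord0 i) / s) @^-1`
   `[(m ord0 i)%:~R, (m ord0 i + 1)%:~R[%classic).
  apply: bigsetI_measurable => i _; rewrite -[X in measurable X]setTI.
  have mc : measurable_fun setT (fun x : V => (x ord0 i - v ord0 i) / s).
    apply: measurable_funM => //; apply: measurable_funB => //; exact: measurable_coord.
  exact: mc.
rewrite -bigcap_seq; apply/seteqP; split => x /= H.
  move=> i _ /=; rewrite in_itv/= -H mxE.
  by rewrite floor_le ?num_real// floorD1_gt ?num_real.
apply/rowP => i; rewrite mxE; have := H i (mem_index_enum _); rewrite /= in_itv/=.
by rewrite -floor_eq => /eqP.
Qed.

Lemma measurable_cellmate v s : measurable (cellmate v s).
Proof.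
rewrite (_ : cellmate v s = \bigcup_(m : 'rV[int]_n)
   ([set x | cell v s x = m] `*` [set x | cell v s x = m])); last first.
  apply/seteqP; split => -[x y] /=.
    by move=> e; exists (cell v s x).
  by move=> [m _ [/= e1 e2]]; rewrite /cellmate/= e1 e2.
apply: countable_bigcupT_measurable; first exact: countableP.
by move=> m; apply: measurableX; apply: (measurable_cell (fun k => k = m)).
Qed.

Lemma measurable_cell_of v s x : measurable [set y | cellmate v s (x, y)].
Proof. exact: (measurable_cell (fun k => cell v s x = k)). Qed.

(** The half-open cell lies between an open cube of side [s] and open cubes of side [s + e]; letting
    [e] tend to zero closes the gap. *)
Lemma rV_lebesgue_cell v s x : 0 < s -> mu [set y | cellmate v s (x, y)] = (s ^+ n)%:E.
Proof.
move=> s0; pose m := cell v s x.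
pose c : V := \row_i (v ord0 i + ((m ord0 i)%:~R + 2^-1) * s).
have cE i : c ord0 i = v ord0 i + ((m ord0 i)%:~R * s + s / 2).
  by rewrite mxE mulrDl; congr (_ + (_ + _)); rewrite mulrC.
have mQ := measurable_cell_of v s x.
have QP y : cellmate v s (x, y) <-> forall i, c ord0 i - s / 2 <= y ord0 i < c ord0 i + s / 2.
  split => [/esym/(cell_itv v y _ s0) H i|H].
    by have := H i; rewrite -/m cE; lra.
  apply/esym/(cell_itv v y _ s0) => i.
  by have := H i; rewrite -/m cE; lra.
apply/eqP; rewrite eq_le; apply/andP; split; last first.
  have -> : ((s ^+ n)%:E = mu (cube c (s / 2)))%E.
    by rewrite rV_lebesgue_cube ?divr_ge0 ?ltW// mulrC divfK.
  apply: le_measure; rewrite ?inE//; first exact: measurable_cube.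
  by move=> y H; apply/QP => i; have := H i; rewrite ltr_distl => /andP[/ltW h1 h2]; apply/andP.
have H (e : R) : 0 < e -> (mu [set y | cellmate v s (x, y)] <= ((s + e) ^+ n)%:E)%E.
  move=> e0; have -> : (((s + e) ^+ n)%:E = mu (cube c ((s + e) / 2)))%E.
    by rewrite rV_lebesgue_cube ?divr_ge0 ?addr_ge0 ?ltW// mulrC divfK.
  apply: le_measure; rewrite ?inE//; first exact: measurable_cube.
  move=> y /QP H i; have := H i; rewrite ltr_distl; lra.
move: H; have : (0 <= mu [set y | cellmate v s (x, y)])%E by exact: measure_ge0.
case: (mu _) => [a a0 H| _ /(_ _ ltr01)|//]; last by rewrite leye_eq.
rewrite lee_fin leNgt; apply/negP => sa.
have cts : {for 0, continuous (fun e : R => (s + e) ^+ n)}.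
  apply: (@continuous_comp _ _ _ (fun e : R => s + e) (fun t : R => t ^+ n)); last exact: exprn_continuous.
  by apply: continuousD; [exact: cst_continuous|].
have : \forall e \near (0 : R), (s + e) ^+ n < a.
  by apply: (cvgr_lt ((s + 0) ^+ n) cts); rewrite addr0.
move=> /nbhs_ballP[d /= d0 /(_ (d / 2))].
rewrite /ball/= sub0r normrN gtr0_norm ?divr_gt0// => /(_ _) h.
have := H (d / 2); rewrite lee_fin divr_gt0// => /(_ isT); rewrite leNgt h//.
by rewrite ltr_pdivrMr// ltr_pMr// ltr1n.
Qed.

Local Open Scope ereal_scope.

(* Conditional expectation on the grid of side [s]. *)
Definition cavg v s (h : V -> \bar R) x : \bar R :=
  (s ^- n)%:E * relint (cellmate v s) h x.

Lemma cavg_ge0 v s h x : (0 < s)%R -> (forall x, 0 <= h x) -> 0 <= cavg v s h x.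
Proof.
move=> s0 h0; rewrite mule_ge0 ?integral_ge0// lee_fin invr_ge0 exprn_ge0//.
exact: ltW.
Qed.

Lemma measurable_cavg v s h : measurable_fun setT h -> (forall x, 0 <= h x) ->
  measurable_fun setT (cavg v s h).
Proof.
by move=> mh h0; apply: measurable_funeM; apply: measurable_relint => //; exact: measurable_cellmate.
Qed.

Lemma relint_cellmate v s h x y : cellmate v s (x, y) ->
  relint (cellmate v s) h x = relint (cellmate v s) h y.
Proof.
move=> xy; rewrite /relint; congr (integral _ _ _); apply/seteqP; split => z /= H.
  by move: xy H; rewrite /cellmate/= => ->.
by move: xy H; rewrite /cellmate/= => ->.
Qed.

Lemma cavg_cellmate v s h x y : cellmate v s (x, y) -> cavg v s h x = cavg v s h y.
Proof. by move=> xy; rewrite /cavg (relint_cellmate h xy). Qed.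

Lemma relint_cellmate_cst v s (a : R) x : (0 < s)%R ->
  relint (cellmate v s) (cst a%:E) x = (a * s ^+ n)%:E.
Proof.
move=> s0; rewrite EFinM -(rV_lebesgue_cell v x s0); apply: integral_cst.
exact: measurable_cell_of.
Qed.

(** Self-adjointness moves the average onto the indicator of [Z], which it fixes because [Z] is a
    union of cells. *)
Lemma integral_cavg v s h (Z : set V) : (0 < s)%R -> measurable Z ->
  (forall x y, cellmate v s (x, y) -> Z x -> Z y) ->
  measurable_fun setT h -> (forall x, 0 <= h x) ->
  \int[mu]_(x in Z) cavg v s h x = \int[mu]_(x in Z) h x.
Proof.
move=> s0 mZ ZQ mh h0; pose g x : \bar R := (\1_Z x)%:E.
have g0 x : 0 <= g x by rewrite lee_fin.
have mg : measurable_fun setT g by apply/measurable_EFinP/measurable_indic.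
have sn0 : (0 <= s ^- n)%R by rewrite invr_ge0 exprn_ge0// ltW.
have mcell := @measurable_cellmate v s.
have mr := measurable_relint mcell mh h0.
have r0 x : 0 <= relint (cellmate v s) h x by exact: integral_ge0.
have ind (f : V -> \bar R) : \int[mu]_(x in Z) f x = \int[mu]_x (g x * f x).
  rewrite integral_mkcond; apply: eq_integral => x _.
  by rewrite /patch /g indicE; case: ifP => _; rewrite ?mul1e ?mul0e.
rewrite ind; under eq_integral do rewrite /cavg muleCA.
rewrite ge0_integralZl//; last 2 first.
- exact: emeasurable_funM.
- by move=> x _; rewrite mule_ge0.
rewrite (relint_swap mcell (@cellmate_sym v s))// ind.
rewrite -ge0_integralZl//; last 2 first.
- by apply: emeasurable_funM => //; exact: measurable_relint.
- by move=> x _; rewrite mule_ge0// integral_ge0.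
apply: eq_integral => x _.
have -> : relint (cellmate v s) g x = g x * (s ^+ n)%:E.
  rewrite /g indicE; case: (boolP (x \in Z)) => [/set_mem Zx|Zx].
    rewrite mul1e -[X in X%:E]mul1r -(relint_cellmate_cst v 1 x s0).
    apply: eq_integral => y /set_mem/= xy; rewrite indicE mem_set//.
    exact: ZQ xy Zx.
  rewrite mul0e /relint; apply: integral0_eq => y /= xy; rewrite indicE memNset// => Zy.
  by move/negP : Zx; apply; apply/mem_set/(ZQ y) => //; exact: cellmate_sym.
by rewrite (muleA (h x)) muleCA -EFinM mulVf ?mule1 1?muleC// expf_neq0 ?gt_eqF.
Qed.

End grid.

(** * Stopping cells and their neighbourhoods *)

Section stopping.
Context {R : realType} {n : nat}.
Local Notation V := 'rV[R]_n.
Local Notation mu := (rV_lebesgue n).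
Implicit Types (x y v c : V) (s r : R) (h : V -> \bar R).
Local Open Scope ereal_scope.

Lemma cavg_double v s h x : (0 < s)%R -> measurable_fun setT h -> (forall x, 0 <= h x) ->
  cavg v s h x <= (2 ^+ n)%:E * cavg v (2 * s) h x.
Proof.
move=> s0 mh h0; rewrite /cavg muleA -EFinM.
have -> : (2 ^+ n * (2 * s) ^- n = s ^- n)%R.
  by rewrite exprMn invfM mulrA mulfV ?mul1r// expf_neq0.
apply: lee_wpmul2l; first by rewrite lee_fin invr_ge0 exprn_ge0// ltW.
apply: ge0_subset_integral => //; try exact: measurable_cell_of.
- exact: measurable_funTS.
- by move=> y; exact: cellmate_double.
Qed.

Lemma cavg_le_integral v s h x : (0 < s)%R -> measurable_fun setT h -> (forall x, 0 <= h x) ->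
  cavg v s h x <= (s ^- n)%:E * \int[mu]_y h y.
Proof.
move=> s0 mh h0; apply: lee_wpmul2l; first by rewrite lee_fin invr_ge0 exprn_ge0// ltW.
by apply: ge0_subset_integral => //; exact: measurable_cell_of.
Qed.

(** [2 * s] is the support radius of a kernel of scale [s]: based at a point off this set, such a
    kernel does not see [Z]. *)
Definition fatten s (Z : set V) : set V := [set x | exists2 y, Z y & (`|x - y| < 2 * s)%R].

Lemma measurable_fatten s Z : measurable (fatten s Z).
Proof.
apply: open_rV_measurable; case: (leP s 0%R) => s0.
  rewrite (_ : fatten s Z = set0); first exact: open0.
  apply/seteqP; split => // x [y _]; rewrite ltNge => /negP; apply.
  by apply: le_trans (normr_ge0 _); rewrite mulr_ge0_le0.
rewrite (_ : fatten s Z = \bigcup_(y in Z) ball y (2 * s)%R).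
  by apply: bigcup_open => y _; exact: ball_open.
apply/seteqP; split => x /=.
  by move=> [y Zy xy]; exists y => //; rewrite -ball_normE/= distrC.
by move=> [y Zy]; rewrite -ball_normE/= distrC => xy; exists y.
Qed.

(** About each point of the fattened set, the cube of radius [3 * s] contains a whole cell of [Z],
    so [s ^ n] is at most the cube integral of the indicator of [Z]; integration gives the volume
    ratio [6 ^ n]. *)
Lemma fatten_le v s Z : (0 < s)%R -> measurable Z ->
  (forall x y, cellmate v s (x, y) -> Z x -> Z y) ->
  mu (fatten s Z) <= (6 ^+ n)%:E * mu Z.
Proof.
move=> s0 mZ ZQ; pose g x : \bar R := (\1_Z x)%:E.
have g0 x : 0 <= g x by rewrite lee_fin.
have mg : measurable_fun setT g by apply/measurable_EFinP/measurable_indic.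
have mF := measurable_fatten s Z.
have sn : (0 < s ^+ n)%R by rewrite exprn_gt0.
have H : (s ^+ n)%:E * mu (fatten s Z) <= ((2 * (3 * s)) ^+ n)%:E * mu Z.
  have muI A : measurable A -> mu A = \int[mu]_x (\1_A x : R)%:E.
    by move=> mA; rewrite integral_indic// setIT.
  rewrite (muI Z)// -(integral_cubeint _ mg g0); last first.
    by rewrite mulr_ge0// ltW.
  apply: (@le_trans _ _ (\int[mu]_(x in fatten s Z) (s ^+ n)%:E)).
    by rewrite integral_cst.
  rewrite integral_mkcond; apply: ge0_le_integralT => x _.
    by rewrite /patch; case: ifP => // _; rewrite lee_fin ltW.
  rewrite /patch; case: ifPn => [/set_mem [y Zy xy]|_]; last exact: cubeint_ge0.
  rewrite -(rV_lebesgue_cell v y s0) (muI _ (measurable_cell_of v s y)).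
  rewrite /cubeint [leRHS]integral_mkcond; apply: ge0_le_integralT => // z _.
  rewrite indicE; case: (boolP (z \in _)) => [/set_mem/= yz|_]; last first.
    by rewrite /patch; case: ifP.
  have zx : cube x (3 * s) z.
    apply: (@cubeS _ _ y x s) (cellmate_near s0 yz).
    by rewrite distrC; move: xy; lra.
  by rewrite /patch mem_set// /g indicE mem_set//; exact: ZQ yz Zy.
rewrite -(lee_pmul2l _ (_ : 0 < (s ^+ n)%:E))//.
apply: le_trans H _; rewrite muleA -EFinM (_ : 2 * (3 * s) = 6 * s)%R; last by ring.
by rewrite exprMn mulrC.
Qed.

(** [Z i] is the union of the cells of level [i] that are maximal among the cells with average above
    [b]. Maximality gives disjointness and, through the parent cell, the bound [2 ^ n * b]. Averages
    over large cells tend to zero, which bounds the levels. *)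
Lemma stopping_cubes v s h (b : R) : (0 < n)%N -> (0 < s)%R -> (0 < b)%R ->
  measurable_fun setT h -> (forall x, 0 <= h x) -> \int[mu]_x h x < +oo ->
  exists L (Z : nat -> set V),
   [/\ forall i, measurable (Z i),
       forall i x y, cellmate v (s * 2 ^+ i) (x, y) -> Z i x -> Z i y,
       forall i j x, Z i x -> Z j x -> i = j,
       forall i x, Z i x -> [/\ (i < L)%N, b%:E < cavg v (s * 2 ^+ i) h x &
          cavg v (s * 2 ^+ i) h x <= (2 ^+ n * b)%:E]
     & forall i x, b%:E < cavg v (s * 2 ^+ i) h x -> exists2 j, (i <= j)%N & Z j x].
Proof.
move=> n0 s0 b0 mh h0 hfin.
have q0 i : (0 < s * 2 ^+ i)%R by rewrite mulr_gt0// exprn_gt0.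
have [L HL] : exists L, forall i x, (L <= i)%N -> cavg v (s * 2 ^+ i) h x <= b%:E.
  have := hfin; have : 0 <= \int[mu]_x h x by exact: integral_ge0.
  case E : (\int[mu]_x h x) => [a| |]// a0 _; rewrite lee_fin in a0.
  (* From this level on the side is at least one and at least [a / b], hence so is its [n]-th
     power. *)
  pose t : R := (Num.max 1 (a / b) / s)%R.
  exists (Num.truncn t).+1 => i x Li; apply: le_trans (cavg_le_integral v x (q0 i) mh h0) _.
  rewrite E -EFinM lee_fin ler_pdivrMl ?exprn_gt0// -ler_pdivrMr//.
  have qi : (Num.max 1 (a / b) <= s * 2 ^+ i)%R.
    rewrite [leRHS]mulrC -ler_pdivrMr// -/t; apply: le_trans (ltW (truncnS_gt t)) _.
    by rewrite -natrX ler_nat; apply: leq_trans Li _; apply/ltnW/ltn_expl.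
  apply: le_trans (le_trans _ qi) _; first by rewrite le_max lexx orbT.
  case: (n) n0 => // m _; rewrite exprS; apply: ler_peMr; first exact: ltW.
  by rewrite exprn_ege1//; apply: le_trans qi; rewrite le_max lexx.
pose Z i := [set x | b%:E < cavg v (s * 2 ^+ i) h x /\
   forall j, (i < j)%N -> cavg v (s * 2 ^+ j) h x <= b%:E].
exists L, Z; split.
- move=> i; rewrite (_ : Z i = [set x | b%:E < cavg v (s * 2 ^+ i) h x] `&`
     \bigcap_(j in [set j | (i < j)%N]) [set x | cavg v (s * 2 ^+ j) h x <= b%:E]).
    apply: measurableI.
      rewrite -[X in measurable X]setTI; apply: emeasurable_fun_o_infty => //.
      exact: measurable_cavg.
    apply: bigcap_measurable => [|j _]; first by exists i.+1 => /=.
    rewrite -[X in measurable X]setTI; apply: emeasurable_fun_infty_c => //.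
    exact: measurable_cavg.
  by apply/seteqP; split => x /= [H1 H2].
- move=> i x y xy [H1 H2]; split; first by rewrite -(cavg_cellmate h xy).
  move=> j ij; rewrite -(cavg_cellmate h (_ : cellmate v (s * 2 ^+ j) (x, y))); first exact: H2.
  rewrite -(subnKC (ltnW ij)) exprD mulrA; exact: cellmate_pow.
- move=> i j x [i1 i2] [j1 j2]; case: (ltngtP i j) => // ij.
    by move: j1; rewrite ltNge i2.
  by move: i1; rewrite ltNge j2.
- move=> i x [i1 i2]; split => //.
    by rewrite ltnNge; apply/negP => /(HL i x); rewrite leNgt i1.
  apply: le_trans (cavg_double v x (q0 i) mh h0) _; rewrite EFinM.
  apply: lee_wpmul2l; first by rewrite lee_fin exprn_ge0.
  by rewrite mulrCA -exprS; exact: i2.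
- move=> i x ix; pose P := [pred j | b%:E < cavg v (s * 2 ^+ j) h x].
  have exP : exists j, P j by exists i.
  have bP j : P j -> (j <= L)%N.
    by rewrite /P/= => Pj; rewrite leqNgt; apply/negP => /ltnW/(HL j x); rewrite leNgt Pj.
  case: (ex_maxnP exP bP) => j Pj jmax; exists j; first exact: jmax.
  split => // k jk; rewrite leNgt; apply/negP => Pk.
  by have := jmax k Pk; rewrite leqNgt jk.
Qed.

Lemma stopping_measure v s h (b : R) L (Z : nat -> set V) : (0 < s)%R -> (0 < b)%R ->
  measurable_fun setT h -> (forall x, 0 <= h x) ->
  (forall i, measurable (Z i)) ->
  (forall i x y, cellmate v (s * 2 ^+ i) (x, y) -> Z i x -> Z i y) ->
  (forall i j x, Z i x -> Z j x -> i = j) ->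
  (forall i x, Z i x -> b%:E < cavg v (s * 2 ^+ i) h x) ->
  b%:E * \sum_(i < L) mu (Z i) <= \int[mu]_x h x.
Proof.
move=> s0 b0 mh h0 mZ ZQ Zd Zb.
have q0 i : (0 < s * 2 ^+ i)%R by rewrite mulr_gt0// exprn_gt0.
rewrite ge0_sume_distrr//.
apply: (@le_trans _ _ (\sum_(i < L) \int[mu]_(x in Z i) h x)).
  apply: lee_sum => i _.
  rewrite -(integral_cavg (q0 i) (mZ i) (ZQ i) mh h0) -integral_cst//.
  apply: ge0_le_integralT => x Zx; first by rewrite lee_fin ltW.
  exact/ltW/Zb.
have tZ : trivIset [set` index_enum 'I_L] (fun i : 'I_L => Z i).
  by apply/trivIsetP => i j _ _ /eqP ij; apply/seteqP; split => // x [/Zd H /H/val_inj].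
rewrite -(@ge0_integral_bigsetU _ _ _ mu 'I_L (fun i => Z i))//=.
- apply: ge0_subset_integral => //; first exact: bigsetU_measurable.
- exact: index_enum_uniq.
- exact: measurable_funTS.
Qed.

(* By Fubini: every cell meeting [cube x s] lies in [cube x (2 * s)]. *)
Lemma cubeint_dyadic_le v s h (b : R) x : (0 < s)%R -> (0 <= b)%R ->
  measurable_fun setT h -> (forall x, 0 <= h x) ->
  (forall y, cube x s y -> cavg v s h y <= b%:E) ->
  cubeint s h x <= (b * (4 * s) ^+ n)%:E.
Proof.
move=> s0 b0 mh h0 H; pose g y := h y * (\1_(cube x s) y)%:E.
have g0 y : 0 <= g y by rewrite mule_ge0// lee_fin.
have mc := @measurable_cube R n x s.
have mg : measurable_fun setT g.
  by apply: emeasurable_funM => //; apply/measurable_EFinP/measurable_indic.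
have -> : cubeint s h x = \int[mu]_y g y.
  rewrite /cubeint integral_mkcond; apply: eq_integral => y _.
  by rewrite /patch /g indicE; case: ifP => _; rewrite ?mule1 ?mule0.
rewrite -(@integral_cavg _ _ v s g setT)//.
have -> : ((b * (4 * s) ^+ n)%:E = cubeint (2 * s) (cst b%:E) x)%E.
  by rewrite cubeint_cst// ?mulrA -?natrM// mulr_ge0// ltW.
rewrite /cubeint [leRHS]integral_mkcond; apply: ge0_le_integralT => z _.
  exact: cavg_ge0.
have [[y [zy yx]]|Hz] := pselect (exists y, cellmate v s (z, y) /\ cube x s y); last first.
  rewrite (_ : cavg v s g z = 0); first by rewrite /patch; case: ifP.
  rewrite /cavg /relint integral0_eq ?mule0// => y /= zy.
  by rewrite /g indicE memNset ?mule0// => yx; apply: Hz; exists y.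
rewrite /patch mem_set/=; last first.
  apply: (@cubeS _ _ y x s) (cellmate_near s0 (cellmate_sym zy)).
  by have /(cubeE x y s0) := yx; lra.
rewrite (cavg_cellmate _ zy); apply: le_trans (H y yx).
apply: lee_wpmul2l; first by rewrite lee_fin invr_ge0 exprn_ge0// ltW.
apply: ge0_le_integralT => w _ //.
by rewrite /g indicE; case: (w \in _); rewrite ?mule1 ?mule0.
Qed.

End stopping.

(** * Weak type bound for the maximal function *)

Section maximal.
Context {R : realType} {n : nat}.
Local Notation V := 'rV[R]_n.
Local Notation mu := (rV_lebesgue n).
Implicit Types (x y v c : V) (s r : R) (h : V -> \bar R).
Local Open Scope ereal_scope.

Lemma dyadic_scale (s r : R) : (0 < s)%R -> (s <= r)%R ->
  exists k, (r <= s * 2 ^+ k <= 2 * r)%R.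
Proof.
move=> s0 sr.
have exP : exists k, (r <= s * 2 ^+ k)%R.
  exists (Num.truncn (r / s)).+1; rewrite [leRHS]mulrC -ler_pdivrMr//.
  apply: le_trans (ltW (truncnS_gt _)) _.
  by rewrite -natrX ler_nat; apply/ltnW/ltn_expl.
case: (ex_minnP exP) => k rk kmin; exists k; rewrite rk/=.
case: k rk kmin => [|k] rk kmin; first by rewrite expr0 mulr1; lra.
have : ~~ (r <= s * 2 ^+ k)%R by apply/negP => /kmin; rewrite ltnn.
by rewrite -ltNge exprS mulrCA => h; rewrite ler_pM2l// ltW.
Qed.

(** The radius [r] is rounded up to a dyadic side, at most [2 * r], which turns [4] into [8]. If the
    cube is too heavy, a cell meeting it has average above [b], and then the centre of the cube lies
    in the fattened stopping cell. *)
Lemma stopping_fatten h (s b : R) : (0 < n)%N -> (0 < s)%R -> (0 < b)%R ->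
  measurable_fun setT h -> (forall x, 0 <= h x) -> \int[mu]_x h x < +oo ->
  exists O : set V, [/\ measurable O, b%:E * mu O <= (6 ^+ n)%:E * \int[mu]_x h x &
    forall x, ~ O x -> forall r, (s <= r)%R -> cubeint r h x <= (b * (8 * r) ^+ n)%:E].
Proof.
move=> n0 s0 b0 mh h0 hfin.
have [L [Z [mZ ZQ Zd Zb Zcov]]] := stopping_cubes 0%R n0 s0 b0 mh h0 hfin.
have q0 i : (0 < s * 2 ^+ i)%R by rewrite mulr_gt0// exprn_gt0.
exists (\big[setU/set0]_(i < L) fatten (s * 2 ^+ i) (Z i)); split.
- by apply: bigsetU_measurable => i _; exact: measurable_fatten.
- apply: (@le_trans _ _ (b%:E * \sum_(i < L) (6 ^+ n)%:E * mu (Z i))).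
    apply: lee_wpmul2l; first by rewrite lee_fin ltW.
    apply: le_trans (@Boole_inequality _ _ _ mu (fun i => fatten (s * 2 ^+ i) (Z i)) L _) _.
      by move=> i _; exact: measurable_fatten.
    by apply: lee_sum => i _; exact: fatten_le (q0 i) (mZ i) (ZQ i).
  rewrite -ge0_sume_distrr// muleCA; apply: lee_wpmul2l.
    by rewrite lee_fin exprn_ge0.
  by apply: stopping_measure s0 b0 mh h0 mZ ZQ Zd _ => i x /Zb[].
- move=> x Ox r sr; have [k /andP[rk kr]] := dyadic_scale s0 sr.
  have r0 : (0 < r)%R by exact: lt_le_trans sr.
  apply: (@le_trans _ _ (cubeint (s * 2 ^+ k) h x)).
    by apply: le_cubeint => //; rewrite subrr normr0 add0r.
  apply: (@le_trans _ _ (b * (4 * (s * 2 ^+ k)) ^+ n)%:E).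
    apply: (@cubeint_dyadic_le _ _ 0%R) => //; first exact: ltW.
    move=> y /(cubeE x y (q0 k)) yx; rewrite leNgt; apply/negP => /Zcov[j kj Zy].
    apply: Ox; rewrite -(bigcup_mkord L (fun i => fatten (s * 2 ^+ i) (Z i))); exists j; first by case: (Zb _ _ Zy).
    exists y => //; rewrite distrC; apply: lt_le_trans yx _.
    rewrite mulrCA ler_pM2l// -exprS; apply: ler_weXn2l; first by rewrite ler1n.
    exact: leqW.
  rewrite lee_fin ler_pM2l//; apply: lerXn2r; rewrite ?nnegrE.
  - by rewrite mulr_ge0// ltW.
  - by rewrite mulr_ge0// ltW.
  - by move: kr; lra.
Qed.

(** The exceptional set is the union of all cubes that violate the bound: it is open, and it is the
    increasing union over [N] of the cubes of radius at least [2 ^- N]. A cube lies in the cube of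
    twice the radius about each of its points, whence [16] instead of [8]. *)
Lemma maximal_weak h (b : R) : (0 < n)%N -> (0 < b)%R ->
  measurable_fun setT h -> (forall x, 0 <= h x) -> \int[mu]_x h x < +oo ->
  exists O : set V, [/\ measurable O, b%:E * mu O <= (6 ^+ n)%:E * \int[mu]_x h x &
    forall x, ~ O x -> forall r, (0 < r)%R -> cubeint r h x <= (b * (16 * r) ^+ n)%:E].
Proof.
move=> n0 b0 mh h0 hfin.
pose D N := [set p : V * R | (2 ^- N <= p.2)%R /\ (b * (16 * p.2) ^+ n)%:E < cubeint p.2 h p.1].
pose G N : set V := \bigcup_(p in D N) cube p.1 p.2.
have e0 N : (0 < 2 ^- N :> R)%R by rewrite invr_gt0 exprn_gt0.
have mG N : measurable (G N).
  apply: open_rV_measurable; apply: bigcup_open => -[x r] [/= r0 _].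
  by apply: open_cube; exact: lt_le_trans r0.
have ndG : nondecreasing_seq G.
  move=> N M NM; apply/subsetPset => z [[x r] [/= Nr hr] zx]; exists (x, r) => //.
  split => //=; apply: le_trans Nr; rewrite lef_pV2 ?posrE ?exprn_gt0//.
  by apply: ler_weXn2l => //; rewrite ler1n.
have GN N : mu (G N) <= (b^-1 * 6 ^+ n)%:E * \int[mu]_x h x.
  have [W [mW muW HW]] := stopping_fatten n0 (e0 N) b0 mh h0 hfin.
  apply: (@le_trans _ _ (mu W)).
    apply: le_measure; rewrite ?inE// => z [[x r] [/= Nr hr] zx].
    have r0 : (0 < r)%R by exact: lt_le_trans Nr.
    apply: contrapT => Wz; have r2 : (2 ^- N <= 2 * r)%R by move: Nr; lra.
    have := HW z Wz _ r2; rewrite leNgt => /negP; apply.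
    rewrite (_ : 8 * (2 * r) = 16 * r)%R; last by ring.
    apply: lt_le_trans hr _; apply: le_cubeint => //.
    by have /(cubeE x z r0) := zx; rewrite distrC; lra.
  by rewrite EFinM -muleA lee_pdivlMl.
exists (\bigcup_N G N); split.
- exact: bigcupT_measurable.
- rewrite -lee_pdivlMl// muleA -EFinM.
  have c := @nondecreasing_cvg_mu _ _ _ mu G mG (bigcupT_measurable G mG) ndG.
  rewrite -(cvg_lim _ c)//; apply: lime_le; first by apply/cvg_ex; eexists; exact: c.
  by apply: nearW => N /=; exact: GN.
- move=> x Ox r r0; rewrite leNgt; apply/negP => hr; apply: Ox.
  exists (Num.truncn r^-1).+1 => //; exists (x, r) => /=; last first.
    by move=> i; rewrite subrr normr0.
  split => //; rewrite -[X in (_ <= X)%R]invrK lef_pV2 ?posrE ?invr_gt0 ?exprn_gt0//.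
  apply: le_trans (ltW (truncnS_gt _)) _.
  by rewrite -natrX ler_nat; apply/ltnW/ltn_expl.
Qed.

End maximal.

(** * Weak type (1,1) bound for finitely many scales *)

Section stopped_average.
Context {R : realType} {n : nat}.
Local Notation V := 'rV[R]_n.
Local Notation mu := (rV_lebesgue n).
Implicit Types (x y z v : V) (f g psi : V -> R).
Variables (m : nat) (v0 : V) (W : nat -> set V) (w : nat -> R) (f : V -> R).
Hypotheses (w0 : forall i, 0 < w i) (mW : forall i, measurable (W i)).
Hypothesis WQ : forall i x y, cellmate v0 (w i) (x, y) -> W i x -> W i y.
Hypothesis Wd : forall i j x, W i x -> W j x -> i = j.
Hypothesis Wc : forall x, exists2 i, (i < m)%N & W i x.
Hypothesis fi : mu.-integrable setT (EFin \o f).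

Let Lf : locint f := locint_integrable fi.
Let mf : measurable_fun setT f := Lf.1.

(** Kernel of the conditional expectation for the partition whose cell at a point of [W i] is its
    grid cell of side [w i]; [saverage] is that expectation. It serves as the good part of the
    decomposition. *)
Definition skernel (p : V * V) : R :=
  \sum_(i < m) \1_(W i) p.1 * (\1_(cellmate v0 (w i)) p * w i ^- n).

Definition saverage y : R := \int[mu]_z (skernel (y, z) * f z).

Lemma sum_W i y (c : nat -> R) : (i < m)%N -> W i y ->
  \sum_(j < m) \1_(W j) y * c j = c i.
Proof.
move=> im Wi; rewrite (bigD1 (Ordinal im))//= indicE mem_set// mul1r big1 ?addr0// => j ji.
rewrite indicE memNset ?mul0r// => Wj; move/negP : ji; apply.
by apply/eqP/val_inj => /=; exact: Wd Wj Wi.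
Qed.

Lemma skernelE i y z : (i < m)%N -> W i y ->
  skernel (y, z) = \1_(cellmate v0 (w i)) (y, z) * w i ^- n.
Proof.
move=> im Wi.
exact: (sum_W (fun i => \1_(cellmate v0 (w i)) (y, z) * w i ^- n) im Wi).
Qed.

(** Cellmates at side [w i] belong to the same [W i], so both points use the same side. *)
Lemma skernel_sym y z : skernel (y, z) = skernel (z, y).
Proof.
have [i im Wy] := Wc y; have [j jm Wz] := Wc z.
rewrite (skernelE z im Wy) (skernelE y jm Wz).
have [e|ne] := pselect (cellmate v0 (w i) (y, z)).
  have ij : i = j by apply: (Wd (WQ e Wy) Wz).
  by rewrite -ij !indicE !mem_set//; exact: cellmate_sym.
rewrite [in LHS]indicE memNset// mul0r indicE memNset ?mul0r// => e.
have ji : j = i by apply: (Wd (WQ e Wz) Wy).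
by apply: ne; apply: cellmate_sym; rewrite -ji.
Qed.

Lemma skernel_ge0 p : 0 <= skernel p.
Proof.
by apply: sumr_ge0 => i _; rewrite !mulr_ge0// invr_ge0 exprn_ge0// ltW.
Qed.

Lemma measurable_skernel : measurable_fun setT skernel.
Proof.
apply: measurable_sum => i; apply: measurable_funM.
  exact: measurableT_comp (measurable_indic (mW i)) (@measurable_fst _ _ V V).
by apply: measurable_funM => //; apply: measurable_indic; exact: measurable_cellmate.
Qed.

Lemma measurable_skernel2 y : measurable_fun setT (fun z => skernel (y, z)).
Proof. exact: measurableT_comp measurable_skernel (measurable_pair1 y). Qed.

Lemma skernel_cube i y z : (i < m)%N -> W i y ->
  `|skernel (y, z)| <= w i ^- n * \1_(cube y (w i)) z.
Proof.
move=> im Wi; rewrite (skernelE z im Wi) ger0_norm; last first.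
  by rewrite mulr_ge0// invr_ge0 exprn_ge0// ltW.
rewrite [leLHS]mulrC; apply: ler_wpM2l; first by rewrite invr_ge0 exprn_ge0// ltW.
rewrite !indicE; case: (boolP ((y, z) \in _)) => [/set_mem e|_] //.
by rewrite mem_set//; exact: cellmate_near e.
Qed.

Lemma skernel_int y (k : V -> R) : locint k ->
  mu.-integrable setT (EFin \o (fun z => skernel (y, z) * k z)).
Proof.
move=> Lk; have [i im Wi] := Wc y.
apply: (kernel_bound (x := y) (r := w i) (a := w i ^- n) Lk _ _ _).1.
- exact: measurable_skernel2.
- by rewrite invr_ge0 exprn_ge0// ltW.
- by move=> z; exact: skernel_cube.
Qed.

Lemma integral_skernel i y (h : V -> \bar R) : (i < m)%N -> W i y ->
  measurable_fun setT h -> (forall x, 0 <= h x)%E ->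
  (\int[mu]_z ((skernel (y, z))%:E * h z) = cavg v0 (w i) h y)%E.
Proof.
move=> im Wi mh h0; rewrite /cavg relintE -ge0_integralZl//.
- by apply: eq_integral => z _; rewrite (skernelE z im Wi) EFinM muleA (muleC (w i ^- n)%:E).
- apply: emeasurable_funM => //; apply/measurable_EFinP.
  apply: measurableT_comp (measurable_pair1 y).
  by apply: measurable_indic; exact: measurable_cellmate.
- by move=> z _; rewrite mule_ge0// lee_fin.
- by rewrite lee_fin invr_ge0 exprn_ge0// ltW.
Qed.

Lemma integral_skernel1 y : (\int[mu]_z (skernel (y, z))%:E = 1)%E.
Proof.
have [i im Wi] := Wc y.
transitivity (\int[mu]_z ((skernel (y, z))%:E * (cst 1 z)))%E.
  by apply: eq_integral => z _; rewrite mule1.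
rewrite (integral_skernel im Wi)// /cavg.
rewrite (relint_cellmate_cst v0 1 y (w0 i)) mul1r -EFinM mulVf// expf_neq0// gt_eqF//.
Qed.

Lemma saverage_le i y : (i < m)%N -> W i y ->
  (`|saverage y|%:E <= cavg v0 (w i) (fun z => `|f z|%:E) y)%E.
Proof.
move=> im Wi; rewrite -(integral_skernel im Wi)//; last exact: measurable_absE.
have I := skernel_int y Lf.
rewrite /saverage EFin_normr_Rintegral//.
apply: le_trans (le_abse_integral _ _ _) _ => //; first by case/integrableP : I.
by apply: ge0_le_integralT => // z _; rewrite abse_EFin normrM (ger0_norm (skernel_ge0 _)).
Qed.

Lemma measurable_saverage : measurable_fun setT saverage.
Proof.
apply: (@measurable_Rint2 _ _ (fun p => skernel p * f p.2)).
apply: measurable_funM; first exact: measurable_skernel.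
exact: measurableT_comp mf (@measurable_snd _ _ V V).
Qed.

Let Fub (h : V * V -> \bar R) := fubini_tonelli (m1 := mu) (m2 := mu) h.

Lemma integral_saverage : (\int[mu]_y `|saverage y|%:E <= \int[mu]_z `|f z|%:E)%E.
Proof.
have mabs := measurable_absE mf.
have mF : measurable_fun setT (fun p : V * V => (skernel p)%:E * `|f p.2|%:E)%E.
  apply: emeasurable_funM; first by apply/measurable_EFinP; exact: measurable_skernel.
  exact: measurableT_comp mabs (@measurable_snd _ _ V V).
apply: (@le_trans _ _ (\int[mu]_y \int[mu]_z ((skernel (y, z))%:E * `|f z|%:E))%E).
  apply: ge0_le_integralT => y _ //.
  have [i im Wi] := Wc y; rewrite (integral_skernel im Wi)//; exact: saverage_le.
rewrite (Fub mF); last by move=> p; rewrite mule_ge0// lee_fin skernel_ge0.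
apply: ge0_le_integralT => z _.
  by apply: integral_ge0 => y _; rewrite mule_ge0// lee_fin skernel_ge0.
rewrite (eq_integral (fun y => `|f z|%:E * (skernel (z, y))%:E)%E); last first.
  by move=> y _; rewrite muleC skernel_sym.
rewrite ge0_integralZl//; last 2 first.
- by apply/measurable_EFinP; exact: measurable_skernel2.
- by move=> y _; rewrite lee_fin skernel_ge0.
by rewrite integral_skernel1 mule1.
Qed.

Variables (q : R) (psi : V -> R).
Hypotheses (q0 : 0 < q) (LP : LPker q psi).

(** The expectation transferred to the kernel. Convolving [psi] with the bad part [f - saverage]
    amounts to integrating [f] against [psi - smoothed], so the cancellation of the bad part turns
    into smoothness of [psi]. *)
Definition smoothed x z : R := \int[mu]_y (skernel (z, y) * psi (x - y)).

Let mp : measurable_fun setT psi. Proof. by case: LP. Qed.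
Let sz x : `|psi x| <= q ^- n. Proof. by case: LP. Qed.

Let Lpsi x : locint (fun y => psi (x - y)).
Proof.
apply: (@locint_bounded _ _ _ (q ^- n)) => //; exact: measurable_kernel.
Qed.

Lemma conv_saverage x : conv psi saverage x = \int[mu]_z (smoothed x z * f z).
Proof.
pose F (p : V * V) : \bar R := (psi (x - p.1) * (skernel p * f p.2))%:E.
have mF : measurable_fun setT F.
  apply/measurable_EFinP; apply: measurable_funM.
    exact: measurableT_comp (measurable_kernel x mp) (@measurable_fst _ _ V V).
  apply: measurable_funM; first exact: measurable_skernel.
  exact: measurableT_comp mf (@measurable_snd _ _ V V).
have qn : 0 <= q ^- n by rewrite invr_ge0 exprn_ge0// ltW.
have I : (mu \x mu)%E.-integrable setT F.
  apply/integrable21ltyP => //.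
  have /integrableP[_] := integrableZl measurableT (q ^- n) fi; apply: le_lt_trans.
  apply: ge0_le_integralT => z _; first exact: integral_ge0.
  apply: (@le_trans _ _ (\int[mu]_y ((q ^- n * `|f z|)%:E * (skernel (z, y))%:E))%E).
    apply: ge0_le_integralT => y _ //; rewrite /F/= -EFinM lee_fin !normrM.
    rewrite (ger0_norm (skernel_ge0 _)) (skernel_sym z y) -[leRHS]mulrA.
    by rewrite (mulrC `|f z|); apply: ler_wpM2r => //; rewrite mulr_ge0// skernel_ge0.
  rewrite ge0_integralZl//.
  - by rewrite integral_skernel1 mule1 /= lee_fin normrM (ger0_norm qn).
  - by apply/measurable_EFinP; exact: measurable_skernel2.
  - by move=> y _; rewrite lee_fin skernel_ge0.
  - by rewrite lee_fin mulr_ge0.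
rewrite /conv /Rintegral; congr fine.
transitivity (\int[mu]_y \int[mu]_z F (y, z))%E.
  apply: eq_integral => y _; have I1 := skernel_int y Lf.
  rewrite /saverage -RintegralZl// /Rintegral fineK//.
  by apply: integrable_fin_num => //; have := integrableZl measurableT (psi (x - y)) I1.
rewrite (Fubini I); apply: eq_integral => z _; have I1 := skernel_int z (Lpsi x).
rewrite /smoothed -RintegralZr// /Rintegral fineK.
  by apply: eq_integral => y _; rewrite /F/= skernel_sym; congr EFin; ring.
by apply: integrable_fin_num => //; have := integrableZr measurableT (f z) I1.
Qed.

Let Rsk z : \int[mu]_y skernel (z, y) = 1.
Proof. by rewrite /Rintegral integral_skernel1. Qed.

Lemma smoothed_near i x z : (i < m)%N -> W i z ->
  `|psi (x - z) - smoothed x z| <= q ^- n.+1 * w i.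
Proof.
move=> im Wi; have [_ _ _ lip _] := LP.
have I1 := skernel_int z (Lpsi x).
have I0 : mu.-integrable setT (EFin \o (fun y => skernel (z, y))).
  have : mu.-integrable setT (EFin \o (fun y => skernel (z, y) * 1)).
    apply: skernel_int; apply: (@locint_bounded _ _ _ 1) => //.
    by move=> y; rewrite normr1.
  by apply: eq_integrable => // y _ /=; rewrite mulr1.
have IZ c : mu.-integrable setT (EFin \o (fun y => skernel (z, y) * c)).
  by have := integrableZr measurableT c I0.
have -> : psi (x - z) - smoothed x z = \int[mu]_y (skernel (z, y) * psi (x - z) - skernel (z, y) * psi (x - y)).
  by rewrite RintegralB// RintegralZr// Rsk mul1r.
have ID : mu.-integrable setT (EFin \o (fun y => skernel (z, y) * psi (x - z) - skernel (z, y) * psi (x - y))).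
  by have := integrableB measurableT (IZ (psi (x - z))) I1.
apply: le_trans (le_normr_Rintegral _ ID) _ => //.
have -> : q ^- n.+1 * w i = \int[mu]_y (skernel (z, y) * (q ^- n.+1 * w i)).
  by rewrite RintegralZr// Rsk mul1r.
apply: le_Rintegral => //; first exact: integrable_norm.
move=> y _; rewrite -mulrBr normrM (ger0_norm (skernel_ge0 _)).
rewrite (skernelE y im Wi) indicE; case: (boolP ((z, y) \in _)) => [/set_mem e|_]; last by rewrite !mul0r.
apply: ler_wpM2l; first by rewrite mulr_ge0// invr_ge0 exprn_ge0// ltW.
apply: le_trans (lip _ _) _; apply: ler_wpM2l; first by rewrite invr_ge0 exprn_ge0// ltW.
rewrite (_ : x - z - (x - y) = y - z); last by rewrite opprB addrC addrA subrK.
by apply/ltW/(cubeE z y (w0 i)); exact: cellmate_near e.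
Qed.

Lemma smoothed_far i x z : (i < m)%N -> W i z ->
  (forall y, cellmate v0 (w i) (z, y) -> psi (x - y) = 0) ->
  psi (x - z) - smoothed x z = 0.
Proof.
move=> im Wi H; rewrite H// sub0r /smoothed.
rewrite (eq_Rintegral _ _ (g := fun=> 0)) ?/Rintegral ?integral0 ?oppr0// => y _.
rewrite (skernelE y im Wi) indicE; case: (boolP ((z, y) \in _)) => [/set_mem /H ->|_].
  by rewrite mulr0.
by rewrite !mul0r.
Qed.

Lemma conv_sub_saverage x (B : V -> \bar R) :
  (forall z, (`|psi (x - z) - smoothed x z|)%:E <= B z)%E ->
  (`|conv psi f x - conv psi saverage x|%:E <= \int[mu]_z (B z * `|f z|%:E))%E.
Proof.
move=> HB; rewrite conv_saverage.
have mS : measurable_fun setT (smoothed x).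
  apply: (@measurable_Rint2 _ _ (fun p => skernel p * psi (x - p.2))).
  apply: measurable_funM; first exact: measurable_skernel.
  exact: measurableT_comp (measurable_kernel x mp) (@measurable_snd _ _ V V).
have I1 := LPker_integrable x q0 LP Lf.
have S0 z : `|smoothed x z| <= q ^- n.
  have I := skernel_int z (Lpsi x).
  rewrite -lee_fin /smoothed EFin_normr_Rintegral//.
  apply: le_trans (le_abse_integral _ _ _) _ => //; first by case/integrableP : I.
  have qn : 0 <= q ^- n by rewrite invr_ge0 exprn_ge0// ltW.
  apply: (@le_trans _ _ (\int[mu]_y ((q ^- n)%:E * (skernel (z, y))%:E))%E).
    apply: ge0_le_integralT => y _ //; rewrite abse_EFin -EFinM lee_fin normrM mulrC.
    by rewrite (ger0_norm (skernel_ge0 _)) ler_wpM2r// skernel_ge0.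
  rewrite ge0_integralZl//.
  - by rewrite integral_skernel1 mule1.
  - by apply/measurable_EFinP; exact: measurable_skernel2.
  - by move=> y _; rewrite lee_fin skernel_ge0.
have I2 : mu.-integrable setT (EFin \o (fun z => smoothed x z * f z)).
  have := integrableZl measurableT (q ^- n) fi; apply: le_integrable => //.
    by apply/measurable_EFinP; exact: measurable_funM.
  move=> z _; rewrite /= lee_fin !normrM ler_wpM2r//.
  by apply: le_trans (S0 z) _; rewrite ler_norm.
have ID : mu.-integrable setT (EFin \o (fun z => psi (x - z) * f z - smoothed x z * f z)).
  by have := integrableB measurableT I1 I2.
rewrite /conv -RintegralB// EFin_normr_Rintegral//.
apply: le_trans (le_abse_integral _ _ _) _ => //; first by case/integrableP : ID.
apply: ge0_le_integralT => z _ //; rewrite -mulrBl abse_EFin normrM EFinM.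
exact: lee_wpmul2r.
Qed.

End stopped_average.

(** * The Calderon-Zygmund estimate *)

Section weak_type.
Context {R : realType} {n : nat}.
Local Notation V := 'rV[R]_n.
Local Notation mu := (rV_lebesgue n).
Implicit Types (x y z v : V) (f g h : V -> R).
Variables (n0 : (0 < n)%N) (M : nat) (s : R) (psi : 'I_M -> V -> R).
Hypothesis s0 : 0 < s.
Hypothesis LP : forall i : 'I_M, LPker (s * 2 ^+ i) (psi i).

Definition sqsum f x : R := \sum_(i < M) conv (psi i) f x ^+ 2.

Lemma sqsum_ge0 f x : 0 <= sqsum f x.
Proof. by apply: sumr_ge0 => i _; exact: sqr_ge0. Qed.

Lemma measurable_sqsum f : measurable_fun setT f -> measurable_fun setT (sqsum f).
Proof.
move=> mf; apply: measurable_sum => i; apply: measurable_funX.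
by apply: measurable_conv => //; case: (LP i).
Qed.

Lemma measurable_ltset (F : V -> R) (c : R) : measurable_fun setT F ->
  measurable [set x | c < F x].
Proof.
move=> mF; have mE : measurable_fun setT (EFin \o F) by apply/measurable_EFinP.
have := emeasurable_fun_o_infty measurableT mE c%:E; rewrite setTI.
by congr measurable; apply/seteqP; split => x /=; rewrite lte_fin.
Qed.

Lemma measurable_leset (F : V -> R) (c : R) : measurable_fun setT F ->
  measurable [set x | c <= F x].
Proof.
move=> mF; have mE : measurable_fun setT (EFin \o F) by apply/measurable_EFinP.
have := emeasurable_fun_c_infty measurableT mE c%:E; rewrite setTI.
by congr measurable; apply/seteqP; split => x /=; rewrite lee_fin.
Qed.

Lemma sqsum_L2 f : sqint f ->
  (\int[mu]_x (sqsum f x)%:E <= (8 * 32 ^+ n)%:E * \int[mu]_x (f x ^+ 2)%:E)%E.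
Proof.
move=> Hf; have q0 (i : 'I_M) : 0 < s * 2 ^+ i by rewrite mulr_gt0// exprn_gt0.
have mc i : measurable_fun setT (fun x => (conv (psi i) f x ^+ 2)%:E).
  by apply: measurable_sqE; apply: measurable_conv; [case: (LP i)|case: Hf].
under eq_integral do rewrite -sumEFin.
rewrite ge0_integral_sum//; last by move=> i x _; rewrite lee_fin sqr_ge0.
rewrite (eq_bigr (fun i => (ip (conv (psi i) f) (conv (psi i) f))%:E)); last first.
  by move=> i _; rewrite ipE//; exact: sqint_conv (q0 i) (LP i) Hf.
rewrite sumEFin -ipE// -EFinM lee_fin; apply: le_trans (sum_ip_conv_le s0 LP Hf) _.
by rewrite mulrA -natrM.
Qed.

Lemma markovE (F : V -> \bar R) (a : R) : 0 < a -> measurable_fun setT F ->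
  (forall x, 0 <= F x)%E ->
  (a%:E * mu [set x | (a%:E <= F x)%E] <= \int[mu]_x F x)%E.
Proof.
move=> a0 mF F0; have := le_integral_abse mu measurableT mF a0.
rewrite setTI (_ : [set x | _] = [set x | (a%:E <= F x)%E]); last first.
  by apply/seteqP; split => x /=; rewrite gee0_abs.
move/le_trans; apply; rewrite (eq_integral F)// => x _.
by rewrite gee0_abs.
Qed.

(** Contributions of the good part, [32 * 64 ^ n], of the fattened stopping cells, [6 ^ n], and of
    the bad part, [4 * 6 ^ n]. *)
Definition weak_cst : R := 32 * 64 ^+ n + 5 * 6 ^+ n.

Theorem sqsum_weak f (a : R) : mu.-integrable setT (EFin \o f) -> 0 < a ->
  (a%:E * mu [set x | (a ^+ 2 < sqsum f x)%R] <= weak_cst%:E * \int[mu]_x `|f x|%:E)%E.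
Proof.
move=> fi a0; have [mf Lf] := locint_integrable fi.
have mabs := measurable_absE mf.
have fin : (\int[mu]_x `|f x|%:E < +oo)%E by case/integrableP : fi.
have q0 i : 0 < s * 2 ^+ i by rewrite mulr_gt0// exprn_gt0.
have [L [Z [mZ ZQ Zd Zb Zcov]]] :=
  stopping_cubes 0 n0 s0 a0 mabs (fun x => normr_ge0 (f x)) fin.
(* [W 0] is what the stopping cells leave over, cut into cells of the finest side [s]; level [i + 1]
   carries [Z i], whence the exponent [i.-1] below. *)
pose W i : set V := if i is j.+1 then Z j else ~` \bigcup_(j in `I_L) Z j.
pose w i : R := s * 2 ^+ i.-1.
have w0 i : 0 < w i by exact: q0.
have ZL j x : Z j x -> (j < L)%N by case/Zb.
have mW i : measurable (W i).
  case: i => [|i]; last exact: mZ.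
  by apply: measurableC; apply: bigcup_measurable => j _; exact: mZ.
have WQ i x y : cellmate 0 (w i) (x, y) -> W i x -> W i y.
  case: i => [|i]; last exact: ZQ.
  rewrite /w/= expr0 mulr1 => xy Wx [j jL Zy]; apply: Wx; exists j => //.
  apply: (ZQ j y) Zy; apply: cellmate_pow => //; exact: cellmate_sym.
have Wd i j x : W i x -> W j x -> i = j.
  case: i => [|i]; case: j => [|j] //=.
  - by move=> H Zj; exfalso; apply: H; exists j => //; exact: ZL Zj.
  - by move=> Zi H; exfalso; apply: H; exists i => //; exact: ZL Zi.
  - by move=> Zi Zj; rewrite (Zd _ _ _ Zi Zj).
have Wc x : exists2 i, (i < L.+1)%N & W i x.
  have [[j jL Zj]|H] := pselect ((\bigcup_(j in `I_L) Z j) x); last by exists 0%N.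
  by exists j.+1.
pose g := saverage L.+1 0 W w f.
have mg : measurable_fun setT g by exact: measurable_saverage mW fi.
(* On [W 0] the average over the finest cell is at most [a] by the stopping rule; this replaces an
   a.e. bound on [f]. *)
have gb y : `|g y| <= 2 ^+ n * a.
  have [i im Wi] := Wc y; rewrite -lee_fin.
  apply: le_trans (saverage_le 0 w0 mW Wd Wc fi im Wi) _.
  case: i im Wi => [|i] im; last by case/Zb.
  rewrite /w/= expr0 mulr1 => Wy; apply: (@le_trans _ _ a%:E).
    rewrite leNgt; apply/negP => h; apply: Wy.
    have := Zcov 0%N y; rewrite expr0 mulr1 => /(_ h)[j _ Zj]; exists j => //.
    exact: ZL Zj.
  by rewrite lee_fin; apply: ler_peMl; [exact: ltW|rewrite exprn_ege1// ler1n].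
have gi : (\int[mu]_y `|g y|%:E <= \int[mu]_y `|f y|%:E)%E.
  exact: integral_saverage w0 mW WQ Wd Wc fi.
have g2 : (\int[mu]_y (g y ^+ 2)%:E <= (2 ^+ n * a)%:E * \int[mu]_y `|f y|%:E)%E.
  apply: (@le_trans _ _ (\int[mu]_y ((2 ^+ n * a)%:E * `|g y|%:E))%E).
    apply: ge0_le_integralT => [y _|y _]; first by rewrite lee_fin sqr_ge0.
    by rewrite -EFinM lee_fin -(real_normK (num_real (g y))) expr2 ler_wpM2r.
  rewrite ge0_integralZl//; last 2 first.
  - exact: measurable_absE.
  - by rewrite lee_fin mulr_ge0 ?exprn_ge0// ltW.
  by apply: lee_wpmul2l => //; rewrite lee_fin mulr_ge0 ?exprn_ge0// ltW.
have Sg : sqint g.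
  split => //; apply: le_lt_trans g2 _; rewrite lte_mul_pinfty//.
  by rewrite lee_fin mulr_ge0 ?exprn_ge0// ltW.
pose O : set V := \big[setU/set0]_(j < L) fatten (s * 2 ^+ j) (Z j).
have mO : measurable O by apply: bigsetU_measurable => j _; exact: measurable_fatten.
have muO : (a%:E * mu O <= (6 ^+ n)%:E * \int[mu]_x `|f x|%:E)%E.
  apply: (@le_trans _ _ (a%:E * \sum_(i < L) (6 ^+ n)%:E * mu (Z i))%E).
    apply: lee_wpmul2l; first by rewrite lee_fin ltW.
    apply: le_trans (@Boole_inequality _ _ _ mu (fun i => fatten (s * 2 ^+ i) (Z i)) L _) _.
      by move=> i _; exact: measurable_fatten.
    by apply: lee_sum => i _; exact: fatten_le (q0 i) (mZ i) (ZQ i).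
  rewrite -ge0_sume_distrr// muleCA; apply: lee_wpmul2l.
    by rewrite lee_fin exprn_ge0.
  by apply: stopping_measure s0 a0 mabs _ mZ ZQ Zd _ => // i x /Zb[].
(* A cell of side [w i] at most [q] costs the oscillation [q ^- n.+1 * w i] of the kernel; larger
   stopping cells matter only inside [O]. *)
pose ak (q : R) z : R := \sum_(i < L.+1) \1_(W i) z * (if w i <= q then q ^- n.+1 * w i else 0).
have akE q z i : (i < L.+1)%N -> W i z -> ak q z = if w i <= q then q ^- n.+1 * w i else 0.
  exact: (sum_W Wd (fun i => if w i <= q then q ^- n.+1 * w i else 0)).
have ak0 q z : 0 < q -> 0 <= ak q z.
  move=> q1; apply: sumr_ge0 => i _; rewrite mulr_ge0//; case: ifP => // _.
  by rewrite mulr_ge0 ?invr_ge0 ?exprn_ge0// ltW.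
have mak q : measurable_fun setT (ak q).
  by apply: measurable_sum => i; apply: measurable_funM => //; exact: measurable_indic.
pose B (k : 'I_M) x : \bar R :=
  cubeint (3 * (s * 2 ^+ k)) (fun z => (ak (s * 2 ^+ k) z * `|f z|)%:E) x.
have hk0 k z : (0 <= (ak (s * 2 ^+ k) z * `|f z|)%:E)%E by rewrite lee_fin mulr_ge0// ak0.
have mhk k : measurable_fun setT (fun z => (ak (s * 2 ^+ k) z * `|f z|)%:E).
  by apply/measurable_EFinP; apply: measurable_funM => //; exact: measurableT_comp.
have mB k : measurable_fun setT (B k) by exact: measurable_cubeint.
have B0 k x : (0 <= B k x)%E by exact: cubeint_ge0.
have TB k x : ~ O x -> (`|conv (psi k) f x - conv (psi k) g x|%:E <= B k x)%E.
  move=> Ox; set q := s * 2 ^+ k.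
  have [_ _ spk _ _] := LP k.
  apply: le_trans (conv_sub_saverage w0 mW WQ Wd Wc fi (q0 k) (LP k)
    (B := fun z => (\1_(cube x (3 * q)) z * ak q z)%:E) _) _.
    move=> z; have [i im Wi] := Wc z; rewrite (akE q z i im Wi).
    have [far|near] := pselect (forall y, cellmate 0 (w i) (z, y) -> psi k (x - y) = 0).
      rewrite (smoothed_far Wd im Wi far) normr0 lee_fin mulr_ge0//.
      by case: ifP => // _; rewrite mulr_ge0 ?invr_ge0 ?exprn_ge0// ltW// q0.
    have [y zy xy] : exists2 y, cellmate 0 (w i) (z, y) & `|x - y| < 2 * q.
      apply: contrapT => H; apply: near => y zy; apply: spk; rewrite leNgt; apply/negP => xy.
      by apply: H; exists y.
    have zy' : `|y - z| < w i by apply/(cubeE z y (w0 i)); exact: cellmate_near zy.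
    have wq : w i <= q.
      case: i {near zy'} im Wi zy => [|i] im Wi zy.
        by rewrite /w/= expr0 mulr1; apply: ler_peMr; [exact: ltW|rewrite exprn_ege1// ler1n].
      rewrite leNgt; apply/negP => qw; apply: Ox.
      rewrite /O -(bigcup_mkord L (fun i => fatten (s * 2 ^+ i) (Z i))); exists i => //=.
      exists y; first exact: ZQ zy Wi.
      by apply: lt_trans xy _; rewrite ltr_pM2l.
    rewrite wq; have xz : cube x (3 * q) z.
      apply/cubeE; first by rewrite mulr_gt0// q0.
      have := ler_distD y z x; rewrite (distrC z y) (distrC y x); move: xy zy' wq; lra.
    rewrite indicE mem_set// mul1r lee_fin.
    exact: (smoothed_near 0 w0 mW Wd Wc (q0 k) (LP k) x im Wi).
  rewrite /B /cubeint [leRHS]integral_mkcond; apply: ge0_le_integralT => z _.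
    by rewrite mule_ge0// lee_fin mulr_ge0// ak0// q0.
  rewrite /patch indicE; case: ifP => _; first by rewrite mul1r -EFinM.
  by rewrite mul0r mul0e.
have sumB : (\int[mu]_x (\sum_(k < M) B k x) <= (2 * 6 ^+ n)%:E * \int[mu]_x `|f x|%:E)%E.
  rewrite ge0_integral_sum//.
  rewrite (eq_bigr (fun k : 'I_M => \int[mu]_z ((6 * (s * 2 ^+ k)) ^+ n * (ak (s * 2 ^+ k) z * `|f z|))%:E)%E); last first.
    move=> k _; rewrite integral_cubeint//; last by rewrite mulr_ge0// ltW.
    rewrite (_ : 2 * (3 * (s * 2 ^+ k)) = 6 * (s * 2 ^+ k)); last by ring.
    rewrite -ge0_integralZl//; last by rewrite lee_fin exprn_ge0// mulr_ge0// ltW.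
  rewrite -ge0_integral_sum//; last 2 first.
  - move=> k; apply/measurable_EFinP; apply: measurable_funM => //.
    by apply: measurable_funM => //; exact: measurableT_comp.
  - by move=> k z _; rewrite lee_fin !mulr_ge0 ?exprn_ge0 ?mulr_ge0 ?ak0// ltW.
  have -> : ((2 * 6 ^+ n)%:E * \int[mu]_x `|f x|%:E = \int[mu]_x ((2 * 6 ^+ n)%:E * `|f x|%:E))%E.
    by rewrite ge0_integralZl// lee_fin mulr_ge0// exprn_ge0.
  apply: ge0_le_integralT => z _.
    by apply: sume_ge0 => k _; rewrite lee_fin !mulr_ge0 ?exprn_ge0 ?mulr_ge0 ?ak0// ltW.
  rewrite sumEFin -EFinM lee_fin.
  have [i im Wi] := Wc z.
  (* For a fixed cell, what remains of the sum over the scales is the geometric sum of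
     [w i / (s * 2 ^ k)]. *)
  rewrite (eq_bigr (fun k : 'I_M => (if w i <= s * 2 ^+ k then w i / (s * 2 ^+ k) else 0) * (6 ^+ n * `|f z|))); last first.
    move=> k _; rewrite (akE _ z i im Wi).
    case: ifP => _; last by rewrite !mul0r mulr0.
    have : s * 2 ^+ k != 0 by rewrite gt_eqF// q0.
    move: (s * 2 ^+ k) => q qn; have qnn : q ^+ n != 0 by exact: expf_neq0.
    by rewrite exprMn exprS; field; rewrite ?qn ?qnn.
  rewrite -mulr_suml -mulrA ler_wpM2r ?mulr_ge0 ?exprn_ge0//.
  exact: geo_sum_up (ltW (w0 i)).
pose Eg := [set x | a ^+ 2 / 4 <= sqsum g x].
pose Eb := [set x | ((a / 2)%:E <= \sum_(k < M) B k x)%E].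
have mEg : measurable Eg.
  by apply: measurable_leset; exact: measurable_sqsum.
have mEb : measurable Eb.
  rewrite /Eb -[X in measurable X]setTI; apply: emeasurable_fun_c_infty => //.
  exact: emeasurable_sum.
have sub : [set x | a ^+ 2 < sqsum f x] `<=` O `|` (Eg `|` Eb).
  (* Off [O] the square sum of [f] is at most twice that of [g] plus twice that of the difference,
     and the latter is an [l^2] sum bounded by the [l^1] sum [D]. The two thresholds allow [a^2 / 2]
     each. *)
  move=> x /= ax; have [Ox|Ox] := pselect (O x); [by left|right].
  have [|gx] := leP (a ^+ 2 / 4) (sqsum g x); [by left|right].
  apply: (@le_trans _ _ (\sum_(k < M) `|conv (psi k) f x - conv (psi k) g x|%:E)%E); last first.
    by apply: lee_sum => k _; exact: TB.
  rewrite sumEFin lee_fin.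
  set D := \sum_(k < M) _; have D0 : 0 <= D by exact: sumr_ge0.
  rewrite leNgt; apply/negP => Da.
  have DD : \sum_(k < M) (conv (psi k) f x - conv (psi k) g x) ^+ 2 <= D ^+ 2.
    rewrite expr2 {1}/D mulr_suml; apply: ler_sum => k _.
    rewrite -(real_normK (num_real (_ - _))) expr2 ler_wpM2l//.
    by rewrite /D (bigD1 k)//= lerDl sumr_ge0.
  have FG : sqsum f x <= 2 * sqsum g x + 2 * \sum_(k < M) (conv (psi k) f x - conv (psi k) g x) ^+ 2.
    rewrite /sqsum !mulr_sumr -big_split/=; apply: ler_sum => k _.
    move: (conv (psi k) f x) (conv (psi k) g x) => u v; rewrite -subr_ge0.
    by rewrite (_ : _ - _ = (u - 2 * v) ^+ 2) ?sqr_ge0//; ring.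
  have Da2 : D ^+ 2 <= a ^+ 2 / 4.
    have -> : a ^+ 2 / 4 = (a / 2) ^+ 2 by field.
    by apply: lerXn2r; rewrite ?nnegrE//; [rewrite divr_ge0// ltW|exact: ltW].
  by move: ax FG DD Da2 gx; lra.
apply: (@le_trans _ _ (a%:E * (mu O + (mu Eg + mu Eb)))%E).
  apply: lee_wpmul2l; first by rewrite lee_fin ltW.
  have mE : measurable [set x | a ^+ 2 < sqsum f x].
    by apply: measurable_ltset; exact: measurable_sqsum.
  apply: (@le_trans _ _ (mu (O `|` (Eg `|` Eb)))).
    by apply: le_measure; rewrite ?inE//; apply: measurableU => //; exact: measurableU.
  apply: le_trans (measureU2 _ _ _) _ => //; first exact: measurableU.
  by apply: leeD2l; exact: measureU2.
have hEg : (a%:E * mu Eg <= (32 * 64 ^+ n)%:E * \int[mu]_x `|f x|%:E)%E.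
  have a4 : 0 < a ^+ 2 / 4 by rewrite divr_gt0// exprn_gt0.
  have := @markovE (EFin \o sqsum g) _ a4 _ _.
  move=> /(_ _ _)/le_trans H.
  have {H} := H _ _ _ (sqsum_L2 Sg).
  have K0 : 0 <= 8 * 32 ^+ n :> R by rewrite mulr_ge0// exprn_ge0.
  have := g2; have : (0 <= (8 * 32 ^+ n : R)%:E)%E by rewrite lee_fin.
  move=> K0' /(lee_wpmul2l K0') H2 H1.
  have {H1 H2} : ((a ^+ 2 / 4)%:E * mu Eg <= (8 * 32 ^+ n)%:E * ((2 ^+ n * a)%:E * \int[mu]_y `|f y|%:E))%E.
    apply: le_trans H2; apply: H1.
    - by apply/measurable_EFinP; exact: measurable_sqsum.
    - by move=> x; rewrite lee_fin sqsum_ge0.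
  have a4' : (0 <= (4 / a)%:E)%E by rewrite lee_fin divr_ge0// ltW.
  move=> /(lee_wpmul2l a4'); rewrite !muleA -!EFinM.
  have -> : 4 / a * (a ^+ 2 / 4) = a by field; rewrite gt_eqF.
  move/le_trans; apply; apply: lee_wpmul2r; first exact: integral_ge0.
  rewrite lee_fin (_ : 64 ^+ n = 32 ^+ n * 2 ^+ n); last by rewrite -exprMn -natrM.
  by rewrite le_eqVlt; apply/orP; left; apply/eqP; field; rewrite gt_eqF.
have hEb : (a%:E * mu Eb <= (4 * 6 ^+ n)%:E * \int[mu]_x `|f x|%:E)%E.
  have a2 : 0 < a / 2 by rewrite divr_gt0.
  have := @markovE (fun x => \sum_(k < M) B k x)%E _ a2 _ _.
  move=> /(_ _ _)/le_trans H; have {H} := H _ _ _ sumB.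
  have a4' : (0 <= (2 : R)%:E)%E by rewrite lee_fin.
  move=> H; have {}H : ((a / 2)%:E * mu Eb <= (2 * 6 ^+ n)%:E * \int[mu]_x `|f x|%:E)%E.
    apply: H; first exact: emeasurable_sum.
    by move=> x; exact: sume_ge0.
  move: H => /(lee_wpmul2l a4'); rewrite !muleA -!EFinM.
  by rewrite (_ : 2 * (a / 2) = a) ?mulrA -?natrM//; field.
rewrite ge0_muleDr ?adde_ge0// ge0_muleDr//.
apply: le_trans (leeD muO (leeD hEg hEb)) _.
rewrite -!ge0_muleDl ?adde_ge0 ?lee_fin ?mulr_ge0 ?exprn_ge0//.
apply: lee_wpmul2r; first exact: integral_ge0.
by rewrite -!EFinD lee_fin /weak_cst; lra.
Qed.

End weak_type.

(** * Weighted sparse sums on a finite tree *)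

Section real_powers.
Context {R : realType}.
Implicit Types (a b t x z p r e th : R) (m : nat).

Lemma powR_le x z r : 0 <= r -> 0 <= x -> x <= z -> x `^ r <= z `^ r.
Proof.
by move=> r0 x0 xz; apply: ge0_ler_powR => //; rewrite nnegrE//; exact: le_trans xz.
Qed.

Lemma powRV x r : 0 <= x -> (x `^ r)^-1 = x^-1 `^ r.
Proof. by move=> x0; rewrite -powRN -(mulN1r r) powRrM powR_inv1. Qed.

Lemma bernoulli m x : 0 <= x <= 1 -> 1 - m%:R * (1 - x) <= x ^+ m.
Proof.
move=> /andP[x0 x1]; elim: m => [|m ih]; first by rewrite mul0r subr0 expr0.
rewrite exprS; apply: (@le_trans _ _ (x * (1 - m%:R * (1 - x)))); last by rewrite ler_wpM2l.
rewrite -subr_ge0 -natr1 (_ : _ - _ = m%:R * (1 - x) ^+ 2); last by ring.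
by rewrite mulr_ge0// sqr_ge0.
Qed.

Lemma mulr_powRB x r : 0 < x -> x * x `^ (r - 1) = x `^ r.
Proof.
move=> x0; rewrite -{1}(powRr1 (ltW x0)) -powRD; first by congr (_ `^ _); ring.
by rewrite (gt_eqF x0)/= implybT.
Qed.

(* The mean value inequality for [p]-th powers, with a crude constant obtained
   from Bernoulli's inequality. *)
Lemma powR_step m p t a : 0 < p -> p <= m%:R -> 0 <= t -> 0 <= a ->
  (t + a) `^ p <= t `^ p + m%:R * (a * (t + a) `^ (p - 1)).
Proof.
move=> p0 pm t0 a0; have := addr_ge0 t0 a0; rewrite le_eqVlt => /predU1P[<-|ta].
  by rewrite powR0 ?gt_eqF// addr_ge0 ?powR_ge0// !mulr_ge0// powR_ge0.
pose x := t / (t + a).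
have x01 : 0 <= x <= 1.
  by rewrite divr_ge0 ?(ltW ta)//= ler_pdivrMr// mul1r lerDl.
have -> : t = x * (t + a) by rewrite divfK// gt_eqF.
have xta : x * (t + a) + a = t + a by rewrite divfK// gt_eqF.
rewrite xta powRM//; [|by case/andP: x01|exact: ltW].
have -> : m%:R * (a * (t + a) `^ (p - 1)) = m%:R * (1 - x) * (t + a) `^ p.
  rewrite -(mulr_powRB1 (ltW ta) p0) !mulrA; congr (_ * _).
  by rewrite -mulrA mulrBl mul1r divfK ?gt_eqF// addrC addKr.
rewrite -mulrDl -[leLHS]mul1r ler_wpM2r ?powR_ge0//.
have : x ^+ m <= x `^ p.
  have [->|x0] := eqVneq x 0; first by rewrite powR0 ?gt_eqF// expr0n; case: m pm => //=; rewrite leNgt p0.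
  rewrite -powR_mulrn; last by case/andP: x01.
  apply: ger_powR => //; case/andP: x01 => h1 h2.
  by rewrite h2 andbT lt_neqAle eq_sym x0.
by have := bernoulli m x01; lra.
Qed.

(** Either [a <= e * b] and the last term suffices, or [b < a / e] and the first one does. *)
Lemma young_eps p e a b : 1 < p -> 0 < e -> 0 <= a -> 0 <= b ->
  a * b `^ (p - 1) <= e `^ (1 - p) * a `^ p + e * b `^ p.
Proof.
move=> p1 e0 a0 b0; have pm : 0 <= p - 1 by lra.
have p0 : 0 < p by lra.
have [ab|ba] := leP a (e * b).
  apply: (@le_trans _ _ (e * b `^ p)); last by rewrite lerDr mulr_ge0 ?powR_ge0.
  by rewrite -(mulr_powRB1 b0 p0) mulrA ler_wpM2r// powR_ge0.
apply: (@le_trans _ _ (e `^ (1 - p) * a `^ p)); last by rewrite lerDl mulr_ge0 ?powR_ge0// ltW.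
rewrite -(mulr_powRB1 a0 p0) mulrCA ler_wpM2l//.
have -> : 1 - p = - (p - 1) by ring.
rewrite powRN (powRV _ (ltW e0)) -powRM ?invr_ge0 ?(ltW e0)//.
by apply: powR_le => //; rewrite mulrC ler_pdivlMr// mulrC ltW.
Qed.

(** Young's inequality for [t ^ th] and one, with exponents [1 / th] and [1 / (1 - th)]. *)
Lemma powR_concave th t : 0 <= th -> th < 1 -> 0 <= t -> t `^ th <= (1 - th) + th * t.
Proof.
move=> th0 th1 t0; have [->|thn0] := eqVneq th 0.
  by rewrite powRr0; lra.
have thp : 0 < th by rewrite lt_neqAle eq_sym thn0.
have := @conjugate_powR R (t `^ th) 1 th^-1 (1 - th)^-1 (powR_ge0 _ _) ler01.
rewrite !invr_gt0 subr_gt0 !invrK => /(_ thp th1 _).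
rewrite mulr1 -powRrM mulfV// powRr1// powR1 mul1r mulrC => h.
by rewrite addrC; apply: h; ring.
Qed.

Lemma powR_add_le r x z : 0 <= r -> 0 <= x -> 0 <= z ->
  (x + z) `^ r <= 2 `^ r * (x `^ r + z `^ r).
Proof.
move=> r0 x0 z0; wlog xz : x z x0 z0 / x <= z => [hw|].
  by have [xz|/ltW zx] := leP x z; [exact: hw|rewrite addrC [in leRHS]addrC; exact: hw].
apply: (@le_trans _ _ (2 `^ r * z `^ r)); last by rewrite ler_wpM2l ?powR_ge0// lerDr powR_ge0.
rewrite -powRM//; apply: powR_le => //; first exact: addr_ge0.
by rewrite mulr2n mulrDl mul1r lerD2r.
Qed.

End real_powers.

(** * Nested partitions of a finite set *)

Section finite_filtration.
Context {R : realType} {T : finType} {K : eqType}.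
Variables (N : nat) (blk : nat -> T -> K).
Hypothesis nested : forall l a b, blk l a = blk l b -> blk l.+1 a = blk l.+1 b.
Implicit Types (a b : T) (l i k : nat) (h g z : T -> R) (s : nat -> T -> R).

(** Blocks grow with the level, so adaptedness passes to lower levels, opposite to the usual
    indexing of filtrations. *)
Definition adapted {A : Type} l (z : T -> A) := forall a b, blk l a = blk l b -> z a = z b.

Lemma blk_le l i a b : (l <= i)%N -> blk l a = blk l b -> blk i a = blk i b.
Proof.
move=> li e; rewrite -(subnK li); elim: (i - l)%N => [|k ih]; first by rewrite add0n.
by rewrite addSn; exact: nested.
Qed.

Lemma adapted_le {A : Type} l i (z : T -> A) : (l <= i)%N -> adapted i z -> adapted l z.
Proof. by move=> li az a b /(blk_le li); exact: az. Qed.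

Definition csum l h a : R := \sum_(b | blk l b == blk l a) h b.
Definition csize l a : R := csum l (fun=> 1) a.
Definition avg l h a : R := csum l h a / csize l a.

Lemma csize_gt0 l a : 0 < csize l a.
Proof.
rewrite /csize /csum (bigD1 a)//= ltr_pwDl// sumr_ge0//.
Qed.

Lemma csize_ge0 l a : 0 <= csize l a. Proof. exact: ltW (csize_gt0 l a). Qed.

Lemma csum_adapted l h : adapted l (csum l h).
Proof. by move=> a b e; apply: eq_bigl => c; rewrite e. Qed.

Lemma avg_adapted l h : adapted l (avg l h).
Proof. by move=> a b e; rewrite /avg /csize !(csum_adapted _ e). Qed.

Lemma csum_le l h g a : (forall b, blk l b = blk l a -> h b <= g b) -> csum l h a <= csum l g a.
Proof. by move=> H; apply: ler_sum => b /eqP; exact: H. Qed.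

Lemma avg_le l h g a : (forall b, blk l b = blk l a -> h b <= g b) -> avg l h a <= avg l g a.
Proof. by move=> H; rewrite ler_wpM2r ?invr_ge0 ?csize_ge0//; exact: csum_le. Qed.

Lemma csum_ge0 l h a : (forall b, 0 <= h b) -> 0 <= csum l h a.
Proof. by move=> h0; exact: sumr_ge0. Qed.

Lemma avg_ge0 l h a : (forall b, 0 <= h b) -> 0 <= avg l h a.
Proof. by move=> h0; rewrite divr_ge0 ?csum_ge0 ?csize_ge0. Qed.

Lemma avg_gt0 l h a : (forall b, 0 < h b) -> 0 < avg l h a.
Proof.
move=> h0; rewrite divr_gt0 ?csize_gt0// /csum (bigD1 a)//= ltr_pwDl//.
by rewrite sumr_ge0// => b _; exact: ltW.
Qed.

Lemma csumE l h a : csum l h a = csize l a * avg l h a.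
Proof. by rewrite mulrC divfK// gt_eqF// csize_gt0. Qed.

Lemma csumZ l c h a : csum l (fun b => c * h b) a = c * csum l h a.
Proof. by rewrite /csum mulr_sumr. Qed.

Lemma csum_sum (I : Type) (r : seq I) (P : pred I) (F : I -> T -> R) l a :
  csum l (fun b => \sum_(i <- r | P i) F i b) a = \sum_(i <- r | P i) csum l (F i) a.
Proof. exact: exchange_big. Qed.

Lemma sum_avg l z h : adapted l z -> \sum_a z a * h a = \sum_a z a * avg l h a.
Proof.
move=> az.
transitivity (\sum_a \sum_(b | blk l b == blk l a) z a * h b / csize l a); last first.
  by apply: eq_bigr => a _; rewrite /avg /csum mulr_suml mulr_sumr; apply: eq_bigr => b _; rewrite mulrA.
rewrite (exchange_big_dep predT)//=; apply: eq_bigr => b _.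
rewrite (eq_bigr (fun a => z b * h b / csize l b * 1)); last first.
  by move=> a /eqP e; rewrite mulr1 (az _ _ e) /csize (csum_adapted _ e).
rewrite -mulr_sumr (eq_bigl (fun a => blk l a == blk l b)); last by move=> a; rewrite eq_sym.
by rewrite -/(csum l (fun=> 1) b) -/(csize l b) divfK// gt_eqF// csize_gt0.
Qed.

(** The indicator of the coarser block is itself adapted to level [l]; absorbed into [z], it reduces
    the claim to the global identity [sum_avg]. *)
Lemma csum_avg l i z h a : (l <= i)%N -> adapted l z ->
  csum i (fun b => z b * h b) a = csum i (fun b => z b * avg l h b) a.
Proof.
move=> li az; rewrite /csum big_mkcond [RHS]big_mkcond/=.
pose z' b := if blk i b == blk i a then z b else 0.
have az' : adapted l z'.
  by move=> b c e; rewrite /z' (az _ _ e) (blk_le li e).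
transitivity (\sum_b z' b * h b).
  by apply: eq_bigr => b _; rewrite /z'; case: ifP; rewrite ?mul0r.
rewrite (sum_avg h az'); apply: eq_bigr => b _.
by rewrite /z'; case: ifP; rewrite ?mul0r.
Qed.

Definition above l s a : R := \sum_(k < N | (l <= k)%N) s k a.
Definition below i s a : R := \sum_(l < N | (l <= i)%N) s l a.

Lemma above_adapted l s : (forall k, adapted k (s k)) -> adapted l (above l s).
Proof.
move=> as_ a b e; apply: eq_bigr => k lk; exact: (adapted_le lk (as_ k)) e.
Qed.

Lemma above_ge0 l s a : (forall k a, 0 <= s k a) -> 0 <= above l s a.
Proof. by move=> s0; exact: sumr_ge0. Qed.

Lemma aboveS l s a : (l < N)%N -> above l s a = above l.+1 s a + s l a.
Proof.
move=> lN; rewrite /above (bigD1 (Ordinal lN))//= addrC; congr (_ + _).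
apply: eq_bigl => k; rewrite ltn_neqAle andbC; congr (_ && _).
by rewrite eq_sym.
Qed.

Lemma above_ge l s a : (forall k a, 0 <= s k a) -> (l < N)%N -> s l a <= above l s a.
Proof. by move=> s0 lN; rewrite aboveS// lerDr above_ge0. Qed.

(* Summation by parts along the chain of blocks containing [a]. *)
Lemma above_powR m (p : R) l s a : 0 < p -> p <= m%:R -> (forall k a, 0 <= s k a) ->
  above l s a `^ p <= m%:R * above l (fun k a => s k a * above k s a `^ (p - 1)) a.
Proof.
move=> p0 pm s0; have [lN|Nl] := leqP l N; last first.
  rewrite /above !big1; first by rewrite powR0 ?gt_eqF// mulr0.
    by move=> k; rewrite leqNgt (ltn_trans (ltn_ord k) Nl).
  by move=> k; rewrite leqNgt (ltn_trans (ltn_ord k) Nl).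
rewrite -(subKn lN); elim: (N - l)%N (leq_subr l N) => [_|d ih dN].
  rewrite subn0 /above !big1; first by rewrite powR0 ?gt_eqF// mulr0.
    by move=> k; rewrite leqNgt ltn_ord.
  by move=> k; rewrite leqNgt ltn_ord.
have e : (N - d = (N - d.+1).+1)%N by rewrite subnS prednK// subn_gt0.
have lt : (N - d.+1 < N)%N by rewrite ltn_subLR// addSn ltnS leq_addl.
rewrite (aboveS _ _ lt) [in leRHS](aboveS _ _ lt) mulrDr.
apply: le_trans (powR_step p0 pm _ (s0 _ _)) _; first exact: above_ge0.
by rewrite -(aboveS _ _ lt) -e; apply: lerD => //; apply: ih; exact: ltnW.
Qed.

(** Exchange of the two levels, then averaging over the blocks of the upper one. *)
Lemma sum_above s (w : nat -> T -> R) : (forall k, adapted k (w k)) ->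
  \sum_a \sum_(l < N) s l a * above l w a =
  \sum_(k < N) \sum_a w k a * avg k (below k s) a.
Proof.
move=> aw; transitivity (\sum_(k < N) \sum_a w k a * below k s a); last first.
  by apply: eq_bigr => k _; rewrite (sum_avg _ (aw k)).
rewrite exchange_big/= [RHS]exchange_big/= -exchange_big/=.
apply: eq_bigr => a _.
transitivity (\sum_(l < N) \sum_(k < N | (l <= k)%N) s l a * w k a).
  by apply: eq_bigr => l _; rewrite /above mulr_sumr.
rewrite (exchange_big_dep predT)//=; apply: eq_bigr => k _.
by rewrite /below mulr_sumr; apply: eq_bigr => l _; rewrite mulrC.
Qed.

End finite_filtration.

(** * Sparse families: Kolmogorov and Carleson bounds *)

Section sparse_sums.
Context {R : realType} {T : finType} {K : eqType}.
Variables (N : nat) (blk : nat -> T -> K).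
Hypothesis nested : forall l a b, blk l a = blk l b -> blk l.+1 a = blk l.+1 b.
Implicit Types (a b : T) (l i k : nat) (h g : T -> R) (s : nat -> T -> R).
Local Notation adapted := (adapted blk).
Local Notation csum := (@csum R T K blk).
Local Notation csize := (@csize R T K blk).
Local Notation avg := (@avg R T K blk).
Local Notation above := (@above R T N).
Local Notation below := (@below R T N).

Definition sparse (S : nat -> T -> bool) := (forall l, adapted l (S l)) /\
  forall i a, (i < N)%N -> S i a ->
    2 * csum i (fun b => ([exists l : 'I_N, (l < i)%N && S l b])%:R) a <= csize i a.

Definition maxbelow i s a : R := \big[Num.max/0]_(l < N | (l <= i)%N) s l a.

Lemma maxbelow_ge i l s a : (l < N)%N -> (l <= i)%N -> s l a <= maxbelow i s a.
Proof.
move=> lN li; rewrite /maxbelow.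
exact: (@le_bigmax_cond _ _ _ 0 (Ordinal lN) (fun l : 'I_N => (l <= i)%N) (fun l : 'I_N => s l a)).
Qed.

Lemma maxbelow_ge0 i s a : 0 <= maxbelow i s a.
Proof. exact: bigmax_ge_id. Qed.

Lemma maxbelow_le i s a (M : R) : 0 <= M ->
  (forall l, (l < N)%N -> (l <= i)%N -> s l a <= M) -> maxbelow i s a <= M.
Proof. by move=> M0 H; apply/bigmax_leP; split => // l li; exact: H. Qed.

(* In a sparse family each selected block keeps at least half of its mass
   outside the selected sub-blocks, and these remainders are disjoint. *)
Lemma sparse_csum S i s h a : sparse S -> (forall l, adapted l (s l)) ->
  (forall l a, 0 <= s l a) ->
  (forall l b, (l < N)%N -> (l <= i)%N -> s l b <= h b) -> (forall b, 0 <= h b) ->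
  csum i (below i (fun l b => (S l b)%:R * s l b)) a <= 2 * csum i h a.
Proof.
move=> [aS sp] as_ s0 sh h0.
(* Indicator of the points not covered by selected blocks of strictly lower level; its average over
   a selected block is at least one half. *)
pose E l b : R := 1 - ([exists k : 'I_N, (k < l)%N && S k b])%:R.
have E0 l b : 0 <= E l b by rewrite /E; case: [exists k, _]; rewrite ?subrr ?subr0.
apply: (@le_trans _ _ (csum i (below i (fun l b => 2 * ((S l b)%:R * s l b * E l b))) a)).
  rewrite /below !csum_sum; apply: ler_sum => l li.
  have az : adapted l (fun b => (S l b)%:R * s l b).
    by move=> b c e; rewrite (aS _ _ _ e) (as_ _ _ _ e).
  rewrite csumZ (csum_avg nested (E l) a li az) -csumZ.
  apply: csum_le => b _; case Sb : (S l b); last by rewrite !mul0r mulr0.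
  rewrite mul1r mulrCA -[leLHS]mulr1 ler_wpM2l//.
  rewrite /avg mulrA ler_pdivlMr ?csize_gt0// mul1r.
  have := sp l b (ltn_ord l) Sb; rewrite /E.
  rewrite (_ : csum l (fun c => 1 - _) b = csize l b - csum l (fun b => ([exists k : 'I_N, (k < l)%N && S k b])%:R) b).
    by move: (csize l b) (csum l _ b) => u v; lra.
  by rewrite /csum sumrB.
rewrite -csumZ; apply: csum_le => b _.
rewrite /below -mulr_sumr ler_pM2l//.
(* At a given point only the lowest selected level survives the factor [E]. *)
have [/existsP[l0 /andP[l0i Sl0]]|no] := boolP [exists l : 'I_N, (l <= i)%N && S l b]; last first.
  rewrite big1 => [|l li]; first exact: h0.
  case Sb : (S l b); last by rewrite !mul0r.
  by move: no; rewrite negb_exists => /forallP/(_ l); rewrite li Sb.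
case: (@arg_minnP _ l0 (fun l : 'I_N => (l <= i)%N && S l b) (fun k : 'I_N => k : nat)); first by rewrite l0i.
move=> l /andP[li Sl] lmin; rewrite (bigD1 l)//= Sl mul1r big1 ?addr0.
  apply: (@le_trans _ _ (s l b)); last exact: sh.
  by rewrite -[leRHS]mulr1 ler_wpM2l// /E gerBl.
move=> k /andP[ki kl]; case Sk : (S k b); last by rewrite !mul0r.
rewrite /E; have -> : [exists j : 'I_N, (j < k)%N && S j b].
  apply/existsP; exists l; rewrite Sl andbT ltn_neqAle; apply/andP; split.
    by rewrite eq_sym; exact: kl.
  by apply: lmin; rewrite ki.
by rewrite subrr mulr0.
Qed.

(* Kolmogorov's inequality for the martingale [avg l h]: the process
   [M ^ th + c * z * M ^ (th - 1)], with [M] the running maximum, decreases. *)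
Lemma kolmogorov i h (th : R) a : (i < N)%N -> 0 <= th -> th < 1 -> (forall b, 0 < h b) ->
  csum i (fun b => maxbelow i (fun l => avg l h) b `^ th) a <=
  (1 - th)^-1 * (csize i a * avg i h a `^ th).
Proof.
move=> iN th0 th1 h0; pose z l := avg l h.
have z0 l b : 0 < z l b by exact: avg_gt0.
pose c := th / (1 - th).
have th1' : 0 < 1 - th by rewrite subr_gt0.
have c0 : 0 <= c by rewrite divr_ge0// ltW.
(* Running maximum of the averages from level [i] down to [i - d]: time runs from coarse to fine
   blocks. *)
pose M := fix M (d : nat) (b : T) {struct d} : R := if d is d'.+1 then Num.max (M d' b) (z (i - d)%N b) else z i b.
have M0 d b : 0 < M d b by elim: d => [|d ih] /=; [exact: z0|rewrite lt_max ih].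
have MA d : adapted (i - d) (M d).
  elim: d => [|d ih] /= b b' e; first by apply: avg_adapted; move: e; rewrite subn0.
  congr (Num.max _ _); last exact: (avg_adapted h e).
  apply: ih.
  by apply: (blk_le nested) e; rewrite subnS leq_pred.
have Mz d l b : (i - d <= l)%N -> (l <= i)%N -> z l b <= M d b.
  elim: d => [|d ih] /= dl li.
    by rewrite subn0 in dl; rewrite (_ : l = i)//; apply/eqP; rewrite eqn_leq li.
  rewrite le_max; have [->|ne] := eqVneq l (i - d.+1)%N; first by rewrite lexx orbT.
  rewrite ih//; have : (i - d.+1 < l)%N by rewrite ltn_neqAle eq_sym ne.
  by rewrite subnS; case: (i - d)%N => //= *; exact: leq_ltn_trans.
pose Psi d b := M d b `^ th + c * (z (i - d)%N b * M d b `^ (th - 1)).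
have step d : (d < i)%N -> csum i (Psi d.+1) a <= csum i (Psi d) a.
  move=> di; have li : (i - d.+1 <= i)%N by exact: leq_subr.
  have li' : (i - d <= i)%N by exact: leq_subr.
  apply: (@le_trans _ _ (csum i (fun b => M d b `^ th + c * (M d b `^ (th - 1) * z (i - d.+1)%N b)) a)).
    apply: csum_le => b _; rewrite /Psi/=; move: (z0 (i - d.+1)%N b) (M0 d b).
    move: (z _ b) (M d b) => u v u0 v0.
    have [uv|vu] := leP u v; first by rewrite (mulrC u).
    (* A new maximum [u] above [v]: concavity of the power [th], applied at [u / v], pays for the
       jump; [c] is chosen so that both sides share the factor [1 / (1 - th)]. *)
    rewrite (mulr_powRB _ u0).
    have -> : v `^ (th - 1) = v `^ th / v by rewrite -(mulr_powRB th v0) mulrC mulKf// gt_eqF.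
    pose t := u / v.
    have uE : u = t * v by rewrite divfK// gt_eqF.
    have t0 : 0 <= t by rewrite divr_ge0// ltW.
    rewrite {1 2}uE powRM//; last exact: ltW.
    have := powR_concave th0 th1 t0; rewrite /c => conc.
    have e1 : t `^ th * v `^ th + th / (1 - th) * (t `^ th * v `^ th) = v `^ th * (t `^ th / (1 - th)).
      by field; rewrite gt_eqF.
    have e2 : v `^ th + th / (1 - th) * (v `^ th / v * u) = v `^ th * ((1 - th + th * t) / (1 - th)).
      by rewrite /t; field; rewrite !gt_eqF.
    rewrite e1 e2; apply: ler_wpM2l; first exact: powR_ge0.
    by apply: ler_wpM2r => //; rewrite invr_ge0 ltW.
  rewrite /Psi /csum !big_split/= lerD2l -!mulr_sumr ler_wpM2l//.
  have aM : adapted (i - d) (fun b => M d b `^ (th - 1)) by move=> b b' /MA ->.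
  have aM' : adapted (i - d.+1) (fun b => M d b `^ (th - 1)).
    by apply: (adapted_le nested) aM; rewrite subnS leq_pred.
  rewrite -!/(csum i _ a) -(csum_avg nested h a li aM') (csum_avg nested h a li' aM).
  by apply: csum_le => b _; rewrite mulrC.
have tot d : (d <= i)%N -> csum i (Psi d) a <= csum i (Psi 0%N) a.
  by elim: d => // d ih di; apply: le_trans (step _ di) _; apply: ih; exact: ltnW.
apply: (@le_trans _ _ (csum i (Psi i) a)).
  apply: csum_le => b _; apply: (@le_trans _ _ (M i b `^ th)).
    apply: powR_le => //; first exact: maxbelow_ge0.
    by apply: maxbelow_le => [|l _ li]; [exact: ltW|apply: Mz; rewrite ?subnn].
  by rewrite lerDl mulr_ge0// mulr_ge0 ?powR_ge0// ltW.
apply: le_trans (tot i (leqnn i)) _.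
rewrite /Psi subn0 /=.
have -> : csum i (fun b => z i b `^ th + c * (z i b * z i b `^ (th - 1))) a =
    csum i (fun b => (1 - th)^-1 * avg i h a `^ th * 1) a.
  apply: eq_bigr => b /eqP e; rewrite mulr1 -(avg_adapted h e) -/(z i b).
  by rewrite (mulr_powRB _ (z0 i b)) /c; field; rewrite gt_eqF.
by rewrite csumZ -/(csize i a) mulrAC mulrA.
Qed.

Lemma sparse_kolmogorov S i h (th : R) a : sparse S -> (i < N)%N -> 0 <= th -> th < 1 ->
  (forall b, 0 < h b) ->
  avg i (below i (fun l b => (S l b)%:R * avg l h b `^ th)) a <= 2 / (1 - th) * avg i h a `^ th.
Proof.
move=> sp iN th0 th1 h0; rewrite ler_pdivrMr ?csize_gt0//.
apply: (@le_trans _ _ (2 * csum i (fun b => maxbelow i (fun l => avg l h) b `^ th) a)).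
  apply: sparse_csum => //.
  - by move=> l b b' e; rewrite (avg_adapted h e).
  - by move=> l b; exact: powR_ge0.
  - move=> l b lN li; apply: powR_le => //; first by rewrite ltW// avg_gt0.
    exact: (maxbelow_ge (fun l => avg l h)).
  - by move=> b; exact: powR_ge0.
have -> : 2 / (1 - th) * avg i h a `^ th * csize i a =
  2 * ((1 - th)^-1 * (csize i a * avg i h a `^ th)) by ring.
by rewrite ler_pM2l//; exact: kolmogorov.
Qed.

(** Carleson packing from an A_infinity hypothesis: the selected averages are dominated by the
    maximal function, so the sparse sum costs at most twice its sum over the block. *)
Lemma sparse_carleson S i h (B : R) a : sparse S -> (forall b, 0 < h b) ->
  csum i (maxbelow i (fun l => avg l h)) a <= B * csum i h a ->
  avg i (below i (fun l b => (S l b)%:R * avg l h b)) a <= 2 * B * avg i h a.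
Proof.
move=> sp h0 HB; rewrite ler_pdivrMr ?csize_gt0//.
apply: (@le_trans _ _ (2 * csum i (maxbelow i (fun l => avg l h)) a)).
  apply: sparse_csum => //.
  - by move=> l b b' e; rewrite (avg_adapted h e).
  - by move=> l b; rewrite ltW// avg_gt0.
  - by move=> l b lN li; exact: (maxbelow_ge (fun l => avg l h)).
  - by move=> b; exact: maxbelow_ge0.
have -> : 2 * B * avg i h a * csize i a = 2 * (B * (csize i a * avg i h a)) by ring.
by rewrite -csumE ler_pM2l.
Qed.

End sparse_sums.

(** * Strata where the joint average is nearly constant *)

Section stratum.
Context {R : realType} {T : finType} {K : eqType}.
Variables (N : nat) (blk : nat -> T -> K).
Hypothesis nested : forall l a b, blk l a = blk l b -> blk l.+1 a = blk l.+1 b.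
Implicit Types (a b : T) (l i k j : nat) (h : T -> R).
Local Notation adapted := (adapted blk).
Local Notation csum := (@csum R T K blk).
Local Notation avg := (@avg R T K blk).
Local Notation above := (@above R T N).
Local Notation below := (@below R T N).
Local Notation sparse := (@sparse R T K N blk).

(** Marks the coarsest level at which [P] holds at [a]; the blocks so marked are disjoint and
    organise the sums over [P]. *)
Definition top (P : nat -> T -> bool) l a :=
  P l a && ~~ [exists k : 'I_N, (l < k)%N && P k a].

Lemma top_adapted (P : nat -> T -> bool) l : (forall k, adapted k (P k)) -> adapted l (top P l).
Proof.
move=> aP a b e; rewrite /top (aP _ _ _ e); congr (_ && ~~ _).
apply: eq_existsb => k; case lk : (l < k)%N => //=.
by rewrite (aP _ _ _ (blk_le nested (ltnW lk) e)).
Qed.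

Lemma top_unique (P : nat -> T -> bool) l k a : (l < N)%N -> (k < N)%N -> top P l a -> top P k a -> l = k.
Proof.
move=> lN kN /andP[Pl nl] /andP[Pk nk]; case: (ltngtP l k) => // lk.
  by move/negP : nl; case; apply/existsP; exists (Ordinal kN); rewrite /= lk Pk.
by move/negP : nk; case; apply/existsP; exists (Ordinal lN); rewrite /= lk Pl.
Qed.

Lemma top_exists (P : nat -> T -> bool) l a : (l < N)%N -> P l a ->
  exists2 k : 'I_N, (l <= k)%N & top P k a.
Proof.
move=> lN Pl.
case: (@arg_maxnP _ (Ordinal lN) (fun k : 'I_N => P k a) (fun k : 'I_N => k : nat)) => //= k Pk kmax.
exists k; first exact: (kmax (Ordinal lN)).
rewrite /top Pk; apply/negP => /existsP[j /andP[kj Pj]].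
by have := kmax j Pj; rewrite leqNgt kj.
Qed.

Lemma sum_top (P : nat -> T -> bool) a (c : R) :
  \sum_(l < N) (top P l a)%:R * c = ([exists l : 'I_N, P l a])%:R * c.
Proof.
case: (boolP [exists l : 'I_N, P l a]) => [/existsP[l Pl]|no].
  have [k lk tk] := top_exists (ltn_ord l) Pl.
  rewrite (bigD1 k)//= tk big1 ?addr0// => j jk.
  case tj : (top P j a); last by rewrite mul0r.
  by move/eqP : jk; case; apply: val_inj; exact: (top_unique (ltn_ord j) (ltn_ord k) tj tk).
rewrite big1 ?mul0r// => l _; case tl : (top P l a); last by rewrite mul0r.
by move: no; rewrite negb_exists => /forallP/(_ l); case/andP : tl => ->.
Qed.

Lemma top_below (P : nat -> T -> bool) (s : nat -> T -> R) a : (forall l a, ~~ P l a -> s l a = 0) ->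
  \sum_(l < N) s l a = \sum_(k < N) (top P k a)%:R * below k s a.
Proof.
move=> Ps; case: (boolP [exists l : 'I_N, P l a]) => [/existsP[l0 Pl0]|no]; last first.
  rewrite !big1// => l _.
    case tl : (top P l a); last by rewrite mul0r.
    by move: no; rewrite negb_exists => /forallP/(_ l); case/andP : tl => ->.
  by apply: Ps; move: no; rewrite negb_exists => /forallP.
have [k _ tk] := top_exists (ltn_ord l0) Pl0.
rewrite [RHS](bigD1 k)//= tk mul1r [X in _ + X]big1 ?addr0 => [|j jk]; last first.
  case tj : (top P j a); last by rewrite mul0r.
  by move/eqP : jk; case; apply: val_inj; exact: (top_unique (ltn_ord j) (ltn_ord k) tj tk).
rewrite /below [RHS]big_mkcond/=; apply: eq_bigr => l _; case: leqP => // kl.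
apply: Ps; apply/negP => Pl; case/andP : tk => _ /negP; case.
by apply/existsP; exists l; rewrite kl.
Qed.

Variables (p : R) (p1 : 1 < p).
Let m := (Num.truncn p).+1.

Let pm : p <= m%:R. Proof. exact/ltW/truncnS_gt. Qed.
Let p0 : 0 < p. Proof. exact: lt_trans p1. Qed.
Let pm1 : 0 < p - 1. Proof. by rewrite subr_gt0. Qed.
Let m0 : 0 < m%:R :> R. Proof. by []. Qed.

Variables (w s : T -> R) (S : nat -> T -> bool) (d : R).
Hypotheses (w0 : forall a, 0 < w a) (s0 : forall a, 0 < s a) (d0 : 0 < d).
Hypothesis spS : sparse S.
Let x l := avg l s.
Let y l := avg l w.
Hypothesis Sd : forall l a, (l < N)%N -> S l a -> d / 2 < y l a * x l a `^ (p - 1) <= d.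

Let x0 l a : 0 < x l a. Proof. exact: avg_gt0. Qed.
Let y0 l a : 0 < y l a. Proof. exact: avg_gt0. Qed.
Let x0w l a : 0 <= x l a. Proof. exact: ltW (x0 l a). Qed.
Let y0w l a : 0 <= y l a. Proof. exact: ltW (y0 l a). Qed.
Let pm1w : 0 <= p - 1. Proof. exact: ltW pm1. Qed.
Let aS l : adapted l (S l). Proof. by case: spS => H _; exact: H. Qed.
Let ax l : adapted l (x l). Proof. exact: avg_adapted. Qed.
Let ay l : adapted l (y l). Proof. exact: avg_adapted. Qed.

(** The first term serves [2 <= p], the second [p < 2]. *)
Definition cst_i : R := 2 * (p - 1) * 2 `^ (p - 1)^-1 + 4 / (p - 1).

Lemma cst_i_gt0 : 0 < cst_i.
Proof. by apply: addr_gt0; rewrite ?divr_gt0// !mulr_gt0// powR_gt0. Qed.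

Let ci0 : 0 < cst_i. Proof. exact: cst_i_gt0. Qed.

(** On a stratum [y * x^(p-1)] equals [d] up to a factor 2, so one average can be traded for a power
    of the other: [x * y] is bounded by [d^(1/(p-1)) * y^th] with [th = 1 - 1/(p-1)] if [2 <= p],
    and by [d * x^th] with [th = 2 - p] otherwise. As [0 <= th < 1], Kolmogorov's inequality sums
    these powers with no A_infinity information, and the lower bound [d / 2] converts back. *)
Lemma stratum_carleson i a : (i < N)%N -> S i a ->
  avg i (below i (fun l b => (S l b)%:R * (x l b * y l b))) a <= cst_i * (x i a * y i a).
Proof.
move=> iN Si; have /andP[d2 dd] := Sd iN Si.
have [p2|p2] := leP 2 p.
  pose th := 1 - (p - 1)^-1.
  have th0 : 0 <= th by rewrite subr_ge0 invf_le1//; lra.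
  have th1 : th < 1 by rewrite /th ltrBlDr ltrDl invr_gt0.
  pose c := d `^ (p - 1)^-1.
  have c0 : 0 < c by exact: powR_gt0.
  have xE l b : x l b = (x l b `^ (p - 1)) `^ (p - 1)^-1.
    by rewrite -powRrM mulfV ?gt_eqF// powRr1// ltW.
  have yE l b : y l b = y l b `^ th * y l b `^ (p - 1)^-1.
    rewrite -powRD; first by rewrite subrK powRr1// ltW.
    by rewrite (gt_eqF (y0 _ _))/= implybT.
  have pr0 : 0 <= (p - 1)^-1 by rewrite invr_ge0 ltW.
  apply: (@le_trans _ _ (c * avg i (below i (fun l b => (S l b)%:R * y l b `^ th)) a)).
    rewrite /avg mulrA -csumZ ler_wpM2r ?invr_ge0 ?csize_ge0//; apply: csum_le => b _.
    rewrite /below mulr_sumr; apply: ler_sum => l _.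
    case Sl : (S l b); last by rewrite !mul0r mulr0.
    have -> : (1 * (x l b * y l b) = (x l b * y l b `^ (p - 1)^-1) * y l b `^ th) by rewrite {1}yE; ring.
    rewrite mul1r; apply: ler_wpM2r; first exact: powR_ge0.
    rewrite xE -powRM; [|exact: powR_ge0|exact: ltW]; apply: powR_le => //.
      by rewrite mulr_ge0 ?powR_ge0// ltW.
    by rewrite mulrC; case/andP : (Sd (ltn_ord l) Sl).
  apply: (@le_trans _ _ (c * (2 / (1 - th) * y i a `^ th))).
    by rewrite ler_pM2l//; exact: sparse_kolmogorov.
  have -> : 2 / (1 - th) = 2 * (p - 1) by rewrite /th opprB addrC subrK invrK.
  apply: (@le_trans _ _ (2 `^ (p - 1)^-1 * (y i a `^ (p - 1)^-1 * x i a) * (2 * (p - 1) * y i a `^ th))).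
    apply: ler_wpM2r; first by rewrite mulr_ge0 ?powR_ge0// mulr_ge0// ltW.
    rewrite [x i a in leRHS]xE -powRM; [|exact: ltW|exact: powR_ge0].
    rewrite -powRM//; last by rewrite mulr_ge0 ?powR_ge0// ltW.
    apply: powR_le => //; first exact: ltW.
    by rewrite -ler_pdivrMl// mulrC ltW.
  apply: (@le_trans _ _ (2 * (p - 1) * 2 `^ (p - 1)^-1 * (x i a * y i a))).
    by rewrite [y i a in leRHS]yE le_eqVlt; apply/orP; left; apply/eqP; ring.
  rewrite /cst_i [leRHS]mulrDl lerDl; apply: mulr_ge0 (mulr_ge0 (x0w _ _) (y0w _ _)).
  by rewrite divr_ge0.
pose th := 2 - p.
have th0 : 0 <= th by rewrite /th; lra.
have th1 : th < 1 by move: p1; rewrite /th; lra.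
apply: (@le_trans _ _ (d * avg i (below i (fun l b => (S l b)%:R * x l b `^ th)) a)).
  rewrite /avg mulrA -csumZ ler_wpM2r ?invr_ge0 ?csize_ge0//; apply: csum_le => b _.
  rewrite /below mulr_sumr; apply: ler_sum => l _.
  case Sl : (S l b); last by rewrite !mul0r mulr0.
  rewrite !mul1r.
  have -> : x l b * y l b = y l b * x l b `^ (p - 1) * x l b `^ th.
    rewrite -mulrA -powRD; last by rewrite (gt_eqF (x0 _ _))/= implybT.
    by rewrite (_ : p - 1 + th = 1) ?powRr1 ?ltW// 1?mulrC// /th; ring.
  by rewrite ler_wpM2r ?powR_ge0//; case/andP : (Sd (ltn_ord l) Sl).
apply: (@le_trans _ _ (d * (2 / (1 - th) * x i a `^ th))).
  by rewrite ler_pM2l//; exact: sparse_kolmogorov.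
have -> : 1 - th = p - 1 by rewrite /th; ring.
apply: (@le_trans _ _ (2 * (y i a * x i a `^ (p - 1)) * (2 / (p - 1) * x i a `^ th))).
  apply: ler_wpM2r; first by rewrite mulr_ge0 ?powR_ge0// divr_ge0// ltW.
  by rewrite -ler_pdivrMl// mulrC ltW.
apply: (@le_trans _ _ (4 / (p - 1) * (x i a * y i a))).
  have xE : x i a = x i a `^ (p - 1) * x i a `^ th.
    rewrite -powRD; last by rewrite (gt_eqF (x0 _ _))/= implybT.
    by rewrite (_ : p - 1 + th = 1) ?powRr1 ?ltW// /th; ring.
  by rewrite [x i a in leRHS]xE le_eqVlt; apply/orP; left; apply/eqP; field; rewrite subr_eq0 gt_eqF.
rewrite /cst_i [leRHS]mulrDl lerDr; apply: mulr_ge0 (mulr_ge0 (x0w _ _) (y0w _ _)).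
by rewrite mulr_ge0 ?powR_ge0// mulr_ge0.
Qed.

(** The first term suffices when [p <= 2]; the second comes from the absorption when [p > 2]. *)
Definition cst_H : R := m%:R * cst_i + 2 * m%:R * cst_i * (2 * m%:R * cst_i) `^ (p - 2).

Lemma cst_H_gt0 : 0 < cst_H.
Proof.
have c0 : 0 < 2 * m%:R * cst_i by rewrite mulr_gt0 ?cst_i_gt0// mulr_gt0.
by apply: addr_gt0; apply: mulr_gt0 => //; exact: powR_gt0.
Qed.

Let sub_adapted (P : nat -> T -> bool) (F : nat -> T -> R) k :
  (forall k, adapted k (P k)) -> (forall k, adapted k (F k)) ->
  adapted k (fun b => (P k b)%:R * F k b).
Proof. by move=> aP aF b c e; rewrite (aP _ _ _ e) (aF _ _ _ e). Qed.

Let nu l a := x l a * y l a.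

Definition tower (P : nat -> T -> bool) l a := above l (fun k b => (P k b)%:R * x k b) a.

(* Hardy's inequality on the tree, with the Carleson measure [x * y]. *)
Lemma stratum_hardy (P : nat -> T -> bool) : (forall l, adapted l (P l)) ->
  (forall l a, P l a -> S l a) ->
  \sum_a \sum_(l < N) (P l a)%:R * nu l a * tower P l a `^ (p - 1) <=
  cst_H * \sum_a \sum_(l < N) (P l a)%:R * nu l a * x l a `^ (p - 1).
Proof.
move=> aP PS; pose t := tower P; rewrite -/t.
have nu0 l a : 0 < nu l a by rewrite mulr_gt0.
have nu0w l a : 0 <= nu l a by exact: ltW.
have px0 k b : 0 <= (P k b)%:R * x k b by rewrite mulr_ge0// ltW.
have t0 l a : 0 <= t l a by exact: above_ge0.
have at_ l : adapted l (t l).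
  by apply: (@above_adapted R T K N blk nested l (fun k b => (P k b)%:R * x k b)) => k; exact: sub_adapted.
set H := \sum_a _; set E := (X in _ <= cst_H * X).
have E0 : 0 <= E.
  apply: sumr_ge0 => a _; apply: sumr_ge0 => l _.
  exact: mulr_ge0 (mulr_ge0 (ler0n _ _) (nu0w _ _)) (powR_ge0 _ _).
have H0 : 0 <= H.
  apply: sumr_ge0 => a _; apply: sumr_ge0 => l _.
  exact: mulr_ge0 (mulr_ge0 (ler0n _ _) (nu0w _ _)) (powR_ge0 _ _).
have mc0 : 0 < m%:R * cst_i by rewrite mulr_gt0.
(* Summation by parts of the power of the tower, exchange of levels, and the Carleson bound for
   [x * y] under each block. *)
have step : H <= m%:R * cst_i * \sum_a \sum_(l < N) (P l a)%:R * nu l a * (x l a * t l a `^ (p - 1 - 1)).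
  pose z k a := (P k a)%:R * x k a * t k a `^ (p - 1 - 1).
  have az k : adapted k (z k).
    by move=> a b e; rewrite /z (aP _ _ _ e) (ax e) (at_ _ _ _ e).
  apply: (@le_trans _ _ (\sum_a \sum_(l < N) ((P l a)%:R * nu l a) * (m%:R * above l z a))).
    apply: ler_sum => a _; apply: ler_sum => l _; apply: ler_wpM2l.
      by rewrite mulr_ge0// ltW.
    by apply: above_powR => //; move: pm; lra.
  rewrite (eq_bigr (fun a => m%:R * \sum_(l < N) ((P l a)%:R * nu l a) * above l z a)); last first.
    by move=> a _; rewrite mulr_sumr; apply: eq_bigr => l _; ring.
  rewrite -mulr_sumr (@sum_above R T K N blk (fun l a => (P l a)%:R * nu l a) z az) -mulrA ler_pM2l//.
  rewrite [in leRHS]exchange_big/= mulr_sumr; apply: ler_sum => k _.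
  rewrite mulr_sumr; apply: ler_sum => a _; rewrite /z.
  case Pk : (P k a); last by rewrite !mul0r mulr0.
  rewrite !mul1r.
  apply: (@le_trans _ _ (x k a * t k a `^ (p - 1 - 1) * (cst_i * nu k a))).
    apply: ler_wpM2l; first by rewrite mulr_ge0 ?powR_ge0// ltW.
    apply: le_trans (stratum_carleson (ltn_ord k) (PS _ _ Pk)).
    apply: avg_le => b _; apply: ler_sum => l _; apply: ler_wpM2r; first by rewrite ltW.
    by case Pl : (P l b) => //; rewrite (PS _ _ Pl).
  by rewrite le_eqVlt; apply/orP; left; apply/eqP; ring.
(* For [p <= 2] the exponent [p - 2] is non-positive and the tower is at least [x], so the tower may
   be replaced by [x]. *)
have [p2|p2] := leP (p - 1) 1.
  apply: le_trans step _; apply: (@le_trans _ _ (m%:R * cst_i * E)); last first.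
    by rewrite ler_wpM2r// lerDl !mulr_ge0 ?powR_ge0// ltW.
  rewrite ler_pM2l//; apply: ler_sum => a _; apply: ler_sum => l _.
  case Pl : (P l a); last by rewrite !mul0r.
  rewrite !mul1r ler_pM2l// -(mulr_powRB (p - 1) (x0 l a)) ler_pM2l//.
  have xt : x l a <= t l a.
    by have := @above_ge R T N l (fun k b => (P k b)%:R * x k b) a px0 (ltn_ord l); rewrite Pl mul1r.
  have -> : p - 1 - 1 = - (2 - p) by ring.
  rewrite !powRN lef_pV2 ?posrE ?powR_gt0//; last exact: lt_le_trans xt.
  by apply: powR_le => //; move: p2; lra.
(* For [p > 2], Young with this parameter leaves [H / 2] on the right, which is absorbed. *)
have e0 : 0 < (2 * m%:R * cst_i)^-1 by rewrite invr_gt0 -mulrA mulr_gt0.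
have {}step : H <= m%:R * cst_i * ((2 * m%:R * cst_i)^-1 `^ (1 - (p - 1)) * E + (2 * m%:R * cst_i)^-1 * H).
  apply: le_trans step _; rewrite ler_pM2l//.
  rewrite /E /H !mulr_sumr -big_split/=; apply: ler_sum => a _.
  rewrite !mulr_sumr -big_split/=; apply: ler_sum => l _.
  apply: le_trans (ler_wpM2l _ (young_eps p2 e0 _ _)) _ => //.
  - exact: mulr_ge0 (ler0n _ _) (nu0w _ _).
  - by rewrite mulrDr !(mulrCA ((P l a)%:R * nu l a)).
have e1 : m%:R * cst_i * ((2 * m%:R * cst_i)^-1 * H) = H / 2.
  by field; rewrite ?gt_eqF// ?mulr_gt0.
have e2 : (2 * m%:R * cst_i)^-1 `^ (1 - (p - 1)) = (2 * m%:R * cst_i) `^ (p - 2).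
  rewrite -powRV ?mulr_ge0 ?(ltW cst_i_gt0)//.
  by rewrite -powRN; congr (_ `^ _); ring.
move: step; rewrite mulrDr e1 e2 => step.
have : H <= 2 * m%:R * cst_i * (2 * m%:R * cst_i) `^ (p - 2) * E.
  by move: step; rewrite -!mulrA; set u := m%:R * _; lra.
move/le_trans; apply; rewrite ler_wpM2r// lerDr.
exact: ltW.
Qed.

End stratum.

Section geometric.
Context {R : realType}.
Implicit Types (c t r : R) (J j : nat).

Definition cst_geo (r : R) : R := 2 `^ r / (2 `^ r - 1).

Lemma powR2_gt1 r : 0 < r -> 1 < 2 `^ r :> R.
Proof.
move=> r0; have : 1 `^ r < 2 `^ r :> R by rewrite gt0_ltr_powR// ?nnegrE ?ltr1n.
by rewrite powR1.
Qed.

Lemma cst_geo_ge0 r : 0 < r -> 0 <= cst_geo r.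
Proof. by move=> /powR2_gt1 r1; rewrite divr_ge0 ?powR_ge0// subr_ge0 ltW. Qed.

Lemma geo_sum_le c t r J : 0 < r -> 0 < c -> 0 <= t ->
  \sum_(j < J) (c * 2 ^+ j <= t)%R%:R * (c * 2 ^+ j) `^ r <= cst_geo r * t `^ r.
Proof.
move=> r0 c0 t0; have D0 : 0 < 2 `^ r - 1 :> R by rewrite subr_gt0 powR2_gt1.
have sc0 j : 0 <= c * 2 ^+ j by rewrite mulr_ge0// ?exprn_ge0// ltW.
have scS j : c * 2 ^+ j.+1 = 2 * (c * 2 ^+ j) by rewrite exprS mulrCA.
have all k : \sum_(j < k) (c * 2 ^+ j) `^ r <= (2 `^ r - 1)^-1 * (c * 2 ^+ k) `^ r.
  elim: k => [|k ih]; first by rewrite big_ord0 mulr_ge0 ?powR_ge0// invr_ge0 ltW.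
  rewrite big_ord_recr/= scS (@powRM _ 2)//.
  apply: le_trans (lerD ih (lexx _)) _; rewrite le_eqVlt; apply/orP; left; apply/eqP.
  by set q := 2 `^ r in D0 *; field; rewrite gt_eqF.
elim: J => [|J ih]; first by rewrite big_ord0 mulr_ge0 ?powR_ge0// divr_ge0 ?powR_ge0// ltW.
have [le_t|lt_t] := leP (c * 2 ^+ J) t; last first.
  by rewrite big_ord_recr/= (lt_geF lt_t) mul0r addr0.
apply: (@le_trans _ _ (\sum_(j < J.+1) (c * 2 ^+ j) `^ r)).
  apply: ler_sum => j _; have [_|_] := leP (c * 2 ^+ j) t.
    by rewrite mul1r.
  by rewrite mul0r powR_ge0.
apply: le_trans (all _) _; rewrite scS (@powRM _ 2)// /cst_geo mulrCA mulrA.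
rewrite ler_wpM2l ?divr_ge0 ?powR_ge0//; first exact: ltW.
by apply: powR_le => //; exact: ltW.
Qed.

(** Finitely many values: those that are not zero fit in a dyadic range, which makes the sums over
    dyadic sizes finite. *)
Lemma dyadic_range (I : eqType) (r : seq I) (v : I -> R) : (forall i, 0 <= v i) ->
  exists c, 0 < c /\ exists J, forall i, i \in r -> v i = 0 \/ c < v i <= c * 2 ^+ J.
Proof.
move=> v0; elim: r => [|i r [c [c0 [J H]]]]; first by exists 1; split=> //; exists 0%N.
have [vi|vi] := eqVneq (v i) 0.
  by exists c; split=> //; exists J => k; rewrite inE => /predU1P[->|/H//]; left.
have vi0 : 0 < v i by rewrite lt_neqAle eq_sym vi v0.
pose c' := Num.min c (v i / 2).
have c'0 : 0 < c' by rewrite lt_min c0 divr_gt0.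
pose M := Num.max (c * 2 ^+ J) (v i).
have [J' HJ'] : exists J', M <= c' * 2 ^+ J'.
  exists (Num.truncn (M / c')).+1.
  rewrite mulrC -ler_pdivrMr//; apply: le_trans (ltW (truncnS_gt _)) _.
  by rewrite -natrX ler_nat ltnW// ltn_expl.
exists c'; split=> //; exists J' => k; rewrite inE => /predU1P[->|kr].
  right; rewrite (le_trans _ HJ') ?le_max ?lexx ?orbT// andbT.
  by rewrite gt_min; apply/orP; right; rewrite ltr_pdivrMr// mulr_natr mulr2n ltrDl.
case: (H _ kr) => [|/andP[cv vJ]]; [by left|right].
by rewrite gt_min cv/= (le_trans _ HJ')// le_max vJ.
Qed.

End geometric.

(** * The weighted bound on one stratum *)

Section stratum_bound.
Context {R : realType} {T : finType} {K : eqType}.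
Variables (N : nat) (blk : nat -> T -> K).
Hypothesis nested : forall l a b, blk l a = blk l b -> blk l.+1 a = blk l.+1 b.
Implicit Types (a b : T) (l i k j : nat) (h : T -> R).
Local Notation adapted := (adapted blk).
Local Notation csum := (@csum R T K blk).
Local Notation avg := (@avg R T K blk).
Local Notation above := (@above R T N).
Local Notation below := (@below R T N).
Local Notation sparse := (@sparse R T K N blk).
Local Notation maxbelow := (@maxbelow R T N).
Local Notation top := (@top T N).

Lemma sum_top_le (P : nat -> T -> bool) (q v bound : nat -> T -> R) :
  (forall l, adapted l (P l)) -> (forall k, adapted k (v k)) -> (forall k a, 0 <= v k a) ->
  (forall k a, (k < N)%N -> P k a -> avg k (below k q) a <= bound k a) ->
  \sum_a \sum_(k < N) (top P k a)%:R * v k a * below k q a <=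
  \sum_a \sum_(k < N) (top P k a)%:R * v k a * bound k a.
Proof.
move=> aP av v0 H; rewrite exchange_big [leRHS]exchange_big/=; apply: ler_sum => k _.
rewrite (sum_avg (blk := blk) (l := k)); last first.
  by move=> a b e; rewrite (top_adapted _ nested aP e) (av _ _ _ e).
apply: ler_sum => a _; case tk : (top P k a); last by rewrite !mul0r.
by rewrite ler_wpM2l// ?mulr_ge0// H//; case/andP : tk.
Qed.

Lemma sum_top_avg (P : nat -> T -> bool) h : (forall l, adapted l (P l)) ->
  \sum_a \sum_(k < N) (top P k a)%:R * avg k h a = \sum_a ([exists l : 'I_N, P l a])%:R * h a.
Proof.
move=> aP; rewrite exchange_big/=.
under eq_bigr => k _.
  rewrite -(sum_avg (blk := blk) (l := k)); last by move=> a b e; rewrite (top_adapted _ nested aP e).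
  over.
by rewrite exchange_big/=; apply: eq_bigr => a _; rewrite sum_top.
Qed.

Variables (p : R) (p1 : 1 < p).
Let m := (Num.truncn p).+1.

Let pm : p <= m%:R. Proof. exact/ltW/truncnS_gt. Qed.
Let p0 : 0 < p. Proof. exact: lt_trans p1. Qed.
Let pm1 : 0 < p - 1. Proof. by rewrite subr_gt0. Qed.
Let pm1w : 0 <= p - 1. Proof. exact: ltW pm1. Qed.
Let m0 : 0 < m%:R :> R. Proof. by []. Qed.

Variables (w s f : T -> R) (S : nat -> T -> bool) (d A B : R).
Hypotheses (w0 : forall a, 0 < w a) (s0 : forall a, 0 < s a) (f0 : forall a, 0 <= f a).
Hypotheses (d0 : 0 < d) (A0 : 0 < A) (B0 : 0 < B).
Hypothesis spS : sparse S.
Let x l := avg l s.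
Let y l := avg l w.
Let F l := avg l f.
Hypothesis Sd : forall l a, (l < N)%N -> S l a -> d / 2 < y l a * x l a `^ (p - 1) <= d.
Hypothesis Bs : forall i a, (i < N)%N -> csum i (maxbelow i x) a <= B * csum i s a.
Hypothesis Aw : forall i a, (i < N)%N -> csum i (maxbelow i y) a <= A * csum i w a.

(** Average of [f / s] over the block with respect to the measure of density [s]. *)
Let g l a := F l a / x l a.
Variables (c0 : R) (J : nat).
Hypothesis c00 : 0 < c0.
Hypothesis grange : forall l a, (l < N)%N -> g l a = 0 \/ c0 < g l a <= c0 * 2 ^+ J.

Let x0 l a : 0 < x l a. Proof. exact: avg_gt0. Qed.
Let y0 l a : 0 < y l a. Proof. exact: avg_gt0. Qed.
Let x0w l a : 0 <= x l a. Proof. exact: ltW (x0 l a). Qed.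
Let y0w l a : 0 <= y l a. Proof. exact: ltW (y0 l a). Qed.
Let F0 l a : 0 <= F l a. Proof. exact: avg_ge0. Qed.
Let aS l : adapted l (S l). Proof. by case: spS => H _; exact: H. Qed.
Let ax l : adapted l (x l). Proof. exact: avg_adapted. Qed.
Let ay l : adapted l (y l). Proof. exact: avg_adapted. Qed.
Let aF l : adapted l (F l). Proof. exact: avg_adapted. Qed.
Let ag l : adapted l (g l). Proof. by move=> a b e; rewrite /g (aF e) (ax e). Qed.
Let FE l a : F l a = g l a * x l a. Proof. by rewrite /g divfK// gt_eqF. Qed.

Let sc j : R := c0 * 2 ^+ j.
Let sc0 j : 0 < sc j. Proof. by rewrite mulr_gt0// exprn_gt0. Qed.
Let sc0w j : 0 <= sc j. Proof. exact: ltW (sc0 j). Qed.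
Let scS j : sc j.+1 = 2 * sc j. Proof. by rewrite /sc exprS mulrCA. Qed.
Let sc_le j k : (j <= k)%N -> sc j <= sc k.
Proof. by move=> jk; rewrite ler_pM2l// ler_weXn2l// ler1n. Qed.

(** Running maximum of [g] over the selected blocks containing the present one. It grows towards
    finer levels, and its dyadic level sets [P j] do the work of principal cubes. *)
Let G l a : R := \big[Num.max/0]_(k < N | (l <= k)%N) ((S k a)%:R * g k a).
Let P j l a := [&& S l a, sc j < G l a & G l a <= sc j.+1].

Let G_adapted l : adapted l (G l).
Proof.
move=> a b e; apply: eq_bigr => k lk.
by rewrite (aS (blk_le nested lk e)) (ag (blk_le nested lk e)).
Qed.

Let P_adapted j l : adapted l (P j l).
Proof. by move=> a b e; rewrite /P (aS e) (G_adapted e). Qed.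

Let G_ge l k a : (l <= k)%N -> (k < N)%N -> S k a -> g k a <= G l a.
Proof.
move=> lk kN Sk; have := @le_bigmax_cond _ _ _ 0 (Ordinal kN) (fun k : 'I_N => (l <= k)%N)
  (fun k : 'I_N => (S k a)%:R * g k a) lk.
by rewrite /= Sk mul1r.
Qed.

Let G_anti l k a : (l <= k)%N -> G k a <= G l a.
Proof.
move=> lk; apply/bigmax_leP; split; first exact: bigmax_ge_id.
move=> j kj; exact: (@le_bigmax_cond _ _ _ 0 j (fun k : 'I_N => (l <= k)%N)
  (fun k : 'I_N => (S k a)%:R * g k a) (leq_trans lk kj)).
Qed.

Let G_range l a : G l a = 0 \/ c0 < G l a <= sc J.
Proof.
rewrite /G; elim/big_ind : _ => [|u v Hu Hv|k _]; first by left.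
  by case: (leP u v).
case Sk : (S k a); last by left; rewrite mul0r.
by rewrite mul1r; exact: grange.
Qed.

Let P_exists l a : (l < N)%N -> S l a -> g l a != 0 -> exists j : 'I_J, P j l a.
Proof.
move=> lN Sl gl; have gG := G_ge (leqnn l) lN Sl.
have : c0 < G l a <= sc J.
  case: (G_range l a) => [G0|//].
  by move: gl; case: (grange a lN) => [->|/andP[+ _]]; rewrite ?eqxx// -G0 => /lt_le_trans/(_ gG); rewrite G0 ltNge (ltW c00).
have : forall j, c0 < G l a <= sc j -> exists k : 'I_j, P k l a; last exact.
elim=> [|j ih] /andP[cG Gj].
  by move: cG; rewrite ltNge (le_trans Gj)// /sc expr0 mulr1.
have [Gj'|Gj'] := leP (G l a) (sc j).
  have [|k Pk] := ih; first by rewrite cG.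
  by exists (widen_ord (leqnSn j) k).
by exists ord_max; rewrite /P Sl Gj' Gj.
Qed.

Let P_unique j k l a : P j l a -> P k l a -> j = k.
Proof.
move=> /and3P[_ j1 j2] /and3P[_ k1 k2]; case: (ltngtP j k) => // jk.
  by move: (le_lt_trans (sc_le jk) k1); rewrite ltNge j2.
by move: (le_lt_trans (sc_le jk) j1); rewrite ltNge k2.
Qed.

Let t l a := above l (fun k b => (S k b)%:R * F k b) a.
(** Sum over the selected blocks where [G] has not yet exceeded [sc j]. Seen from a block of [P j]
    these are strictly coarser, and the sum does not depend on the level. *)
Let V j a := \sum_(k < N) (S k a && (G k a <= sc j))%:R * F k a.
Let tw j := tower N blk s (P j).
Let nu l a := x l a * y l a.

Let SF0 k b : 0 <= (S k b)%:R * F k b.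
Proof. exact: mulr_ge0 (ler0n _ _) (F0 _ _). Qed.
Let t0 l a : 0 <= t l a. Proof. exact: above_ge0. Qed.
Let V0 j a : 0 <= V j a.
Proof. by apply: sumr_ge0 => k _; exact: mulr_ge0 (ler0n _ _) (F0 _ _). Qed.
Let tw0 j l a : 0 <= tw j l a.
Proof. by apply: above_ge0 => k b; exact: mulr_ge0 (ler0n _ _) (x0w _ _). Qed.
Let nu0 l a : 0 < nu l a. Proof. exact: mulr_gt0. Qed.
Let nu0w l a : 0 <= nu l a. Proof. exact: ltW (nu0 l a). Qed.
Let at_ l : adapted l (t l).
Proof.
by apply: (above_adapted (s := fun k b => (S k b)%:R * F k b) _ nested) => k a b e;
  rewrite (aS e) (aF e).
Qed.

Let PS j l a : P j l a -> S l a. Proof. by case/and3P. Qed.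

Let V_le j l a : P j l a -> V j a <= t l a.
Proof.
move=> /and3P[_ jG _]; rewrite /V /t /above [leRHS]big_mkcond/=; apply: ler_sum => k _.
case: (boolP (S k a && (G k a <= sc j))) => [/andP[Sk Gk]|_].
  have [lk|kl] := leqP l k; first by rewrite Sk.
  by move: jG; rewrite ltNge (le_trans (G_anti a (ltnW kl)) Gk).
by rewrite mul0r; case: ifP => // _; exact: SF0.
Qed.

Let F_le j l a : (l < N)%N -> P j l a -> F l a <= sc j.+1 * x l a.
Proof.
move=> lN /and3P[Sl _ Gl]; rewrite FE ler_pM2r//.
exact: le_trans (G_ge (leqnn l) lN Sl) Gl.
Qed.

(** Above a block of [P j], a selected block either belongs to [P j], where [F <= sc j.+1 * x], or
    is counted in [V j]. *)
Let t_le j l a : P j l a -> t l a <= sc j.+1 * tw j l a + V j a.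
Proof.
move=> Pl; rewrite /t /tw /tower /above mulr_sumr.
apply: (@le_trans _ _ (\sum_(k < N | (l <= k)%N) (sc j.+1 * ((P j k a)%:R * x k a) +
    (S k a && (G k a <= sc j))%:R * F k a))); last first.
  rewrite big_split/= lerD2l /V [leRHS](bigID (fun k : 'I_N => (l <= k)%N))/= lerDl.
  by apply: sumr_ge0 => k _; exact: mulr_ge0 (ler0n _ _) (F0 _ _).
apply: ler_sum => k lk; case Sk : (S k a); last first.
  by rewrite mul0r /P Sk !(mul0r, mulr0) addr0.
have [Gk|Gk] := leP (G k a) (sc j).
  by rewrite lerDr; exact: mulr_ge0 (sc0w _) (mulr_ge0 (ler0n _ _) (x0w _ _)).
have Pk : P j k a.
  by rewrite /P Sk Gk/=; case/and3P : Pl => _ _; apply: le_trans; exact: G_anti.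
by rewrite Pk !mul1r mul0r addr0; exact: F_le.
Qed.

Let Y j : R := \sum_a \sum_(k < N) (top (P j) k a)%:R * x k a.
Let Ytot : R := \sum_(j < J) sc j `^ p * Y j.
Let X : R := \sum_a \sum_(l < N) (S l a)%:R * F l a * t l a `^ (p - 1) * y l a.
Let Z : R := \sum_a \sum_(l < N) (S l a)%:R * y l a * t l a `^ p.

(** Within one generation: after Hardy's inequality the upper bound [d] of the stratum leaves a
    sparse sum of [x], which the A_infinity bound [B] reduces to the top blocks. *)
Let T1 j : \sum_a \sum_(l < N) (P j l a)%:R * nu l a * tw j l a `^ (p - 1) <=
  cst_H p * (d * (2 * B * Y j)).
Proof.
apply: le_trans (stratum_hardy nested p1 w0 s0 d0 spS Sd (P_adapted j) (@PS j)) _.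
have cH0 : 0 <= cst_H p.
  have c0' := cst_i_gt0 p1.
  by rewrite addr_ge0// mulr_ge0 ?powR_ge0// ?mulr_ge0// ltW.
rewrite ler_wpM2l//.
apply: (@le_trans _ _ (\sum_a \sum_(l < N) d * ((P j l a)%:R * x l a))).
  apply: ler_sum => a _; apply: ler_sum => l _; case Pl : (P j l a); last by rewrite !mul0r mulr0.
  rewrite !mul1r -mulrA [leRHS]mulrC (ler_pM2l (x0 _ _)).
  by case/andP : (Sd (ltn_ord l) (PS Pl)).
rewrite (eq_bigr (fun a => d * \sum_(l < N) (P j l a)%:R * x l a)); last by move=> a _; rewrite mulr_sumr.
rewrite -mulr_sumr ler_pM2l//.
rewrite (eq_bigr (fun a => \sum_(k < N) (top (P j) k a)%:R * 1 * below k (fun l b => (P j l b)%:R * x l b) a)); last first.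
  move=> a _; rewrite (@top_below R T N (P j) (fun l b => (P j l b)%:R * x l b) a).
    by apply: eq_bigr => k _; rewrite mulr1.
  by move=> l b /negbTE ->; rewrite mul0r.
apply: le_trans (sum_top_le (v := fun _ _ => 1) (bound := fun k a => 2 * B * x k a) _ _ _ _) _ => //.
  move=> k a kN Pk; apply: le_trans (sparse_carleson nested spS s0 (Bs a kN)).
  apply: avg_le => b _; apply: ler_sum => l _; rewrite ler_wpM2r//.
  by case Pl : (P j l b) => //; rewrite (PS Pl).
rewrite /Y mulr_sumr; apply: ler_sum => a _; rewrite mulr_sumr; apply: ler_sum => k _.
by rewrite mulr1 mulrCA.
Qed.

(** Interaction with coarser generations: [V j] is at most [t] at the top block, the Carleson bound
    collects [x * y] there, and Young splits the product, [y * x^p] being at most [d * x]. *)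
Let T2 j (e : R) : 0 < e -> sc j.+1 * \sum_a \sum_(l < N) (P j l a)%:R * nu l a * V j a `^ (p - 1) <=
  cst_i p * (e `^ (1 - p) * (sc j.+1 `^ p * (d * Y j)) +
    e * \sum_a \sum_(k < N) (top (P j) k a)%:R * (y k a * t k a `^ p)).
Proof.
move=> e0; have ci0 := cst_i_gt0 p1.
apply: (@le_trans _ _ (sc j.+1 * \sum_a \sum_(k < N) (top (P j) k a)%:R * t k a `^ (p - 1) *
    below k (fun l b => (P j l b)%:R * nu l b) a)).
  rewrite ler_pM2l//; apply: ler_sum => a _; rewrite -mulr_suml.
  rewrite (@top_below R T N (P j) (fun l b => (P j l b)%:R * nu l b) a); last first.
    by move=> l b /negbTE ->; rewrite mul0r.
  rewrite mulr_suml; apply: ler_sum => k _; case tk : (top (P j) k a); last by rewrite !mul0r.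
  rewrite !mul1r mulrC ler_wpM2r//.
    by apply: sumr_ge0 => l _; exact: mulr_ge0 (ler0n _ _) (nu0w _ _).
  by apply: powR_le => //; apply: V_le; case/andP : tk.
apply: (@le_trans _ _ (sc j.+1 * \sum_a \sum_(k < N) (top (P j) k a)%:R * t k a `^ (p - 1) *
    (cst_i p * nu k a))).
  rewrite ler_pM2l//; apply: (@sum_top_le (P j) (fun l b => (P j l b)%:R * nu l b) (fun k a => t k a `^ (p - 1)) (fun k a => cst_i p * nu k a)) => //.
  - by move=> k a b e'; rewrite (at_ e').
  - by move=> k a; exact: powR_ge0.
  - move=> k a kN Pk.
    apply: le_trans (stratum_carleson nested p1 w0 s0 d0 spS Sd kN (PS Pk)).
    apply: avg_le => b _; apply: ler_sum => l _; apply: (ler_wpM2r (nu0w l b)).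
    by case Pl : (P j l b) => //; rewrite (PS Pl).
rewrite /Y !mulr_sumr -big_split/= mulr_sumr; apply: ler_sum => a _.
rewrite !mulr_sumr -big_split/= mulr_sumr; apply: ler_sum => k _.
case tk : (top (P j) k a); last by rewrite !(mul0r, mulr0, addr0).
have Sk : S k a by apply: PS; case/andP : tk; eauto.
rewrite !mul1r.
have -> : sc j.+1 * (t k a `^ (p - 1) * (cst_i p * nu k a)) =
    cst_i p * (y k a * (sc j.+1 * x k a * t k a `^ (p - 1))) by rewrite /nu; ring.
rewrite ler_pM2l//.
apply: (@le_trans _ _ (y k a * (e `^ (1 - p) * (sc j.+1 * x k a) `^ p + e * t k a `^ p))).
  by rewrite ler_pM2l//; apply: young_eps => //; exact: mulr_ge0.
rewrite mulrDr !(mulrCA (y k a)) lerD2r ler_wpM2l ?powR_ge0//.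
rewrite powRM// mulrCA ler_wpM2l ?powR_ge0//.
rewrite -(mulr_powRB p (x0 k a)) mulrCA mulrC ler_pM2r//.
by case/andP : (Sd (ltn_ord k) Sk).
Qed.

(** Summation by parts with the A_infinity bound [A] of [w]; it closes the loop from [Z] back to
    [X]. *)
Let Z_le : Z <= m%:R * (2 * A * X).
Proof.
apply: (@le_trans _ _ (\sum_a \sum_(l < N) ((S l a)%:R * y l a) * (m%:R *
    above l (fun k b => (S k b)%:R * F k b * t k b `^ (p - 1)) a))).
  apply: ler_sum => a _; apply: ler_sum => l _.
  apply: ler_wpM2l; first exact: mulr_ge0 (ler0n _ _) (y0w _ _).
  exact: (@above_powR R T N m p l (fun k b => (S k b)%:R * F k b) a p0 pm SF0).
under eq_bigr => a _ do under eq_bigr => l _ do rewrite mulrCA.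
under eq_bigr => a _ do rewrite -mulr_sumr.
rewrite -mulr_sumr ler_pM2l//.
rewrite (@sum_above R T K N blk (fun l a => (S l a)%:R * y l a)
  (fun k b => (S k b)%:R * F k b * t k b `^ (p - 1))); last first.
  by move=> k a b e; rewrite (aS e) (aF e) (at_ e).
rewrite /X [in leRHS]exchange_big/= mulr_sumr; apply: ler_sum => k _.
rewrite mulr_sumr; apply: ler_sum => a _.
rewrite (mulrC (2 * A)) -[leRHS]mulrA; apply: ler_wpM2l.
  exact: mulr_ge0 (SF0 _ _) (powR_ge0 _ _).
rewrite mulrC; exact: (sparse_carleson nested spS w0 (Aw a (ltn_ord k))).
Qed.

(** [T1] and [T2] summed over the generations. [X] reappears on the right with the factor [e * A];
    taking [e] of order [1 / A] absorbs it, and [e^(1-p)] is then the origin of [A^(p-1)]. *)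
Let X_le (e : R) : 0 < e -> X <= 2 `^ (p - 1) * (2 `^ p * (d * (2 * B * cst_H p + cst_i p * e `^ (1 - p)) * Ytot) +
  cst_i p * e * (m%:R * (2 * A * X))).
Proof.
move=> e0; have ci0 := cst_i_gt0 p1.
have tops : \sum_(j < J) \sum_a \sum_(k < N) (top (P j) k a)%:R * (y k a * t k a `^ p) <= Z.
  rewrite exchange_big/=; apply: ler_sum => a _; rewrite exchange_big/=; apply: ler_sum => k _.
  rewrite -mulr_suml -mulrA ler_wpM2r//; first exact: mulr_ge0 (y0w _ _) (powR_ge0 _ _).
  case: (boolP [exists j : 'I_J, top (P j) k a]) => [/existsP[j tj]|no].
    rewrite (bigD1 j)//= tj big1 ?addr0 => [|i ij].
      by rewrite (@PS j)//; case/andP : tj.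
    case ti : (top (P i) k a) => //; move/eqP : ij; case; apply: val_inj.
    by case/andP : tj => Pj _; case/andP : ti => Pi _; exact: P_unique Pi Pj.
  by rewrite big1// => j _; move: no; rewrite negb_exists => /forallP/(_ j)/negbTE ->.
have step j : \sum_a \sum_(l < N) (P j l a)%:R * (sc j.+1 * nu l a * t l a `^ (p - 1)) <=
    2 `^ (p - 1) * (2 `^ p * (d * (2 * B * cst_H p + cst_i p * e `^ (1 - p)) * (sc j `^ p * Y j)) +
     cst_i p * e * \sum_a \sum_(k < N) (top (P j) k a)%:R * (y k a * t k a `^ p)).
  apply: (@le_trans _ _ (2 `^ (p - 1) * (sc j.+1 `^ p * \sum_a \sum_(l < N) (P j l a)%:R * nu l a * tw j l a `^ (p - 1) +
      sc j.+1 * \sum_a \sum_(l < N) (P j l a)%:R * nu l a * V j a `^ (p - 1)))).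
    rewrite !mulr_sumr -big_split/= mulr_sumr; apply: ler_sum => a _.
    rewrite !mulr_sumr -big_split/= mulr_sumr; apply: ler_sum => l _.
    case Pl : (P j l a); last by rewrite !(mul0r, mulr0, addr0).
    rewrite !mul1r -(mulr_powRB p (sc0 j.+1)).
    apply: (@le_trans _ _ (sc j.+1 * nu l a * (2 `^ (p - 1) * ((sc j.+1 * tw j l a) `^ (p - 1) + V j a `^ (p - 1))))).
      rewrite ler_wpM2l//; first exact: mulr_ge0.
      apply: le_trans (powR_le pm1w (t0 l a) (t_le Pl)) _.
      by apply: powR_add_le => //; exact: mulr_ge0.
    by rewrite powRM// le_eqVlt; apply/orP; left; apply/eqP; ring.
  rewrite ler_wpM2l ?powR_ge0//.
  apply: le_trans (lerD (ler_wpM2l (powR_ge0 _ _) (T1 j)) (T2 j e0)) _.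
  rewrite scS powRM// le_eqVlt; apply/orP; left; apply/eqP; ring.
apply: (@le_trans _ _ (\sum_(j < J) \sum_a \sum_(l < N) (P j l a)%:R * (sc j.+1 * nu l a * t l a `^ (p - 1)))).
  rewrite [leRHS]exchange_big/=; apply: ler_sum => a _.
  rewrite [leRHS]exchange_big/=; apply: ler_sum => l _.
  have nn (j : 'I_J) : 0 <= (P j l a)%:R * (sc j.+1 * nu l a * t l a `^ (p - 1)).
    exact: mulr_ge0 (ler0n _ _) (mulr_ge0 (mulr_ge0 (sc0w _) (nu0w _ _)) (powR_ge0 _ _)).
  case Sl : (S l a); last by rewrite !mul0r; apply: sumr_ge0 => j _; exact: nn.
  have [gl|gl] := eqVneq (g l a) 0.
    by rewrite FE gl !(mul0r, mulr0); apply: sumr_ge0 => j _; exact: nn.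
  have [j Pj] := P_exists (ltn_ord l) Sl gl.
  rewrite (bigD1 j)//= ler_wpDr//; first by apply: sumr_ge0 => i _; exact: nn.
  rewrite Pj !mul1r /nu mulrA mulrAC ler_wpM2r ?powR_ge0// ler_wpM2r//.
  exact: F_le.
apply: le_trans; first by apply: ler_sum => j _; exact: step.
rewrite -mulr_sumr ler_wpM2l ?powR_ge0// big_split/= -!mulr_sumr lerD2l.
apply: ler_wpM2l; last exact: le_trans tops Z_le.
by rewrite mulr_ge0 ?ltW.
Qed.

(** A Doob maximal inequality for the measure of density [s]. At a top block of [P j] the average
    [g] itself exceeds [sc j], which is a weak type bound; the part where [f / s] is below
    [sc j / 2] is absorbed, and the rest is a geometric sum over [j]. *)
Let Y_le : Ytot <= 2 `^ p * cst_geo (p - 1) * \sum_a (f a / s a) `^ p * s a.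
Proof.
pose e j a := [exists l : 'I_N, P j l a].
have YE j : Y j = \sum_a (e j a)%:R * s a by rewrite /Y sum_top_avg.
have Doob j : sc j * Y j <= \sum_a (e j a)%:R * f a.
  rewrite -sum_top_avg// /Y mulr_sumr; apply: ler_sum => a _; rewrite mulr_sumr; apply: ler_sum => k _.
  case tk : (top (P j) k a); last by rewrite !mul0r mulr0.
  rewrite !mul1r -/(F k a) FE ler_pM2r//; case/andP : tk => /and3P[Sk jG Gj] no.
  rewrite leNgt; apply/negP => gk; move: jG; rewrite ltNge => /negP; apply.
  apply/bigmax_leP; split; first exact: sc0w.
  move=> i; rewrite leq_eqVlt => /predU1P[ki|ki].
    by rewrite -ki Sk mul1r ltW.
  case Si : (S i a); last by rewrite mul0r.
  rewrite mul1r; apply: le_trans (G_ge (leqnn i) (ltn_ord i) Si) _.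
  rewrite leNgt; apply/negP => Gi; case/negP : no; apply/existsP; exists i.
  by rewrite ki /P Si Gi/= (le_trans (G_anti a (ltnW ki)) Gj).
have split_ j a : sc j `^ (p - 1) * ((e j a)%:R * f a) <=
    f a * ((sc j <= 2 * (f a / s a))%R%:R * sc j `^ (p - 1)) + 2^-1 * (sc j `^ p * ((e j a)%:R * s a)).
  have a1 : 0 <= f a * ((sc j <= 2 * (f a / s a))%R%:R * sc j `^ (p - 1)).
    exact: mulr_ge0 (f0 _) (mulr_ge0 (ler0n _ _) (powR_ge0 _ _)).
  have a2 : 0 <= 2^-1 * (sc j `^ p * s a).
    by rewrite mulr_ge0// mulr_ge0 ?powR_ge0// ltW.
  case: (e j a); last by rewrite !(mul0r, mulr0) addr0.
  rewrite !mul1r; have [le2|lt2] := leP (sc j) (2 * (f a / s a)).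
    by rewrite mul1r mulrC lerDl.
  rewrite mul0r mulr0 add0r -(mulr_powRB p (sc0 j)) .
  have -> : 2^-1 * (sc j * sc j `^ (p - 1) * s a) = sc j `^ (p - 1) * (sc j / 2 * s a) by ring.
  rewrite ler_wpM2l ?powR_ge0// -ler_pdivrMr//.
  by move: lt2; set q := f a / s a; lra.
suff : Ytot <= cst_geo (p - 1) * 2 `^ (p - 1) * \sum_a (f a / s a) `^ p * s a + 2^-1 * Ytot.
  have -> : 2 `^ p = 2 * 2 `^ (p - 1) :> R by rewrite mulr_powRB.
  by move=> h; move: h; set q := \sum_a _; rewrite -!mulrA; lra.
apply: (@le_trans _ _ (\sum_(j < J) \sum_a (f a * ((sc j <= 2 * (f a / s a))%R%:R * sc j `^ (p - 1)) + 2^-1 * (sc j `^ p * ((e j a)%:R * s a))))).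
  apply: ler_sum => j _; have -> : sc j `^ p * Y j = sc j `^ (p - 1) * (sc j * Y j).
    by rewrite -(mulr_powRB p (sc0 j)); ring.
  apply: le_trans (ler_wpM2l (powR_ge0 _ _) (Doob j)) _.
  by rewrite mulr_sumr; apply: ler_sum => a _; exact: split_.
under eq_bigr => j _ do rewrite big_split/=.
rewrite big_split/= lerD//; last first.
  rewrite /Ytot mulr_sumr; apply: ler_sum => j _.
  by rewrite YE -mulr_sumr -mulr_sumr.
rewrite exchange_big/= mulr_sumr; apply: ler_sum => a _; rewrite -mulr_sumr.
have fs0 : 0 <= f a / s a by rewrite divr_ge0// ltW.
apply: le_trans (ler_wpM2l (f0 a) (geo_sum_le J pm1 c00 _)) _; first by rewrite mulr_ge0.
rewrite powRM//.
have [fa|fa] := eqVneq (f a) 0.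
  by rewrite fa !mul0r; exact: mulr_ge0 (mulr_ge0 (cst_geo_ge0 pm1) (powR_ge0 _ _)) (mulr_ge0 (powR_ge0 _ _) (ltW (s0 _))).
have fs : 0 < f a / s a by rewrite lt_neqAle fs0 eq_sym mulf_neq0// invr_neq0// gt_eqF.
rewrite -(mulr_powRB p fs) le_eqVlt; apply/orP; left; apply/eqP.
by set q := _ `^ _; set q' := (_ / _) `^ _; field; rewrite gt_eqF.
Qed.

Definition cst_X : R := m%:R * (2 * (2 `^ (p - 1) * (2 `^ p *
  (2 * cst_H p + cst_i p * (4 * m%:R * 2 `^ (p - 1) * cst_i p) `^ (p - 1)) * (2 `^ p * cst_geo (p - 1))))).

Lemma stratum_bound_ranged :
  \sum_a (\sum_(l < N) (S l a)%:R * F l a) `^ p * w a <=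
  cst_X * (d * (B + A `^ (p - 1))) * \sum_a (f a / s a) `^ p * s a.
Proof.
have ci0 := cst_i_gt0 p1; have cH0 := cst_H_gt0 p1.
have p2 : 0 < 2 `^ (p - 1) :> R by exact: powR_gt0.
(* Summation by parts from the finest level bounds the [p]-th power; averaging over blocks then
   replaces [w] by [y]. *)
apply: (@le_trans _ _ (m%:R * X)).
  rewrite /X.
  apply: (@le_trans _ _ (\sum_a \sum_(l < N) m%:R * ((S l a)%:R * F l a * t l a `^ (p - 1) * w a))).
    apply: ler_sum => a _; rewrite -mulr_sumr -mulr_suml mulrA ler_wpM2r//; first exact: ltW.
    apply: le_trans (_ : t 0 a `^ p <= _).
      by rewrite le_eqVlt; apply/orP; left; apply/eqP; congr (_ `^ _).
    apply: le_trans (above_powR N 0 a p0 pm SF0) _.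
    by [].
  rewrite exchange_big/= [X in _ <= _ * X]exchange_big/= mulr_sumr; apply: ler_sum => l _.
  rewrite -mulr_sumr ler_pM2l// (sum_avg (blk := blk) (l := l))//.
  by move=> a b e; rewrite (aS e) (aF e) (at_ e).
(* This parameter makes the recurring term equal to [X / 2]. *)
have e0 : 0 < (4 * m%:R * 2 `^ (p - 1) * cst_i p * A)^-1.
  by rewrite invr_gt0 !mulr_gt0.
have := X_le e0.
have -> : (4 * m%:R * 2 `^ (p - 1) * cst_i p * A)^-1 `^ (1 - p) =
    (4 * m%:R * 2 `^ (p - 1) * cst_i p) `^ (p - 1) * A `^ (p - 1).
  rewrite -powRV ?mulr_ge0 ?powR_ge0 ?(ltW ci0) ?(ltW A0)//.
  rewrite -powRN opprB powRM ?(ltW A0)//.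
  by rewrite !mulr_ge0 ?powR_ge0 ?(ltW ci0).
set Q := (4 * _ * _ * _) `^ _.
have Q0 : 0 <= Q by exact: powR_ge0.
rewrite [2 `^ (p - 1) * _]mulrDr.
have -> : 2 `^ (p - 1) * (cst_i p * (4 * m%:R * 2 `^ (p - 1) * cst_i p * A)^-1 * (m%:R * (2 * A * X))) = X / 2.
  by field; rewrite ?mulf_neq0 ?gt_eqF.
move=> XX.
have : X <= 2 * (2 `^ (p - 1) * (2 `^ p * (d * (2 * B * cst_H p + cst_i p * (Q * A `^ (p - 1))) * Ytot))).
  by move: XX; set q := _ * (_ * (_ * Ytot)); lra.
set M := 2 * B * _ + _ => XM.
have MB : M <= (2 * cst_H p + cst_i p * Q) * (B + A `^ (p - 1)).
  rewrite -subr_ge0 (_ : _ - _ = 2 * cst_H p * A `^ (p - 1) + cst_i p * Q * B); last by rewrite /M; ring.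
  by rewrite addr_ge0// mulr_ge0 ?powR_ge0 ?(ltW B0)// mulr_ge0// ltW.
have B1 : 0 <= B + A `^ (p - 1) by rewrite addr_ge0 ?powR_ge0 ?ltW.
have E0 : 0 <= \sum_a (f a / s a) `^ p * s a.
  by apply: sumr_ge0 => a _; rewrite mulr_ge0 ?powR_ge0// ltW.
have C0 : 0 <= 2 * cst_H p + cst_i p * Q.
  by rewrite addr_ge0// mulr_ge0// ltW.
have Yt0 : 0 <= Ytot.
  apply: sumr_ge0 => j _; apply: mulr_ge0; first exact: powR_ge0.
  by apply: sumr_ge0 => a _; apply: sumr_ge0 => k _; exact: mulr_ge0 (ler0n _ _) (x0w _ _).
rewrite /cst_X -/Q -!mulrA ler_pM2l//; apply: le_trans XM _; rewrite ler_pM2l// ler_pM2l// ler_pM2l ?powR_gt0//.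
apply: (@le_trans _ _ (d * ((2 * cst_H p + cst_i p * Q) * (B + A `^ (p - 1))) * Ytot)).
  by rewrite ler_wpM2r// ler_pM2l.
apply: le_trans (ler_wpM2l _ Y_le) _.
  exact: mulr_ge0 (ltW d0) (mulr_ge0 C0 B1).
by rewrite /cst_geo le_eqVlt; apply/orP; left; apply/eqP; ring.
Qed.

End stratum_bound.

(** * Summation over the strata *)

Section weighted_sparse.
Context {R : realType} {T : finType} {K : eqType}.
Variables (N : nat) (blk : nat -> T -> K).
Hypothesis nested : forall l a b, blk l a = blk l b -> blk l.+1 a = blk l.+1 b.
Implicit Types (a b : T) (l i k j : nat) (h : T -> R).
Local Notation adapted := (adapted blk).
Local Notation csum := (@csum R T K blk).
Local Notation csize := (@csize R T K blk).
Local Notation avg := (@avg R T K blk).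
Local Notation sparse := (@sparse R T K N blk).
Local Notation maxbelow := (@maxbelow R T N).

Lemma sparse_sub (S S' : nat -> T -> bool) : sparse S -> (forall l, adapted l (S' l)) ->
  (forall l a, S' l a -> S l a) -> sparse S'.
Proof.
move=> [aS sp] aS' sub; split=> // i a iN /sub Si; apply: le_trans (sp i a iN Si).
rewrite ler_pM2l//; apply: csum_le => b _.
have [/existsP[l /andP[li /sub Sl]]|_] := boolP [exists l : 'I_N, (l < i)%N && S' l b]; last first.
  exact: ler0n.
by rewrite (_ : [exists l : 'I_N, _ && S l b])//; apply/existsP; exists l; rewrite li.
Qed.

Variables (p : R) (p1 : 1 < p).
Variables (w s f : T -> R).
Hypotheses (w0 : forall a, 0 < w a) (s0 : forall a, 0 < s a) (f0 : forall a, 0 <= f a).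

Lemma stratum_bound (S : nat -> T -> bool) (d A B : R) : 0 < d -> 0 < A -> 0 < B -> sparse S ->
  (forall l a, (l < N)%N -> S l a -> d / 2 < avg l w a * avg l s a `^ (p - 1) <= d) ->
  (forall i a, (i < N)%N -> csum i (maxbelow i (fun l => avg l s)) a <= B * csum i s a) ->
  (forall i a, (i < N)%N -> csum i (maxbelow i (fun l => avg l w)) a <= A * csum i w a) ->
  \sum_a (\sum_(l < N) (S l a)%:R * avg l f a) `^ p * w a <=
  cst_X p * (d * (B + A `^ (p - 1))) * \sum_a (f a / s a) `^ p * s a.
Proof.
move=> d0 A0 B0 spS Sd Bs Aw.
have [|c [c0 [J H]]] := @dyadic_range R ('I_N * T)%type (enum [set: 'I_N * T])
    (fun u => avg u.1 f u.2 / avg u.1 s u.2).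
  by move=> i; rewrite divr_ge0 ?avg_ge0// => b; exact: ltW.
apply: (stratum_bound_ranged nested p1 w0 s0 f0 d0 A0 B0 spS Sd Bs Aw c0 (J := J)) => l a lN.
by apply: (H (Ordinal lN, a)); rewrite mem_enum inE.
Qed.

(** Geometric series of ratio [1 / lam], to the power [p]. As [lam ^ p = 2 ^ (1/2)], the weights of
    the strata spend half of the decay [2 ^ (-r)] of the stratum bounds. *)
Definition cst_strata : R := (1 - 2 `^ (- (2 * p)^-1))^-1 `^ p.

Let lam : R := 2 `^ (2 * p)^-1.
Let p0 : 0 < p. Proof. exact: lt_trans p1. Qed.
Let lam1 : 1 < lam. Proof. by apply: powR2_gt1; rewrite invr_gt0 mulr_gt0. Qed.
Let lam0 : 0 < lam. Proof. exact: lt_trans lam1. Qed.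

Lemma finite_geo_sum (q : R) M : 0 <= q -> q < 1 -> \sum_(r < M) q ^+ r <= (1 - q)^-1.
Proof.
move=> q0 q1; have d0 : 0 < 1 - q by rewrite subr_gt0.
rewrite -(ler_pM2l d0) mulfV ?gt_eqF// -opprB mulNr -subrX1 opprB.
by rewrite lerBlDr lerDl exprn_ge0.
Qed.

(** Each [v r] is at most [lam ^- r] times the [p]-th root of the weighted sum, and these bounds
    form a geometric series. *)
Lemma sum_strata_powR M (v : nat -> R) : (forall r, 0 <= v r) ->
  (\sum_(r < M) v r) `^ p <= cst_strata * \sum_(r < M) (lam `^ p) ^+ r * v r `^ p.
Proof.
move=> v0; set W := \sum_(r < M) _ ^+ _ * _.
have W0 : 0 <= W.
  by apply: sumr_ge0 => r _; rewrite mulr_ge0 ?powR_ge0// exprn_ge0 ?powR_ge0.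
pose mx := W `^ p^-1.
have vm (r : 'I_M) : v r <= lam^-1 ^+ r * mx.
  rewrite exprVn -ler_pdivrMl ?invr_gt0 ?exprn_gt0// invrK.
  have nn : 0 <= lam ^+ r * v r by rewrite mulr_ge0// exprn_ge0// ltW.
  rewrite -[leLHS]powRr1// -(mulfV (x := p)) ?gt_eqF// powRrM; apply: powR_le.
  - by rewrite invr_ge0 ltW.
  - exact: powR_ge0.
  rewrite /W (bigD1 r)//= powRM ?exprn_ge0 ?(ltW lam0)//.
  rewrite -!powR_mulrn ?powR_ge0 ?(ltW lam0)// -!powRrM (mulrC p) lerDl.
  by apply: sumr_ge0 => i _; rewrite mulr_ge0 ?powR_ge0// exprn_ge0 ?powR_ge0.
have lamV : 2 `^ (- (2 * p)^-1) = lam^-1 by rewrite powRN.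
have c0 : 0 <= (1 - lam^-1)^-1 by rewrite invr_ge0 subr_ge0 invf_le1// ltW.
apply: (@le_trans _ _ (((1 - lam^-1)^-1 * mx) `^ p)).
  apply: powR_le; [exact: ltW|exact: sumr_ge0|].
  apply: (@le_trans _ _ (\sum_(r < M) lam^-1 ^+ r * mx)); first exact: ler_sum.
  rewrite -mulr_suml ler_wpM2r ?powR_ge0// finite_geo_sum ?invr_ge0 ?(ltW lam0)//.
  by rewrite invf_lt1.
by rewrite powRM ?powR_ge0// /cst_strata lamV -powRrM mulVf ?gt_eqF// powRr1.
Qed.

Lemma cst_X_gt0 : 0 < cst_X p.
Proof.
have ci0 := cst_i_gt0 p1; have cH0 := cst_H_gt0 p1.
have g0 : 0 < cst_geo (p - 1).
  by rewrite divr_gt0 ?powR_gt0// subr_gt0 powR2_gt1// subr_gt0.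
apply: mulr_gt0 => //; apply: mulr_gt0 => //; apply: mulr_gt0; first exact: powR_gt0.
apply: mulr_gt0; last by rewrite mulr_gt0 ?powR_gt0.
apply: mulr_gt0; first exact: powR_gt0.
by rewrite ltr_pwDl ?mulr_gt0// ?mulr_ge0 ?powR_ge0// ltW.
Qed.

Let cst_X_ge0 : 0 <= cst_X p. Proof. exact: ltW cst_X_gt0. Qed.

Definition cst_W : R := cst_strata * 4 * cst_X p.

Lemma cst_W_gt0 : 0 < cst_W.
Proof.
apply: mulr_gt0 cst_X_gt0; rewrite mulr_gt0// powR_gt0// invr_gt0 subr_gt0.
by rewrite powRN invf_lt1.
Qed.

(* Every block is assigned to one of the strata on which the joint average
   [y x^(p-1)] is comparable to [D / 2^r]; the bounds are summable in [r]. *)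
Lemma weighted_sparse_sum (S : nat -> T -> bool) (D A B : R) : 0 < D -> 0 < A -> 0 < B -> sparse S ->
  (forall l a, (l < N)%N -> avg l w a * avg l s a `^ (p - 1) <= D) ->
  (forall i a, (i < N)%N -> csum i (maxbelow i (fun l => avg l s)) a <= B * csum i s a) ->
  (forall i a, (i < N)%N -> csum i (maxbelow i (fun l => avg l w)) a <= A * csum i w a) ->
  \sum_a (\sum_(l < N) (S l a)%:R * avg l f a) `^ p * w a <=
  cst_W * (D * (B + A `^ (p - 1))) * \sum_a (f a / s a) `^ p * s a.
Proof.
move=> D0 A0 B0 spS SD Bs Aw; have [aS _] := spS; pose z l a := avg l w a * avg l s a `^ (p - 1).
have z0 l a : 0 < z l a by rewrite mulr_gt0 ?powR_gt0 ?avg_gt0.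
have F0 l a : 0 <= avg l f a by exact: avg_ge0.
have az l : adapted l (z l) by move=> a b e; rewrite /z !(avg_adapted _ e).
have [|c [c0 [M H]]] := @dyadic_range R ('I_N * T)%type (enum [set: 'I_N * T])
    (fun u => D / z u.1 u.2).
  by move=> i; rewrite divr_ge0 ?(ltW D0)// ltW.
pose dr r : R := D / 2 ^+ r.
have dr0 r : 0 < dr r by rewrite divr_gt0// exprn_gt0.
pose Sr r l a := [&& S l a, dr r / 2 < z l a & z l a <= dr r].
have spr r : sparse (Sr r).
  apply: sparse_sub spS _ _ => l a; last by case/and3P.
  by move=> b e; rewrite /Sr (aS _ _ _ e) (az _ _ _ e).
(* The joint averages take finitely many positive values, so finitely many strata exhaust the
   selected blocks. *)
have [M' HM] : exists M', forall l a, (l < N)%N -> dr M' < z l a.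
  have [M' HM'] : exists M', c * 2 ^+ M < 2 ^+ M'.
    exists (Num.truncn (c * 2 ^+ M)).+1; apply: lt_trans (truncnS_gt _) _.
    by move: (Num.truncn _).+1 => k; rewrite -natrX ltr_nat ltn_expl.
  exists M' => l a lN.
  have : D / z l a < 2 ^+ M'.
    apply: le_lt_trans HM'; case: (H (Ordinal lN, a)); rewrite ?mem_enum ?inE//=.
      by move=> ->; rewrite mulr_ge0// ?exprn_ge0// ltW.
    by case/andP.
  by rewrite ltr_pdivrMr// /dr ltr_pdivrMr ?exprn_gt0// mulrC.
pose v r a := \sum_(l < N) (Sr r l a)%:R * avg l f a.
have v0 r a : 0 <= v r a by apply: sumr_ge0 => l _; exact: mulr_ge0.
have SE a : \sum_(l < N) (S l a)%:R * avg l f a <= \sum_(r < M') v r a.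
  rewrite exchange_big/=; apply: ler_sum => l _; rewrite -mulr_suml ler_wpM2r//.
  case Sl : (S l a); last by apply: sumr_ge0 => r _; exact: ler0n.
  suff [r Hr] : exists r : 'I_M', Sr r l a.
    by rewrite (bigD1 r)//= Hr lerDl; apply: sumr_ge0 => i _; exact: ler0n.
  have zD : z l a <= dr 0 by rewrite /dr expr0 divr1; exact: SD.
  have := HM l a (ltn_ord l); elim: M' {HM} => [|k ih]; first by rewrite ltNge zD.
  have [zk _|zk kz] := ltP (dr k) (z l a).
    have [r Hr] := ih zk; by exists (widen_ord (leqnSn k) r).
  exists ord_max; rewrite /Sr Sl zk andbT/=.
  by apply: le_lt_trans kz; rewrite /dr exprSr invfM mulrA.
have lam2 : lam `^ p = 2 `^ (2^-1).
  by rewrite -powRrM invfM mulfVK ?gt_eqF.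
set E := \sum_a (f a / s a) `^ p * s a.
have E0 : 0 <= E by apply: sumr_ge0 => a _; rewrite mulr_ge0 ?powR_ge0// ltW.
have cs0 : 0 <= cst_strata by exact: powR_ge0.
apply: (@le_trans _ _ (\sum_a \sum_(r < M') cst_strata * ((lam `^ p) ^+ r * (v r a `^ p * w a)))).
  apply: ler_sum => a _.
  apply: (@le_trans _ _ (cst_strata * (\sum_(r < M') (lam `^ p) ^+ r * v r a `^ p) * w a)).
    rewrite ler_wpM2r//; first exact: ltW.
    apply: le_trans (sum_strata_powR _ (fun r => v0 r a)).
    apply: powR_le; [exact: ltW| |exact: SE].
    by apply: sumr_ge0 => l _; exact: mulr_ge0.
  rewrite mulr_sumr mulr_suml; apply: ler_sum => r _.
  by rewrite -!mulrA.
rewrite exchange_big/=.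
have X0 : 0 <= cst_X p * (B + A `^ (p - 1)) * E * D.
  apply: mulr_ge0 (ltW D0); apply: mulr_ge0 E0; apply: mulr_ge0 cst_X_ge0 _.
  by rewrite addr_ge0 ?powR_ge0 ?(ltW B0).
apply: (@le_trans _ _ (\sum_(r < M') cst_strata * (cst_X p * (B + A `^ (p - 1)) * E * D) * (2 `^ (- 2^-1)) ^+ r)).
  apply: ler_sum => r _; rewrite -mulr_sumr -mulrA ler_wpM2l// -mulr_sumr.
  apply: le_trans (ler_wpM2l _ (stratum_bound (dr0 r) A0 B0 (spr r) _ Bs Aw)) _.
  - by rewrite exprn_ge0 ?powR_ge0.
  - by move=> l a lN /and3P[_ H1 H2]; rewrite H1 H2.
  have -> : 2 `^ (- 2^-1) = 2 `^ (2^-1) / 2 :> R.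
    rewrite -[X in _ / X]powRr1// -powRB ?implybT//; first by congr (_ `^ _); field.
    by rewrite pnatr_eq0 implybT.
  rewrite expr_div_n lam2 /dr le_eqVlt; apply/orP; left; apply/eqP.
  have : 2 ^+ r != 0 :> R by rewrite expf_neq0.
  set u := (2 `^ _) ^+ r; set q := 2 ^+ r; set A' := A `^ _; set X := cst_X p => q0.
  by rewrite -/E; field.
rewrite -mulr_sumr.
apply: (@le_trans _ _ (cst_strata * (cst_X p * (B + A `^ (p - 1)) * E * D) * 4)); last first.
  by rewrite /cst_W le_eqVlt; apply/orP; left; apply/eqP; ring.
apply: ler_wpM2l; first exact: mulr_ge0 cs0 X0.
(* With ratio at most [3 / 4] the series sums to at most [4], the factor in [cst_W]. *)
have h0 : 2 `^ (- 2^-1) <= 3 / 4 :> R.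
  have s2 : 4 / 3 <= Num.sqrt 2 :> R.
    by rewrite -(@ler_pXn2r _ 2) ?nnegrE ?sqrtr_ge0 ?divr_ge0// sqr_sqrtr//; lra.
  have -> : 3 / 4 = (4 / 3)^-1 :> R by rewrite invfM invrK mulrC.
  by rewrite powRN powR12_sqrt// lef_pV2 ?posrE ?sqrtr_gt0 ?divr_gt0.
apply: le_trans (finite_geo_sum _ (powR_ge0 _ _) _) _; first by apply: le_lt_trans h0 _; lra.
by rewrite -[4](invrK) lef_pV2 ?posrE; lra.
Qed.

End weighted_sparse.

(** * Sparse domination *)

Section sparse_domination.
Context {R : realType} {n : nat}.
Local Notation V := 'rV[R]_n.
Local Notation mu := (rV_lebesgue n).
Implicit Types (x y z : V) (l i m : nat).

(** A union of cells is a countable union, whatever condition defines it. *)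
Lemma saturated_measurable (v : V) (r : R) (A : set V) :
  (forall x y, cellmate v r (x, y) -> A x -> A y) -> measurable A.
Proof.
move=> HA; rewrite (_ : A = [set x | exists2 y, cell v r y = cell v r x & A y]).
  exact: (measurable_cell (fun c => exists2 y, cell v r y = c & A y)).
by apply/seteqP; split => x /=; [exists x|move=> [y e]; exact: HA].
Qed.

Variables (n0 : (0 < n)%N) (M : nat) (s : R) (psi : 'I_M -> V -> R).
Hypothesis s0 : 0 < s.
Hypothesis LP : forall i : 'I_M, LPker (s * 2 ^+ i) (psi i).
Variables (v : V) (f : V -> R).
Hypothesis Lf : locint f.
Let af y : \bar R := `|f y|%:E.
Let side l : R := s * 2 ^+ l.
Local Notation mate l := (cellmate v (s * 2 ^+ l)).

Let side0 l : 0 < side l. Proof. by rewrite mulr_gt0// exprn_gt0. Qed.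
Let side0w l : 0 <= side l. Proof. exact: ltW. Qed.
Let sideD l k : side (l + k) = side l * 2 ^+ k. Proof. by rewrite /side exprD mulrA. Qed.
Let sidele l k : (l <= k)%N -> side l <= side k.
Proof. by move=> lk; rewrite ler_pM2l// ler_weXn2l// ler1n. Qed.
Let af0 y : (0 <= af y)%E. Proof. by rewrite lee_fin. Qed.
Let maf : measurable_fun setT af. Proof. exact: measurable_absE Lf.1. Qed.

Let matele l k x y : (l <= k)%N -> mate l (x, y) -> mate k (x, y).
Proof.
move=> lk xy; have := cellmate_pow (k - l) (side0 l) xy.
by rewrite /side -mulrA -exprD subnKC.
Qed.

Definition cmean l x : R := fine (cavg v (s * 2 ^+ l) af x).

Lemma cell_integral_fin l x : (relint (mate l) af x < +oo)%E.
Proof.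
apply: le_lt_trans (Lf.2 x (side l)).
apply: ge0_subset_integral => //; [exact: measurable_cell_of|exact: measurable_cube|exact: measurable_funTS|].
by move=> y; apply: cellmate_near; exact: side0.
Qed.

Lemma relint_cmean l x : relint (mate l) af x = (side l ^+ n * cmean l x)%:E.
Proof.
have fi : relint (mate l) af x \is a fin_num.
  by rewrite ge0_fin_numE ?cell_integral_fin// integral_ge0.
rewrite /cmean /cavg -(fineK fi) -EFinM/= mulrA mulfV ?mul1r//.
by rewrite expf_neq0// gt_eqF.
Qed.

Lemma cmeanE l x : (cmean l x)%:E = cavg v (side l) af x.
Proof.
rewrite /cavg relint_cmean -EFinM mulrA mulVf ?mul1r//.
by rewrite expf_neq0// gt_eqF.
Qed.

Lemma cmean_ge0 l x : 0 <= cmean l x.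
Proof. by rewrite fine_ge0//; apply: cavg_ge0 => //; exact: side0. Qed.

Lemma cmean_cellmate l x y : mate l (x, y) -> cmean l x = cmean l y.
Proof. by move=> xy; rewrite /cmean (cavg_cellmate _ xy). Qed.

Lemma cmean_le l i x : (l <= i)%N -> side l ^+ n * cmean l x <= side i ^+ n * cmean i x.
Proof.
move=> li; rewrite -lee_fin -!relint_cmean.
apply: ge0_subset_integral => //; try exact: measurable_cell_of.
  exact: measurable_funTS.
by move=> y; exact: matele.
Qed.

(** The kernel of scale [k] based at [x] does not reach beyond the grid cell of [x] four levels up,
    whose side is [16] times the scale. *)
Definition nearby k x := forall y, cube x (2 * (s * 2 ^+ k)) y -> mate k.+4 (x, y).

(** The scale [k] is kept only at points well inside their cell of this grid; the shifted grids
    together recover all points. *)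
Definition tau (k : 'I_M) x : R := if `[< nearby k x >] then conv (psi k) f x else 0.

Let side4 k : side k.+4 = 16 * side k.
Proof. by rewrite -addn4 sideD mulrC; congr (_ * _); rewrite -natrX. Qed.

Lemma tau_le (k : 'I_M) x : `|tau k x| <= 16 ^+ n * cmean k.+4 x.
Proof.
have c0 : 0 <= 16 ^+ n * cmean k.+4 x by rewrite mulr_ge0 ?cmean_ge0// exprn_ge0.
rewrite /tau; case: asboolP => [near|_]; last by rewrite normr0.
rewrite -lee_fin; apply: le_trans (conv_le x (side0 k) (LP k) Lf) _.
have -> : (16 ^+ n * cmean k.+4 x)%:E = ((side k ^- n)%:E * relint (mate k.+4) af x)%E.
  rewrite relint_cmean -EFinM side4 (exprMn n 16 (side k)); congr (_%:E).
  have : side k ^+ n != 0 by rewrite expf_neq0// gt_eqF.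
  by move: (side k ^+ n) (16 ^+ n : R) (cmean _ _) => q t c' q0; field.
apply: lee_wpmul2l; first by rewrite lee_fin invr_ge0 exprn_ge0.
apply: ge0_subset_integral => //; [exact: measurable_cube|exact: measurable_cell_of|].
exact: measurable_funTS.
Qed.

(** The first term, multiplied by the mean [e], is [20 * B] for the constant [B] of [bad_sub]; the
    second makes the weak type set at most a quarter of the cell. *)
Definition cst_a : R := 80 * 256 ^+ n * 6 ^+ n + 8 * @weak_cst R n.

Let weak0 : 0 < @weak_cst R n.
Proof. by rewrite addr_gt0// mulr_gt0// exprn_gt0. Qed.

Let a80 : 80 * 256 ^+ n * 6 ^+ n <= cst_a.
Proof. by rewrite lerDl mulr_ge0// ltW. Qed.

Lemma cst_a_ge1 : 1 <= cst_a.
Proof.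
apply: le_trans a80; rewrite -mulrA -[leLHS]mul1r ler_pM// ?mulr_ege1 ?exprn_ege1// ler1n//.
Qed.

Let a1 : 1 <= cst_a. Proof. exact: cst_a_ge1. Qed.
Let a0 : 0 < cst_a. Proof. exact: lt_le_trans a1. Qed.

(** Stopping condition relative to a selected cell of level [i]: the mean of [f], or the square sum
    of the scales in between, is too large somewhere in the cell of level [l]. The quantifier over
    the cell makes the condition constant on cells. *)
Definition bad i l x := exists2 x', mate l (x, x') &
  cst_a * cmean i x < cmean l x' \/
  (cst_a * cmean i x) ^+ 2 < \sum_(k < M | (l < k.+4 <= i)%N) tau k x' ^+ 2.

Lemma bad_cellmate i l x y : (l <= i)%N -> mate l (x, y) -> bad i l x -> bad i l y.
Proof.
move=> li xy [x' xx' H]; exists x'; first exact: cellmate_trans (cellmate_sym xy) xx'.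
by rewrite -(cmean_cellmate (matele li xy)).
Qed.

(** Transfers a value from one point of a cell to another: the convolution varies by the ratio of
    the sides, and [u^2 <= 2 t^2 + 2 (u - t)^2]. *)
Lemma conv_osc (k : 'I_M) g y x' m (B : R) : locint g -> 0 <= B -> `|x' - y| <= side m ->
  (m < k.+4)%N -> (cubeint (16 * side k) (fun z => `|g z|%:E) y <= (B * side k ^+ n)%:E)%E ->
  conv (psi k) g x' ^+ 2 <= 2 * conv (psi k) g y ^+ 2 + 2 * (B * (side m / side k)) ^+ 2.
Proof.
move=> Lg B0 x'y mk small.
have sk : side k ^+ n != 0 by rewrite expf_neq0// gt_eqF.
have d : `|conv (psi k) g x' - conv (psi k) g y| <= B * (side m / side k).
  rewrite -lee_fin; apply: le_trans (conv_lip (s := 16 * side k) (side0 k) (LP k) Lg _) _.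
    have : side m <= side k.+3 by exact: sidele.
    by have := side0w k; rewrite -addn3 sideD (_ : 2 ^+ 3 = 8); [lra|rewrite -natrX].
  apply: le_trans (lee_wpmul2l _ small) _.
    by rewrite lee_fin mulr_ge0// invr_ge0 exprn_ge0.
  rewrite -EFinM lee_fin; have sk0 := side0 k; rewrite exprS.
  apply: (@le_trans _ _ ((side k)^-1 * side m * B)); last by rewrite mulrC (mulrC _^-1).
  rewrite (_ : _ * (B * _) = (side k)^-1 * `|x' - y| * B).
    by apply: ler_wpM2r => //; apply: ler_wpM2l; rewrite ?invr_ge0// ltW.
  move: (side k ^+ n) (side k) sk sk0 => q r' ? ?.
  by field; rewrite gt_eqF//; apply/andP.
move: d; set u := conv _ _ x'; set t := conv _ _ y; set c := B * _ => d.
have : (u - t) ^+ 2 <= c ^+ 2.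
  by rewrite -real_normK ?num_real// lerXn2r ?nnegrE// (le_trans _ d).
by have := sqr_ge0 (t - (u - t)); nra.
Qed.

(** The squared ratios decrease by a factor [4] from the scale [k = m - 3] on, and
    [64 * 4 / 3 <= 86]. *)
Lemma geo_quarter m i (B : R) :
  \sum_(k < M | (m < k.+4 <= i)%N) (B * (side m / side k)) ^+ 2 <= B ^+ 2 * 86.
Proof.
have p4 j : 0 < 4 ^+ j :> R by exact: exprn_gt0.
have sq j : side j ^+ 2 = s ^+ 2 * 4 ^+ j.
  by rewrite exprMn -exprM mulnC exprM (_ : 2 ^+ 2 = 4)// -natrX.
have E (k : nat) : (B * (side m / side k)) ^+ 2 = B ^+ 2 * (4 ^+ m * (4 ^+ k)^-1).
  rewrite exprMn; congr (_ * _); rewrite expr_div_n !sq -mulf_div mulfV ?mul1r//.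
  by rewrite expf_neq0// gt_eqF.
rewrite (eq_bigr (fun k : 'I_M => B ^+ 2 * (4 ^+ m * (4 ^+ k)^-1))); last by move=> k _; exact: E.
rewrite -mulr_sumr ler_wpM2l ?sqr_ge0// -mulr_sumr.
pose S K : R := \sum_(k < K | (m < k.+4)%N) (4 ^+ k)^-1.
have S0 K : 0 <= S K by apply: sumr_ge0 => k _; rewrite invr_ge0 ltW.
have H K : (m < K.+4)%N -> 4 ^+ m * S K + 4 ^+ m * (4 ^+ K)^-1 * (4 / 3) <= 86.
  elim: K => [|K ih] mK.
    rewrite /S big_ord0 mulr0 add0r expr0 invr1 mulr1.
    have : 4 ^+ m <= 64 :> R by rewrite -natrX ler_nat (leq_trans (leq_pexp2l _ (_ : (m <= 3)%N))).
    by lra.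
  rewrite /S big_mkcond big_ord_recr/= -big_mkcond/= -/(S K).
  move: mK; rewrite ltnS leq_eqVlt => /predU1P[mK|mK].
    have -> : S K = 0 by rewrite /S big_pred0// => k; apply/negbTE; rewrite -leqNgt mK; exact: (ltnW (ltn_ord k)).
    rewrite mK ltnn addr0.
    rewrite mulr0 add0r !exprS; move: (4 ^+ K : R) (p4 K) => t t0.
    rewrite (_ : _ * (4 / 3) = 4 * 4 * 4 * 4 / 3); first by lra.
    by field; rewrite gt_eqF.
  rewrite mK; apply: le_trans (ih mK); rewrite exprS invfM mulrDr.
  by set u := 4 ^+ m * _; set t := (4 ^+ K)^-1; set r := 4 ^+ m; lra.
have HM : 4 ^+ m * S M <= 86.
  have [mM|mM] := ltnP m M.+4.
    by apply: le_trans (H _ mM); rewrite lerDl !mulr_ge0 ?invr_ge0 ?(ltW (p4 _)).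
  rewrite /S big_pred0 ?mulr0// => k; apply/negbTE; rewrite -leqNgt; apply: leq_trans mM.
  exact: (ltnW (ltn_ord k)).
apply: le_trans HM; apply: ler_wpM2l; first exact: ltW.
rewrite /S big_mkcond [leRHS]big_mkcond/=; apply: ler_sum => k _.
by case: (m < k.+4)%N => //=; case: ifP => // _; rewrite invr_ge0 ltW.
Qed.

Section one_cell.
Variables (i : nat) (x : V).
Let Q := [set y | mate i (x, y)].
Let e := cmean i x.
Let g : V -> R := patch (fun=> 0) Q f.

Let mQ : measurable Q. Proof. exact: measurable_cell_of. Qed.

Let Lg : locint g. Proof. exact: locint_patch. Qed.

Let ag_int : (\int[mu]_y `|g y|%:E = (side i ^+ n * e)%:E)%E.
Proof.
rewrite -relint_cmean /relint [RHS]integral_mkcond; apply: eq_integral => y _.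
by rewrite /g /patch -/Q; case: ifP => // _; rewrite normr0.
Qed.

Let gi : mu.-integrable setT (EFin \o g).
Proof.
apply/integrableP; split; first by apply/measurable_EFinP; exact: Lg.1.
by rewrite (_ : (\int[mu]_y _ = \int[mu]_y `|g y|%:E)%E)// ag_int ltry.
Qed.

Let ag y : \bar R := `|g y|%:E.
Let ag0 y : (0 <= ag y)%E. Proof. by rewrite lee_fin. Qed.
Let mag : measurable_fun setT ag. Proof. exact: measurable_absE Lg.1. Qed.

Let relint_g m y : (m <= i)%N -> Q y -> relint (mate m) ag y = (side m ^+ n * cmean m y)%:E.
Proof.
move=> mi Qy; rewrite -relint_cmean; apply: eq_integral => z /set_mem yz.
by rewrite /ag /g /patch mem_set//; exact: cellmate_trans Qy (matele mi yz).
Qed.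

Let conv_g (k : 'I_M) y : Q y -> nearby k y -> (k.+4 <= i)%N -> conv (psi k) g y = conv (psi k) f y.
Proof.
move=> Qy near ki; congr (fine _); apply: eq_integral => z _; congr (_%:E).
rewrite /g /patch; case: ifPn => // /negP Qz.
suff -> : psi k (y - z) = 0 by rewrite !mul0r.
apply/eqP; rewrite -normr_le0; apply: le_trans (LPker_cube y z (side0 k) (LP k)) _.
rewrite indicE memNset ?mulr0// => /near yz.
by apply: Qz; apply: mem_set; exact: cellmate_trans Qy (matele ki yz).
Qed.

(** The height at which the exceptional set of the maximal function has at most a quarter of the
    measure of [Q]. *)
Let b := 4 * 6 ^+ n * e.

(** Off the exceptional set the first alternative is impossible, and the square sum at the bad point
    moves to [y] at the cost [172 * B^2]. As [20 * B] is at most [cst_a * e], more than a quarter of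
    [(cst_a * e)^2] is left. *)
Let bad_sub (W : set V) y m : 0 < e -> Q y -> (m < i)%N -> bad i m y -> ~ W y ->
  (forall r, 0 < r -> (cubeint r ag y <= (b * (16 * r) ^+ n)%:E)%E) ->
  (cst_a * e / 2) ^+ 2 < sqsum psi g y.
Proof.
move=> e0 Qy mi [x' yx' bd] _ small.
have ee : cmean i y = e by rewrite /e (cmean_cellmate Qy).
have Qx' : Q x' by exact: cellmate_trans Qy (matele (ltnW mi) yx').
have b0 : 0 < b by rewrite !mulr_gt0// exprn_gt0.
move: bd; rewrite ee => -[big|big].
  have : ((side m ^+ n * cmean m x')%:E <= (b * (16 * side m) ^+ n)%:E)%E.
    apply: le_trans (small _ (side0 m)); rewrite -(cmean_cellmate yx') -(relint_g (ltnW mi) Qy).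
    apply: ge0_subset_integral => //; [exact: measurable_cell_of|exact: measurable_cube|exact: measurable_funTS|].
    by move=> z; apply: cellmate_near; exact: side0.
  rewrite lee_fin => h.
  have : cmean m x' <= b * 16 ^+ n.
    rewrite -(ler_pM2l (exprn_gt0 n (side0 m))); apply: le_trans h _.
    by rewrite exprMn mulrA [leLHS]mulrC.
  move=> /(lt_le_trans big).
  rewrite /b mulrAC ltr_pM2r// ltNge => /negP[]; apply: le_trans a80.
  rewrite mulrAC ler_pM2r ?exprn_gt0//; apply: ler_pM; rewrite ?exprn_ge0 ?ler_nat//.
  by rewrite lerXn2r ?nnegrE// ler_nat.
set A := cst_a * e in big *.
pose B := b * 256 ^+ n; have B0 : 0 <= B by apply: mulr_ge0; rewrite ?exprn_ge0// ltW.
have near_y (k : 'I_M) : (m < k.+4 <= i)%N -> tau k x' ^+ 2 <=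
    2 * conv (psi k) g y ^+ 2 + 2 * (B * (side m / side k)) ^+ 2.
  move=> /andP[mk ki].
  rewrite /tau; case: asboolP => [near|_]; last first.
    by rewrite (expr0n _ 2); apply: addr_ge0; apply: mulr_ge0 => //; exact: sqr_ge0.
  rewrite -(conv_g Qx' near ki); apply: conv_osc => //.
    by rewrite ltW//; apply/(cubeE _ _ (side0 m)); exact: (cellmate_near (side0 m) yx').
  have r0 : 0 < 16 * side k by rewrite mulr_gt0.
  apply: le_trans (small _ r0) _; rewrite lee_fin /B -mulrA; apply: ler_wpM2l; first exact: ltW.
  by rewrite -exprMn mulrA -natrM.
have : A ^+ 2 < 2 * sqsum psi g y + 2 * (B ^+ 2 * 86).
  apply: lt_le_trans big _; apply: (@le_trans _ _ (\sum_(k < M | (m < k.+4 <= i)%N)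
     (2 * conv (psi k) g y ^+ 2 + 2 * (B * (side m / side k)) ^+ 2))).
    by apply: ler_sum => k; exact: near_y.
  rewrite big_split/= -!mulr_sumr; apply: lerD; rewrite ler_pM2l//; last exact: geo_quarter.
  rewrite /sqsum big_mkcond; apply: ler_sum => k _.
  by case: ifP => // _; exact: sqr_ge0.
have : (20 * B) ^+ 2 <= A ^+ 2.
  rewrite lerXn2r ?nnegrE ?mulr_ge0 ?(ltW a0) ?(ltW e0)//.
  apply: (@le_trans _ _ (80 * 256 ^+ n * 6 ^+ n * e)); last by rewrite ler_pM2r.
  rewrite /B /b; move: (256 ^+ n : R) (6 ^+ n : R) => t u.
  by rewrite le_eqVlt; apply/orP; left; apply/eqP; ring.
by rewrite expr_div_n !expr2; have := sqr_ge0 B; rewrite expr2; lra.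
Qed.

(** Bad points lie in the exceptional set of the maximal function or in a weak type level set of the
    square sum of [g], each of measure at most a quarter of the cell. A cell of mean zero contains
    no bad point. *)
Lemma bad_small :
  (2%:E * mu [set y | mate i (x, y) /\ exists2 m, (m < i)%N & bad i m y] <= (side i ^+ n)%:E)%E.
Proof.
set B := [set y | _].
have mB : measurable B.
  apply: (@saturated_measurable v (s * 2 ^+ 0)) => y z yz [xy [m mi bm]]; split.
    exact: cellmate_trans xy (matele _ yz).
  by exists m => //; apply: bad_cellmate bm; rewrite ?(ltnW mi)//; exact: matele yz.
have := cmean_ge0 i x; rewrite le_eqVlt => /predU1P[e0|e0].
  rewrite (_ : B = set0) ?measure0 ?mule0 ?lee_fin ?exprn_ge0//.
  apply/seteqP; split => // y [xy [m mi [x' yx' bd]]]; move: bd.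
  have z l z' : (l <= i)%N -> mate m (y, z') -> cmean l z' = 0.
    move=> li yz; apply/eqP; rewrite eq_le cmean_ge0 andbT.
    have := cmean_le z' li; rewrite -(cmean_cellmate (cellmate_trans xy (matele (ltnW mi) yz))) -e0 mulr0.
    by rewrite pmulr_rle0// exprn_gt0.
  rewrite -(cmean_cellmate xy) -e0 mulr0 expr0n/= => -[|].
    by rewrite (z _ _ (ltnW mi) yx') ltxx.
  rewrite big1 ?ltxx// => k /andP[_ ki]; apply/eqP; rewrite sqrf_eq0 -normr_le0.
  by apply: le_trans (tau_le k x') _; rewrite (z _ _ ki yx') mulr0.
have b0 : 0 < b by rewrite !mulr_gt0// exprn_gt0.
have [|W [mW Wle Wsmall]] := maximal_weak n0 b0 mag ag0.
  by rewrite ag_int ltry.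
have h0 : 0 < cst_a * e / 2 by rewrite !mulr_gt0.
have weak := sqsum_weak n0 s0 LP gi h0.
set Z := [set y | _ < _] in weak.
have mZ : measurable Z by apply: measurable_ltset; apply: measurable_sqsum LP _ Lg.1.
have sub : B `<=` W `|` Z.
  move=> y [xy [m mi bm]]; have [Wy|nWy] := pselect (W y); [by left|right].
  exact: bad_sub e0 xy mi bm nWy (Wsmall _ nWy).
have mle : (mu B <= mu W + mu Z)%E.
  apply: le_trans (@measureU2 _ _ _ mu W Z mW mZ); apply: le_measure => //; rewrite inE//.
  exact: measurableU.
have q0 : 0 < side i ^+ n by rewrite exprn_gt0.
have W4 : (mu W <= (side i ^+ n / 4)%:E)%E.
  rewrite -(@lee_pmul2l _ b%:E) ?lte_fin//; apply: le_trans Wle _.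
  by rewrite ag_int -!EFinM lee_fin /b le_eqVlt; apply/orP; left; apply/eqP; field.
have Z4 : (mu Z <= (side i ^+ n / 4)%:E)%E.
  rewrite -(@lee_pmul2l _ (cst_a * e / 2)%:E) ?lte_fin//; apply: le_trans weak _.
  rewrite ag_int -!EFinM lee_fin.
  have a8 : 8 * @weak_cst R n <= cst_a by rewrite lerDr !mulr_ge0// exprn_ge0.
  have := ler_wpM2r (ltW (mulr_gt0 q0 e0)) a8; rewrite -/e.
  move: (cst_a) (@weak_cst R n) (side i ^+ n) e => a u q e' H.
  by rewrite (_ : a * e' / 2 * (q / 4) = a * (q * e') / 8); [lra|field].
apply: (@le_trans _ _ (2%:E * (mu W + mu Z))%E); first by apply: lee_wpmul2l.
apply: (@le_trans _ _ (2%:E * ((side i ^+ n / 4)%:E + (side i ^+ n / 4)%:E))%E).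
  by apply: lee_wpmul2l => //; exact: leeD.
by rewrite -EFinD -EFinM lee_fin; lra.
Qed.

End one_cell.
End sparse_domination.

(** * Selection of the sparse family *)

Section selection.
Context {R : realType} {n : nat}.
Local Notation V := 'rV[R]_n.
Local Notation mu := (rV_lebesgue n).
Implicit Types (x y z : V) (l i m : nat).
Variables (n0 : (0 < n)%N) (M : nat) (s : R) (psi : 'I_M -> V -> R).
Hypothesis s0 : 0 < s.
Hypothesis LP : forall i : 'I_M, LPker (s * 2 ^+ i) (psi i).
Variables (v : V) (f : V -> R).
Hypothesis Lf : locint f.
Local Notation mate l := (cellmate v (s * 2 ^+ l)).
Local Notation cmean := (cmean s v f).
Local Notation tau := (tau s psi v f).
Local Notation bad := (bad s psi v f).
Local Notation L := M.+3.

Let side0 l : 0 < s * 2 ^+ l. Proof. by rewrite mulr_gt0// exprn_gt0. Qed.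

Lemma mate_le l k x y : (l <= k)%N -> mate l (x, y) -> mate k (x, y).
Proof.
move=> lk xy; have := cellmate_pow (k - l) (side0 l) xy.
by rewrite -mulrA -exprD subnKC.
Qed.

(** Stopping recursion from the top level [M + 3], the highest level [k + 4] attached to a scale
    [k < M]: going down, the selected level is kept until a cell is bad relative to it. *)
Fixpoint lev_at d x : nat :=
  if d is d'.+1 then
    if `[< bad (lev_at d' x) (L - d) x >] then (L - d)%N else lev_at d' x
  else L.

(* Level of the smallest selected cell containing [x] among the levels [>= l]. *)
Definition lev l x := lev_at (L - l) x.
Definition sel l x : bool := lev l x == l.

Lemma levL x : lev L x = L.
Proof. by rewrite /lev subnn. Qed.

Lemma levE l x : (l < L)%N -> lev l x = if `[< bad (lev l.+1 x) l x >] then l else lev l.+1 x.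
Proof.
move=> lL; rewrite /lev; have e : (L - l)%N = (L - l.+1).+1 by rewrite subnSK.
by rewrite e/= -e subKn// ltnW.
Qed.

Lemma lev_ind (P : nat -> Prop) : P L -> (forall l, (l < L)%N -> P l.+1 -> P l) ->
  forall l, (l <= L)%N -> P l.
Proof.
move=> PL PS l lL; rewrite -(subKn lL); elim: (L - l)%N (leq_subr l L) => [|d ih] dL.
  by rewrite subn0.
apply: PS; first by rewrite ltn_subrL.
by rewrite subnSK//; apply: ih; exact: ltnW.
Qed.

Lemma lev_bounds l x : (l <= L)%N -> (l <= lev l x <= L)%N.
Proof.
move: l; apply: lev_ind => [|l lL ih]; first by rewrite levL leqnn.
rewrite levE//; case: asboolP => _; first by rewrite leqnn ltnW.
by case/andP : ih => /ltnW -> ->.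
Qed.

Lemma lev_cellmate l x y : (l <= L)%N -> mate l (x, y) -> lev l x = lev l y.
Proof.
move=> lL; move: l lL x y; apply: lev_ind => [x y _|l lL ih x y xy]; first by rewrite !levL.
have e := ih _ _ (mate_le (leqnSn l) xy); rewrite (levE x lL) (levE y lL) e.
have /andP[il _] := lev_bounds y lL.
suff -> : `[< bad (lev l.+1 y) l x >] = `[< bad (lev l.+1 y) l y >] by [].
by apply: asbool_equiv_eq; split; apply: bad_cellmate; rewrite ?(ltnW il)//; exact: cellmate_sym.
Qed.

Lemma sel_cellmate l x y : (l <= L)%N -> mate l (x, y) -> sel l x = sel l y.
Proof. by move=> lL xy; rewrite /sel (lev_cellmate lL xy). Qed.

Lemma lev_const l m x : (l <= m)%N -> (m <= lev l x)%N -> (l <= L)%N -> lev m x = lev l x.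
Proof.
move=> lm mi lL; elim: m lm mi => [|m ih]; first by rewrite leqn0 => /eqP ->.
rewrite leq_eqVlt => /predU1P[<-//|lm] mi.
have e := ih lm (ltnW mi); have /andP[_ iL] := lev_bounds x lL.
have mL : (m < L)%N by exact: leq_trans iL.
move: e; rewrite levE//; case: asboolP => // _ e.
by move: mi; rewrite -e ltnn.
Qed.

Lemma lev_notbad l m x : (l <= m)%N -> (m < lev l x)%N -> (l <= L)%N -> ~ bad (lev l x) m x.
Proof.
move=> lm mi lL; have /andP[_ iL] := lev_bounds x lL.
have mL : (m < L)%N by exact: leq_trans iL.
have := lev_const lm (ltnW mi) lL; rewrite levE// (lev_const _ mi)//; last exact: leqW.
by case: asboolP => // _ e; move: mi; rewrite -e ltnn.
Qed.

Lemma sel_lev l x : (l <= L)%N -> sel (lev l x) x.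
Proof.
move=> lL; have /andP[li _] := lev_bounds x lL.
by rewrite /sel (lev_const li).
Qed.

(** If no level below [i] were bad relative to [i], the recursion would never leave [i]. *)
Lemma sel_bad l i x : (l < i)%N -> (i <= L)%N -> sel l x -> sel i x ->
  exists2 m, (m < i)%N & bad i m x.
Proof.
move=> li iL /eqP sl /eqP si; apply: contrapT => no.
suff : forall d, (d <= i)%N -> lev (i - d) x = i.
  move=> /(_ (i - l)%N (leq_subr _ _)); rewrite subKn ?(ltnW li)// sl => e.
  by move: li; rewrite e ltnn.
elim=> [|d ih] di; first by rewrite subn0.
have dl : (i - d.+1 < L)%N by apply: leq_trans iL; rewrite ltn_subrL (leq_trans _ di).
rewrite levE// subnSK// ih ?(ltnW di)//; case: asboolP => // bd.
by case: no; exists (i - d.+1)%N => //; rewrite ltn_subrL (leq_trans _ di).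
Qed.

Lemma sel_sparse i x : (i <= L)%N -> sel i x ->
  (2%:E * mu [set y | mate i (x, y) /\ exists2 l, (l < i)%N & sel l y] <= ((s * 2 ^+ i) ^+ n)%:E)%E.
Proof.
move=> iL si; apply: le_trans (bad_small n0 s0 LP v Lf i x).
apply: lee_wpmul2l => //; apply: le_measure; rewrite ?inE.
- apply: (@saturated_measurable _ _ v (s * 2 ^+ 0)) => y z yz [xy [l li sl]]; split.
    exact: cellmate_trans xy (mate_le _ yz).
  by exists l => //; rewrite -(sel_cellmate _ (mate_le _ yz))// (leq_trans (ltnW li)).
- apply: (@saturated_measurable _ _ v (s * 2 ^+ 0)) => y z yz [xy [m mi bm]]; split.
    exact: cellmate_trans xy (mate_le _ yz).
  by exists m => //; apply: bad_cellmate bm => //; [exact: ltnW|exact: mate_le yz].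
move=> y [xy [l li sl]]; split => //.
by apply: (sel_bad li iL sl); rewrite -(sel_cellmate iL xy).
Qed.

Definition cst_d : R := @cst_a R n ^+ 2 + (16 ^+ n * @cst_a R n) ^+ 2.

(** Scales are grouped by the selected level [i] reached from [k + 4]. The smallest [k] of a group
    is bounded by the mean over its cell; either [k + 4 = i], or level [k + 4] is not bad relative
    to [i], and then both that mean and the square sum of the other scales are controlled by
    [cst_a * cmean i x]. *)
Lemma sel_dom x : \sum_(k < M) tau k x ^+ 2 <= cst_d * \sum_(i < L.+1) (sel i x)%:R * cmean i x ^+ 2.
Proof.
have kL (k : 'I_M) : (k.+4 <= L)%N by exact: ltn_ord k.
have a1 : 1 <= @cst_a R n by exact: cst_a_ge1.
have a0 : 0 < @cst_a R n := lt_le_trans ltr01 a1.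
have d0 : 0 <= cst_d by rewrite addr_ge0 ?sqr_ge0.
rewrite (partition_big (fun k : 'I_M => inord (lev k.+4 x) : 'I_L.+1) predT)//= mulr_sumr.
apply: ler_sum => i _.
have iE (k : 'I_M) : ((inord (lev k.+4 x) : 'I_L.+1) == i) = (lev k.+4 x == i).
  by rewrite -val_eqE/= inordK// ltnS; case/andP : (lev_bounds x (kL k)).
rewrite (eq_bigl _ _ iE).
have [/existsP[k0 e0]|no] := boolP [exists k : 'I_M, lev k.+4 x == i]; last first.
  rewrite big1; last by move=> k e; move: no; rewrite negb_exists => /forallP/(_ k); rewrite e.
  exact: mulr_ge0 d0 (mulr_ge0 (ler0n _ _) (sqr_ge0 _)).
case: (@arg_minnP _ k0 (fun k : 'I_M => lev k.+4 x == i) (fun k : 'I_M => k : nat) e0) => k /eqP ek kmin.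
have si : sel i x by rewrite -ek sel_lev.
rewrite si mul1r (bigD1 k)/= ?ek// [cst_d * _]mulrDl [leRHS]addrC.
have ki : (k.+4 <= i)%N by rewrite -ek; case/andP : (lev_bounds x (kL k)).
have c0 := cmean_ge0 s0 v f.
apply: lerD.
  rewrite -real_normK ?num_real// -exprMn lerXn2r ?nnegrE//.
    by rewrite mulr_ge0// mulr_ge0 ?exprn_ge0// ltW.
  apply: le_trans (tau_le s0 LP v Lf k x) _; rewrite -mulrA ler_wpM2l ?exprn_ge0//.
  move: ki; rewrite leq_eqVlt => /predU1P[->|ki]; first by rewrite ler_peMl.
  rewrite leNgt; apply/negP => big.
  apply: (@lev_notbad k.+4 k.+4 x (leqnn _) _ (kL k)); rewrite ek//.
  by exists x => //; left.
rewrite -exprMn.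
have [e|ki'] := eqVneq (k.+4) i.
  rewrite big1 ?sqr_ge0// => j /andP[/eqP ej jk].
  have ji : (j.+4 <= i)%N by rewrite -ej; case/andP : (lev_bounds x (kL j)).
  move/eqP : jk; case; apply: val_inj; apply/eqP; rewrite eqn_leq kmin ?ej// andbT.
  by move: ji; rewrite -e.
have {}ki : (k.+4 < i)%N by rewrite ltn_neqAle ki'.
apply: (@le_trans _ _ (\sum_(j < M | (k.+4 < j.+4 <= i)%N) tau j x ^+ 2)).
  rewrite big_mkcond [leRHS]big_mkcond/=; apply: ler_sum => j _.
  case: ifP => [/andP[/eqP ej jk]|_]; last by case: ifP => // _; exact: sqr_ge0.
  have ji : (j.+4 <= i)%N by rewrite -ej; case/andP : (lev_bounds x (kL j)).
  rewrite ji andbT; case: ifP => // /negbT; rewrite -leqNgt !ltnS => jk'.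
  by move/eqP : jk; case; apply: val_inj; apply/eqP; rewrite eqn_leq jk' kmin ?ej.
rewrite leNgt; apply/negP => big.
apply: (@lev_notbad k.+4 k.+4 x (leqnn _) _ (kL k)); rewrite ek//.
by exists x => //; right.
Qed.

End selection.

(** * Shifted dyadic grids *)

Section shifted_grids.
Context {R : realType} {n : nat}.
Local Notation V := 'rV[R]_n.
Implicit Types (x y z : V) (l i m k : nat).

Lemma pow2_mod3 j : exists (a : nat) (r : R), (2 : R) ^+ j = 3 * a%:R + r /\ (r = 1 \/ r = 2).
Proof.
elim: j => [|j [a [r [e r12]]]].
  by exists 0%N, 1; rewrite expr0 mulr0 add0r; split; [|left].
case: r12 => rE; rewrite rE in e.
  by exists (2 * a)%N, 2; split; [rewrite exprS e natrM; ring|right].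
by exists (2 * a + 1)%N, 1; split; [rewrite exprS e natrD natrM; ring|left].
Qed.

(* The one-third trick: [2 ^ j] is not divisible by 3. *)
Lemma third_shift (t L : R) j : 0 < L -> exists b : bool, exists m : int,
  m%:~R * L + L / 8 <= t - (if b then L * 2 ^+ j / 3 else 0) <= m%:~R * L + 7 * L / 8.
Proof.
move=> L0; pose m := Num.floor (t / L); pose u := t - m%:~R * L.
have u0 : 0 <= u by rewrite subr_ge0 -ler_pdivlMr// floor_le ?num_real.
have uL : u < L.
  by have := floorD1_gt (t / L); rewrite -/m ltr_pdivrMr// rmorphD rmorph1 mulrDl mul1r /u; lra.
have tE : t = m%:~R * L + u by rewrite /u; lra.
have [/andP[h1 h2]|out] := boolP (L / 8 <= u <= 7 * L / 8).
  by exists false, m; rewrite subr0 tE; lra.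
have [a [r [e r12]]] := pow2_mod3 j.
pose M (d : int) := m - a%:Z - d.
have ME d : (M d)%:~R * L = m%:~R * L - a%:R * L - d%:~R * L.
  by rewrite /M !rmorphB/= !mulrBl.
have vE : L * 2 ^+ j / 3 = a%:R * L + r * L / 3 by rewrite e; field.
exists true; have [h|h] := ltP u (L / 8).
  by exists (M 1); rewrite ME vE tE; case: r12 => ->; rewrite mul1r; lra.
have h' : 7 * L / 8 < u by move: out; rewrite h/= -ltNge.
by exists (M 0); rewrite ME vE tE; case: r12 => ->; rewrite mul0r; lra.
Qed.

Variables (M : nat) (s : R).
Hypothesis s0 : 0 < s.

(** Each coordinate is shifted by nothing or by a third of a side above all levels in use; modulo
    the side of any such level, the shift is a third or two thirds of a cell. *)
Definition grid (c : {ffun 'I_n -> bool}) : V :=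
  \row_i (if c i then s * 2 ^+ M.+4 / 3 else 0).

Lemma nearby_grid k x : (k <= M)%N -> exists c, nearby s (grid c) k x.
Proof.
move=> kM; pose L := s * 2 ^+ k.+4.
have L0 : 0 < L by rewrite mulr_gt0// exprn_gt0.
have shiftE : s * 2 ^+ M.+4 = L * 2 ^+ (M - k).
  by rewrite /L -mulrA -exprD !addSn subnKC.
have H (i : 'I_n) := third_shift (x ord0 i) (M - k) L0.
have [b Hb] := choice H; exists [ffun i => b i] => y xy.
have fl (t : R) (m : int) : m%:~R * L <= t < m%:~R * L + L -> Num.floor (t / L) = m.
  move=> h; apply/eqP; rewrite floor_eq rmorphD rmorph1 ler_pdivlMr// ltr_pdivrMr//.
  by rewrite mulrDl mul1r.
apply/rowP => i; rewrite !mxE ffunE shiftE -/L; have [m Hm] := Hb i.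
(* The reach of the kernel is exactly the margin [1 / 8] left by the shift. *)
have L8 : 2 * (s * 2 ^+ k) = L / 8.
  by rewrite /L !exprS; field.
have := xy i; rewrite L8 ltr_distl => yi.
by rewrite (fl _ m) ?(fl _ m)//; move: Hm yi; set w := if _ then _ else _; lra.
Qed.

Variable psi : 'I_M -> V -> R.
Hypothesis n0 : (0 < n)%N.
Hypothesis LP : forall i : 'I_M, LPker (s * 2 ^+ i) (psi i).
Variable f : V -> R.
Hypothesis Lf : locint f.

Definition sparse_form c x : R :=
  \sum_(i < M.+4) (sel s psi (grid c) f i x)%:R * cmean s (grid c) f i x.

Lemma sparse_form_ge0 c x : 0 <= sparse_form c x.
Proof. by apply: sumr_ge0 => i _; rewrite mulr_ge0// cmean_ge0. Qed.

(** Every scale is near in some grid. A sum of squares of non-negative terms is at most the square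
    of their sum, which leads to linear sparse sums. *)
Lemma sqsum_sparse x : sqsum psi f x <=
  @cst_d R n * \sum_(c : {ffun 'I_n -> bool}) sparse_form c x ^+ 2.
Proof.
have d0 : 0 <= @cst_d R n by rewrite addr_ge0 ?sqr_ge0.
apply: (@le_trans _ _ (\sum_(c : {ffun 'I_n -> bool}) \sum_(k < M) tau s psi (grid c) f k x ^+ 2)).
  rewrite exchange_big/=; apply: ler_sum => k _.
  have [c nc] := nearby_grid x (ltnW (ltn_ord k)).
  rewrite (bigD1 c)//= {1}/tau asboolT// lerDl; apply: sumr_ge0 => i _; exact: sqr_ge0.
rewrite mulr_sumr; apply: ler_sum => c _.
apply: le_trans (sel_dom s0 LP (grid c) Lf x) _; rewrite ler_wpM2l//.
have F0 i : 0 <= (sel s psi (grid c) f i x)%:R * cmean s (grid c) f i x.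
  by rewrite mulr_ge0// cmean_ge0.
rewrite expr2 /sparse_form mulr_suml; apply: ler_sum => i _.
have -> : (sel s psi (grid c) f i x)%:R * cmean s (grid c) f i x ^+ 2 =
  ((sel s psi (grid c) f i x)%:R * cmean s (grid c) f i x) * ((sel s psi (grid c) f i x)%:R * cmean s (grid c) f i x).
  by case: (sel _ _ _ _ _ _); rewrite ?mul1r ?mul0r.
by apply: ler_wpM2l => //; rewrite (bigD1 i)//= lerDl; exact: sumr_ge0.
Qed.

(** [2 ^ (2 ^ n)] is a crude bound for the number [2 ^ n] of grids. *)
Definition cst_grids (p : R) : R := (@cst_d R n * 2 ^+ (2 ^ n)) `^ (p / 2).

Lemma sqsum_sparse_powR (p : R) x : 0 < p -> sqsum psi f x `^ (p / 2) <=
  cst_grids p * \sum_(c : {ffun 'I_n -> bool}) sparse_form c x `^ p.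
Proof.
move=> p0; have d0 : 0 <= @cst_d R n by rewrite addr_ge0 ?sqr_ge0.
set W := \sum_c _; have W0 : 0 <= W by apply: sumr_ge0 => c _; exact: powR_ge0.
pose m := W `^ p^-1.
have um c : sparse_form c x <= m.
  rewrite -[leLHS]powRr1 ?sparse_form_ge0// -(mulfV (x := p)) ?gt_eqF// powRrM; apply: powR_le.
  - by rewrite invr_ge0 ltW.
  - exact: powR_ge0.
  by rewrite /W (bigD1 c)//= lerDl; apply: sumr_ge0 => i _; exact: powR_ge0.
have h : sqsum psi f x <= @cst_d R n * 2 ^+ (2 ^ n) * m ^+ 2.
  apply: le_trans (sqsum_sparse x) _; rewrite -mulrA ler_wpM2l//.
  apply: (@le_trans _ _ (\sum_(c : {ffun 'I_n -> bool}) m ^+ 2)).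
    by apply: ler_sum => c _; rewrite lerXn2r ?nnegrE ?sparse_form_ge0 ?powR_ge0.
  rewrite sumr_const card_ffun card_bool card_ord -[leLHS]mulr_natl ler_wpM2r ?sqr_ge0//.
  by rewrite -natrX ler_nat ltnW// ltn_expl.
apply: le_trans (powR_le _ (sqsum_ge0 _ _ _) h) _; first by rewrite divr_ge0// ltW.
rewrite powRM ?sqr_ge0//; last by rewrite mulr_ge0// exprn_ge0.
rewrite -(@powR_mulrn R m 2) ?powR_ge0// -!powRrM /cst_grids.
rewrite (_ : p^-1 * (2%:R * (p / 2)) = 1) ?powRr1//.
by field; rewrite gt_eqF.
Qed.

End shifted_grids.

(** * Transfer to the finite tree *)

Section transfer.
Context {R : realType} {n : nat}.
Local Notation V := 'rV[R]_n.
Local Notation mu := (rV_lebesgue n).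
Implicit Types (x y z : V).
Variables (L : nat) (s : R).
Hypothesis s0 : 0 < s.
Variables (v x0 : V).
Local Notation mate l := (cellmate v (s * 2 ^+ l)).
Local Notation cmean h l x := (cmean s v h l x).
Local Notation T := {ffun 'I_n -> 'I_(2 ^ L)}.

Let side0 l : 0 < s * 2 ^+ l. Proof. by rewrite mulr_gt0// exprn_gt0. Qed.

(** Lower corner of a cell of side [s] in the top cell of [x0], indexed by its integer offset in
    each coordinate; these corners are the points of the finite tree. *)
Definition atom (a : T) : V :=
  \row_i (v ord0 i + ((cell v (s * 2 ^+ L) x0 ord0 i)%:~R * (s * 2 ^+ L) + (a i)%:R * s)).

Definition atom_blk l (a : T) : 'rV[int]_n := cell v (s * 2 ^+ l) (atom a).

Lemma atom_blk_nested l a b : atom_blk l a = atom_blk l b -> atom_blk l.+1 a = atom_blk l.+1 b.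
Proof. exact: (mate_le s0 (leqnSn l)). Qed.

Let pw : ((2 ^ L)%N%:Z)%:~R = 2 ^+ L :> R. Proof. by rewrite -natrX. Qed.

Let atomE a i : atom a ord0 i - v ord0 i =
  (cell v (s * 2 ^+ L) x0 ord0 i)%:~R * (s * 2 ^+ L) + (a i)%:R * s.
Proof. by rewrite mxE addrC addKr. Qed.

Lemma mate_atom a : mate L (x0, atom a).
Proof.
apply/esym/cell_itv => // i; set c := cell v _ x0 ord0 i; rewrite mxE -/c.
have : 0 <= (a i)%:R * s < 2 ^+ L * s.
  by rewrite mulr_ge0 ?(ltW s0)//= ltr_pM2r// -natrX ltr_nat ltn_ord.
by rewrite (mulrC (2 ^+ L)); lra.
Qed.

Lemma mate0_atomP a y : mate 0 (atom a, y) <-> forall i,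
  (cell v (s * 2 ^+ L) x0 ord0 i)%:~R * (s * 2 ^+ L) + (a i)%:R * s <= y ord0 i - v ord0 i <
  (cell v (s * 2 ^+ L) x0 ord0 i)%:~R * (s * 2 ^+ L) + (a i)%:R * s + s.
Proof.
have cE i : cell v (s * 2 ^+ 0) (atom a) ord0 i = cell v (s * 2 ^+ L) x0 ord0 i * (2 ^ L)%N%:Z + (a i)%:Z.
  rewrite mxE atomE -[RHS](@intrKfloor R); congr Num.floor.
  by rewrite rmorphD rmorphM/= pw expr0 mulr1; field; rewrite gt_eqF.
have H i : (cell v (s * 2 ^+ 0) (atom a) ord0 i)%:~R * (s * 2 ^+ 0) =
    (cell v (s * 2 ^+ L) x0 ord0 i)%:~R * (s * 2 ^+ L) + (a i)%:R * s.
  by rewrite cE rmorphD rmorphM/= pw expr0 mulr1; ring.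
split => [/esym/(cell_itv _ _ _ (side0 0)) h i|h].
  by have := h i; rewrite H expr0 mulr1.
by apply/esym/(cell_itv _ _ _ (side0 0)) => i; rewrite H expr0 mulr1.
Qed.

Lemma atom_inj a b : mate 0 (atom a, atom b) -> a = b.
Proof.
move=> /mate0_atomP H; apply/ffunP => i; apply: val_inj => /=.
have := H i; rewrite atomE.
set c := _%:~R * _ => /andP[h1 h2].
have : ((a i)%:R : R) <= (b i)%:R by rewrite -(ler_pM2r s0); lra.
have : ((b i)%:R : R) < (a i).+1%:R by rewrite -(ltr_pM2r s0) -natr1 mulrDl mul1r; lra.
by rewrite ltr_nat ler_nat ltnS => ba ab; apply/eqP; rewrite eqn_leq ab.
Qed.

Lemma atom_exists y : mate L (x0, y) -> exists a, mate 0 (atom a, y).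
Proof.
move=> xy; have := xy; rewrite /cellmate/= => xyE.
have D i := cell_bounds v y i (side0 L).
have D0 i := cell_bounds v y i s0.
have lo i : cell v (s * 2 ^+ L) y ord0 i * (2 ^ L)%N%:Z <= cell v s y ord0 i.
  rewrite -ltzD1 -(ltr_int R) -(ltr_pM2r s0) rmorphD rmorphM/= rmorph1 mulrDl mul1r.
  have /andP[d1 d2] := D i; have /andP[d3 d4] := D0 i; apply: le_lt_trans d4.
  by apply: le_trans d1; rewrite -mulrA pw (mulrC _ s).
have hi i : cell v s y ord0 i < cell v (s * 2 ^+ L) y ord0 i * (2 ^ L)%N%:Z + (2 ^ L)%N%:Z.
  rewrite -(ltr_int R) -(ltr_pM2r s0) rmorphD rmorphM/= mulrDl.
  have /andP[d1 d2] := D i; have /andP[d3 d4] := D0 i; apply: le_lt_trans d3 _.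
  by apply: lt_le_trans d2 _; rewrite pw -mulrA (mulrC _ s).
pose m i := absz (cell v s y ord0 i - cell v (s * 2 ^+ L) y ord0 i * (2 ^ L)%N%:Z)%R.
have mE i : (m i)%:Z = cell v s y ord0 i - cell v (s * 2 ^+ L) y ord0 i * (2 ^ L)%N%:Z.
  by rewrite gez0_abs// subr_ge0.
have mlt i : (m i < 2 ^ L)%N by rewrite -ltz_nat mE ltrBlDr addrC.
exists [ffun i => Ordinal (mlt i)]; apply/mate0_atomP => i; rewrite ffunE/=.
have -> : (m i)%:R = ((m i)%:Z)%:~R :> R by [].
by have := D0 i; rewrite xyE mE rmorphB rmorphM/= pw; lra.
Qed.

(** The indicator of a cell is the sum of the indicators of its atoms. *)
Lemma relint_atoms l y (h : V -> \bar R) : (l <= L)%N -> mate L (x0, y) ->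
  measurable_fun setT h -> (forall x, (0 <= h x)%E) ->
  relint (mate l) h y =
  (\sum_(b : T | atom_blk l b == cell v (s * 2 ^+ l) y) relint (mate 0) h (atom b))%E.
Proof.
move=> lL xy mh h0.
have mI (a : T) : measurable_fun setT (fun z => (\1_(mate 0) (atom a, z) : R)%:E).
  rewrite (_ : (fun z => _) = (fun z => (\1_[set z | mate 0 (atom a, z)] z : R)%:E)).
    by apply/measurable_EFinP/measurable_indic; exact: measurable_cell_of.
  by apply/funext => z; congr (_%:E); rewrite !indicE.
rewrite relintE.
rewrite [RHS](eq_bigr (fun b => \int[mu]_z ((\1_(mate 0) (atom b, z))%:E * h z))%E); last first.
  by move=> b _; rewrite relintE.
rewrite -[RHS]big_filter -ge0_integral_sum//; last 2 first.
- by move=> b; apply: emeasurable_funM.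
- by move=> b z _; rewrite mule_ge0// lee_fin.
apply: eq_integral => z _; rewrite big_filter.
rewrite -ge0_sume_distrl; last by move=> b _; rewrite lee_fin.
congr (_ * _)%E; rewrite sumEFin; congr (_%:E).
have [yz|yz] := pselect (mate l (y, z)).
  rewrite indicE mem_set//.
  have [a az] := atom_exists (cellmate_trans xy (mate_le s0 lL yz)).
  rewrite (bigD1 a)/=; last first.
    apply/eqP; rewrite /atom_blk.
    by have := cellmate_trans (mate_le s0 (leq0n l) az) (cellmate_sym yz).
  rewrite indicE mem_set// big1 ?addr0// => b /andP[_ ba].
  rewrite indicE memNset// => bz; move/eqP : ba; apply; apply: atom_inj.
  exact: cellmate_trans bz (cellmate_sym az).
rewrite indicE memNset// big1// => b /eqP by_; rewrite indicE memNset// => bz; apply: yz.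
by apply: cellmate_trans (mate_le s0 (leq0n l) bz); exact/esym.
Qed.

Variables (h F : V -> R).
Hypotheses (Lh : locint h) (F0 : forall x, 0 <= F x).
Hypothesis cF : forall x y, mate 0 (x, y) -> F x = F y.

Lemma mate0_measurable : measurable_fun setT F.
Proof.
move=> _ Y mY; rewrite setTI; apply: (@saturated_measurable _ _ v (s * 2 ^+ 0)) => x y xy.
by rewrite /preimage/= (cF xy).
Qed.

Lemma relint_cell_const l y : (l <= L)%N -> mate L (x0, y) ->
  relint (mate l) (fun z => (F z * `|h z|)%:E) y =
  (s ^+ n * \sum_(b : T | atom_blk l b == cell v (s * 2 ^+ l) y) F (atom b) * cmean h 0 (atom b))%:E.
Proof.
move=> lL xy; rewrite relint_atoms//; last 2 first.
- apply/measurable_EFinP; apply: measurable_funM; first exact: mate0_measurable.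
  by apply/measurable_EFinP; exact: measurable_absE Lh.1.
- by move=> x; rewrite lee_fin mulr_ge0.
rewrite mulr_sumr -sumEFin; apply: eq_bigr => b _.
rewrite mulrCA EFinM -[s in s ^+ n]mulr1 -(expr0 2) -relint_cmean// /relint.
rewrite -ge0_integralZl//; last 3 first.
- exact: measurable_cell_of.
- by apply: measurable_funTS; exact: measurable_absE Lh.1.
- by rewrite lee_fin.
- by apply: eq_integral => z /set_mem bz; rewrite -EFinM (cF bz).
Qed.

End transfer.

(** * The weighted bound on one grid *)

Section grid_weighted.
Context {R : realType} {n : nat}.
Local Notation V := 'rV[R]_n.
Local Notation mu := (rV_lebesgue n).
Implicit Types (x y z : V) (l i : nat).
Variables (L : nat) (s : R) (v : V) (S : nat -> V -> bool) (p : R).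
Hypotheses (s0 : 0 < s) (p1 : 1 < p).
Local Notation mate l := (cellmate v (s * 2 ^+ l)).
Local Notation cm h l x := (cmean s v h l x).

Hypothesis aS : forall l x y, (l <= L)%N -> mate l (x, y) -> S l x = S l y.
Hypothesis spS : forall i x, (i <= L)%N -> S i x ->
  (2%:E * mu [set y | mate i (x, y) /\ exists2 l, (l < i)%N & S l y] <= ((s * 2 ^+ i) ^+ n)%:E)%E.

(** Dyadic maximal function over the levels up to [i], the counterpart on the grid of the maximal
    function in the A_infinity constants. *)
Definition maxlev (h : V -> R) i y : R := \big[Num.max/0]_(l < L.+1 | (l <= i)%N) cm h l y.

Variables (w sg f : V -> R) (D A B : R).
Hypotheses (Lw : locint w) (Lsg : locint sg) (Lf : locint f).
Hypotheses (w0 : forall x, 0 < w x) (sg0 : forall x, 0 < sg x).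
Hypothesis wsg : forall x, w x = sg x `^ (1 - p).
Hypotheses (D0 : 0 < D) (A0 : 0 < A) (B0 : 0 < B).
Hypothesis HD : forall l x, (l <= L)%N -> cm w l x * cm sg l x `^ (p - 1) <= D.
Hypothesis HB : forall i x, (i <= L)%N ->
  (relint (mate i) (fun y => (maxlev sg i y)%:E) x <= B%:E * relint (mate i) (fun y => `|sg y|%:E) x)%E.
Hypothesis HA : forall i x, (i <= L)%N ->
  (relint (mate i) (fun y => (maxlev w i y)%:E) x <= A%:E * relint (mate i) (fun y => `|w y|%:E) x)%E.

Let side0 l : 0 < s * 2 ^+ l. Proof. by rewrite mulr_gt0// exprn_gt0. Qed.
Let p0 : 0 < p. Proof. exact: lt_trans p1. Qed.

(** Young's inequality with [t] frozen: for [q] the dual weight, [q^(1-p)] is the weight, and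
    integration over a cell with the best [t] is Hoelder's inequality. *)
Lemma young_tangent (t u q : R) : 0 <= t -> 0 <= u -> 0 < q ->
  p * t `^ (p - 1) * u <= u `^ p * q `^ (1 - p) + (p - 1) * t `^ p * q.
Proof.
move=> t0 u0 q0; have pm : 0 < p - 1 by rewrite subr_gt0.
have := @conjugate_powR R (u / q) (t `^ (p - 1)) p (p / (p - 1)).
rewrite divr_ge0 ?(ltW q0)// powR_ge0 divr_gt0// => /(_ isT isT p0 isT).
rewrite invf_div -powRrM (_ : (p - 1) * (p / (p - 1)) = p); last by field; rewrite gt_eqF.
have e1 : p^-1 + (p - 1) / p = 1 by field; rewrite gt_eqF.
move=> /(_ e1); have -> : u `^ p * q `^ (1 - p) = (u / q) `^ p * q.
  rewrite powRM ?invr_ge0 ?(ltW q0)// -mulrA; congr (_ * _).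
  rewrite -powRV ?(ltW q0)// -powRN -[X in _ = _ * X](powRr1 (ltW q0)) -powRD; first by congr (_ `^ _); ring.
  by rewrite (gt_eqF q0) implybT.
set c := t `^ _; set X := (u / q) `^ p; set Y := t `^ p.
have -> : X / p + Y * ((p - 1) / p) = (X + (p - 1) * Y) / p by field; rewrite gt_eqF.
rewrite ler_pdivlMr// => h.
have : u / q * c * p * q <= (X + (p - 1) * Y) * q by rewrite ler_pM2r.
rewrite (_ : u / q * c * p * q = p * c * u); last by field; rewrite gt_eqF.
by rewrite mulrDl.
Qed.

Let locint1 : locint ((fun=> 1) : V -> R).
Proof.
split=> // c r; apply: (@le_lt_trans _ _ (cubeint `|r| (cst 1%:E) c)); last first.
  by rewrite cubeint_cst// ltry.
rewrite /cubeint; under eq_integral do rewrite normr1.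
apply: ge0_subset_integral => //; try exact: measurable_cube.
by move=> y h i; exact: lt_le_trans (h i) (ler_norm _).
Qed.

Let cmean1 l x : cm (fun=> 1) l x = 1.
Proof.
rewrite /cmean /cavg; under eq_fun do rewrite normr1.
rewrite relint_cellmate_cst// mul1r -EFinM/= mulVf//.
by rewrite expf_neq0// gt_eqF.
Qed.

Section one_top_cell.
Variable x0 : V.
Local Notation T := {ffun 'I_n -> 'I_(2 ^ L)}.
Local Notation atom := (@atom R n L s v x0).
Local Notation blk := (@atom_blk R n L s v x0).
Local Notation csum := (@csum R T _ blk).
Local Notation csize := (@csize R T _ blk).
Local Notation avg := (@avg R T _ blk).

Let d (h : V -> R) (a : T) : R := cm h 0 (atom a).

Let nested l a b : blk l a = blk l b -> blk l.+1 a = blk l.+1 b.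
Proof. exact: atom_blk_nested. Qed.

Let relint_csum (h F : V -> R) l a : locint h -> (forall x, 0 <= F x) ->
  (forall x y, mate 0 (x, y) -> F x = F y) -> (l <= L)%N ->
  relint (mate l) (fun z => (F z * `|h z|)%:E) (atom a) =
  (s ^+ n * csum l (fun b => F (atom b) * d h b) a)%:E.
Proof. by move=> Lh F0 cF lL; rewrite (relint_cell_const s0 Lh F0 cF lL (mate_atom s0 v x0 a)). Qed.

Let relint_csum1 (h : V -> R) l a : locint h -> (l <= L)%N ->
  relint (mate l) (fun z => `|h z|%:E) (atom a) = (s ^+ n * csum l (d h) a)%:E.
Proof.
move=> Lh lL; have := @relint_csum h (fun=> 1) l a Lh (fun _ => ler01) (fun _ _ _ => erefl) lL.
rewrite (_ : (fun z => (1 * _)%:E) = (fun z => `|h z|%:E)); last by apply/funext => z; rewrite mul1r.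
move=> ->; congr (_ * _)%:E; apply: eq_bigr => b _; exact: mul1r.
Qed.

Let csum_cmean (h : V -> R) l a : locint h -> (l <= L)%N ->
  csum l (d h) a = (2 ^+ l) ^+ n * cm h l (atom a).
Proof.
move=> Lh lL; have := relint_csum1 a Lh lL; rewrite relint_cmean// => -[].
rewrite exprMn -mulrA => /mulfI -> //.
by rewrite expf_neq0// gt_eqF.
Qed.

Let csizeE l a : (l <= L)%N -> csize l a = (2 ^+ l) ^+ n.
Proof.
move=> lL; have := csum_cmean a locint1 lL; rewrite cmean1 mulr1 => <-.
by apply: eq_bigr => b _; rewrite /d cmean1.
Qed.

Let avg_cmean (h : V -> R) l a : locint h -> (l <= L)%N -> avg l (d h) a = cm h l (atom a).
Proof.
move=> Lh lL; rewrite /avg csum_cmean// csizeE// mulrAC mulfV ?mul1r//.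
Qed.

Let dpos (h : V -> R) a : locint h -> (forall x, 0 < h x) -> 0 < d h a.
Proof.
move=> Lh h0; have q0 : 0 < (s * 2 ^+ 0) ^+ n by rewrite exprn_gt0.
rewrite -(pmulr_rgt0 _ q0) -lte_fin -(relint_cmean s0 v Lh 0).
have mh : measurable_fun setT (fun y => `|h y|%:E) by exact: measurable_absE Lh.1.
rewrite lt_neqAle integral_ge0 ?andbT//; apply/negP => /eqP e; rewrite /relint in e.
have mC := measurable_cell_of v (s * 2 ^+ 0) (atom a).
have := (ae_eq_integral_abs mu mC (measurable_funTS mh)).1.
rewrite (eq_integral (fun y => `|h y|%:E)) => [|y _]; last by rewrite gee0_abs.
rewrite -e => /(_ erefl) [N [mN N0 sub]].
have : (mu [set y | mate 0 (atom a, y)] <= mu N)%E.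
  apply: le_measure; rewrite ?inE// => y ay; apply: sub => /=.
  by move=> /(_ ay) [] /eqP; rewrite normr_eq0 gt_eqF.
by rewrite N0 rV_lebesgue_cell// lee_fin leNgt q0.
Qed.

Let Sd l a := S l (atom a).

Let bnd (h : V -> R) (C : R) : locint h ->
  (forall i x, (i <= L)%N -> (relint (mate i) (fun y => (maxlev h i y)%:E) x <= C%:E * relint (mate i) (fun y => `|h y|%:E) x)%E) ->
  forall i a, (i < L.+1)%N -> csum i (@maxbelow R T L.+1 i (fun l => avg l (d h))) a <= C * csum i (d h) a.
Proof.
move=> Lh H i a iL; have q0 : 0 < s ^+ n by rewrite exprn_gt0.
rewrite -(ler_pM2l q0) mulrCA -lee_fin [in leRHS]EFinM -relint_csum1//.
apply: le_trans (H i (atom a) iL).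
rewrite (_ : (fun y => (maxlev h i y)%:E) = (fun z => (maxlev h i z * `|(fun=> 1 : R) z|)%:E)); last first.
  by apply/funext => z; rewrite normr1 mulr1.
rewrite relint_csum//; last 2 first.
- by move=> x; exact: bigmax_ge_id.
- by move=> x y xy; apply: eq_bigr => l _; apply: cmean_cellmate; exact: mate_le xy.
rewrite lee_fin ler_pM2l//; apply: csum_le => b _; rewrite /d cmean1 mulr1 /maxlev /maxbelow.
rewrite le_eqVlt; apply/orP; left; apply/eqP; apply: eq_bigr => l _.
by rewrite avg_cmean// -ltnS; exact: ltn_ord.
Qed.

(** The condition [l <= L] is built into the family because [S] is known to be constant on cells
    only up to level [L]. *)
Let sparse_d : @sparse R T _ L.+1 blk (fun l a => Sd l a && (l <= L)%N).
Proof.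
split=> [l a b e|i a iL].
  by case lL: (l <= L)%N; rewrite ?andbF// !andbT /Sd (aS lL e).
rewrite ltnS in iL; rewrite iL andbT => Si; have q0 : 0 < s ^+ n by rewrite exprn_gt0.
pose F y : R := ([exists l : 'I_L.+1, (l < i)%N && S l y])%:R.
have cF x y : mate 0 (x, y) -> F x = F y.
  move=> xy; rewrite /F; congr (nat_of_bool _)%:R; apply: eq_existsb => l.
  by rewrite (aS _ (mate_le s0 (leq0n l) xy))// -ltnS.
have := spS iL Si; set E := [set y | _] => sp.
have mE : measurable E.
  apply: (@saturated_measurable _ _ v (s * 2 ^+ 0)) => y z yz [ay [l li Sl]]; split.
    by apply: cellmate_trans ay (mate_le s0 (leq0n i) yz).
  by exists l => //; rewrite -(aS _ (mate_le s0 (leq0n l) yz))// (leq_trans (ltnW li)).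
have muE : mu E = (s ^+ n * csum i (fun b => F (atom b) * d (fun=> 1) b) a)%:E.
  rewrite -(relint_csum a locint1 _ cF iL) => [|x]; last exact: ler0n.
  have -> : mu E = (\int[mu]_y (\1_E y : R)%:E)%E by rewrite integral_indic// setIT.
  rewrite /relint [RHS]integral_mkcond.
  apply: eq_integral => y _; rewrite /patch indicE normr1 mulr1 /F.
  case: ifPn => [/set_mem ay|/negP ay]; last first.
    by rewrite memNset// => -[/mem_set].
  congr (nat_of_bool _)%:R%:E; apply/idP/idP => [/set_mem[_ [l li Sl]]|/existsP[l /andP[li Sl]]].
    have lL : (l < L.+1)%N by rewrite ltnS (leq_trans (ltnW li)).
    by apply/existsP; exists (Ordinal lL); rewrite li.
  by apply: mem_set; split => //; exists l.
move: sp; rewrite muE -EFinM lee_fin exprMn mulrCA ler_pM2l// csizeE//.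
apply: le_trans; rewrite ler_pM2l//; apply: csum_le => b _; rewrite /d cmean1 mulr1 /F.
rewrite ler_nat; case: existsP => // -[l /andP[li /andP[Sl _]]].
by rewrite (_ : [exists l : 'I_L.+1, _])//; apply/existsP; exists l; rewrite li.
Qed.

(** Hoelder's inequality on a cell of the finest side: the best [t] in [young_tangent] is the ratio
    of the means of [f] and [sg]. *)
Let atom_holder a : s ^+ n * ((d f a / d sg a) `^ p * d sg a) <=
  fine (relint (mate 0) (fun y => (`|f y| `^ p * w y)%:E) (atom a)) \/
  relint (mate 0) (fun y => (`|f y| `^ p * w y)%:E) (atom a) = +oo%E.
Proof.
set I := relint _ _ _.
have [Ioo|Ifin] := eqVneq I +oo%E; [by right|left].
have I0 : (0 <= I)%E by apply: integral_ge0 => y _; rewrite lee_fin mulr_ge0 ?powR_ge0// ltW.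
have IE : I = (fine I)%:E.
  by rewrite fineK// ge0_fin_numE// lt_neqAle Ifin leey.
pose t := d f a / d sg a.
have sgp : 0 < d sg a by exact: dpos.
have t0 : 0 <= t by apply: divr_ge0; [exact: cmean_ge0|exact: ltW].
have mC := measurable_cell_of v (s * 2 ^+ 0) (atom a).
have mf := measurable_absE Lf.1; have msg := measurable_absE Lsg.1.
have c1 : 0 <= p * t `^ (p - 1) by rewrite mulr_ge0 ?powR_ge0// ltW.
have c2 : 0 <= (p - 1) * t `^ p by rewrite mulr_ge0 ?powR_ge0// subr_ge0 ltW.
have mfw : measurable_fun setT (fun y => (`|f y| `^ p * w y)%:E).
  apply/measurable_EFinP; apply: measurable_funM; last exact: Lw.1.
  by apply: (measurableT_comp (measurable_powR p)); apply/measurable_EFinP; exact: mf.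
have : ((p * t `^ (p - 1))%:E * relint (mate 0) (fun y => `|f y|%:E) (atom a) <=
    I + ((p - 1) * t `^ p)%:E * relint (mate 0) (fun y => `|sg y|%:E) (atom a))%E.
  rewrite /I /relint -ge0_integralZl//; last exact: measurable_funTS.
  rewrite -ge0_integralZl//; last exact: measurable_funTS.
  rewrite -ge0_integralD//; last 4 first.
  - by move=> y _; rewrite lee_fin mulr_ge0 ?powR_ge0// ltW.
  - exact: measurable_funTS.
  - by move=> y _; rewrite -EFinM lee_fin mulr_ge0.
  - by apply: measurable_funTS; apply: measurable_funeM.
  apply: ge0_le_integralT => y _; first by rewrite -EFinM lee_fin mulr_ge0.
  rewrite -!EFinM -EFinD lee_fin (gtr0_norm (sg0 y)) wsg.
  exact: young_tangent.
rewrite !relint_cmean// IE -!EFinM -EFinD lee_fin expr0 mulr1 -/(d f a) -/(d sg a).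
have fE : d f a = t * d sg a by rewrite /t divfK// gt_eqF.
rewrite -/t /= fE; clearbody t; set q := s ^+ n; set u := d sg a; move: (fine I) => J.
have [->|tn] := eqVneq t 0.
  rewrite !powR0 ?gt_eqF ?subr_gt0// !(mul0r, mulr0) addr0; exact.
have tp : 0 < t by rewrite lt_neqAle eq_sym tn.
rewrite -(mulr_powRB p tp); set c := t `^ (p - 1); lra.
Qed.

Lemma top_cell_weighted :
  (relint (mate L) (fun y => ((\sum_(i < L.+1) (S i y)%:R * cm f i y) `^ p * `|w y|)%:E) x0 <=
   (cst_W p * (D * (B + A `^ (p - 1))))%:E * relint (mate L) (fun y => (`|f y| `^ p * w y)%:E) x0)%E.
Proof.
pose form y := \sum_(i < L.+1) (S i y)%:R * cm f i y.
have form0 y : 0 <= form y by apply: sumr_ge0 => i _; rewrite mulr_ge0// cmean_ge0.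
have q0 : 0 < s ^+ n by rewrite exprn_gt0.
have refl : mate L (x0, x0) by [].
have all b : (blk L b == cell v (s * 2 ^+ L) x0) = true.
  by apply/eqP/esym; exact: (mate_atom s0 v x0 b).
have cform x y : mate 0 (x, y) -> form x `^ p = form y `^ p.
  move=> xy; congr (_ `^ _); apply: eq_bigr => i _.
  have iL : (i <= L)%N by rewrite -ltnS.
  by rewrite (aS iL (mate_le s0 (leq0n i) xy)) (cmean_cellmate _ (mate_le s0 (leq0n i) xy)).
rewrite (relint_cell_const s0 Lw (fun x => powR_ge0 (form x) p) cform (leqnn L) refl).
have mfw : measurable_fun setT (fun y => (`|f y| `^ p * w y)%:E).
  apply/measurable_EFinP; apply: measurable_funM; last exact: Lw.1.
  apply: (measurableT_comp (measurable_powR p)); apply/measurable_EFinP; exact: measurable_absE Lf.1.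
rewrite [in leRHS](relint_atoms s0 (leqnn L) refl mfw) => [|y]; last first.
  by rewrite lee_fin mulr_ge0 ?powR_ge0// ltW.
rewrite (eq_bigl predT)// [in leRHS](eq_bigl predT)//.
have c0 : 0 < cst_W p * (D * (B + A `^ (p - 1))) by apply: mulr_gt0 (cst_W_gt0 p1) (mulr_gt0 D0 _); rewrite ltr_pwDl ?powR_ge0.
have [noo|/negP oo] := boolP [forall a : T, relint (mate 0) (fun y => (`|f y| `^ p * w y)%:E) (atom a) != +oo%E]; last first.
  have /existsP[a /negPn/eqP ea] : [exists a : T, ~~ (relint (mate 0) (fun y => (`|f y| `^ p * w y)%:E) (atom a) != +oo%E)].
    by rewrite -negb_forall; apply/negP.
  have S0 : (0 <= \sum_(i | i != a) relint (mate 0) (fun y => (`|f y| `^ p * w y)%:E) (atom i))%E.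
    by apply: sume_ge0 => i _; apply: integral_ge0 => y _; rewrite lee_fin mulr_ge0 ?powR_ge0// ltW.
  rewrite [in leRHS](bigD1 a)//= ea addye; last by rewrite (gt_eqF (lt_le_trans (@ltNy0 R) S0)).
  by rewrite gt0_muley ?leey// lte_fin.
have HA' a : ((s ^+ n * ((d f a / d sg a) `^ p * d sg a))%:E <= relint (mate 0) (fun y => (`|f y| `^ p * w y)%:E) (atom a))%E.
  have := forallP noo a; case: (atom_holder a) => [h na|->]; last by rewrite eqxx.
  apply: le_trans (_ : (fine (relint (mate 0) (fun y => (`|f y| `^ p * w y)%:E) (atom a)))%:E <= _)%E; first by rewrite lee_fin.
  rewrite fineK// ge0_fin_numE ?lt_neqAle ?na ?leey//.
  by apply: integral_ge0 => y _; rewrite lee_fin mulr_ge0 ?powR_ge0// ltW.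
apply: (@le_trans _ _ ((cst_W p * (D * (B + A `^ (p - 1))))%:E * \sum_a (s ^+ n * ((d f a / d sg a) `^ p * d sg a))%:E)%E); last first.
  by apply: lee_wpmul2l; [rewrite lee_fin ltW|exact: lee_sum].
rewrite sumEFin -EFinM lee_fin -mulr_sumr mulrCA ler_pM2l//.
have := weighted_sparse_sum nested p1 (w := d w) (s := d sg) (f := d f) _ _ _ D0 A0 B0 sparse_d _ (bnd Lsg HB) (bnd Lw HA).
move=> /(_ _ _ _ _) H.
apply: le_trans (H _ _ _ _).
- apply: ler_sum => a _; rewrite /d -/(d w a) le_eqVlt; apply/orP; left; apply/eqP; congr (_ `^ _ * _).
  apply: eq_bigr => i _; have iL : (i <= L)%N by rewrite -ltnS.
  by rewrite /Sd iL andbT avg_cmean.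
- by move=> a; exact: dpos.
- by move=> a; exact: dpos.
- by move=> a; exact: cmean_ge0.
- by move=> l a lN; rewrite !avg_cmean//; exact: HD.
Qed.

End one_top_cell.

(** Averaging over top cells leaves integrals unchanged, so the bound in each top cell, whose
    constant does not depend on the cell, integrates to the whole space. *)
Theorem grid_weighted :
  (\int[mu]_y ((\sum_(i < L.+1) (S i y)%:R * cm f i y) `^ p * w y)%:E <=
   (cst_W p * (D * (B + A `^ (p - 1))))%:E * \int[mu]_y (`|f y| `^ p * w y)%:E)%E.
Proof.
pose form y := \sum_(i < L.+1) (S i y)%:R * cm f i y.
have form0 y : 0 <= form y by apply: sumr_ge0 => i _; rewrite mulr_ge0// cmean_ge0.
have cform x y : mate 0 (x, y) -> form x `^ p = form y `^ p.
  move=> xy; congr (_ `^ _); apply: eq_bigr => i _.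
  have iL : (i <= L)%N by rewrite -ltnS.
  by rewrite (aS iL (mate_le s0 (leq0n i) xy)) (cmean_cellmate _ (mate_le s0 (leq0n i) xy)).
have mfw : measurable_fun setT (fun y => (`|f y| `^ p * w y)%:E).
  apply/measurable_EFinP; apply: measurable_funM; last exact: Lw.1.
  apply: (measurableT_comp (measurable_powR p)); apply/measurable_EFinP; exact: measurable_absE Lf.1.
have mform : measurable_fun setT (fun y => (form y `^ p * w y)%:E).
  apply/measurable_EFinP; apply: measurable_funM; last exact: Lw.1.
  exact: (mate0_measurable cform).
have fw0 y : (0 <= (`|f y| `^ p * w y)%:E)%E by rewrite lee_fin mulr_ge0 ?powR_ge0// ltW.
have ff0 y : (0 <= (form y `^ p * w y)%:E)%E by rewrite lee_fin mulr_ge0 ?powR_ge0// ltW.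
have c0 : 0 < cst_W p * (D * (B + A `^ (p - 1))) by apply: mulr_gt0 (cst_W_gt0 p1) (mulr_gt0 D0 _); rewrite ltr_pwDl ?powR_ge0.
rewrite -(integral_cavg (v := v) (s := s * 2 ^+ L) _ measurableT _ mform ff0)//.
rewrite -(integral_cavg (v := v) (s := s * 2 ^+ L) _ measurableT _ mfw fw0)//.
rewrite -ge0_integralZl//; last 3 first.
- exact: measurable_cavg.
- by move=> y _; exact: cavg_ge0.
- by rewrite lee_fin ltW.
apply: ge0_le_integralT => y _; first exact: cavg_ge0.
rewrite /cavg muleCA; apply: lee_wpmul2l; first by rewrite lee_fin invr_ge0 exprn_ge0// ltW.
apply: le_trans (top_cell_weighted y); rewrite le_eqVlt; apply/orP; left; apply/eqP; apply: eq_integral => z _.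
by rewrite (gtr0_norm (w0 z)).
Qed.

End grid_weighted.

(** * From the cubes of the weight constants to grid cells *)

Section weighted_sqsum.
Context {R : realType} {n : nat}.
Local Notation V := 'rV[R]_n.
Local Notation mu := (rV_lebesgue n).
Implicit Types (x y z : V) (l i : nat).

(** The constants of the weights are defined by open cubes, whereas cells are half-open; the open
    cube with this centre differs from the cell by a null set. *)
Definition cell_center (v : V) (r : R) x : V :=
  \row_i (v ord0 i + ((cell v r x ord0 i)%:~R * r + r / 2)).

Lemma cell_centerE v r x (i : 'I_n) :
  cell_center v r x ord0 i = v ord0 i + ((cell v r x ord0 i)%:~R * r + r / 2).
Proof. by rewrite mxE. Qed.

Lemma cell_centerP v r x y : 0 < r ->
  cellmate v r (x, y) <-> forall i : 'I_n, cell_center v r x ord0 i - r / 2 <= y ord0 i < cell_center v r x ord0 i + r / 2.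
Proof.
move=> r0; split => [/esym/(cell_itv v y _ r0) H i|H].
  by have := H i; rewrite cell_centerE/=; lra.
apply/esym/(cell_itv v y _ r0) => i.
by have := H i; rewrite cell_centerE/=; lra.
Qed.

Lemma open_cell_sub v r x : 0 < r ->
  cube (cell_center v r x) (r / 2) `<=` [set y | cellmate v r (x, y)].
Proof.
move=> r0 y H; apply/cell_centerP => // i; have := H i; rewrite ltr_distl => /andP[/ltW h1 h2].
by apply/andP.
Qed.

Lemma cell_boundary_null v r x : 0 < r ->
  mu ([set y | cellmate v r (x, y)] `\` cube (cell_center v r x) (r / 2)) = 0%E.
Proof.
move=> r0; have mQ := measurable_cell_of v r x.
have mP : measurable (cube (cell_center v r x) (r / 2)) by exact: measurable_cube.
have Qoo : (mu [set y | cellmate v r (x, y)] < +oo)%E by rewrite rV_lebesgue_cell// ltry.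
rewrite measureD//.
rewrite (setIidr (@open_cell_sub v r x r0)).
change (mu [set y | cellmate v r (x, y)] - mu (cube (cell_center v r x) (r / 2)) = 0)%E.
rewrite rV_lebesgue_cell// rV_lebesgue_cube ?divr_ge0 ?ltW//.
by rewrite mulrC divfK// subee.
Qed.

Lemma integral_cell_interior v r x (h : V -> \bar R) (E : set V) : 0 < r -> measurable E ->
  E `<=` [set y | cellmate v r (x, y)] -> measurable_fun setT h -> (forall y, (0 <= h y)%E) ->
  (\int[mu]_(y in E) h y = \int[mu]_(y in E `&` cube (cell_center v r x) (r / 2)) h y)%E.
Proof.
move=> r0 mE EQ mh h0; set P := cube _ _.
have mP : measurable P by exact: measurable_cube.
have EE : E = (E `&` P) `|` (E `\` P) by rewrite setUIDK.
have mN : measurable (E `\` P) by exact: measurableD.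
have mI : measurable (E `&` P) by exact: measurableI.
rewrite [in LHS]EE ge0_integral_setU//; last 2 first.
- exact: measurable_funTS.
- by apply/disj_setPS => y [[_ Py] []].
rewrite [X in (_ + X)%E](_ : _ = 0%E) ?adde0//.
apply: null_set_integral => //; first exact: measurable_funTS.
apply/eqP; rewrite eq_le measure_ge0 andbT -(cell_boundary_null v x r0).
apply: le_measure; rewrite ?inE//.
  by apply: measurableD => //; exact: measurable_cell_of.
by move=> y [/EQ].
Qed.

Variables (s : R) (v : V).
Hypothesis s0 : 0 < s.
Local Notation mate l := (cellmate v (s * 2 ^+ l)).
Let side0 l : 0 < s * 2 ^+ l. Proof. by rewrite mulr_gt0// exprn_gt0. Qed.

Lemma cmean_cube (h : V -> R) l x : locint h -> (forall x, 0 <= h x) ->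
  ((cmean s v h l x)%:E <= ((s * 2 ^+ l) ^- n)%:E * cubeint (s * 2 ^+ l) (fun y => (h y)%:E) x)%E.
Proof.
move=> Lh h0; rewrite cmeanE// /cavg; apply: lee_wpmul2l.
  by rewrite lee_fin invr_ge0 exprn_ge0// ltW.
rewrite /relint; under eq_integral do rewrite ger0_norm//.
apply: ge0_subset_integral; [exact: measurable_cell_of|exact: measurable_cube| | |].
- by apply: measurable_funTS; apply/measurable_EFinP; exact: Lh.1.
- by move=> y _; rewrite lee_fin.
- by move=> y; exact: (cellmate_near (side0 l)).
Qed.

(** The cell of level [l] at [y] lies in the cube of twice its side centred at [y], whence [2 ^ n].
    It stays in the cell of level [i], so cutting [h] off outside [P] loses only a null set. *)
Lemma cmean_HL_max (h : V -> R) l i x y : (l <= i)%N -> locint h -> (forall x, 0 <= h x) ->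
  let P := cube (cell_center v (s * 2 ^+ i) x) (s * 2 ^+ i / 2) in P y ->
  ((cmean s v h l y)%:E <= (2 ^+ n)%:E * HL_max (patch (fun=> 0%E) P (EFin \o h)) y)%E.
Proof.
move=> li Lh h0 P Py; set g := patch _ _ _.
have mP : measurable P by exact: measurable_cube.
have mh : measurable_fun setT (fun y => (h y)%:E) by apply/measurable_EFinP; exact: Lh.1.
have mg : measurable_fun setT g by apply/(measurable_restrictT _ _).1 => //; exact: measurable_funTS.
have g0 z : (0 <= g z)%E by rewrite /g /patch; case: ifP => // _; rewrite lee_fin.
have sub : [set z | mate l (y, z)] `<=` [set z | mate i (x, z)].
  move=> z yz; apply: cellmate_trans (open_cell_sub (side0 i) Py) _.
  exact: mate_le yz.
have sn : (s * 2 ^+ l) ^+ n != 0 by rewrite expf_neq0// gt_eqF.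
apply: (@le_trans _ _ ((2 ^+ n)%:E * average (cube y (s * 2 ^+ l)) (fun z => `|g z|))%E); last first.
  apply: lee_wpmul2l; first by rewrite lee_fin exprn_ge0.
  apply: ereal_sup_ubound; exists y, (s * 2 ^+ l); split => //.
  by apply/cubeE; rewrite ?subrr ?normr0.
rewrite /average rV_lebesgue_cube; last exact: ltW.
have -> : (((2 * (s * 2 ^+ l)) ^+ n)%:E^-1 = ((2 ^+ n)^-1 * (s * 2 ^+ l) ^- n)%:E)%E.
  rewrite inver ifF; last by rewrite expf_eq0 mulf_eq0 (gt_eqF (side0 l)) pnatr_eq0 andbF.
  by rewrite exprMn invfM.
rewrite muleA -EFinM mulrA mulfV ?expf_neq0// mul1r cmeanE// /cavg.
apply: lee_wpmul2l; first by rewrite lee_fin invr_ge0 exprn_ge0// ltW.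
rewrite (_ : relint (mate l) _ y = relint (mate l) (fun z => (h z)%:E) y); last first.
  by apply: eq_integral => z _; rewrite ger0_norm.
rewrite /relint (integral_cell_interior (side0 i) _ sub mh) => [||z]; last 2 first.
- exact: measurable_cell_of.
- by rewrite lee_fin.
rewrite (eq_integral g) => [|z /set_mem[_ Pz]]; last by rewrite /g /patch mem_set.
under [in leRHS]eq_integral do rewrite gee0_abs//.
apply: ge0_subset_integral => //.
- by apply: measurableI => //; exact: measurable_cell_of.
- exact: measurable_cube.
- exact: measurable_funTS.
- by move=> z [yz _]; exact: (cellmate_near (side0 l) yz).
Qed.

Lemma maxlev_HL (h : V -> R) (L i : nat) (C : R) x : locint h -> (forall x, 0 <= h x) -> 0 <= C ->
  let P := cube (cell_center v (s * 2 ^+ i) x) (s * 2 ^+ i / 2) in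
  (\int[mu]_(y in P) HL_max (patch (fun=> 0) P (EFin \o h)) y <= C%:E * \int[mu]_(y in P) (h y)%:E)%E ->
  (relint (mate i) (fun y => (maxlev L s v h i y)%:E) x <=
   (2 ^+ n * C)%:E * relint (mate i) (fun y => `|h y|%:E) x)%E.
Proof.
move=> Lh h0 C0 P HP.
have mh : measurable_fun setT (fun y => (h y)%:E) by apply/measurable_EFinP; exact: Lh.1.
have mmax : measurable_fun setT (fun y => (maxlev L s v h i y)%:E).
  apply/measurable_EFinP; apply: (@mate0_measurable R n s v) => y z yz.
  by apply: eq_bigr => l _; apply: cmean_cellmate; exact: mate_le yz.
have mQ := measurable_cell_of v (s * 2 ^+ i) x.
rewrite [in leRHS](_ : (fun y => `|h y|%:E) = (fun y => (h y)%:E)); last first.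
  by apply/funext => y; rewrite ger0_norm.
rewrite /relint !(integral_cell_interior (side0 i) mQ (@subset_refl _ _))//; last first.
  by move=> y; rewrite lee_fin; exact: bigmax_ge_id.
rewrite (setIidr (@open_cell_sub v _ x (side0 i))) -/P EFinM -muleA.
apply: le_trans (lee_wpmul2l _ HP); last by rewrite lee_fin exprn_ge0.
have HL0 y : (0 <= HL_max (patch (fun=> 0) P (EFin \o h)) y)%E.
  apply: le_trans (_ : average (cube y 1) (fun z => `|patch (fun=> 0) P (EFin \o h) z|) <= _)%E.
    by rewrite /average mule_ge0 ?inve_ge0 ?measure_ge0// integral_ge0.
  by apply: ereal_sup_ubound; exists y, 1; split => //; apply/cubeE; rewrite ?subrr ?normr0.
have p2 : 0 < 2 ^+ n :> R by rewrite exprn_gt0.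
have max0 y : (0 <= (maxlev L s v h i y)%:E)%E by rewrite lee_fin; exact: bigmax_ge_id.
have mP : measurable P by exact: measurable_cube.
(* The factor is kept with the measurable integrand, so that [HL_max] is compared by monotonicity
   alone. *)
have -> : (\int[mu]_(y in P) (maxlev L s v h i y)%:E =
    (2 ^+ n)%:E * \int[mu]_(y in P) ((2 ^- n)%:E * (maxlev L s v h i y)%:E))%E.
  rewrite ge0_integralZl//; last first.
    by first [exact: measurable_funTS|rewrite lee_fin invr_ge0 ltW].
  by rewrite muleA -EFinM mulfV ?mul1e// gt_eqF.
apply: lee_wpmul2l; first by rewrite lee_fin ltW.
rewrite integral_mkcond [leRHS]integral_mkcond; apply: ge0_le_integralT => y _.
  by rewrite /patch; case: ifP => // _; rewrite mule_ge0// lee_fin invr_ge0 ltW.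
rewrite /patch; case: ifPn => // /set_mem Py.
rewrite -EFin_bigmax -(@lee_pmul2l _ (2 ^+ n)%:E)// ?lte_fin// muleA -EFinM mulfV ?gt_eqF// mul1e.
apply/bigmax_leP; split; first by apply: mule_ge0; [rewrite lee_fin ltW|exact: HL0].
by move=> l li; exact: cmean_HL_max.
Qed.

End weighted_sqsum.

(** * The weighted bound for finitely many scales *)

Section weighted_bound.
Context {R : realType} {n : nat}.
Local Notation V := 'rV[R]_n.
Local Notation mu := (rV_lebesgue n).
Implicit Types (x y z : V) (l i : nat).
Variables (n0 : (0 < n)%N) (p : R) (p1 : 1 < p).
Variables (w sg : V -> R) (a A B : R).
Hypotheses (Lw : locint w) (Lsg : locint sg).
Hypotheses (w0 : forall x, 0 < w x) (sg0 : forall x, 0 < sg x).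
Hypothesis wsg : forall x, w x = sg x `^ (1 - p).
Hypotheses (a0 : 0 < a) (A0 : 0 < A) (B0 : 0 < B).
Hypothesis joint : forall c r, 0 < r ->
  fine (cubeint r (fun y => (w y)%:E) c) * fine (cubeint r (fun y => (sg y)%:E) c) `^ (p - 1) <=
  a * ((2 * r) ^+ n) `^ p.
Let HLbound (h : V -> R) (C : R) := forall c r, 0 < r ->
  (\int[mu]_(y in cube c r) HL_max (patch (fun=> 0) (cube c r) (EFin \o h)) y <=
   C%:E * \int[mu]_(y in cube c r) (h y)%:E)%E.
Hypotheses (HLw : HLbound w A) (HLsg : HLbound sg B).

Let p0 : 0 < p. Proof. exact: lt_trans p1. Qed.

(** [young_tangent] with [t = 1] bounds [|f|] by [|f|^p w] plus a multiple of the dual weight. *)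
Lemma locint_weighted (f : V -> R) : measurable_fun setT f ->
  (\int[mu]_y (`|f y| `^ p * w y)%:E < +oo)%E -> locint f.
Proof.
move=> mf fw; split => // c r.
have mfw : measurable_fun setT (fun y => (`|f y| `^ p * w y)%:E).
  apply/measurable_EFinP; apply: measurable_funM; last exact: Lw.1.
  by apply: (measurableT_comp (measurable_powR p)); apply/measurable_EFinP; exact: measurable_absE.
have fw0 y : (0 <= (`|f y| `^ p * w y)%:E)%E by rewrite lee_fin mulr_ge0 ?powR_ge0// ltW.
apply: (@le_lt_trans _ _ (\int[mu]_y (`|f y| `^ p * w y)%:E + (p - 1)%:E * cubeint r (fun y => `|sg y|%:E) c)%E); last first.
  by rewrite lte_add_pinfty// lte_mul_pinfty ?lee_fin ?subr_ge0 ?(ltW p1)//; exact: Lsg.2.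
apply: (@le_trans _ _ (cubeint r (fun y => (`|f y| `^ p * w y)%:E + (p - 1)%:E * `|sg y|%:E)%E c)).
  rewrite /cubeint integral_mkcond [leRHS]integral_mkcond; apply: ge0_le_integralT => y _.
    by rewrite /patch; case: ifP.
  rewrite /patch; case: ifP => // _; rewrite -EFinM -EFinD lee_fin (gtr0_norm (sg0 y)) wsg.
  apply: (@le_trans _ _ (p * 1 `^ (p - 1) * `|f y|)).
    by rewrite powR1 mulr1 ler_peMl// ltW.
  apply: le_trans (young_tangent p1 ler01 (normr_ge0 (f y)) (sg0 y)) _.
  by rewrite powR1 mulr1.
have msg := measurable_absE Lsg.1.
have mc : measurable (cube c r) by exact: measurable_cube.
have pm : 0 <= p - 1 by rewrite subr_ge0 ltW.
rewrite /cubeint ge0_integralD//; last 3 first.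
- exact: measurable_funTS.
- by move=> y _; rewrite -EFinM lee_fin mulr_ge0.
- by apply: measurable_funTS; exact: measurable_funeM.
apply: leeD; first exact: cubeint_le_integral.
by rewrite ge0_integralZl//; exact: measurable_funTS.
Qed.

Variables (M : nat) (s : R) (psi : 'I_M -> V -> R).
Hypothesis s0 : 0 < s.
Hypothesis LP : forall i : 'I_M, LPker (s * 2 ^+ i) (psi i).

Let pw2 : 1 <= 2 ^+ n :> R. Proof. by rewrite exprn_ege1// ler1n. Qed.
Let pw20 : 0 < 2 ^+ n :> R. Proof. exact: lt_le_trans pw2. Qed.

(** A cell of side [q] lies in a cube of radius [q], of volume [2 ^ n] times larger; the two
    averages together lose [(2 ^ n)^p]. *)
Let joint_cmean v l x : cmean s v w l x * cmean s v sg l x `^ (p - 1) <= (2 ^+ n) `^ p * a.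
Proof.
have pm : 0 < p - 1 by rewrite subr_gt0.
set q := (s * 2 ^+ l); have q0 : 0 < q by rewrite mulr_gt0// exprn_gt0.
have qn : 0 < q ^+ n by rewrite exprn_gt0.
have fin_ (h : V -> R) : locint h -> (forall x, 0 < h x) ->
    cmean s v h l x <= (q ^+ n)^-1 * fine (cubeint q (fun y => (h y)%:E) x).
  move=> Lh h0; have h0w y : 0 <= h y by exact: ltW.
  have fn : cubeint q (fun y => (h y)%:E) x \is a fin_num.
    rewrite ge0_fin_numE; last by apply: cubeint_ge0 => y; rewrite lee_fin.
    apply: le_lt_trans (Lh.2 x q); rewrite le_eqVlt; apply/orP; left; apply/eqP.
    by apply: eq_integral => y _; rewrite ger0_norm.
  by have := @cmean_cube R n s v s0 h l x Lh h0w; rewrite -/q -(fineK fn) -EFinM lee_fin.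
have h1 := fin_ _ Lw w0; have h2 := fin_ _ Lsg sg0.
have cw0 := cmean_ge0 s0 v w l x; have cs0 := cmean_ge0 s0 v sg l x.
have J := joint x q0; move: h1 h2 J.
set W := fine _; set S := fine _ => h1 h2 J.
have S0 : 0 <= S.
  by rewrite -(@pmulr_rge0 _ (q ^+ n)^-1) ?invr_gt0//; exact: le_trans cs0 h2.
apply: (@le_trans _ _ (((q ^+ n)^-1 * W) * ((q ^+ n)^-1 * S) `^ (p - 1))).
  by apply: ler_pM; rewrite ?powR_ge0//; apply: powR_le => //; exact: ltW.
rewrite powRM ?invr_ge0 ?(ltW qn)// mulrACA.
rewrite mulr_powRB ?invr_gt0//.
apply: (@le_trans _ _ ((q ^+ n)^-1 `^ p * (a * ((2 * q) ^+ n) `^ p))); first by rewrite ler_wpM2l ?powR_ge0.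
rewrite mulrCA -powRM ?invr_ge0 ?exprn_ge0 ?(ltW qn) ?mulr_ge0 ?(ltW q0)//.
  by rewrite (exprMn n 2 q) mulrCA mulVf ?gt_eqF// mulr1 mulrC.
all: exact: ltW.
Qed.

Definition cst_weighted : R := @cst_grids R n p * (2 ^ n)%:R * (cst_W p * (2 * (2 ^+ n) `^ p * (2 ^+ n) `^ p)).

Theorem sqsum_weighted (f : V -> R) : measurable_fun setT f ->
  (\int[mu]_y (`|f y| `^ p * w y)%:E < +oo)%E ->
  (\int[mu]_y (sqsum psi f y `^ (p / 2) * w y)%:E <=
   (cst_weighted * (a * (B + A `^ (p - 1))))%:E * \int[mu]_y (`|f y| `^ p * w y)%:E)%E.
Proof.
move=> mf fw; have Lf := locint_weighted mf fw.
set F := (\int[mu]_y (`|f y| `^ p * w y)%:E)%E in fw *.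
have F0 : (0 <= F)%E by apply: integral_ge0 => y _; rewrite lee_fin mulr_ge0 ?powR_ge0// ltW.
have pm : 0 < p - 1 by rewrite subr_gt0.
have g0 : 0 <= @cst_grids R n p by exact: powR_ge0.
pose form c y := sparse_form s psi f c y.
have form0 c y : 0 <= form c y by exact: sparse_form_ge0.
have side0 l : 0 < s * 2 ^+ l by rewrite mulr_gt0// exprn_gt0.
have mform c : measurable_fun setT (fun y => (form c y `^ p * w y)%:E).
  apply/measurable_EFinP; apply: measurable_funM; last exact: Lw.1.
  apply: (@mate0_measurable R n s (grid M s c)) => x y xy; congr (_ `^ _).
  apply: eq_bigr => i _; have iL : (i <= M.+3)%N by rewrite -ltnS.
  have xyi := mate_le s0 (leq0n i) xy.
  by rewrite (sel_cellmate _ _ _ iL xyi) // (cmean_cellmate _ xyi).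
pose C1 := cst_W p * ((2 ^+ n) `^ p * a * (2 ^+ n * B + (2 ^+ n * A) `^ (p - 1))).
have one c : (\int[mu]_y (form c y `^ p * w y)%:E <= C1%:E * F)%E.
  apply: (@grid_weighted R n M.+3 s (grid M s c) (fun i y => sel s psi (grid M s c) f i y) p s0 p1 _ _ w sg f
     ((2 ^+ n) `^ p * a) (2 ^+ n * A) (2 ^+ n * B)) => //.
  - by move=> l x y lL xy; apply: sel_cellmate xy.
  - by move=> i x iL si; apply: sel_sparse.
  - by rewrite mulr_gt0 ?powR_gt0.
  - by rewrite mulr_gt0.
  - by rewrite mulr_gt0.
  - move=> i x iL; apply: maxlev_HL => //; [by move=> y; exact: ltW|exact: ltW|].
    by apply: HLsg; rewrite divr_gt0.
  - move=> i x iL; apply: maxlev_HL => //; [by move=> y; exact: ltW|exact: ltW|].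
    by apply: HLw; rewrite divr_gt0.
have C10 : 0 <= C1.
  by rewrite mulr_ge0 ?(ltW (cst_W_gt0 p1))// mulr_ge0 ?addr_ge0 ?powR_ge0 ?mulr_ge0 ?powR_ge0 ?(ltW a0) ?(ltW B0) ?(ltW pw20).
apply: (@le_trans _ _ ((@cst_grids R n p)%:E * \sum_(c : {ffun 'I_n -> bool}) \int[mu]_y (form c y `^ p * w y)%:E)%E).
  rewrite -ge0_integral_sum//; last by move=> c y _; rewrite lee_fin mulr_ge0 ?powR_ge0// ltW.
  rewrite -ge0_integralZl//; last 2 first.
  - exact: emeasurable_sum.
  - by move=> y _; apply: sume_ge0 => c _; rewrite lee_fin mulr_ge0 ?powR_ge0// ltW.
  apply: ge0_le_integralT => y _; first by rewrite lee_fin mulr_ge0 ?powR_ge0// ltW.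
  rewrite sumEFin -EFinM lee_fin -mulr_suml mulrA ler_wpM2r ?(ltW (w0 y))//.
  exact: sqsum_sparse_powR.
apply: (@le_trans _ _ ((@cst_grids R n p)%:E * ((2 ^ n)%:R * C1)%:E * F)%E).
  rewrite -muleA; apply: lee_wpmul2l; first by rewrite lee_fin.
  have FE : F = (fine F)%:E by rewrite fineK// ge0_fin_numE.
  apply: (@le_trans _ _ (\sum_(c : {ffun 'I_n -> bool}) (C1 * fine F)%:E)%E).
    by apply: lee_sum => c _; rewrite EFinM -FE.
  rewrite sumEFin sumr_const card_ffun card_bool card_ord {2}FE -EFinM lee_fin.
  by rewrite -[in leRHS]mulrA mulr_natl.
rewrite -EFinM; apply: lee_wpmul2r => //; rewrite lee_fin /cst_weighted -[leRHS]mulrA [leLHS]mulrA.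
apply: ler_wpM2l; first exact: mulr_ge0 g0 (ler0n _ _).
rewrite /C1 -[leRHS]mulrA; apply: ler_wpM2l; first exact: ltW (cst_W_gt0 p1).
have t0 : 0 < (2 ^+ n) `^ p :> R by rewrite powR_gt0.
have h1 : 2 ^+ n <= (2 ^+ n) `^ p :> R.
  by rewrite -{1}(powRr1 (ltW pw20)) ler_powR// ltW.
have h2 : (2 ^+ n) `^ (p - 1) <= (2 ^+ n) `^ p :> R by rewrite ler_powR// gerBl.
have A'0 : 0 <= A `^ (p - 1) by exact: powR_ge0.
have : 2 ^+ n * B + (2 ^+ n * A) `^ (p - 1) <= 2 * (2 ^+ n) `^ p * (B + A `^ (p - 1)).
  rewrite powRM ?(ltW pw20) ?(ltW A0)//.
  have := ler_wpM2r (ltW B0) h1; have := ler_wpM2r A'0 h2.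
  have := mulr_ge0 (ltW t0) (ltW B0); have := mulr_ge0 (ltW t0) A'0; nra.
set X := _ + _ => HX.
apply: (@le_trans _ _ ((2 ^+ n) `^ p * a * (2 * (2 ^+ n) `^ p * (B + A `^ (p - 1))))).
  by rewrite -!mulrA ler_pM2l// ler_pM2l// !mulrA.
by rewrite le_eqVlt; apply/orP; left; apply/eqP; ring.
Qed.

End weighted_bound.

(** * From the rough kernel to Littlewood-Paley kernels *)

Section riesz_integral.
Context {R : realType} {n : nat}.
Local Notation V := 'rV[R]_n.
Local Notation mu := (rV_lebesgue n).
Implicit Types (x y z : V) (r q : R).

Lemma half_geo_sum J : \sum_(j < J) (2^-1 : R) ^+ j <= 2.
Proof.
apply: le_trans (finite_geo_sum J _ _) _; [by rewrite invr_ge0|by rewrite invf_lt1// ltr1n|].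
by rewrite (_ : 1 - 2^-1 = 2^-1) ?invrK//; field.
Qed.

(** Local integrability of [|z|^(1-n)]: the dyadic shell of radius [r 2^-j] contributes in
    proportion to its radius. *)
Lemma riesz_integral r : 0 < r ->
  (\int[mu]_(z in cube 0%R r) (`|z| * `|z| ^- n)%:E <= (4 * 8 ^+ n * r)%:E)%E.
Proof.
move=> r0; pose h j : R := 2^-1 ^+ j.
have h0 j : 0 < h j by rewrite exprn_gt0// invr_gt0.
(* Bound of the integrand on the shell [r h <= |z| <= 2 r h], which the open cube of radius [4 r h]
   contains. *)
pose a j : R := 2 * r * h j * (r * h j) ^- n.
have a0 j : 0 <= a j by rewrite !mulr_ge0 ?invr_ge0 ?exprn_ge0 ?mulr_ge0 ?(ltW r0) ?(ltW (h0 _)).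
pose g j z : \bar R := (a j * \1_(cube 0 (4 * r * h j)) z)%:E.
have mg j : measurable_fun setT (g j).
  by apply/measurable_EFinP; apply: measurable_funM => //; apply: measurable_indic; exact: measurable_cube.
have g0 j z : (0 <= g j z)%E by rewrite lee_fin mulr_ge0.
apply: (@le_trans _ _ (\int[mu]_z (\sum_(0 <= j <oo) g j z))%E).
  rewrite integral_mkcond; apply: ge0_le_integralT => z _.
    by rewrite /patch; case: ifP => // _; rewrite lee_fin mulr_ge0// invr_ge0 exprn_ge0.
  rewrite /patch; case: ifPn => [/set_mem zr|_]; last exact: nneseries_ge0.
  have [->|zn] := eqVneq z 0; first by rewrite normr0 mul0r; exact: nneseries_ge0.
  have z0 : 0 < `|z| by rewrite normr_gt0.
  have zr' : `|z| < r by move/cubeE : zr => /(_ r0); rewrite subr0.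
  have [k /andP[k1 k2]] := dyadic_scale z0 (ltW zr').
  have hk : h k * 2 ^+ k = 1 by rewrite /h -exprMn mulVf ?expr1n.
  have p2 : 0 < 2 ^+ k :> R by rewrite exprn_gt0.
  have lo : r * h k <= `|z|.
    rewrite -(ler_pM2r p2) -mulrA hk mulr1; exact: k1.
  have hi : `|z| <= 2 * r * h k by rewrite -(ler_pM2r p2) -[leRHS](mulrA (2 * r)) hk mulr1.
  apply: (@le_trans _ _ (g k z)); last first.
    rewrite (@nneseriesD1 _ (fun j => g j z) k xpredT)//.
    by rewrite leeDl// nneseries_ge0.
  rewrite lee_fin indicE mem_set ?mulr1; last first.
    by apply/cubeE; rewrite ?subr0 ?mulr_gt0//; apply: le_lt_trans hi _; rewrite ltr_pM2r// ltr_pM2r// ltr_nat.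
  apply: ler_pM => //.
  rewrite lef_pV2 ?posrE ?exprn_gt0 ?mulr_gt0//.
  by apply: lerXn2r => //; rewrite nnegrE ?mulr_ge0 ?(ltW r0) ?(ltW (h0 _)).
rewrite integral_nneseries//.
have E j : (\int[mu]_z g j z = (2 * 8 ^+ n * r * h j)%:E)%E.
  rewrite /g; under eq_integral do rewrite EFinM.
  rewrite ge0_integralZl//; last first.
  - by rewrite lee_fin.
  - by apply/measurable_EFinP/measurable_indic; exact: measurable_cube.
  rewrite integral_indic//; last exact: measurable_cube.
  have q0 : 0 < r * h j by rewrite mulr_gt0.
  transitivity ((a j)%:E * ((2 * (4 * r * h j)) ^+ n)%:E)%E.
    congr (_ * _)%E; rewrite setIT; apply: rV_lebesgue_cube.
    by rewrite -mulrA mulr_ge0// ltW.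
  rewrite -EFinM.
  congr (_%:E); rewrite /a (_ : 2 * (4 * r * h j) = 8 * (r * h j)); last by ring.
  rewrite (exprMn n 8 (r * h j)); have : (r * h j) ^+ n != 0 by rewrite expf_neq0// gt_eqF.
  by move: ((r * h j) ^+ n) (8 ^+ n : R) => u t u0; field.
apply: lime_le; first by apply: is_cvg_nneseries => j _ _; exact: integral_ge0.
apply: nearW => J; rewrite (eq_bigr (fun j => (2 * 8 ^+ n * r * h j)%:E)) => [|j _]; last exact: E.
rewrite sumEFin lee_fin -mulr_sumr big_mkord.
apply: (@le_trans _ _ (2 * 8 ^+ n * r * 2)); last by rewrite le_eqVlt; apply/orP; left; apply/eqP; ring.
by rewrite ler_wpM2l ?half_geo_sum// !mulr_ge0 ?exprn_ge0// ltW.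
Qed.

End riesz_integral.

(** * Size, smoothness and mean of the smoothed kernel *)

Section smoothed_kernel.
Context {R : realType} {n : nat}.
Local Notation V := 'rV[R]_n.
Local Notation mu := (rV_lebesgue n).
Implicit Types (x y z : V).
Variables (q C Lam : R) (phi k : V -> R).
Hypotheses (q0 : 0 < q) (C0 : 0 <= C) (Lam0 : 0 <= Lam).
Hypotheses (mphi : measurable_fun setT phi) (mk : measurable_fun setT k).
Hypothesis k_le : forall z, `|k z| <= C * `|z| ^- n.
Hypothesis k_supp : forall z, q < `|z| -> k z = 0.
Hypothesis phi_supp : forall x, q <= `|x| -> phi x = 0.
Hypothesis phi_ge0 : forall x, 0 <= phi x.
Hypothesis phi_int : mu.-integrable setT (EFin \o phi).
Hypothesis phi_lip : forall x y, `|phi x - phi y| <= Lam * q ^- n.+1 * `|x - y|.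
Hypothesis phi_lip2 : forall x y z,
  `|(phi (x - z) - phi x) - (phi (y - z) - phi y)| <= Lam * q ^- n.+2 * `|x - y| * `|z|.

Definition smoothk x : R := \int[mu]_z ((phi (x - z) - phi x) * k z).

Let m2 : measurable_fun setT (fun p : V * V => (phi (p.1 - p.2) - phi p.1) * k p.2).
Proof.
apply: measurable_funM; last exact: measurableT_comp mk _.
apply: measurable_funB.
  exact: (measurableT_comp mphi (@measurable_rV_sub R n)).
exact: measurableT_comp mphi _.
Qed.

Let m1 x : measurable_fun setT (fun z => (phi (x - z) - phi x) * k z).
Proof.
by apply: measurable_funM => //; apply: measurable_funB => //; exact: measurable_kernel.
Qed.

(* A multiplier [u] with [|u z| <= a |z|] tames the singularity of [k]. *)
Lemma tamed_integral (u : V -> R) (a : R) r : measurable_fun setT u -> 0 <= a -> 0 < r ->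
  (forall z, `|u z| <= a * `|z|) -> (forall z, r <= `|z| -> u z * k z = 0) ->
  (\int[mu]_z `|u z * k z|%:E <= (a * C * (4 * 8 ^+ n) * r)%:E)%E.
Proof.
move=> mu_ a0 r0 ua us.
have mz : measurable_fun setT (fun z : V => (`|z| * `|z| ^- n)%:E).
  apply/measurable_EFinP; apply: measurable_funM; first exact: measurable_rV_norm.
  rewrite (_ : (fun z => _) = (fun z : V => `|z| `^ (- n%:R))).
    by apply: (measurableT_comp (measurable_powR _)); exact: measurable_rV_norm.
  by apply/funext => z; rewrite powRN powR_mulrn.
apply: (@le_trans _ _ ((a * C)%:E * \int[mu]_(z in cube 0%R r) (`|z| * `|z| ^- n)%:E)%E).
  rewrite -ge0_integralZl//.
  all: first [exact: measurable_cube|exact: measurable_funTS|by rewrite lee_fin mulr_ge0|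
    by move=> z _; rewrite lee_fin mulr_ge0// invr_ge0 exprn_ge0|idtac].
  rewrite [leRHS]integral_mkcond; apply: ge0_le_integralT => z _ //.
  rewrite /patch; case: ifPn => [_|/negP zr].
    rewrite -EFinM lee_fin normrM mulrACA; apply: ler_pM => //.
  rewrite us ?normr0// leNgt; apply/negP => zr'; apply: zr; apply: mem_set.
  by apply/cubeE; rewrite ?subr0.
apply: le_trans (lee_wpmul2l _ (riesz_integral r0)) _; first by rewrite lee_fin mulr_ge0.
by rewrite -EFinM lee_fin !mulrA.
Qed.

Lemma tamed_integrable (u : V -> R) (a : R) r : measurable_fun setT u -> 0 <= a -> 0 < r ->
  (forall z, `|u z| <= a * `|z|) -> (forall z, r <= `|z| -> u z * k z = 0) ->
  mu.-integrable setT (EFin \o (fun z => u z * k z)) /\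
  `|\int[mu]_z (u z * k z)| <= a * C * (4 * 8 ^+ n) * r.
Proof.
move=> mu_ a0 r0 ua us; have B := tamed_integral mu_ a0 r0 ua us.
have I : mu.-integrable setT (EFin \o (fun z => u z * k z)).
  apply/integrableP; split; first by apply/measurable_EFinP; exact: measurable_funM.
  by apply: le_lt_trans B _; rewrite ltry.
split=> //; rewrite -lee_fin; apply: le_trans B.
by rewrite EFin_normr_Rintegral//; apply: le_abse_integral => //; apply/measurable_EFinP; exact: measurable_funM.
Qed.

Let k2 z : 2 * q <= `|z| -> k z = 0.
Proof. by move=> qz; apply: k_supp; apply: lt_le_trans qz; rewrite ltr_pMl// ltr1n. Qed.

Let mdiff x : measurable_fun setT (fun z => phi (x - z) - phi x).
Proof. by apply: measurable_funB => //; exact: measurable_kernel. Qed.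

Let diff_le x z : `|phi (x - z) - phi x| <= Lam * q ^- n.+1 * `|z|.
Proof. by apply: le_trans (phi_lip _ _) _; rewrite addrAC subrr add0r normrN. Qed.

Let la0 m : 0 <= Lam * q ^- m.
Proof. by rewrite mulr_ge0// invr_ge0 exprn_ge0// ltW. Qed.

Lemma smoothk_integrable x : mu.-integrable setT (EFin \o (fun z => (phi (x - z) - phi x) * k z)).
Proof.
have [||I _] := @tamed_integrable (fun z => phi (x - z) - phi x) _ (2 * q) (mdiff x) (la0 _) _ (diff_le x) _.
- by rewrite mulr_gt0.
- by move=> z /k2 ->; rewrite mulr0.
exact: I.
Qed.

Definition cst_k : R := 8 * 8 ^+ n * (Lam + 1).

Let absorb m : Lam * q ^- m.+1 * C * (4 * 8 ^+ n) * (2 * q) <= cst_k * C * q ^- m.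
Proof.
have qm : 0 < q ^+ m by rewrite exprn_gt0.
have -> : Lam * q ^- m.+1 * C * (4 * 8 ^+ n) * (2 * q) = 8 * 8 ^+ n * Lam * C * q ^- m.
  rewrite exprS; move: (q ^+ m) qm (8 ^+ n : R) => u u0 t.
  by field; rewrite !gt_eqF.
rewrite /cst_k; apply: ler_wpM2r; first by rewrite invr_ge0 ltW.
apply: ler_wpM2r => //; apply: ler_wpM2l; last by rewrite lerDl.
by rewrite mulr_ge0// exprn_ge0.
Qed.

Lemma smoothk_le x : `|smoothk x| <= cst_k * C * q ^- n.
Proof.
apply: le_trans (absorb n).
have [||_ B] := @tamed_integrable (fun z => phi (x - z) - phi x) _ (2 * q) (mdiff x) (la0 _) _ (diff_le x) _.
- by rewrite mulr_gt0.
- by move=> z /k2 ->; rewrite mulr0.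
exact: B.
Qed.

(** The difference in [x] is taken under the integral, where the mixed second difference [phi_lip2]
    again supplies the factor [|z|] that tames the singularity. *)
Lemma smoothk_lip x y : `|smoothk x - smoothk y| <= cst_k * C * q ^- n.+1 * `|x - y|.
Proof.
rewrite /smoothk -RintegralB//; [|exact: smoothk_integrable|exact: smoothk_integrable].
under eq_Rintegral do rewrite -mulrBl.
have [||||_ B] := @tamed_integrable (fun z => (phi (x - z) - phi x) - (phi (y - z) - phi y))
    (Lam * q ^- n.+2 * `|x - y|) (2 * q) _ _ _ (phi_lip2 x y) _.
- exact: measurable_funB.
- by rewrite mulr_ge0.
- by rewrite mulr_gt0.
- by move=> z /k2 ->; rewrite mulr0.
apply: le_trans B _; rewrite (_ : Lam * _ * _ * _ * _ * _ = Lam * q ^- n.+2 * C * (4 * 8 ^+ n) * (2 * q) * `|x - y|).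
  by rewrite ler_wpM2r// absorb.
by move: (8 ^+ n : R) (q ^- n.+2) => t u; ring.
Qed.

Lemma smoothk_supp x : 2 * q <= `|x| -> smoothk x = 0.
Proof.
move=> qx; rewrite /smoothk (eq_Rintegral _ _ (g := fun=> 0)) ?/Rintegral ?integral0// => z _.
have [zq|/k_supp ->] := leP `|z| q; last by rewrite mulr0.
rewrite !phi_supp ?subrr ?mul0r//.
  by apply: le_trans qx; rewrite ler_peMl ?(ltW q0)// ler1n.
by have := lerB_normD x (- z); rewrite normrN; lra.
Qed.

Lemma measurable_smoothk : measurable_fun setT smoothk.
Proof. exact: (measurable_Rint2 m2). Qed.

(** By Fubini the integral of [phi (x - z) - phi x] in [x] is taken first, and it vanishes by
    translation invariance. *)
Lemma integral_smoothk : \int[mu]_x smoothk x = 0.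
Proof.
pose F (p : V * V) : \bar R := ((phi (p.1 - p.2) - phi p.1) * k p.2)%:E.
have mF : measurable_fun setT F by exact/measurable_EFinP.
have q3 : 0 < 3 * q by rewrite mulr_gt0.
have diff_supp x z : 3 * q <= `|x| -> (phi (x - z) - phi x) * k z = 0.
  move=> qx; have [zq|/k_supp ->] := leP `|z| q; last by rewrite mulr0.
  rewrite !phi_supp ?subrr ?mul0r//; first by apply: le_trans qx; rewrite ler_peMl ?(ltW q0)// ler1n.
  by have := lerB_normD x (- z); rewrite normrN; lra.
have I : (mu \x mu)%E.-integrable setT F.
  apply/integrable12ltyP => //.
  pose c : \bar R := (Lam * q ^- n.+1 * C * (4 * 8 ^+ n) * (2 * q))%:E.
  have c0 : (0 <= c)%E by rewrite lee_fin !mulr_ge0 ?invr_ge0 ?exprn_ge0 ?(ltW q0).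
  apply: (@le_lt_trans _ _ (\int[mu]_(x in cube 0%R (3 * q)) c)%E); last first.
    rewrite integral_cst; last exact: measurable_cube.
    apply: lte_mul_pinfty => //; change (mu (cube 0%R (3 * q)) < +oo)%E.
    by rewrite rV_lebesgue_cube ?ltry// ltW.
  rewrite [leRHS]integral_mkcond; apply: ge0_le_integralT => x _; first exact: integral_ge0.
  rewrite /patch; case: ifPn => [_|/negP xq].
    apply: (tamed_integral (mdiff x) (la0 _) _ (diff_le x)) => [|z]; first by rewrite mulr_gt0.
    by move/k2 => ->; rewrite mulr0.
  rewrite integral0_eq// => z _; rewrite /F/= diff_supp ?abse0 ?normr0// leNgt; apply/negP => xq'.
  by apply: xq; apply: mem_set; apply/cubeE; rewrite ?subr0.
rewrite /Rintegral (_ : (\int[mu]_x (smoothk x)%:E)%E = (\int[mu]_x \int[mu]_z F (x, z))%E); last first.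
  apply: eq_integral => x _; rewrite /smoothk /Rintegral fineK//.
  by apply: integrable_fin_num => //; exact: smoothk_integrable.
rewrite (Fubini I) (_ : (\int[mu]_z _)%E = 0%E)//; apply: integral0_eq => z _.
have sh : (\int[mu]_x (phi (x - z))%:E = \int[mu]_x (phi x)%:E)%E.
  apply: (@ge0_integral_rV_subr R n (EFin \o phi)) => [|x]; first exact/measurable_EFinP.
  by rewrite lee_fin.
have I2 : mu.-integrable setT (EFin \o (fun x => phi (x - z))).
  apply/integrableP; split.
    by apply/measurable_EFinP; apply: measurableT_comp mphi _; exact: measurable_rV_addr.
  under eq_integral do rewrite gee0_abs ?lee_fin//.
  rewrite sh; have /integrableP[_] := phi_int.
  by under eq_integral do rewrite gee0_abs ?lee_fin//.
have I3 : mu.-integrable setT (EFin \o (fun x => phi (x - z) - phi x)).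
  by have := integrableB measurableT I2 phi_int.
have fn : (\int[mu]_x (phi x)%:E)%E \is a fin_num by exact: integrable_fin_num phi_int.
rewrite /F/=; under eq_integral do rewrite EFinM muleC.
rewrite integralZl//; rewrite (_ : (\int[mu]_x _)%E = 0%E) ?mule0//.
under eq_integral do rewrite EFinB.
by rewrite integralB_EFin// sh subee.
Qed.

End smoothed_kernel.

(** * Uniform bounds for smooth functions of compact support *)

Section smooth_bounds.
Context {R : realType} {n : nat}.
Local Notation V := 'rV[R]_n.
Local Notation mu := (rV_lebesgue n).
Implicit Types (x y z : V) (g phi : V -> R).
Local Notation dir i := (delta_mx ord0 i : V).

Lemma quotient_line g x (v : V) (t : R) :
  (fun h : R => h^-1 *: (((fun t => g (x + t *: v)) \o shift t) (h *: (1 : R)) - g (x + t *: v))) =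
  (fun h : R => h^-1 *: ((g \o shift (x + t *: v)) (h *: v) - g (x + t *: v))).
Proof.
apply/funext => h /=; congr (_ *: (g _ - _)).
have -> : h *: (1 : R) + t = h + t by rewrite /GRing.scale/= mulr1.
by rewrite scalerDl addrCA.
Qed.

Lemma is_derive_line g x (v : V) (t : R) : derivable g (x + t *: v) v ->
  is_derive t (1 : R) (fun t => g (x + t *: v)) ('D_v g (x + t *: v)).
Proof.
move=> dg; apply: DeriveDef; first by rewrite /derivable quotient_line.
by rewrite /derive quotient_line.
Qed.

Lemma line_lipschitz g x (v : V) (B t : R) : (forall x, derivable g x v) ->
  (forall x, `|'D_v g x| <= B) -> `|g (x + t *: v) - g x| <= B * `|t|.
Proof.
move=> dg gB; pose h (t : R) := g (x + t *: v).
have dh u : is_derive u (1 : R) h ('D_v g (x + u *: v)) by exact: is_derive_line.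
have key a b : a <= b -> `|h b - h a| <= B * `|b - a|.
  move=> ab; have [|c _ ->] := @MVT_segment R h (fun u => 'D_v g (x + u *: v)) a b ab.
    by apply: derivable_within_continuous => u _; have [] := dh u.
  by rewrite normrM ler_wpM2r.
have -> : g x = h 0 by rewrite /h scale0r addr0.
have [t0|/ltW t0] := leP 0 t; first by have := key 0 t t0; rewrite subr0.
by rewrite distrC; have := key t 0 t0; rewrite sub0r normrN.
Qed.

(** The coordinates are changed one at a time; [z j] takes its first [j] coordinates from [x] and
    the others from [y]. *)
Lemma coord_lipschitz g (B : R) : (forall (i : 'I_n) x, derivable g x (dir i)) ->
  (forall (i : 'I_n) x, `|'D_(dir i) g x| <= B) -> forall x y, `|g x - g y| <= n%:R * B * `|x - y|.
Proof.
move=> dg gB x y; pose z (j : nat) : V := \row_i (if (i < j)%N then x ord0 i else y ord0 i).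
have z0 : z 0 = y by apply/rowP => i; rewrite mxE.
have zn : z n = x by apply/rowP => i; rewrite mxE ltn_ord.
have zS (j : 'I_n) : z j.+1 = z j + (x ord0 j - y ord0 j) *: dir j.
  apply/rowP => i; rewrite !mxE eqxx/= ltnS leq_eqVlt -(inj_eq val_inj)/=.
  case: eqP => [e|ne]/=; last by rewrite mulr0 addr0.
  by rewrite (val_inj e) ltnn mulr1 addrC subrK.
have : `|g (z n) - g (z 0)| <= \sum_(j < n) `|g (z j.+1) - g (z j)|.
  rewrite -(telescope_sumr (fun j => g (z j)) (leq0n n)) big_mkord; exact: ler_norm_sum.
rewrite z0 zn; move/le_trans; apply; rewrite -mulrA -[n in n%:R]card_ord mulr_natl -sumr_const.
apply: ler_sum => j _; rewrite zS.
have B0 : 0 <= B by apply: le_trans (gB j x); exact: normr_ge0.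
apply: le_trans (line_lipschitz _ _ (dg j) (gB j)) _; rewrite ler_wpM2l//.
by have := norm_coord (x - y) j; rewrite !mxE.
Qed.

Lemma continuous_bounded g : continuous g -> (forall x, 4^-1 < `|x| -> g x = 0) ->
  exists B, forall x, `|g x| <= B.
Proof.
move=> cg gs; pose A : set V := [set v | forall i, `[-1, 1]%classic (v ord0 i)].
have cA : compact A by exact: (@rV_compact R n (fun _ => `[-1, 1]%classic) (fun i => @segment_compact R (-1) 1)).
have [b [_ Hb]] := compact_bounded (continuous_compact (continuous_subspaceT cg) cA).
exists (Num.max 0 (b + 1)) => x; rewrite le_max.
have [x1|x1] := leP `|x| 1; last first.
  by rewrite gs ?normr0 ?lexx//; apply: lt_trans x1; rewrite invf_lt1// ltr1n.
apply/orP; right; apply: (Hb (b + 1)); first by rewrite ltrDl.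
exists x => // i; rewrite /= in_itv/= -ler_norml.
exact: le_trans (norm_coord x i) x1.
Qed.

Lemma derive_supp g (v : V) x : (forall x, 4^-1 < `|x| -> g x = 0) -> 4^-1 < `|x| -> 'D_v g x = 0.
Proof.
move=> gs xx; rewrite (@near_eq_derive _ _ _ g (cst 0) x v) ?derive_cst//.
have : nbhs x [set y : V | 4^-1 < `|y|].
  apply: open_nbhs_nbhs; split => //.
  rewrite (_ : [set y : V | _] = (fun y : V => `|y|) @^-1` [set t : R | 4^-1 < t])//.
  by apply: open_comp; [move=> y _; exact: norm_continuous|exact: open_gt].
by apply: filterS => y; exact: gs.
Qed.

Variable phi : V -> R.
Hypothesis phi_smooth : smooth phi.
Hypothesis phi_supp : forall x, 4^-1 < enorm x -> phi x = 0.

Let supp0 x : 4^-1 < `|x| -> phi x = 0.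
Proof. by move=> h; apply: phi_supp; exact: lt_le_trans (norm_le_enorm x). Qed.

Let suppi s x : 4^-1 < `|x| -> iter_partial s phi x = 0.
Proof. by elim: s x => [|i s ih] x; [exact: supp0|exact: derive_supp]. Qed.

Let bound_partial s : exists B, forall x, `|iter_partial s phi x| <= B.
Proof. by apply: continuous_bounded; [case: (phi_smooth s)|exact: suppi]. Qed.

(** The last bound is [coord_lipschitz] for the function sending [x] to [phi (x - z) - phi x]: its
    partial derivatives are differences of those of [phi], hence of size [|z|]. *)
Lemma smooth_bounds : exists Lam, [/\ 0 < Lam, forall x, `|phi x| <= Lam,
  forall x y, `|phi x - phi y| <= Lam * `|x - y| &
  forall x y z, `|(phi (x - z) - phi x) - (phi (y - z) - phi y)| <= Lam * `|x - y| * `|z|].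
Proof.
have [B0 HB0] := bound_partial [::].
have [B1 HB1] := choice (fun i : 'I_n => bound_partial [:: i]).
have [B2 HB2] := choice (fun ij : 'I_n * 'I_n => bound_partial [:: ij.1; ij.2]).
pose S1 := \sum_i `|B1 i|; pose S2 := \sum_ij `|B2 ij|.
have b1 i x : `|'D_(dir i) phi x| <= S1.
  apply: le_trans (HB1 i x) _; apply: le_trans (ler_norm _) _.
  by rewrite /S1 (bigD1 i)//= lerDl; exact: sumr_ge0.
have b2 i j x : `|'D_(dir i) (iter_partial [:: j] phi) x| <= S2.
  apply: le_trans (HB2 (i, j) x) _; apply: le_trans (ler_norm _) _.
  by rewrite /S2 (bigD1 (i, j))//= lerDl; exact: sumr_ge0.
have S10 : 0 <= S1 by exact: sumr_ge0.
have S20 : 0 <= S2 by exact: sumr_ge0.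
have l0 := coord_lipschitz (phi_smooth [::]).2 b1.
have l1 j := coord_lipschitz (phi_smooth [:: j]).2 (fun i => b2 i j).
have n0 : 0 <= n%:R :> R by exact: ler0n.
pose Lam := `|B0| + n%:R * S1 + n%:R * (n%:R * S2) + 1.
have t1 : 0 <= n%:R * S1 by exact: mulr_ge0.
have t2 : 0 <= n%:R * (n%:R * S2) by rewrite !mulr_ge0.
have t0 := normr_ge0 B0.
exists Lam; split.
- by rewrite /Lam; lra.
- by move=> x; apply: le_trans (HB0 x) _; have := ler_norm B0; rewrite /Lam; lra.
- move=> x y; apply: le_trans (l0 x y) _; rewrite ler_wpM2r// /Lam; lra.
move=> x y z.
have shiftE (i : 'I_n) u : (fun h : R => h^-1 *: (((fun x => phi (x - z) - phi x) \o shift u) (h *: dir i) -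
     (phi (u - z) - phi u))) =
   (fun h : R => h^-1 *: ((phi \o shift (u - z)) (h *: dir i) - phi (u - z))) \-
   (fun h : R => h^-1 *: ((phi \o shift u) (h *: dir i) - phi u)).
  apply/funext => h /=; rewrite /GRing.scale/= -mulrBr addrA; congr (_ * _); ring.
have d (i : 'I_n) u : is_derive u (dir i) (fun x => phi (x - z) - phi x)
    ('D_(dir i) phi (u - z) - 'D_(dir i) phi u).
  have c1 : derivable phi (u - z) (dir i) := (phi_smooth [::]).2 i (u - z).
  have c2 : derivable phi u (dir i) := (phi_smooth [::]).2 i u.
  have L : (fun h : R => h^-1 *: (((fun x => phi (x - z) - phi x) \o shift u) (h *: dir i) -
     (phi (u - z) - phi u))) @ (0 : R)^' --> ('D_(dir i) phi (u - z) - 'D_(dir i) phi u : R).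
    by rewrite shiftE; apply: cvgB; [exact: c1|exact: c2].
  apply: DeriveDef; first by apply/cvg_ex; eexists; exact: L.
  exact: cvg_lim L.
have b (i : 'I_n) u : `|'D_(dir i) (fun x => phi (x - z) - phi x) u| <= n%:R * S2 * `|z|.
  have [_ ->] := d i u; apply: le_trans (l1 i _ _) _.
  by rewrite addrAC subrr add0r normrN.
have := coord_lipschitz (fun i u => let: DeriveDef h _ := d i u in h) b x y.
move/le_trans; apply; rewrite mulrA -(mulrA (n%:R * _)) (mulrC `|z|) mulrA.
by rewrite ler_wpM2r// ler_wpM2r// /Lam; lra.
Qed.

End smooth_bounds.

(** * Existence and value of the principal value *)

Section principal_value.
Context {R : realType} {n : nat}.
Local Notation V := 'rV[R]_n.
Local Notation mu := (rV_lebesgue n).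
Implicit Types (x y z : V).
Variables (n0 : (0 < n)%N) (phi : V -> R) (Lam : R).
Hypotheses (cphi : continuous phi) (phi_ge0 : forall x, 0 <= phi x).
Hypothesis phi_supp : forall x, 4^-1 < enorm x -> phi x = 0.
Hypotheses (Lam0 : 0 < Lam) (phi_le : forall x, `|phi x| <= Lam).
Hypothesis phi_lip : forall x y, `|phi x - phi y| <= Lam * `|x - y|.
Hypothesis phi_lip2 : forall x y z,
  `|(phi (x - z) - phi x) - (phi (y - z) - phi y)| <= Lam * `|x - y| * `|z|.
Variable q : R.
Hypothesis q0 : 0 < q.

Definition phiq x : R := q ^- n * phi (q^-1 *: x).

Let qn0 m : 0 < q ^- m. Proof. by rewrite invr_gt0 exprn_gt0. Qed.
Let qn0w m : 0 <= q ^- m. Proof. exact: ltW. Qed.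
Let qV0 : 0 < q^-1. Proof. by rewrite invr_gt0. Qed.
Let normq x : `|q^-1 *: x| = q^-1 * `|x|.
Proof. by rewrite normrZ gtr0_norm. Qed.

Lemma measurable_phiq : measurable_fun setT phiq.
Proof.
apply: measurable_funM => //; apply: continuous_rV_measurable => x.
apply: continuous_comp; last exact: cphi.
exact: scaler_continuous.
Qed.

Lemma phiq_ge0 x : 0 <= phiq x. Proof. exact: mulr_ge0. Qed.

Lemma phiq_supp x : q <= `|x| -> phiq x = 0.
Proof.
move=> qx; rewrite /phiq phi_supp ?mulr0//.
apply: lt_le_trans (norm_le_enorm _); rewrite normq.
apply: (@lt_le_trans _ _ 1); first by rewrite invf_lt1// ltr1n.
by rewrite mulrC ler_pdivlMr// mul1r.
Qed.

Lemma phiq_lip x y : `|phiq x - phiq y| <= Lam * q ^- n.+1 * `|x - y|.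
Proof.
rewrite /phiq -mulrBr normrM (ger0_norm (qn0w n)).
apply: le_trans (ler_wpM2l (qn0w n) (phi_lip _ _)) _.
by rewrite -scalerBr normq exprS invfM le_eqVlt; apply/orP; left; apply/eqP; ring.
Qed.

Lemma phiq_lip2 x y z : `|(phiq (x - z) - phiq x) - (phiq (y - z) - phiq y)| <=
  Lam * q ^- n.+2 * `|x - y| * `|z|.
Proof.
rewrite /phiq -!mulrBr normrM (ger0_norm (qn0w n)) !scalerBr.
apply: le_trans (ler_wpM2l (qn0w n) (phi_lip2 _ _ _)) _.
by rewrite -scalerBr !normq !exprS !invfM le_eqVlt; apply/orP; left; apply/eqP; ring.
Qed.

Lemma phiq_integrable : mu.-integrable setT (EFin \o phiq).
Proof.
apply/integrableP; split; first by apply/measurable_EFinP; exact: measurable_phiq.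
apply: (@le_lt_trans _ _ (\int[mu]_(x in cube 0%R q) (q ^- n * Lam)%:E)%E); last first.
  rewrite integral_cst; last exact: measurable_cube.
  apply: lte_mul_pinfty; rewrite ?lee_fin ?mulr_ge0// ?(ltW Lam0)//.
  by change (mu (cube 0%R q) < +oo)%E; rewrite rV_lebesgue_cube ?ltry// ltW.
rewrite [leRHS]integral_mkcond; apply: ge0_le_integralT => x _ //.
rewrite /patch; case: ifPn => [_|/negP xq] /=.
  by rewrite lee_fin /phiq normrM (ger0_norm (qn0w n)) ler_wpM2l.
rewrite phiq_supp ?normr0// leNgt; apply/negP => xq'; apply: xq; apply: mem_set.
by apply/cubeE; rewrite ?subr0.
Qed.

Variables (C : R) (kap : V -> R).
Hypotheses (C0 : 0 <= C) (mkap : measurable_fun setT kap).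
Hypothesis kap_le : forall z, `|kap z| <= C * `|z| ^- n.
Hypothesis kap_int : forall e r : R, 0 < e -> e < r ->
  \int[mu]_(z in [set z | e < enorm z < r]) kap z = 0.

Definition kapq z : R := if enorm z <= q then kap z else 0.

Let mset (P : R -> bool) : measurable [set t : R | P t] -> measurable [set z : V | P (enorm z)].
Proof. by move=> mP; have := @measurable_enorm R n measurableT _ mP; rewrite setTI. Qed.

Let m_le r : measurable [set z : V | enorm z <= r].
Proof.
apply: (mset (P := fun t => t <= r)); rewrite (_ : [set t | _] = `]-oo, r]%classic); first exact: measurable_itv.
by apply/seteqP; split => t; rewrite /= in_itv.
Qed.

Let m_lt r : measurable [set z : V | enorm z < r].
Proof.
apply: (mset (P := fun t => t < r)); rewrite (_ : [set t | _] = `]-oo, r[%classic); first exact: measurable_itv.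
by apply/seteqP; split => t; rewrite /= in_itv.
Qed.

Let annle (e r : R) : set V := [set z | e < enorm z <= r].
Let annlt (e r : R) : set V := [set z | e < enorm z < r].

Let m_annle e r : measurable (annle e r).
Proof.
rewrite (_ : annle e r = [set z | enorm z <= r] `\` [set z | enorm z <= e]); first exact: measurableD.
by apply/seteqP; split => z /= => [/andP[h1 h2]|[h1 /negP]]; [split=> //; apply/negP|]; rewrite -ltNge// => h2; apply/andP.
Qed.

Let m_annlt e r : measurable (annlt e r).
Proof.
rewrite (_ : annlt e r = [set z | enorm z < r] `\` [set z | enorm z <= e]); first exact: measurableD.
by apply/seteqP; split => z /= => [/andP[h1 h2]|[h1 /negP]]; [split=> //; apply/negP|]; rewrite -ltNge// => h2; apply/andP.
Qed.

Lemma measurable_kapq : measurable_fun setT kapq.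
Proof.
rewrite (_ : kapq = (kap \_ [set z | enorm z <= q])).
  by apply/(measurable_restrictT _ _).1 => //; exact: measurable_funTS.
apply/funext => z; rewrite /kapq /patch; case: ifPn => h; first by rewrite mem_set.
by rewrite memNset//; exact/negP.
Qed.

Lemma kapq_le z : `|kapq z| <= C * `|z| ^- n.
Proof.
rewrite /kapq; case: ifP => // _; rewrite normr0 mulr_ge0// invr_ge0 exprn_ge0//.
Qed.

Lemma kapq_supp z : q < `|z| -> kapq z = 0.
Proof. by move=> qz; rewrite /kapq leNgt (lt_le_trans qz (norm_le_enorm z)). Qed.

Let enorm_lt_supp r z : r <= `|z| -> r <= enorm z.
Proof. by move/le_trans; apply; exact: norm_le_enorm. Qed.

(** A bounded multiplier that vanishes near the origin is at most a multiple of [|z|], so it tames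
    the kernel; [Num.sqrt n%:R] compares the two norms. *)
Let away (u : V -> R) (B e r : R) : measurable_fun setT u -> 0 <= B -> 0 < e -> 0 < r ->
  (forall z, `|u z| <= B) -> (forall z, enorm z <= e -> u z = 0) -> (forall z, r <= `|z| -> u z = 0) ->
  mu.-integrable setT (EFin \o (fun z => u z * kap z)).
Proof.
move=> mu_ B0 e0 r0 uB ue ur.
pose a := B * Num.sqrt n%:R / e.
have a0 : 0 <= a by rewrite divr_ge0 ?mulr_ge0 ?sqrtr_ge0// ltW.
have ua z : `|u z| <= a * `|z|.
  have [/ue ->|ez] := leP (enorm z) e; first by rewrite normr0 mulr_ge0.
  apply: le_trans (uB z) _; rewrite /a mulrAC ler_pdivlMr// -mulrA; apply: ler_wpM2l => //.
  exact: le_trans (ltW ez) (enorm_le_norm z).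
have uk z : r <= `|z| -> u z * kap z = 0 by move=> /ur ->; rewrite mul0r.
by have [] := tamed_integrable C0 mkap kap_le mu_ a0 r0 ua uk.
Qed.

Let ind (D : set V) (u : V -> R) : \int[mu]_(z in D) u z = \int[mu]_z (\1_D z * u z).
Proof.
rewrite Rintegral_mkcond; apply: eq_Rintegral => z _.
by rewrite /patch indicE; case: ifP; rewrite ?mul1r ?mul0r.
Qed.

Let ind_le (D : set V) z : `|\1_D z : R| <= 1.
Proof. by rewrite indicE; case: (_ \in _); rewrite ?normr1 ?normr0. Qed.

(** Cancellation is given on open annuli; the half-closed annulus is the difference of those from
    [e] to [2 q] and from [q] to [2 q]. *)
Let annle_int e : 0 < e -> e < q -> \int[mu]_z (\1_(annle e q) z * kap z) = 0.
Proof.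
move=> e0 eq.
have q2 : 0 < 2 * q by rewrite mulr_gt0.
have split z : \1_(annle e q) z * kap z = \1_(annlt e (2 * q)) z * kap z - \1_(annlt q (2 * q)) z * kap z :> R.
  rewrite -mulrBl; congr (_ * _); rewrite !indicE.
  have [zq|zq] := leP (enorm z) q.
    rewrite (memNset (_ : ~ annlt q (2 * q) z)) ?subr0; last by rewrite /annlt/= ltNge zq.
    congr (nat_of_bool _)%:R; apply/idP/idP => /set_mem /andP[h1 h2]; apply: mem_set; apply/andP; split => //.
    by apply: le_lt_trans zq _; rewrite ltr_pMl// ltr1n.
  rewrite (memNset (_ : ~ annle e q z)); last by rewrite /annle/= leNgt zq andbF.
  rewrite (_ : (z \in annlt e (2 * q)) = (z \in annlt q (2 * q))) ?subrr//.
  apply/idP/idP => /set_mem /andP[h1 h2]; apply: mem_set; apply/andP; split => //.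
  exact: lt_trans h1.
have I a b : 0 < a -> mu.-integrable setT (EFin \o (fun z => \1_(annlt a b) z * kap z)).
  move=> a0; apply: (@away _ 1 a (Num.max b 1)) => //.
  - by rewrite lt_max ltr01 orbT.
  - by move=> z za; rewrite indicE memNset// /annlt/= ltNge za.
  - move=> z; rewrite ge_max => /andP[zb _]; rewrite indicE memNset// /annlt/= => /andP[_].
    by rewrite ltNge (enorm_lt_supp zb).
under eq_Rintegral do rewrite split.
rewrite RintegralB//; [|exact: I|exact: I].
by rewrite -!ind !kap_int ?subrr// ?(lt_trans eq)// ltr_pMl// ltr1n.
Qed.

Let mdiff x : measurable_fun setT (fun z => phiq (x - z) - phiq x).
Proof. by apply: measurable_funB => //; apply: measurable_kernel; exact: measurable_phiq. Qed.

Let diff_le x z : `|phiq (x - z) - phiq x| <= Lam * q ^- n.+1 * `|z|.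
Proof. by apply: le_trans (phiq_lip _ _) _; rewrite addrAC subrr add0r normrN. Qed.

Let la0 : 0 <= Lam * q ^- n.+1. Proof. by rewrite mulr_ge0// ltW. Qed.

(** By cancellation [phiq x] may be subtracted in the truncated integral too; the error is then an
    integral over the ball of radius [e], and is of order [e]. *)
Let trunc_diff x e : 0 < e -> e < q ->
  `|smoothk phiq kapq x - \int[mu]_(z in annle e q) (phiq (x - z) * kap z)| <=
  Lam * q ^- n.+1 * C * (4 * 8 ^+ n) * (2 * e).
Proof.
move=> e0 eq; have me := m_annle e q.
have mI D : measurable D -> measurable_fun setT (\1_D : V -> R) by move=> mD; exact: measurable_indic.
have I1 : mu.-integrable setT (EFin \o (fun z => (phiq (x - z) - phiq x) * kapq z)).
  apply: (smoothk_integrable q0 C0 (ltW Lam0) measurable_phiq measurable_kapq kapq_le kapq_supp phiq_lip).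
have q2 : 0 < 2 * q by rewrite mulr_gt0.
have van z : 2 * q <= `|z| -> \1_(annle e q) z = 0 :> R.
  move=> zq; rewrite indicE memNset// /annle/= => /andP[_]; rewrite leNgt (lt_le_trans _ (enorm_lt_supp zq))//.
  by rewrite ltr_pMl// ltr1n.
have van0 z : enorm z <= e -> \1_(annle e q) z = 0 :> R.
  by move=> ze; rewrite indicE memNset// /annle/= ltNge ze.
have I2 : mu.-integrable setT (EFin \o (fun z => (phiq (x - z) * \1_(annle e q) z) * kap z)).
  apply: (@away _ (q ^- n * Lam) e (2 * q)) => //.
  - by apply: measurable_funM; [apply: measurable_kernel; exact: measurable_phiq|exact: mI].
  - by rewrite mulr_ge0 ?ltW.
  - move=> z; rewrite normrM -[leRHS]mulr1; apply: ler_pM => //.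
    by rewrite /phiq normrM (ger0_norm (qn0w n)) ler_wpM2l.
  - by move=> z /van0 ->; rewrite mulr0.
  - by move=> z /van ->; rewrite mulr0.
have I3 : mu.-integrable setT (EFin \o (fun z => (phiq x * \1_(annle e q) z) * kap z)).
  apply: (@away _ (q ^- n * Lam) e (2 * q)) => //.
  - by apply: measurable_funM => //; exact: mI.
  - by rewrite mulr_ge0 ?ltW.
  - move=> z; rewrite normrM -[leRHS]mulr1; apply: ler_pM => //.
    by rewrite /phiq normrM (ger0_norm (qn0w n)) ler_wpM2l.
  - by move=> z /van0 ->; rewrite mulr0.
  - by move=> z /van ->; rewrite mulr0.
have Z : \int[mu]_z ((phiq x * \1_(annle e q) z) * kap z) = 0.
  under eq_Rintegral do rewrite -mulrA.
  rewrite RintegralZl ?annle_int ?mulr0//.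
  apply: (@away _ 1 e (2 * q)) => //; exact: mI.
have PE : \int[mu]_(z in annle e q) (phiq (x - z) * kap z) =
    \int[mu]_z ((phiq (x - z) * \1_(annle e q) z) * kap z - (phiq x * \1_(annle e q) z) * kap z).
  rewrite RintegralB// Z subr0 ind; apply: eq_Rintegral => z _; ring.
rewrite PE /smoothk -RintegralB//; last first.
  by have := integrableB measurableT I2 I3.
have E z : (phiq (x - z) - phiq x) * kapq z -
    ((phiq (x - z) * \1_(annle e q) z) * kap z - (phiq x * \1_(annle e q) z) * kap z) =
    ((phiq (x - z) - phiq x) * \1_[set z | enorm z <= e] z) * kap z.
  have [ze|ze] := leP (enorm z) e.
    have -> : \1_(annle e q) z = 0 :> R by exact: van0.
    have -> : \1_[set z | enorm z <= e] z = 1 :> R by rewrite indicE mem_set.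
    have -> : kapq z = kap z by rewrite /kapq (le_trans ze (ltW eq)).
    ring.
  have -> : \1_[set z | enorm z <= e] z = 0 :> R by rewrite indicE memNset//= leNgt ze.
  have [zq|zq] := leP (enorm z) q.
    have -> : \1_(annle e q) z = 1 :> R by rewrite indicE mem_set//; apply/andP.
    have -> : kapq z = kap z by rewrite /kapq zq.
    ring.
  have -> : \1_(annle e q) z = 0 :> R by rewrite indicE memNset// /annle/= leNgt zq andbF.
  have -> : kapq z = 0 by rewrite /kapq leNgt zq.
  ring.
under eq_Rintegral do rewrite E.
have [|||||_ //] := @tamed_integrable R n C kap C0 mkap kap_le
  (fun z => (phiq (x - z) - phiq x) * \1_[set z | enorm z <= e] z) (Lam * q ^- n.+1) (2 * e) _.
- by apply: measurable_funM; [exact: mdiff|exact: mI].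
- by [].
- by rewrite mulr_gt0.
- move=> z; rewrite normrM -[leRHS]mulr1; apply: ler_pM => //; exact: diff_le.
- move=> z ze; rewrite indicE memNset ?mulr0 ?mul0r//= => ze'; move: (enorm_lt_supp ze).
  by rewrite leNgt (le_lt_trans ze')// ltr_pMl// ltr1n.
Qed.

Theorem pv_limit x :
  \int[mu]_(z in [set z | e < enorm z <= q]) (phiq (x - z) * kap z) @[e --> 0^'+] -->
  smoothk phiq kapq x.
Proof.
pose B := Lam * q ^- n.+1 * C * (4 * 8 ^+ n) * 2 + 1.
have B0 : 0 < B by rewrite ltr_wpDl// !mulr_ge0// ?exprn_ge0// ltW.
apply/cvgrPdist_le => eps eps0; near=> e.
have e0 : 0 < e by near: e; exact: nbhs_right_gt.
have eq : e < q by near: e; exact: nbhs_right_lt.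
have eB : e < eps / B by near: e; apply: nbhs_right_lt; rewrite divr_gt0.
apply: le_trans (trunc_diff x e0 eq) _.
apply: (@le_trans _ _ (B * e)).
  have -> : Lam * q ^- n.+1 * C * (4 * 8 ^+ n) * (2 * e) = (B - 1) * e by rewrite /B; ring.
  by apply: ler_wpM2r; [exact: ltW|rewrite gerBl].
by rewrite mulrC -ler_pdivlMr// ltW.
Unshelve. all: by end_near.
Qed.

End principal_value.

(** * Normalised kernels from one real part of the kernel *)

Section kernel_part.
Context {R : realType} {n : nat}.
Local Notation V := 'rV[R]_n.
Local Notation mu := (rV_lebesgue n).
Implicit Types (x y z : V) (k : int) (e r : R).
Variables (n0 : (0 < n)%N) (phi : V -> R) (Lam : R).
Hypotheses (cphi : continuous phi) (phi_ge0 : forall x, 0 <= phi x).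
Hypothesis phi_supp : forall x, 4^-1 < enorm x -> phi x = 0.
Hypotheses (Lam0 : 0 < Lam) (phi_le : forall x, `|phi x| <= Lam).
Hypothesis phi_lip : forall x y, `|phi x - phi y| <= Lam * `|x - y|.
Hypothesis phi_lip2 : forall x y z,
  `|(phi (x - z) - phi x) - (phi (y - z) - phi y)| <= Lam * `|x - y| * `|z|.

Lemma enorm_gt0 x : x != 0 -> 0 < enorm x.
Proof. by move=> x0; apply: lt_le_trans (norm_le_enorm x); rewrite normr_gt0. Qed.

Lemma dilateE k x : dilate phi k x = phiq phi (2 ^ k) x.
Proof. by rewrite /dilate /phiq invr_expz exprnN exprz_exp mulrN. Qed.

Lemma measurable_annulus e r : measurable [set z : V | e < enorm z < r].
Proof.
have := @measurable_enorm R n measurableT _ (measurable_itv `]e, r[); rewrite setTI.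
by congr measurable; apply/seteqP; split => z; rewrite /= in_itv.
Qed.

Lemma measurable_annulus_le e r : measurable [set z : V | e < enorm z <= r].
Proof.
have := @measurable_enorm R n measurableT _ (measurable_itv `]e, r]); rewrite setTI.
by congr measurable; apply/seteqP; split => z; rewrite /= in_itv.
Qed.

Lemma ae_eq_Rintegral (D : set V) (f g : V -> R) : measurable D -> measurable_fun setT g ->
  (\forall x \ae mu, D x -> f x = g x) -> \int[mu]_(x in D) f x = \int[mu]_(x in D) g x.
Proof.
move=> mD mg fg; rewrite /Rintegral; congr fine; apply: ae_eq_integralT => //.
  by apply/measurable_EFinP; exact: measurable_funTS.
by apply: filterS fg => x H Dx; rewrite H.
Qed.

Variables (k0 : V -> R) (C : R).
Hypotheses (mk0 : lebesgue_measurable k0) (C0 : 0 <= C).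
Hypothesis k0_le : forall z, z != 0 -> `|k0 z| <= C * enorm z ^- n.
Hypothesis k0_int : forall e r : R, 0 < e -> e < r ->
  \int[mu]_(z in [set z | e < enorm z < r]) k0 z = 0.

(** A Borel version is set to [0] at the origin and wherever it violates the size bound, which then
    holds everywhere. The maximum norm is the smaller one, so the bound is weakened by using it. *)
Let borel_version : exists kap : V -> R, [/\ measurable_fun setT kap,
  forall z, `|kap z| <= C * `|z| ^- n & \forall z \ae mu, z != 0 -> k0 z = kap z].
Proof.
have [g mg k0g] := mk0.
pose D := [set z : V | 0 < `|z|] `&` [set z : V | `|g z| * `|z| ^+ n <= C].
have mN := @measurable_rV_norm R n.
have mD : measurable D.
  apply: measurableI.
    have := mN measurableT _ (measurable_itv `]0, +oo[); rewrite setTI.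
    by congr measurable; apply/seteqP; split => z; rewrite /= in_itv/= andbT.
  have m1 : measurable_fun setT (fun z : V => `|g z| * `|z| ^+ n).
    by apply: measurable_funM; [exact: measurableT_comp|exact: measurable_funX].
  have := m1 measurableT _ (measurable_itv `]-oo, C]); rewrite setTI.
  by congr measurable; apply/seteqP; split => z; rewrite /= in_itv.
exists (g \_ D); split.
- exact/(measurable_restrictT _ _).1/measurable_funTS.
- move=> z; rewrite /patch; case: ifPn => [/set_mem[z0 zC]|_].
    by rewrite ler_pdivlMr// exprn_gt0.
  by rewrite normr0 mulr_ge0// invr_ge0 exprn_ge0.
- apply: filterS k0g => z k0g z0; have z1 : 0 < `|z| by rewrite normr_gt0.
  rewrite /patch mem_set//; split => //=; rewrite -k0g -ler_pdivlMr ?exprn_gt0//.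
  apply: le_trans (k0_le z0) _; apply: ler_wpM2l => //.
  by rewrite lef_pV2 ?posrE ?exprn_gt0 ?enorm_gt0// lerXn2r ?nnegrE ?enorm_ge0// norm_le_enorm.
Qed.

Lemma kernel_part : exists psi : int -> V -> R, forall k : int, LPker (2 ^ k) (psi k) /\
  forall x, (\int[mu]_(z in [set z | e < enorm z <= 2 ^ k]) (dilate phi k (x - z) * k0 z))
    @[e --> 0^'+] --> @cst_k R n Lam * C * psi k x.
Proof.
have [kap [mkap kap_le k0kap]] := borel_version.
have q0 k : 0 < (2 ^ k : R) by rewrite exprz_gt0.
have L0 := ltW Lam0.
have c0 : 0 < @cst_k R n Lam by rewrite /cst_k !mulr_gt0 ?exprn_gt0// ltr_wpDl.
have kap_int (e r : R) : 0 < e -> e < r -> \int[mu]_(z in [set z | e < enorm z < r]) kap z = 0.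
  move=> e0 er; rewrite -(k0_int e0 er); apply/esym/ae_eq_Rintegral => //; first exact: measurable_annulus.
  apply: filterS k0kap => z H /andP[ez _]; apply: H; apply: contraTneq ez => ->.
  by rewrite -leNgt (le_trans (enorm_le_norm 0))// normr0 mulr0 ltW.
pose sk k := smoothk (phiq phi (2 ^ k)) (kapq (2 ^ k) kap).
have ks k := kapq_supp kap (q := 2 ^ k).
have kl k := kapq_le (2 ^ k) C0 kap_le.
have mkq k := measurable_kapq (2 ^ k) mkap.
have mpq k := measurable_phiq cphi (2 ^ k).
have lip1 k := phiq_lip phi_lip (q0 k).
have lip2 k := phiq_lip2 phi_lip2 (q0 k).
have ps k := phiq_supp phi_supp (q0 k).
have pge k := phiq_ge0 phi_ge0 (q0 k).
have pint k := phiq_integrable cphi phi_supp Lam0 phi_le (q0 k).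
have size_sk k x : `|sk k x| <= @cst_k R n Lam * C * (2 ^ k) ^- n.
  exact: (smoothk_le (q0 k) C0 L0 (mpq k) (mkq k) (kl k) (@ks k) (lip1 k)).
have supp_sk k x : 2 * 2 ^ k <= `|x| -> sk k x = 0.
  by move=> qx; exact: (smoothk_supp (q0 k) (@ks k) (@ps k) qx).
pose A := @cst_k R n Lam * C.
have A0 : 0 <= A by rewrite mulr_ge0// ltW.
exists (fun k x => A^-1 * sk k x) => k; split; last first.
  move=> x; rewrite (_ : _ * _ = sk k x); last first.
    (* If [A] is zero, the size bound makes the smoothed kernel vanish, and both sides are zero. *)
    have [A00|A1] := eqVneq A 0; last by rewrite -/A mulrA divff// mul1r.
    have := size_sk k x; rewrite -/A A00 mul0r mul0r.
    by rewrite normr_le0 => /eqP.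
  have L := pv_limit cphi Lam0 phi_le phi_lip (q0 k) C0 mkap kap_le kap_int (x := x).
  apply: cvg_trans L.
  apply: near_eq_cvg; near=> e.
  have e0 : 0 < e by near: e; exact: nbhs_right_gt.
  apply/esym; under eq_Rintegral do rewrite dilateE.
  apply: ae_eq_Rintegral; first exact: measurable_annulus_le.
    by apply: measurable_funM => //; exact: measurable_kernel.
  apply: filterS k0kap => z H /andP[ez _]; rewrite H//; apply: contraTneq ez => ->.
  by rewrite -leNgt (le_trans (enorm_le_norm 0))// normr0 mulr0 ltW.
have Adiv (t B : R) : 0 <= B -> t <= A * B -> A^-1 * t <= B.
  move=> B0 tB; have [A00|A1] := eqVneq A 0; first by rewrite A00 invr0 mul0r.
  by rewrite mulrC ler_pdivrMr 1?mulrC// lt_neqAle eq_sym A1.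
have AV : `|A^-1| = A^-1 by rewrite ger0_norm// invr_ge0.
split.
- apply: measurable_funM => //; exact: measurable_smoothk.
- by move=> x; rewrite normrM AV; apply: Adiv; [rewrite invr_ge0 exprn_ge0// ltW|exact: size_sk].
- by move=> x qx; rewrite (supp_sk k x qx) mulr0.
- move=> x y; rewrite -mulrBr normrM AV; apply: Adiv; first by rewrite mulr_ge0// invr_ge0 exprn_ge0// ltW.
  rewrite mulrA; exact: (smoothk_lip (q0 k) C0 L0 (mpq k) (mkq k) (kl k) (@ks k) (lip1 k) (lip2 k)).
- have I0 := integral_smoothk (q0 k) C0 L0 (mpq k) (mkq k) (kl k) (@ks k) (@ps k) (pge k) (pint k) (lip1 k).
  rewrite -[RHS](mulr0 A^-1) -I0 RintegralZl//.
  have l1 : locint (fun _ : V => 1 : R).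
    split => // c r; have [r0|r0] := ltP 0 r.
      rewrite (_ : (fun y => _) = cst 1%:E) ?cubeint_cst ?ltry// ?ltW//.
      by apply/funext => y; rewrite normr1.
    rewrite /cubeint (_ : cube c r = set0) ?integral_set0//; apply/seteqP; split => // z.
    by move/(_ (Ordinal n0)); rewrite ltNge (le_trans r0).
  have b1 z : `|sk k z| <= @cst_k R n Lam * C * (2 ^ k) ^- n * \1_(cube 0%R (2 * 2 ^ k)) z.
    rewrite indicE; have [zk|zk] := leP (2 * 2 ^ k) `|z|.
      rewrite (supp_sk k z zk) normr0 mulr_ge0// (le_trans _ (size_sk k 0))//.
    rewrite mem_set ?mulr1//; apply/cubeE; first by rewrite mulr_gt0.
    by rewrite subr0.
  have [|I _] := kernel_bound l1 _ (le_trans (normr_ge0 _) (size_sk k 0)) b1; first exact: measurable_smoothk.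
  by move: I; under eq_fun do rewrite mulr1.
Unshelve. all: by end_near.
Qed.

End kernel_part.

(** * Sums over all integer scales as limits of windows *)

Section integer_sums.
Context {R : realType}.
Local Open Scope ereal_scope.
Implicit Types (a : int -> \bar R).

(** Enumerates the integers from [-N] to [N]; the scale [2 ^ window N i] is [2 ^- N * 2 ^ i], the
    form used for finitely many scales. *)
Definition window N (i : nat) : int := (i%:Z - N%:Z)%R.

Let window_inj N : injective (window N).
Proof. by move=> i j /(@addIr _ _) []. Qed.

Lemma esum_window a N : (forall k, 0 <= a k) ->
  \esum_(k in window N @` `I_(N.*2.+1)) a k = \sum_(i < N.*2.+1) a (window N i).
Proof.
move=> a0; rewrite esum_image; last by move=> i j _ _ /window_inj.
rewrite esum_fset; [|exact: finite_II|by move=> i _; exact: a0].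
by rewrite (fsbig_ord _ _ (fun i => a (window N i))).
Qed.

Let windowP N (k : int) : (`|k| <= N)%N -> (window N @` `I_(N.*2.+1)) k.
Proof.
move=> kN; exists (absz (k + N%:Z)%R); rewrite /window /=; lia.
Qed.

Lemma esum_int_le a (C : \bar R) : (forall k, 0 <= a k) ->
  (forall N, \sum_(i < N.*2.+1) a (window N i) <= C) -> \esum_(k in [set: int]) a k <= C.
Proof.
move=> a0 aC; apply: ge_ereal_sup => _ [F [finF _] <-].
pose N := (\max_(k <- finmap.enum_fset (fset_set F)) absz k)%N.
apply: le_trans (aC N); rewrite -esum_window//; apply: esum_ge; exists F => //; split => // k Fk.
by apply: windowP; rewrite /N; apply: (@leq_bigmax_seq _ _ xpredT absz) => //; rewrite in_fset_set// inE.
Qed.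

Lemma esum_int_ge a N : (forall k, 0 <= a k) ->
  \sum_(i < N.*2.+1) a (window N i) <= \esum_(k in [set: int]) a k.
Proof.
move=> a0; rewrite -esum_window//.
rewrite esum_mkcond; apply: le_esum => k _; case: ifP => // _; exact: a0.
Qed.

Lemma nd_window a : (forall k, 0 <= a k) ->
  nondecreasing_seq (fun N => \sum_(i < N.*2.+1) a (window N i)).
Proof.
move=> a0; apply/nondecreasing_seqP => N; rewrite -!esum_window//.
rewrite esum_mkcond [leRHS]esum_mkcond; apply: le_esum => k _.
case: ifPn => [/set_mem[i/= iN <-]|_]; last by case: ifP => // _; exact: a0.
rewrite mem_set//; apply: windowP; rewrite /window; lia.
Qed.

Lemma cvg_window a : (forall k, 0 <= a k) ->
  (fun N => \sum_(i < N.*2.+1) a (window N i)) @ \oo --> \esum_(k in [set: int]) a k.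
Proof.
move=> a0; have nd := nd_window a0.
rewrite (_ : \esum_(k in [set: int]) a k =
  ereal_sup (range (fun N => \sum_(i < N.*2.+1) a (window N i)))).
  exact: ereal_nondecreasing_cvgn.
apply/eqP; rewrite eq_le; apply/andP; split.
  by apply: esum_int_le => // N; apply: ereal_sup_ubound; exists N.
by apply: ge_ereal_sup => _ [N _ <-]; exact: esum_int_ge.
Qed.

End integer_sums.

Section complex_norm.
Context {R : rcfType}.
Implicit Types (a b : R).

Lemma normcE a b : Normc.normc (a +i* b)%C ^+ 2 = a ^+ 2 + b ^+ 2.
Proof. by rewrite /= sqr_sqrtr// addr_ge0 ?sqr_ge0. Qed.

Lemma normc_le a b : Normc.normc (a +i* b)%C <= `|a| + `|b|.
Proof.
rewrite -(@ler_pXn2r _ 2)// ?nnegrE ?addr_ge0 ?sqrtr_ge0// normcE -(real_normK (num_real a)).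
rewrite -(real_normK (num_real b)) sqrrD addrAC lerDl.
by rewrite mulrn_wge0// mulr_ge0.
Qed.

Lemma Re_le_normc (z : R[i]) : `|complex.Re z| <= Normc.normc z.
Proof. by case: z => a b /=; rewrite -sqrtr_sqr ler_wsqrtr// lerDl sqr_ge0. Qed.

Lemma Im_le_normc (z : R[i]) : `|complex.Im z| <= Normc.normc z.
Proof. by case: z => a b /=; rewrite -sqrtr_sqr ler_wsqrtr// lerDr sqr_ge0. Qed.

Lemma normc_ge0 (z : R[i]) : 0 <= Normc.normc z.
Proof. by case: z => a b; exact: sqrtr_ge0. Qed.

End complex_norm.

(** * The complex kernel *)

Section complex_kernel.
Context {R : realType} {n : nat}.
Local Notation V := 'rV[R]_n.
Local Notation mu := (rV_lebesgue n).
Implicit Types (x y z : V) (k : int) (e r : R).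
Variables (n0 : (0 < n)%N) (phi : V -> R) (Lam : R).
Hypotheses (cphi : continuous phi) (phi_ge0 : forall x, 0 <= phi x).
Hypothesis phi_supp : forall x, 4^-1 < enorm x -> phi x = 0.
Hypotheses (Lam0 : 0 < Lam) (phi_le : forall x, `|phi x| <= Lam).
Hypothesis phi_lip : forall x y, `|phi x - phi y| <= Lam * `|x - y|.
Hypothesis phi_lip2 : forall x y z,
  `|(phi (x - z) - phi x) - (phi (y - z) - phi y)| <= Lam * `|x - y| * `|z|.
Variables (K : V -> R[i]) (C : R).
Hypotheses (mK : clebesgue_measurable K).
Hypothesis K_int : forall e r : R, 0 < e -> e < r -> cintegral [set x | e < enorm x < r] K = 0.
Hypothesis K_le : forall x, x != 0 -> Normc.normc (K x) <= C * enorm x ^- n.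

(** The size bound is tested at a coordinate vector, which exists because [0 < n]. *)
Lemma kernel_cst_ge0 : 0 <= C.
Proof.
pose u : V := delta_mx ord0 (Ordinal n0).
have u0 : u != 0.
  by apply/eqP => /matrixP/(_ ord0 (Ordinal n0)); rewrite !mxE !eqxx => /eqP; rewrite oner_eq0.
have := le_trans (normc_ge0 _) (K_le u0).
by rewrite pmulr_lge0// invr_gt0 exprn_gt0// enorm_gt0.
Qed.

Lemma kernel_parts : exists psi1 psi2 : int -> V -> R,
  [/\ forall k : int, LPker (2 ^ k) (psi1 k), forall k : int, LPker (2 ^ k) (psi2 k) & forall (k : int) x,
   pv_conv_exists phi K k x /\
   pv_conv phi K k x = ((@cst_k R n Lam * C * psi1 k x) +i* (@cst_k R n Lam * C * psi2 k x))%C].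
Proof.
have C0 := kernel_cst_ge0; have [mRe mIm] := mK.
have re_le z : z != 0 -> `|complex.Re (K z)| <= C * enorm z ^- n.
  by move=> z0; exact: le_trans (Re_le_normc _) (K_le z0).
have im_le z : z != 0 -> `|complex.Im (K z)| <= C * enorm z ^- n.
  by move=> z0; exact: le_trans (Im_le_normc _) (K_le z0).
have re_int (e r : R) : 0 < e -> e < r -> \int[mu]_(z in [set z | e < enorm z < r]) complex.Re (K z) = 0.
  by move=> e0 er; have := K_int e0 er => -[].
have im_int (e r : R) : 0 < e -> e < r -> \int[mu]_(z in [set z | e < enorm z < r]) complex.Im (K z) = 0.
  by move=> e0 er; have := K_int e0 er => -[].
have [psi1 H1] := kernel_part n0 cphi phi_ge0 phi_supp Lam0 phi_le phi_lip phi_lip2 mRe C0 re_le re_int.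
have [psi2 H2] := kernel_part n0 cphi phi_ge0 phi_supp Lam0 phi_le phi_lip phi_lip2 mIm C0 im_le im_int.
exists psi1, psi2; split=> [k|k|k x]; [by have [] := H1 k|by have [] := H2 k|].
have {H1} [_ /(_ x) c1] := H1 k; have {H2} [_ /(_ x) c2] := H2 k.
have trE : (fun e => pv_trunc phi K k x e) = (fun e =>
   ((\int[mu]_(z in [set z | e < enorm z <= 2 ^ k]) (dilate phi k (x - z) * complex.Re (K z)))
     +i* (\int[mu]_(z in [set z | e < enorm z <= 2 ^ k]) (dilate phi k (x - z) * complex.Im (K z))))%C).
  apply/funext => e; rewrite /pv_trunc /cintegral.
  congr (_ +i* _)%C; apply: eq_Rintegral => z _; case: (K z) => a b /=; ring.
have reE : (fun e => complex.Re (pv_trunc phi K k x e)) = (fun e =>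
   \int[mu]_(z in [set z | e < enorm z <= 2 ^ k]) (dilate phi k (x - z) * complex.Re (K z))).
  by apply/funext => e; rewrite [pv_trunc _ _ _ _ _](congr1 (@^~ e) trE).
have imE : (fun e => complex.Im (pv_trunc phi K k x e)) = (fun e =>
   \int[mu]_(z in [set z | e < enorm z <= 2 ^ k]) (dilate phi k (x - z) * complex.Im (K z))).
  by apply/funext => e; rewrite [pv_trunc _ _ _ _ _](congr1 (@^~ e) trE).
split; first by rewrite /pv_conv_exists reE imE; split; apply/cvg_ex; eexists; [exact: c1|exact: c2].
by rewrite /pv_conv reE imE; congr (_ +i* _)%C; apply: cvg_lim.
Qed.

End complex_kernel.

(** Induction on the stronger bound [2 * (rho ^- m.+1 - u M)]: a term that is counted equals [u M],
    and the next value of [u] is at most half of it. *)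
Lemma geo_tail_sum (R : realFieldType) (s rho : R) m M : 0 < s -> 0 < rho ->
  \sum_(i < M | rho < s * 2 ^+ i) (s * 2 ^+ i) ^- m.+1 <= 2 * rho ^- m.+1.
Proof.
move=> s0 r0; have t0 i : 0 < s * 2 ^+ i by rewrite mulr_gt0 ?exprn_gt0.
pose u i := Num.min (rho ^- m.+1) ((s * 2 ^+ i) ^- m.+1).
have half i : (s * 2 ^+ i.+1) ^- m.+1 <= (s * 2 ^+ i) ^- m.+1 / 2.
  have -> : s * 2 ^+ i.+1 = (s * 2 ^+ i) * 2 by rewrite exprSr mulrA.
  rewrite exprMn invfM; apply: ler_wpM2l; first by rewrite invr_ge0 exprn_ge0// ltW.
  by rewrite lef_pV2 ?posrE ?exprn_gt0// ler_eXnr// ler1n.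
suff H : \sum_(i < M | rho < s * 2 ^+ i) (s * 2 ^+ i) ^- m.+1 <= 2 * (rho ^- m.+1 - u M).
  apply: le_trans H _; rewrite ler_pM2l// gerBl le_min !invr_ge0 !exprn_ge0// ltW//.
elim: M => [|M ih].
  by rewrite big_ord0 mulr_ge0// subr_ge0 ge_min lexx.
rewrite big_mkcond big_ord_recr -big_mkcond/=.
have hM := half M.
have uM1 : u M.+1 <= (s * 2 ^+ M.+1) ^- m.+1 by rewrite ge_min lexx orbT.
case: ifPn => rM.
  have uM : u M = (s * 2 ^+ M) ^- m.+1.
    by apply/min_idPr; rewrite lef_pV2 ?posrE ?exprn_gt0// lerXn2r ?nnegrE ?ltW.
  rewrite uM in ih; lra.
rewrite addr0; apply: le_trans ih _; rewrite ler_pM2l// lerB// le_min.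
rewrite {1}/u ge_min lexx/=; apply: le_trans uM1 (le_trans hM _).
have : 0 < (s * 2 ^+ M) ^- m.+1 by rewrite invr_gt0 exprn_gt0.
lra.
Qed.

Lemma windowE (R : numFieldType) N i : 2 ^ window N i = 2 ^- N * 2 ^+ i :> R.
Proof. by rewrite /window expfzDr// [LHS]mulrC -exprnN. Qed.

(** * Size and regularity of the complex kernels *)

Section kernel_regularity.
Context {R : realType} {n : nat}.
Local Notation V := 'rV[R]_n.
Implicit Types (x y : V) (k : int).
Variables (n0 : (0 < n)%N) (psi1 psi2 : int -> V -> R) (D : R).
Hypotheses (LP1 : forall k : int, LPker (2 ^ k) (psi1 k)) (LP2 : forall k : int, LPker (2 ^ k) (psi2 k)).
Hypothesis D0 : 0 <= D.

Definition ckernel k x : R[i] := ((D * psi1 k x) +i* (D * psi2 k x))%C.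

Lemma ckernel_size k x : Normc.normc (ckernel k x) <= 2 * D / 2 ^ (k * n%:Z).
Proof.
have [_ s1 _ _ _] := LP1 k; have [_ s2 _ _ _] := LP2 k.
apply: le_trans (normc_le _ _) _; rewrite !normrM !(ger0_norm D0).
rewrite -exprz_exp -exprnP.
apply: le_trans (lerD (ler_wpM2l D0 (s1 x)) (ler_wpM2l D0 (s2 x))) _.
by rewrite le_eqVlt; apply/orP; left; apply/eqP; ring.
Qed.

Lemma ckernel_lip k x y :
  Normc.normc (ckernel k x - ckernel k y) <= 2 * D * (2 ^ k) ^- n.+1 * `|x - y|.
Proof.
have [_ _ _ s1 _] := LP1 k; have [_ _ _ s2 _] := LP2 k.
rewrite (_ : _ - _ = (D * (psi1 k x - psi1 k y) +i* (D * (psi2 k x - psi2 k y)))%C); last first.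
  by rewrite /ckernel /= !mulrBr.
apply: le_trans (normc_le _ _) _; rewrite !normrM !(ger0_norm D0).
apply: le_trans (lerD (ler_wpM2l D0 (s1 x y)) (ler_wpM2l D0 (s2 x y))) _.
by rewrite le_eqVlt; apply/orP; left; apply/eqP; ring.
Qed.

Lemma ckernel_supp k x : 2 * 2 ^ k <= `|x| -> ckernel k x = 0.
Proof.
have [_ _ s1 _ _] := LP1 k; have [_ _ s2 _ _] := LP2 k.
by move=> xk; rewrite /ckernel s1// s2// !mulr0.
Qed.

(** Coordinatewise [x^2 <= 2 (x - y)^2 + 2 y^2]; after summation the hypothesis makes the last term
    at most half of the left side. *)
Lemma enorm_sub_ge x y : 2 * enorm y <= enorm x -> enorm x / 2 <= enorm (x - y).
Proof.
move=> yx; rewrite -(@ler_pXn2r _ 2)// ?nnegrE ?divr_ge0 ?enorm_ge0//.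
have sq z : enorm z ^+ 2 = \sum_(i < n) z ord0 i ^+ 2.
  by rewrite sqr_sqrtr// sumr_ge0// => i _; exact: sqr_ge0.
have y2 : 4 * enorm y ^+ 2 <= enorm x ^+ 2.
  rewrite (_ : 4 * _ = (2 * enorm y) ^+ 2); last by ring.
  by rewrite lerXn2r// ?nnegrE ?mulr_ge0 ?enorm_ge0.
have : enorm x ^+ 2 <= 2 * enorm (x - y) ^+ 2 + 2 * enorm y ^+ 2.
  rewrite !sq !mulr_sumr -big_split/=; apply: ler_sum => i _; rewrite !mxE.
  have := sqr_ge0 (x ord0 i - 2 * y ord0 i); move: (x ord0 i) (y ord0 i) => a b; nra.
by move: y2; move: (enorm x) (enorm y) (enorm (x - y)) => a b c; rewrite expr_div_n; nra.
Qed.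

Lemma enorm_le_natr x : enorm x <= n%:R * `|x|.
Proof.
apply: le_trans (enorm_le_norm x) _; apply: ler_wpM2r => //.
rewrite -[leRHS]ger0_norm// -sqrtr_sqr ler_wsqrtr// expr2 -natrM ler_nat; exact: leq_pmulr.
Qed.

(* Only the scales with [2 ^ k] at least comparable to [enorm x] contribute. *)
Lemma ckernel_lip_vanish k x y : 2 * enorm y <= enorm x -> n%:R * 4 * 2 ^ k <= enorm x ->
  ckernel k (x - y) - ckernel k x = 0.
Proof.
move=> yx xk; have nn : 0 < n%:R :> R by rewrite ltr0n.
have e0 := enorm_ge0 x.
have aux (z : V) : enorm x / 2 <= enorm z -> 2 * 2 ^ k <= `|z|.
  move=> zx; rewrite -(ler_pM2l nn); apply: (@le_trans _ _ (enorm z)); last exact: enorm_le_natr.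
  by apply: le_trans zx; rewrite ler_pdivlMr//; apply: le_trans xk; rewrite le_eqVlt; apply/orP; left; apply/eqP; ring.
rewrite !ckernel_supp ?subrr//; apply: aux; last exact: enorm_sub_ge.
by rewrite ler_pdivrMr// ler_peMr// ler1n.
Qed.

(** Scales up to [rho] vanish, and the others are summed through the Lipschitz bound of order
    [2^(-k(n+1))]; the exponent one of the regularity comes from here. *)
Lemma ckernel_lip_sum x y : 0 < 2 * enorm y <= enorm x ->
  (\esum_(k in [set: int]) (Normc.normc (ckernel k (x - y) - ckernel k x))%:E <=
   (4 * D * (4 * n%:R) ^+ n.+1 * (enorm y / enorm x ^+ n.+1))%:E)%E.
Proof.
move=> /andP[y0 yx]; have nn : 0 < n%:R :> R by rewrite ltr0n.
have x0 : 0 < enorm x := lt_le_trans y0 yx.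
have {}y0 : 0 < enorm y by move: y0; rewrite pmulr_rgt0.
pose rho := enorm x / (4 * n%:R).
have rho0 : 0 < rho by rewrite divr_gt0 ?mulr_gt0.
apply: esum_int_le => [k|N]; first by rewrite lee_fin normc_ge0.
rewrite sumEFin lee_fin.
apply: (@le_trans _ _ (\sum_(i < N.*2.+1 | rho < 2 ^ window N i) 2 * D * (2 ^ window N i) ^- n.+1 * enorm y)).
  rewrite [leRHS]big_mkcond; apply: ler_sum => i _; case: ltP => h.
    apply: le_trans (ckernel_lip _ _ _) _; rewrite addrAC subrr add0r normrN.
    by apply: ler_wpM2l (norm_le_enorm y); rewrite !mulr_ge0// invr_ge0 exprn_ge0// exprz_ge0.
  rewrite ckernel_lip_vanish// ?/Normc.normc/= ?expr0n ?addr0 ?sqrtr0//.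
  by move: h; rewrite /rho ler_pdivlMr ?mulr_gt0//; congr (_ <= _); ring.
rewrite -mulr_suml -mulr_sumr.
have G : \sum_(i < N.*2.+1 | rho < 2 ^ window N i) (2 ^ window N i) ^- n.+1 <= 2 * rho ^- n.+1.
  have -> : \sum_(i < N.*2.+1 | rho < 2 ^ window N i) (2 ^ window N i) ^- n.+1 =
     \sum_(i < N.*2.+1 | rho < 2 ^- N * 2 ^+ i) (2 ^- N * 2 ^+ i) ^- n.+1 :> R.
    by apply: eq_big => i; rewrite windowE.
  by apply: geo_tail_sum => //; rewrite invr_gt0 exprn_gt0.
apply: (@le_trans _ _ (2 * D * (2 * rho ^- n.+1) * enorm y)).
  by apply: ler_wpM2r; [exact: ltW|apply: ler_wpM2l => //; rewrite mulr_ge0].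
rewrite /rho expr_div_n le_eqVlt; apply/orP; left; apply/eqP.
field; rewrite !gt_eqF ?exprn_gt0 ?mulr_gt0//.
Qed.

End kernel_regularity.

(** * The square function *)

Section square_function_estimates.
Context {R : realType} {n : nat}.
Local Notation V := 'rV[R]_n.
Local Notation mu := (rV_lebesgue n).
Implicit Types (x y : V) (k : int) (N : nat).
Variables (n0 : (0 < n)%N) (psi1 psi2 : int -> V -> R) (D : R).
Hypotheses (LP1 : forall k : int, LPker (2 ^ k) (psi1 k)) (LP2 : forall k : int, LPker (2 ^ k) (psi2 k)).
Hypothesis D0 : 0 <= D.

Definition cconv k (f : V -> R[i]) x : R[i] :=
  cintegral setT (fun y => ckernel psi1 psi2 D k (x - y) * f y).
Definition sqfun2 (f : V -> R[i]) x : \bar R :=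
  \esum_(k in [set: int]) (Normc.normc (cconv k f x) ^+ 2)%:E.

Definition winsq (psi : int -> V -> R) N (g : V -> R) x : R :=
  @sqsum R n (N.*2.+1) (fun i => psi (window N i)) g x.

Variables (f : V -> R[i]) (f1 f2 : V -> R).
Hypotheses (L1 : locint f1) (L2 : locint f2).
Hypothesis fE : \forall x \ae mu, complex.Re (f x) = f1 x /\ complex.Im (f x) = f2 x.

Let q0 k : 0 < (2 ^ k : R). Proof. exact: exprz_gt0. Qed.

Lemma cconvE k x : cconv k f x =
  ((D * (conv (psi1 k) f1 x - conv (psi2 k) f2 x)) +i*
   (D * (conv (psi1 k) f2 x + conv (psi2 k) f1 x)))%C.
Proof.
have [mp1 _ _ _ _] := LP1 k; have [mp2 _ _ _ _] := LP2 k; have [mf1 _] := L1; have [mf2 _] := L2.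
have I1 g := LPker_integrable x (q0 k) (LP1 k) (f := g).
have I2 g := LPker_integrable x (q0 k) (LP2 k) (f := g).
have mp (psi g : V -> R) : measurable_fun setT psi -> measurable_fun setT g ->
    measurable_fun setT (fun y => psi (x - y) * g y).
  by move=> m1 m2; apply: measurable_funM => //; exact: measurable_kernel.
have re : \int[mu]_y (D * (psi1 k (x - y) * f1 y - psi2 k (x - y) * f2 y)) =
    D * (conv (psi1 k) f1 x - conv (psi2 k) f2 x).
  rewrite RintegralZl//; last by have := integrableB measurableT (I1 _ L1) (I2 _ L2).
  by rewrite RintegralB//; [exact: I1|exact: I2].
have im : \int[mu]_y (D * (psi1 k (x - y) * f2 y + psi2 k (x - y) * f1 y)) =
    D * (conv (psi1 k) f2 x + conv (psi2 k) f1 x).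
  rewrite RintegralZl//; last by have := integrableD measurableT (I1 _ L2) (I2 _ L1).
  by rewrite RintegralD//; [exact: I1|exact: I2].
rewrite /cconv /cintegral -re -im; congr (_ +i* _)%C; apply: ae_eq_Rintegral => //.
- by apply: measurable_funM => //; apply: measurable_funB; exact: mp.
- by apply: filterS fE => y [<- <-] _; case: (f y) => a b /=; ring.
- by apply: measurable_funM => //; apply: measurable_funD; exact: mp.
- by apply: filterS fE => y [<- <-] _; case: (f y) => a b /=; ring.
Qed.

Definition windowed N x : R := \sum_(i < N.*2.+1) Normc.normc (cconv (window N i) f x) ^+ 2.

Lemma windowed_ge0 N x : 0 <= windowed N x.
Proof. by apply: sumr_ge0 => i _; exact: sqr_ge0. Qed.

Let term_ge0 x k : (0 <= (Normc.normc (cconv k f x) ^+ 2)%:E)%E.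
Proof. by rewrite lee_fin sqr_ge0. Qed.

Let windowedE x : (fun N => \sum_(i < N.*2.+1) (Normc.normc (cconv (window N i) f x) ^+ 2)%:E)%E =
  (fun N => (windowed N x)%:E).
Proof. by apply/funext => N; rewrite sumEFin. Qed.

Lemma cvg_windowed x : (windowed N x)%:E @[N --> \oo] --> sqfun2 f x.
Proof. by rewrite -windowedE; exact: (cvg_window (term_ge0 x)). Qed.

Lemma nd_windowed x : nondecreasing_seq (fun N => (windowed N x)%:E).
Proof. by rewrite -windowedE; exact: (nd_window (term_ge0 x)). Qed.

Lemma measurable_windowed N : measurable_fun setT (windowed N).
Proof.
have [mf1 _] := L1; have [mf2 _] := L2.
have mc1 k g : measurable_fun setT g -> measurable_fun setT (conv (psi1 k) g).
  by have [mp _ _ _ _] := LP1 k; exact: measurable_conv.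
have mc2 k g : measurable_fun setT g -> measurable_fun setT (conv (psi2 k) g).
  by have [mp _ _ _ _] := LP2 k; exact: measurable_conv.
apply: measurable_sum => i.
under eq_fun do rewrite cconvE normcE.
have m1 := measurable_funB (mc1 (window N i) _ mf1) (mc2 (window N i) _ mf2).
have m2 := measurable_funD (mc1 (window N i) _ mf2) (mc2 (window N i) _ mf1).
have mD : measurable_fun setT (fun _ : V => D) by exact: measurable_cst.
exact: (measurable_funD (measurable_funX 2 (measurable_funM mD m1)) (measurable_funX 2 (measurable_funM mD m2))).
Qed.

Lemma measurable_sqfun2 : measurable_fun setT (sqfun2 f).
Proof.
apply: (emeasurable_fun_cvg (fun N x => (windowed N x)%:E)) => [N|x _]; last exact: cvg_windowed.
by apply/measurable_EFinP; exact: measurable_windowed.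
Qed.

(** Four real square sums control the complex one: each part of the kernel meets each part of
    [f]. *)
Definition pieces N x : R := (winsq psi1 N f1 x + winsq psi2 N f2 x) + (winsq psi1 N f2 x + winsq psi2 N f1 x).

Lemma windowed_le N x : windowed N x <= 2 * D ^+ 2 * pieces N x.
Proof.
rewrite /pieces /winsq /sqsum -!big_split/= mulr_sumr; apply: ler_sum => i _.
rewrite cconvE normcE.
move: (conv _ _ _) (conv _ _ _) (conv _ _ _) (conv _ _ _) => a b c d.
rewrite -subr_ge0.
have -> : 2 * D ^+ 2 * (d ^+ 2 + c ^+ 2 + (b ^+ 2 + a ^+ 2)) -
    ((D * (d - c)) ^+ 2 + (D * (b + a)) ^+ 2) = (D * (d + c)) ^+ 2 + (D * (b - a)) ^+ 2 by ring.
by rewrite addr_ge0 ?sqr_ge0.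
Qed.

End square_function_estimates.

(** * Monotone limits of powers, integrals and measures *)

Section monotone_limits.
Context d (T : measurableType d) {R : realType} (mu : {measure set T -> \bar R}).
Local Open Scope ereal_scope.

Lemma le_poweR (x y : \bar R) (r : R) : (0 <= r)%R -> 0 <= x -> x <= y -> x `^ r <= y `^ r.
Proof.
move=> r0 x0 xy; apply: gt0_ler_poweR => //; rewrite in_itv/= leey andbT//.
exact: le_trans xy.
Qed.

Lemma poweRK (x : \bar R) (r : R) : r != 0%R -> 0 <= x -> (x `^ r) `^ r^-1 = x.
Proof. by move=> r0 x0; rewrite -poweRrM divff// poweRe1. Qed.

Lemma poweRVK (x : \bar R) (r : R) : r != 0%R -> 0 <= x -> (x `^ r^-1) `^ r = x.
Proof. by move=> r0 x0; rewrite -poweRrM mulVf// poweRe1. Qed.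

(** Monotone limits are suprema, and the power is increasing with inverse the power [1 / r]; the
    value [+oo] is included. *)
Lemma cvg_nd_poweR (u : nat -> \bar R) (l : \bar R) (r : R) : (0 < r)%R ->
  nondecreasing_seq u -> (forall N, 0 <= u N) -> u @ \oo --> l ->
  (fun N => u N `^ r) @ \oo --> l `^ r.
Proof.
move=> r0 nd u0 ul.
have lE : l = ereal_sup (range u) by rewrite -(cvg_lim _ ul)//; apply/cvg_lim => //; exact: ereal_nondecreasing_cvgn.
have ndr : nondecreasing_seq (fun N => u N `^ r).
  by move=> i j ij; apply: le_poweR => //; [exact: ltW|exact: nd].
have ule N : u N <= l by rewrite lE; apply: ereal_sup_ubound; exists N.
have l0 : 0 <= l by exact: le_trans (u0 0%N) (ule 0%N).
rewrite (_ : l `^ r = ereal_sup (range (fun N => u N `^ r))); first exact: ereal_nondecreasing_cvgn.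
apply/eqP; rewrite eq_le; apply/andP; split; last first.
  by apply: ge_ereal_sup => _ [N _ <-]; apply: le_poweR => //; exact: ltW.
set t := ereal_sup _.
have ut N : u N `^ r <= t by apply: ereal_sup_ubound; exists N.
have t0 : 0 <= t by apply: le_trans (ut 0%N); exact: poweR_ge0.
have r1 : r != 0%R by rewrite gt_eqF.
rewrite -(poweRVK r1 t0); apply: le_poweR => //; first exact: ltW.
rewrite lE; apply: ge_ereal_sup => _ [N _ <-].
rewrite -(poweRK r1 (u0 N)); apply: le_poweR; rewrite ?invr_ge0 ?poweR_ge0//.
exact: ltW.
Qed.

Lemma integral_nd_le (g : nat -> T -> \bar R) (G : T -> \bar R) (B : \bar R) :
  (forall N, measurable_fun setT (g N)) -> (forall N x, 0 <= g N x) ->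
  (forall x, nondecreasing_seq (g^~ x)) -> (forall x, (g N x @[N --> \oo]) --> G x) ->
  (forall N, \int[mu]_x g N x <= B) -> \int[mu]_x G x <= B.
Proof.
move=> mg g0 nd gG gB.
have H := cvg_monotone_convergence (mu := mu) measurableT mg (fun N x _ => g0 N x) (fun x _ => nd x).
rewrite (eq_integral (fun x => limn (g^~ x))); last by move=> x _; apply/esym/cvg_lim.
rewrite -(cvg_lim _ H)//; apply: lime_le; first by apply/cvg_ex; eexists; exact: H.
by apply: nearW => N; exact: gB.
Qed.

Lemma ge0_integral_sum4 (c : R) (h1 h2 h3 h4 : T -> \bar R) : (0 <= c)%R ->
  measurable_fun setT h1 -> measurable_fun setT h2 -> measurable_fun setT h3 -> measurable_fun setT h4 ->
  (forall x, 0 <= h1 x) -> (forall x, 0 <= h2 x) -> (forall x, 0 <= h3 x) -> (forall x, 0 <= h4 x) ->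
  \int[mu]_x (c%:E * ((h1 x + h2 x) + (h3 x + h4 x))) =
  c%:E * ((\int[mu]_x h1 x + \int[mu]_x h2 x) + (\int[mu]_x h3 x + \int[mu]_x h4 x)).
Proof.
move=> c0 m1 m2 m3 m4 p1 p2 p3 p4.
have m12 := emeasurable_funD m1 m2; have m34 := emeasurable_funD m3 m4.
rewrite ge0_integralZl//; last 2 first.
- exact: emeasurable_funD m12 m34.
- by move=> x _; rewrite !adde_ge0.
rewrite (@ge0_integralD _ _ _ mu setT measurableT (fun x => h1 x + h2 x) (fun x => h3 x + h4 x))//.
- by rewrite !ge0_integralD.
- by move=> x _; rewrite adde_ge0.
- by move=> x _; rewrite adde_ge0.
Qed.

Lemma mu_nd_le (F : nat -> set T) (B : \bar R) : (forall N, measurable (F N)) ->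
  (forall i j, (i <= j)%N -> F i `<=` F j) -> (forall N, mu (F N) <= B) ->
  mu (\bigcup_N F N) <= B.
Proof.
move=> mF nd FB.
have H := nondecreasing_cvg_mu (mu := mu) mF (bigcupT_measurable F mF) _.
have {}H : (mu \o F) x @[x --> \oo] --> mu (\bigcup_n F n).
  by apply: H => i j ij; apply/subsetPset; exact: nd.
rewrite -(cvg_lim _ H)//; apply: lime_le; first by apply/cvg_ex; eexists; exact: H.
by apply: nearW => N; exact: FB.
Qed.

End monotone_limits.

(** * Bounds uniform in the window *)

Section square_function_bounds.
Context {R : realType} {n : nat}.
Local Notation V := 'rV[R]_n.
Local Notation mu := (rV_lebesgue n).
Implicit Types (x y : V) (k : int) (N : nat).
Variables (n0 : (0 < n)%N) (psi1 psi2 : int -> V -> R) (D : R).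
Hypotheses (LP1 : forall k : int, LPker (2 ^ k) (psi1 k)) (LP2 : forall k : int, LPker (2 ^ k) (psi2 k)).
Hypothesis D0 : 0 <= D.
Variables (f : V -> R[i]) (f1 f2 : V -> R).
Hypotheses (mf1 : measurable_fun setT f1) (mf2 : measurable_fun setT f2).
Hypothesis fE : \forall x \ae mu, complex.Re (f x) = f1 x /\ complex.Im (f x) = f2 x.
Local Notation Q := (sqfun2 psi1 psi2 D f).
Local Notation W := (windowed psi1 psi2 D f).
Local Notation sq psi N g := (winsq psi N g).

Let s0 N : 0 < 2 ^- N :> R. Proof. by rewrite invr_gt0 exprn_gt0. Qed.

Lemma LPker_window (psi : int -> V -> R) : (forall k : int, LPker (2 ^ k) (psi k)) ->
  forall N (i : 'I_N.*2.+1), LPker (2 ^- N * 2 ^+ i) (psi (window N i)).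
Proof. by move=> LP N i; rewrite -windowE. Qed.

Lemma measurable_winsq (psi : int -> V -> R) N g : (forall k : int, LPker (2 ^ k) (psi k)) ->
  measurable_fun setT g -> measurable_fun setT (winsq psi N g).
Proof. by move=> LP mg; exact: (measurable_sqsum (LPker_window LP (N := N)) mg). Qed.

Lemma winsq_ge0 (psi : int -> V -> R) N g x : 0 <= winsq psi N g x.
Proof. exact: sqsum_ge0. Qed.

Let mpieces N (h : R -> R) : measurable_fun setT h -> [/\ measurable_fun setT (h \o sq psi1 N f1),
  measurable_fun setT (h \o sq psi2 N f2), measurable_fun setT (h \o sq psi1 N f2) &
  measurable_fun setT (h \o sq psi2 N f1)].
Proof.
by move=> mh; split; apply: measurableT_comp => //; exact: measurable_winsq.
Qed.

Theorem sqfun2_L2 : sqint f1 -> sqint f2 ->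
  (\int[mu]_x Q x <= (32 * 32 ^+ n * D ^+ 2)%:E *
    (\int[mu]_x (f1 x ^+ 2)%:E + \int[mu]_x (f2 x ^+ 2)%:E))%E.
Proof.
move=> S1 S2; have l1 := sqint_locint S1; have l2 := sqint_locint S2.
apply: (@integral_nd_le _ _ _ _ (fun N x => (W N x)%:E)).
- by move=> N; apply/measurable_EFinP; exact: (measurable_windowed D LP1 LP2 l1 l2 fE).
- by move=> N x; rewrite lee_fin windowed_ge0.
- by move=> x; exact: nd_windowed.
- by move=> x; exact: cvg_windowed.
move=> N; have [m1 m2 m3 m4] := mpieces N (@measurable_id _ _ setT).
have K0 : (0 <= (8 * 32 ^+ n : R)%:E)%E by rewrite lee_fin mulr_ge0// exprn_ge0.
have b1 := sqsum_L2 (s0 N) (LPker_window LP1 (N := N)) S1.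
have b2 := sqsum_L2 (s0 N) (LPker_window LP2 (N := N)) S2.
have b3 := sqsum_L2 (s0 N) (LPker_window LP1 (N := N)) S2.
have b4 := sqsum_L2 (s0 N) (LPker_window LP2 (N := N)) S1.
have D2 : 0 <= 2 * D ^+ 2 by rewrite mulr_ge0// sqr_ge0.
have w0 psi (g : V -> R) x : (0 <= (sq psi N g x)%:E)%E by rewrite lee_fin winsq_ge0.
apply: (@le_trans _ _ (\int[mu]_x ((2 * D ^+ 2)%:E *
    (((sq psi1 N f1 x)%:E + (sq psi2 N f2 x)%:E) + ((sq psi1 N f2 x)%:E + (sq psi2 N f1 x)%:E)))))%E.
  apply: ge0_le_integralT => x _; first by rewrite lee_fin windowed_ge0.
  rewrite -!EFinD -EFinM lee_fin; exact: (windowed_le D LP1 LP2 l1 l2 fE).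
have mE g : measurable_fun setT g -> measurable_fun setT (fun x : V => (g x : R)%:E).
  by move=> mg; exact/measurable_EFinP.
rewrite ge0_integral_sum4//; try exact: mE.
apply: (@le_trans _ _ ((2 * D ^+ 2)%:E * ((8 * 32 ^+ n)%:E * (\int[mu]_x (f1 x ^+ 2)%:E + \int[mu]_x (f2 x ^+ 2)%:E)
   + (8 * 32 ^+ n)%:E * (\int[mu]_x (f1 x ^+ 2)%:E + \int[mu]_x (f2 x ^+ 2)%:E)))%E).
  apply: lee_wpmul2l; first by rewrite lee_fin.
  apply: leeD; (rewrite ge0_muleDr ?integral_ge0//; last 2 first).
  all: rewrite ?lee_fin ?sqr_ge0//.
  all: try by move=> x _; rewrite lee_fin sqr_ge0.
  - exact: (leeD b1 b2).
  - by rewrite addeC; exact: (leeD b4 b3).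
rewrite -ge0_muleDl// muleA -EFinD -EFinM.
rewrite (_ : 2 * D ^+ 2 * (8 * 32 ^+ n + 8 * 32 ^+ n) = 32 * 32 ^+ n * D ^+ 2)//; ring.
Qed.

Theorem sqfun2_weak (a : R) : mu.-integrable setT (EFin \o f1) -> mu.-integrable setT (EFin \o f2) ->
  0 < a ->
  (a%:E * mu [set x | ((a ^+ 2)%:E < Q x)%E] <= (8 * @weak_cst R n * D)%:E *
    (\int[mu]_x `|f1 x|%:E + \int[mu]_x `|f2 x|%:E))%E.
Proof.
move=> S1 S2 a0; have l1 := locint_integrable S1; have l2 := locint_integrable S2.
have wc0 : 0 <= @weak_cst R n :> R by rewrite /weak_cst addr_ge0// mulr_ge0// exprn_ge0.
have mW N : measurable [set x | a ^+ 2 < W N x].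
  have := @measurable_windowed _ _ _ _ D LP1 LP2 _ _ _ l1 l2 fE N measurableT _ (measurable_itv `]a ^+ 2, +oo[).
  by rewrite setTI; congr measurable; apply/seteqP; split => z; rewrite /= in_itv/= andbT.
have QW : [set x | ((a ^+ 2)%:E < Q x)%E] `<=` \bigcup_N [set x | a ^+ 2 < W N x].
  move=> x /= aQ; apply: contrapT => H; move: aQ; rewrite ltNge => /negP; apply.
  have c := @cvg_windowed R n psi1 psi2 D f x.
  rewrite -(cvg_lim _ c)//; apply: lime_le; first by apply/cvg_ex; eexists; exact: c.
  by apply: nearW => N; rewrite lee_fin leNgt; apply/negP => h; apply: H; exists N.
have nd x N M : (N <= M)%N -> W N x <= W M x.
  by move=> NM; have := @nd_windowed R n psi1 psi2 D f x _ _ NM; rewrite lee_fin.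
have [D00|D1] := eqVneq D 0.
  rewrite (_ : mkset _ = set0); first by rewrite measure0 mule0 D00 mulr0 mul0e.
  apply/seteqP; split => // x /QW[N _] /=; rewrite ltNge => /negP; apply.
  apply: le_trans (windowed_le D LP1 LP2 l1 l2 fE N x) _.
  by rewrite D00 expr0n mulr0 mul0r sqr_ge0.
have Dp : 0 < D by rewrite lt_neqAle eq_sym D1.
(* When each of the four pieces is at most [b^2], the windowed sum is at most
   [2 D^2 * 4 b^2 = a^2 / 2]. *)
pose b := a / (4 * D); have b0 : 0 < b by rewrite divr_gt0// mulr_gt0.
set I1 := (\int[mu]_x `|f1 x|%:E)%E; set I2 := (\int[mu]_x `|f2 x|%:E)%E.
have i1 : (0 <= I1)%E by apply: integral_ge0.
have i2 : (0 <= I2)%E by apply: integral_ge0.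
have bound N : (b%:E * mu [set x | (a ^+ 2 < W N x)%R] <= (2 * @weak_cst R n)%:E * (I1 + I2))%E.
  pose E psi g : set V := [set x | b ^+ 2 < sq psi N g x].
  have mE psi g : (forall k : int, LPker (2 ^ k) (psi k)) -> measurable_fun setT g -> measurable (E psi g).
    move=> LP mg; have := measurable_winsq N LP mg measurableT (measurable_itv `]b ^+ 2, +oo[).
    by rewrite setTI; congr measurable; apply/seteqP; split => z; rewrite /= in_itv/= andbT.
  have m1 := mE _ _ LP1 mf1; have m2 := mE _ _ LP2 mf2; have m3 := mE _ _ LP1 mf2; have m4 := mE _ _ LP2 mf1.
  have b1 := sqsum_weak n0 (s0 N) (LPker_window LP1 (N := N)) S1 b0.
  have b2 := sqsum_weak n0 (s0 N) (LPker_window LP2 (N := N)) S2 b0.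
  have b3 := sqsum_weak n0 (s0 N) (LPker_window LP1 (N := N)) S2 b0.
  have b4 := sqsum_weak n0 (s0 N) (LPker_window LP2 (N := N)) S1 b0.
  have sub : [set x | a ^+ 2 < W N x] `<=` (E psi1 f1 `|` E psi2 f2) `|` (E psi1 f2 `|` E psi2 f1).
    move=> x /= aW; apply: contrapT => /not_orP[/not_orP[/negP h1 /negP h2] /not_orP[/negP h3 /negP h4]].
    move: h1 h2 h3 h4; rewrite -!leNgt => h1 h2 h3 h4; move: aW; rewrite ltNge => /negP; apply.
    apply: le_trans (windowed_le D LP1 LP2 l1 l2 fE N x) _.
    apply: (@le_trans _ _ (2 * D ^+ 2 * (4 * b ^+ 2))).
      apply: ler_wpM2l; first by rewrite mulr_ge0// sqr_ge0.
      rewrite /pieces; lra.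
    rewrite (_ : 2 * D ^+ 2 * (4 * b ^+ 2) = a ^+ 2 / 2); last by rewrite /b; field.
    by rewrite ler_pdivrMr// ler_peMr ?sqr_ge0// ler1n.
  have muU (A B : set V) : measurable A -> measurable B -> (mu (A `|` B) <= mu A + mu B)%E.
    by move=> mA mB; exact: measureU2.
  apply: (@le_trans _ _ (b%:E * ((mu (E psi1 f1) + mu (E psi2 f2)) + (mu (E psi1 f2) + mu (E psi2 f1))))%E).
    apply: lee_wpmul2l; first by rewrite lee_fin ltW.
    apply: le_trans (le_measure _ _ _ sub) _; rewrite ?inE//; first by do !apply: measurableU.
    apply: le_trans (muU _ _ _ _) _; [exact: measurableU|exact: measurableU|].
    by apply: leeD; exact: muU.
  apply: (@le_trans _ _ ((@weak_cst R n)%:E * I1 + (@weak_cst R n)%:E * I2 + ((@weak_cst R n)%:E * I2 + (@weak_cst R n)%:E * I1))%E).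
    rewrite ge0_muleDr ?adde_ge0// ge0_muleDr// [X in (_ + X)%E]ge0_muleDr//.
    by apply: leeD; apply: leeD.
  move: (I1) (I2) i1 i2 => J1 J2 j1 j2.
  rewrite [X in (_ + X)%E]addeC -ge0_muleDr// -ge0_muleDl ?lee_fin//.
  by rewrite -EFinD (_ : @weak_cst R n + @weak_cst R n = 2 * @weak_cst R n)//; ring.
have mub : (mu (\bigcup_N [set x | (a ^+ 2 < W N x)%R]) <= (b^-1)%:E * ((2 * @weak_cst R n)%:E * (I1 + I2)))%E.
  apply: mu_nd_le => // [i j ij x /= aW|N]; first exact: lt_le_trans aW (nd x _ _ ij).
  by rewrite lee_pdivlMl//; exact: bound.
have mQ : measurable [set x | ((a ^+ 2)%:E < Q x)%E].
  have := emeasurable_fun_o_infty measurableT (measurable_sqfun2 D LP1 LP2 l1 l2 fE) (a ^+ 2)%:E.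
  by rewrite setTI.
apply: (@le_trans _ _ (a%:E * ((b^-1)%:E * ((2 * @weak_cst R n)%:E * (I1 + I2))))%E).
  apply: lee_wpmul2l; first by rewrite lee_fin ltW.
  apply: le_trans mub; apply: le_measure => //; rewrite inE//; exact: bigcupT_measurable.
rewrite !muleA -!EFinM; apply: lee_wpmul2r; first exact: adde_ge0.
rewrite lee_fin le_eqVlt; apply/orP; left; apply/eqP; rewrite /b; field.
by rewrite gt_eqF// gt_eqF.
Qed.

Variables (p Z : R) (w : V -> R).
Hypotheses (p1 : 1 < p) (mw : measurable_fun setT w) (w0 : forall x, 0 < w x) (Z0 : 0 <= Z).
Hypothesis weighted : forall (psi : int -> V -> R) (g : V -> R) N, (forall k : int, LPker (2 ^ k) (psi k)) ->
  measurable_fun setT g -> (\int[mu]_y (`|g y| `^ p * w y)%:E < +oo)%E ->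
  (\int[mu]_y (winsq psi N g y `^ (p / 2) * w y)%:E <= Z%:E * \int[mu]_y (`|g y| `^ p * w y)%:E)%E.

Theorem sqfun2_weighted : locint f1 -> locint f2 ->
  (\int[mu]_y (`|f1 y| `^ p * w y)%:E < +oo)%E -> (\int[mu]_y (`|f2 y| `^ p * w y)%:E < +oo)%E ->
  (\int[mu]_x (Q x `^ (p / 2) * (w x)%:E) <= (2 * (8 `^ (p / 2) * D `^ p) * Z)%:E *
    (\int[mu]_y (`|f1 y| `^ p * w y)%:E + \int[mu]_y (`|f2 y| `^ p * w y)%:E))%E.
Proof.
move=> l1 l2 I1 I2.
have p0 : 0 < p by exact: lt_trans p1.
have h0 : 0 < p / 2 by rewrite divr_gt0.
have h0w := ltW h0.
have mWp N : measurable_fun setT (fun x => W N x `^ (p / 2) * w x).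
  apply: measurable_funM => //; apply: (@measurableT_comp _ _ _ _ _ _ ((@powR R)^~ (p / 2)) _ (W N)); first exact: measurable_powR.
  exact: (measurable_windowed D LP1 LP2 l1 l2 fE).
have Qlim x : (((W N x `^ (p / 2)) * w x)%:E @[N --> \oo] --> Q x `^ (p / 2) * (w x)%:E)%E.
  under eq_fun do rewrite EFinM -poweR_EFin.
  apply: cvgeZr => //; apply: cvg_nd_poweR => //; [exact: nd_windowed|by move=> N; rewrite lee_fin windowed_ge0|exact: cvg_windowed].
apply: (@integral_nd_le _ _ _ _ (fun N x => (W N x `^ (p / 2) * w x)%:E)) => //.
- by move=> N; apply/measurable_EFinP; exact: mWp.
- by move=> N x; rewrite lee_fin mulr_ge0 ?powR_ge0// ltW.
- move=> x i j ij; rewrite lee_fin ler_wpM2r ?(ltW (w0 x))//.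
  have := @nd_windowed R n psi1 psi2 D f x _ _ ij; rewrite lee_fin => Wij.
  by apply: ge0_ler_powR => //; rewrite nnegrE windowed_ge0.
move=> N; have [m1 m2 m3 m4] := mpieces N (measurable_powR (p / 2)).
set c := 8 `^ (p / 2) * D `^ p.
have c0 : 0 <= c by rewrite mulr_ge0 ?powR_ge0.
pose T psi g x := sq psi N g x `^ (p / 2) * w x.
have T0 psi g x : (0 <= (T psi g x)%:E)%E by rewrite lee_fin mulr_ge0 ?powR_ge0// ltW.
have mT psi g : measurable_fun setT ((@powR R)^~ (p / 2) \o sq psi N g) -> measurable_fun setT (fun x => (T psi g x)%:E).
  by move=> m; apply/measurable_EFinP; exact: measurable_funM.
have {}m1 := mT _ _ m1; have {}m2 := mT _ _ m2; have {}m3 := mT _ _ m3; have {}m4 := mT _ _ m4.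
apply: (@le_trans _ _ (\int[mu]_x (c%:E *
    (((T psi1 f1 x)%:E + (T psi2 f2 x)%:E) + ((T psi1 f2 x)%:E + (T psi2 f1 x)%:E)))))%E.
  apply: ge0_le_integralT => x _; first by rewrite lee_fin mulr_ge0 ?powR_ge0// ltW.
  rewrite /T.
  have := windowed_le D LP1 LP2 l1 l2 fE N x; rewrite /pieces.
  have := winsq_ge0 psi1 N f1 x; have := winsq_ge0 psi2 N f2 x.
  have := winsq_ge0 psi1 N f2 x; have := winsq_ge0 psi2 N f1 x.
  have := windowed_ge0 psi1 psi2 D f N x.
  move: (W N x) (sq psi1 N f1 x) (sq psi2 N f2 x) (sq psi1 N f2 x) (sq psi2 N f1 x).
  move=> u t1 t2 t3 t4 u0 t4_0 t3_0 t2_0 t1_0 ut.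
  rewrite -!EFinD -EFinM lee_fin -!mulrDl mulrA; apply: ler_wpM2r; first exact: ltW.
  (* The four pieces are replaced by their maximum, whose power is at most the sum of the four
     powers. *)
  pose t := Num.max (Num.max t1 t2) (Num.max t3 t4).
  have [h1 h2 h3 h4] : [/\ t1 <= t, t2 <= t, t3 <= t & t4 <= t].
    by split; rewrite !le_max lexx ?orbT.
  have t0 : 0 <= t by exact: le_trans h1.
  apply: (@le_trans _ _ (c * t `^ (p / 2))).
    apply: (@le_trans _ _ ((8 * D ^+ 2 * t) `^ (p / 2))).
      apply: ge0_ler_powR => //; rewrite ?nnegrE ?mulr_ge0 ?sqr_ge0//.
      apply: le_trans ut _; rewrite (_ : 8 * D ^+ 2 * t = 2 * D ^+ 2 * (t + t + (t + t))); last by ring.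
      by apply: ler_wpM2l; [rewrite mulr_ge0 ?sqr_ge0|do !apply: lerD].
    rewrite powRM ?mulr_ge0 ?sqr_ge0// powRM ?sqr_ge0// -[D ^+ 2]powR_mulrn// -powRrM.
    by rewrite (_ : 2%:R * (p / 2) = p)//; field.
  apply: ler_wpM2l => //.
  have P1 := powR_ge0 t1 (p / 2); have P2 := powR_ge0 t2 (p / 2).
  have P3 := powR_ge0 t3 (p / 2); have P4 := powR_ge0 t4 (p / 2).
  by rewrite /t !maxEle; do !case: ifP => _; lra.
rewrite (@ge0_integral_sum4 _ _ _ mu c (fun x => (T psi1 f1 x)%:E) (fun x => (T psi2 f2 x)%:E)
  (fun x => (T psi1 f2 x)%:E) (fun x => (T psi2 f1 x)%:E) c0 m1 m2 m3 m4 (T0 psi1 f1) (T0 psi2 f2)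
  (T0 psi1 f2) (T0 psi2 f1)).
set J1 := (\int[mu]_y (`|f1 y| `^ p * w y)%:E)%E; set J2 := (\int[mu]_y (`|f2 y| `^ p * w y)%:E)%E.
have j1 : (0 <= J1)%E by apply: integral_ge0 => x _; rewrite lee_fin mulr_ge0 ?powR_ge0// ltW.
have j2 : (0 <= J2)%E by apply: integral_ge0 => x _; rewrite lee_fin mulr_ge0 ?powR_ge0// ltW.
have Z0' : (0 <= Z%:E)%E by rewrite lee_fin.
have b1 := weighted N LP1 mf1 I1; have b2 := weighted N LP2 mf2 I2.
have b3 := weighted N LP1 mf2 I2; have b4 := weighted N LP2 mf1 I1.
apply: (@le_trans _ _ (c%:E * ((Z%:E * J1 + Z%:E * J2) + (Z%:E * J2 + Z%:E * J1)))%E).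
  apply: lee_wpmul2l; first by rewrite lee_fin.
  exact: (leeD (leeD b1 b2) (leeD b3 b4)).
move: (J1) (J2) j1 j2 => {}J1 {}J2 j1 j2.
rewrite [X in (_ + X)%E]addeC -ge0_muleDr// -ge0_muleDl// muleA -EFinD -EFinM.
by rewrite (_ : c * (Z + Z) = 2 * c * Z)//; ring.
Qed.

End square_function_bounds.

(** * The grand maximal operator *)

Section grand_maximal_bound.
Context {R : realType} {n : nat}.
Local Notation V := 'rV[R]_n.
Local Notation mu := (rV_lebesgue n).
Implicit Types (x y c : V) (r q b : R) (k : int) (N : nat).

Local Notation off c r g := (patch (fun=> 0 : R) (~` cube c (3 * r)) g).

Lemma sqr_perturb (D u v s t e : R) : `|u - s| <= e -> `|v - t| <= e ->
  (D * (u + v)) ^+ 2 <= 2 * (D * (s + t)) ^+ 2 + 8 * D ^+ 2 * e ^+ 2.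
Proof.
move=> us vt; have e0 : 0 <= e := le_trans (normr_ge0 _) us.
have h : (u + v - (s + t)) ^+ 2 <= 4 * e ^+ 2.
  rewrite (_ : 4 * e ^+ 2 = (e + e) ^+ 2); last by ring.
  rewrite -(real_normK (num_real _)) lerXn2r// ?nnegrE ?addr_ge0//.
  by rewrite opprD addrACA; apply: le_trans (ler_normD _ _) _; exact: lerD.
apply: (@le_trans _ _ (D ^+ 2 * (2 * (s + t) ^+ 2 + 2 * (u + v - (s + t)) ^+ 2))).
  rewrite exprMn; apply: ler_wpM2l; first exact: sqr_ge0.
  move: (u + v) (s + t) => a b; have := sqr_ge0 (a - 2 * b); nra.
rewrite (_ : _ + 8 * _ * _ = D ^+ 2 * (2 * (s + t) ^+ 2 + 8 * e ^+ 2)); last by ring.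
apply: ler_wpM2l; [exact: sqr_ge0|lra].
Qed.

Lemma cubeT c r x y : cube c r x -> ~ cube c (3 * r) y -> 0 < r -> 2 * r <= `|x - y|.
Proof.
move=> /[swap] yc /[swap] r0 /(cubeE _ _ r0) xc.
have {}yc : 3 * r <= `|y - c|.
  by rewrite leNgt; apply/negP => h; apply: yc; apply/cubeE => //; rewrite mulr_gt0.
have : `|y - c| <= `|y - x| + `|x - c|.
  by apply: le_trans (ler_normD _ _); rewrite addrA subrK.
rewrite (distrC x y); lra.
Qed.

Section one_kernel.
Variables (n0 : (0 < n)%N) (psi : V -> R) (q : R) (g : V -> R) (h : V -> \bar R).
Hypotheses (q0 : 0 < q) (LP : LPker q psi) (Lg : locint g).
Hypotheses (gh : forall y, (`|g y|%:E <= h y)%E).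
Variables (c x xi : V) (r b : R).
Hypotheses (r0 : 0 < r) (b0 : 0 <= b) (xc : cube c r x) (xic : cube c r xi).
Hypothesis hb : forall rho, 0 < rho -> (cubeint rho h x <= (b * (16 * rho) ^+ n)%:E)%E.

Let mcompl : measurable (~` cube c (3 * r)).
Proof. by apply: measurableC; exact: measurable_cube. Qed.

Let h0 y : (0 <= h y)%E. Proof. by apply: le_trans (gh y); rewrite lee_fin. Qed.

(** The support radius [2 * q] is at most [2 * r], and points outside the tripled cube are at
    distance at least [2 * r] from [xi]. *)
Lemma conv_off_small : q <= r -> conv psi (off c r g) xi = 0.
Proof.
have [_ _ sp _ _] := LP.
move=> qr; rewrite /conv (eq_Rintegral _ _ (g := fun=> 0)) ?/Rintegral ?integral0// => y _.
rewrite /patch; case: ifPn => [/set_mem yc|_]; last by rewrite mulr0.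
rewrite sp ?mul0r//; apply: le_trans (cubeT xic yc r0); lra.
Qed.

Let xxi : `|xi - x| <= 2 * r.
Proof.
have /(cubeE _ _ r0) x1 := xc; have /(cubeE _ _ r0) x2 := xic.
apply: ltW; apply: le_lt_trans (_ : `|xi - c| + `|x - c| < _); last by lra.
by rewrite (distrC x c); apply: le_trans (ler_normD _ _); rewrite addrA subrK.
Qed.

(** Two errors of relative size [r / q], both controlled by the maximal bound at [x]: moving from
    [xi] to [x] by the Lipschitz condition, and restoring [g] on [cube c (3 * r)], where the kernel
    leaves [(r / q) ^ n]. *)
Lemma conv_off_large : r < q ->
  `|conv psi (off c r g) xi - conv psi g x| <= 3 * 64 ^+ n * b * (r / q).
Proof.
move=> rq; have Loff : locint (off c r g) by exact: locint_patch.
have Lin : locint (patch (fun=> 0) (cube c (3 * r)) g) by apply: locint_patch => //; exact: measurable_cube.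
have qn0 : 0 < q ^+ n by rewrite exprn_gt0.
have b1 : `|conv psi (off c r g) xi - conv psi (off c r g) x| <= 2 * 64 ^+ n * b * (r / q).
  have s4 : `|xi - x| + 2 * q <= 4 * q by apply: le_trans (lerD xxi (lexx _)) _; lra.
  have H := conv_lip q0 LP Loff s4.
  rewrite -lee_fin; apply: le_trans H _.
  apply: (@le_trans _ _ ((q ^- n.+1 * `|xi - x|)%:E * (b * (16 * (4 * q)) ^+ n)%:E)%E).
    apply: lee_wpmul2l; first by rewrite lee_fin mulr_ge0// invr_ge0 exprn_ge0// ltW.
    apply: le_trans (hb _); last by rewrite mulr_gt0.
    apply: ge0_le_integralT => y _ //; apply: le_trans (gh y).
    by rewrite /patch; case: ifP => // _; rewrite normr0 lee_fin.
  rewrite -EFinM lee_fin.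
  apply: (@le_trans _ _ (q ^- n.+1 * (2 * r) * (b * (16 * (4 * q)) ^+ n))).
    apply: ler_wpM2r; first by rewrite mulr_ge0// exprn_ge0// !mulr_ge0// ltW.
    by apply: ler_wpM2l => //; rewrite invr_ge0 exprn_ge0// ltW.
  rewrite (_ : 16 * (4 * q) = 64 * q); last by ring.
  rewrite exprMn exprS le_eqVlt; apply/orP; left; apply/eqP.
  move: (64 ^+ n : R) qn0; move: (q ^+ n) => t u t0; field; rewrite !gt_eqF//.
have E : conv psi (off c r g) x - conv psi g x = - conv psi (patch (fun=> 0) (cube c (3 * r)) g) x.
  have -> : conv psi g x = conv psi (off c r g) x + conv psi (patch (fun=> 0) (cube c (3 * r)) g) x.
    rewrite /conv -RintegralD//; last 2 first.
    - exact: (LPker_integrable x q0 LP Loff).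
    - exact: (LPker_integrable x q0 LP Lin).
    apply: eq_Rintegral => y _; rewrite /patch in_setC.
    by case: (y \in cube c (3 * r)); rewrite mulr0 ?add0r ?addr0.
  by rewrite opprD addrA subrr add0r.
have b2 : `|conv psi (off c r g) x - conv psi g x| <= 64 ^+ n * b * (r / q).
  rewrite E normrN -lee_fin; apply: le_trans (conv_le x q0 LP Lin) _.
  apply: (@le_trans _ _ ((q ^- n)%:E * (b * (16 * (4 * r)) ^+ n)%:E)%E).
    apply: lee_wpmul2l; first by rewrite lee_fin invr_ge0 exprn_ge0// ltW.
    apply: le_trans (hb _); last by rewrite mulr_gt0.
    apply: (@le_trans _ _ (\int[mu]_(y in cube x (4 * r)) `|patch (fun=> 0) (cube c (3 * r)) g y|%:E)%E).
      rewrite /cubeint [leLHS]integral_mkcond [leRHS]integral_mkcond.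
      apply: ge0_le_integralT => y _; rewrite /patch; first by case: ifP.
      case: (boolP (y \in cube c (3 * r))) => yc; last first.
        by rewrite normr0; case: ifP => _; case: ifP.
      have -> : y \in cube x (4 * r).
        apply: mem_set; have /(cubeE _ _ r0) x1 := xc.
        apply: (cubeS (x := c) (r := 3 * r)); last exact: set_mem.
        by rewrite distrC; lra.
      by case: ifP => // _; rewrite lee_fin.
    apply: ge0_le_integralT => y _ //; apply: le_trans (gh y).
    by rewrite /patch; case: ifP => // _; rewrite normr0 lee_fin.
  rewrite -EFinM lee_fin (_ : 16 * (4 * r) = 64 * r); last by ring.
  rewrite exprMn (_ : q ^- n * _ = 64 ^+ n * b * (r / q) ^+ n); last first.
    by rewrite expr_div_n; ring.
  apply: ler_wpM2l; first by rewrite mulr_ge0// exprn_ge0.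
  have rq0 : 0 <= r / q by rewrite divr_ge0// ltW.
  have rq1 : r / q <= 1 by rewrite ler_pdivrMr// mul1r ltW.
  by case: (n) n0 => // m _; rewrite exprS ler_piMr// exprn_ile1.
rewrite (_ : _ - _ = (conv psi (off c r g) xi - conv psi (off c r g) x) +
  (conv psi (off c r g) x - conv psi g x)); last by ring.
apply: le_trans (ler_normD _ _) _; lra.
Qed.

End one_kernel.

Variables (n0 : (0 < n)%N) (psi1 psi2 : int -> V -> R) (D : R).
Hypotheses (LP1 : forall k : int, LPker (2 ^ k) (psi1 k)) (LP2 : forall k : int, LPker (2 ^ k) (psi2 k)).
Hypothesis D0 : 0 <= D.
Variables (f : V -> R[i]) (f1 f2 : V -> R).
Hypotheses (S1 : mu.-integrable setT (EFin \o f1)) (S2 : mu.-integrable setT (EFin \o f2)).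
Hypothesis fE : \forall x \ae mu, complex.Re (f x) = f1 x /\ complex.Im (f x) = f2 x.
Local Notation coff c r := (patch (fun=> 0 : R[i]) (~` cube c (3 * r)) f).
Let h y : \bar R := (`|f1 y| + `|f2 y|)%:E.

(** Cotlar's inequality for the square sum: scales up to [r] do not see the truncated function, and
    for the others the errors [r / 2^k] are square summable. The numerical constant is
    [288 <= 17^2]. *)
Lemma windowed_off c r x xi b N : 0 < r -> 0 <= b -> cube c r x -> cube c r xi ->
  (forall rho, 0 < rho -> (cubeint rho h x <= (b * (16 * rho) ^+ n)%:E)%E) ->
  windowed psi1 psi2 D (coff c r) N xi <=
  2 * windowed psi1 psi2 D f N x + (17 * 64 ^+ n * D * b) ^+ 2.
Proof.
move=> r0 b0 xc xic hb; have l1 := locint_integrable S1; have l2 := locint_integrable S2.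
have mC : measurable (~` cube c (3 * r)) by apply: measurableC; exact: measurable_cube.
have lo1 := locint_patch mC l1; have lo2 := locint_patch mC l2.
have mh : measurable_fun setT h.
  by apply/measurable_EFinP; apply: measurable_funD; apply: measurableT_comp => //; [exact: l1.1|exact: l2.1].
have gh1 y : (`|f1 y|%:E <= h y)%E by rewrite lee_fin lerDl.
have gh2 y : (`|f2 y|%:E <= h y)%E by rewrite lee_fin lerDr.
have foE : \forall x \ae mu, complex.Re (coff c r x) = off c r f1 x /\ complex.Im (coff c r x) = off c r f2 x.
  by apply: filterS fE => y [e1 e2]; rewrite /patch; case: ifP.
pose B := 3 * 64 ^+ n * b.
have B0 : 0 <= B by rewrite !mulr_ge0// exprn_ge0.
have q0 k : 0 < (2 ^ k : R) by rewrite exprz_gt0.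
apply: (@le_trans _ _ (2 * windowed psi1 psi2 D f N x +
  \sum_(i < N.*2.+1 | r < 2 ^ window N i) 16 * D ^+ 2 * (B * (r / 2 ^ window N i)) ^+ 2)).
  rewrite /windowed mulr_sumr [X in _ <= _ + X]big_mkcond -big_split; apply: ler_sum => i _.
  move: (window N i) => k.
  rewrite (cconvE D LP1 LP2 lo1 lo2 foE) (cconvE D LP1 LP2 l1 l2 fE) !normcE/=.
  case: ltP => rq; last first.
    rewrite !(conv_off_small _ _ r0 xic rq)//.
    by rewrite !(subr0, addr0, mulr0) expr0n/= ?addr0 mulr_ge0// addr_ge0// sqr_ge0.
  have e11 := conv_off_large n0 (q0 k) (LP1 k) l1 gh1 r0 b0 xc xic hb rq.
  have e12 := conv_off_large n0 (q0 k) (LP1 k) l2 gh2 r0 b0 xc xic hb rq.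
  have e21 := conv_off_large n0 (q0 k) (LP2 k) l1 gh1 r0 b0 xc xic hb rq.
  have e22 := conv_off_large n0 (q0 k) (LP2 k) l2 gh2 r0 b0 xc xic hb rq.
  rewrite -/B in e11 e12 e21 e22.
  have e0 : 0 <= B * (r / 2 ^ k) by rewrite mulr_ge0// divr_ge0// ltW.
  move: (B * (r / 2 ^ k)) e0 e11 e12 e21 e22 => e e0 e11 e12 e21 e22.
  rewrite [2 * (_ + _)]mulrDr (_ : 16 * D ^+ 2 * e ^+ 2 = 8 * D ^+ 2 * e ^+ 2 + 8 * D ^+ 2 * e ^+ 2); last by ring.
  rewrite addrACA; apply: lerD; apply: (sqr_perturb D) => //.
  by rewrite opprK addrC distrC.
rewrite lerD2l -mulr_sumr.
have -> : \sum_(i < N.*2.+1 | r < 2 ^ window N i) (B * (r / 2 ^ window N i)) ^+ 2 =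
   (B * r) ^+ 2 * \sum_(i < N.*2.+1 | r < 2 ^- N * 2 ^+ i) (2 ^- N * 2 ^+ i) ^- 2.
  rewrite mulr_sumr; apply: eq_big => i; rewrite windowE// => _.
  by rewrite exprMn expr_div_n; ring.
have G := @geo_tail_sum R (2 ^- N) r 1 N.*2.+1 _ r0.
apply: (@le_trans _ _ (16 * D ^+ 2 * ((B * r) ^+ 2 * (2 * r ^- 2)))).
  apply: ler_wpM2l; first by rewrite mulr_ge0// sqr_ge0.
  by apply: ler_wpM2l; [exact: sqr_ge0|apply: G; rewrite invr_gt0 exprn_gt0].
rewrite (_ : _ * _ = 288 * (64 ^+ n * D * b) ^+ 2); last first.
  by rewrite /B; move: (64 ^+ n : R) => t; field; rewrite gt_eqF.
rewrite (_ : (17 * _ * _ * _) ^+ 2 = 289 * (64 ^+ n * D * b) ^+ 2); last first.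
  by move: (64 ^+ n : R) => t; ring.
by apply: ler_wpM2r; [exact: sqr_ge0|rewrite ler_nat].
Qed.

Definition sqfun (g : V -> R[i]) x : \bar R := (sqfun2 psi1 psi2 D g x `^ 2^-1)%E.

Definition grand_cst : R := 34 * 64 ^+ n * 6 ^+ n + 32 * @weak_cst R n.

Lemma grand_maximal_ge0 (U : (V -> R[i]) -> V -> \bar R) g x : (0 <= grand_maximal U g x)%E.
Proof.
have m0 : (0 < mu [set: V])%E.
  apply: (@lt_le_trans _ _ (mu (cube (0 : V) 1))).
    by rewrite rV_lebesgue_cube// lte_fin mulr1 exprn_gt0.
  by apply: le_measure; rewrite ?inE//; exact: measurable_cube.
have x1 : cube x 1 x by move=> i; rewrite subrr normr0.
have H : (_ <= grand_maximal U g x)%E :=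
  ereal_sup_ubound (ex_intro _ x (ex_intro _ 1 (And3 ltr01 x1 erefl))).
apply: le_trans H; apply: ess_sup_gee => //; apply: aeW => y; rewrite /patch; case: ifP => // _; exact: abse_ge0.
Qed.

(** A cube that makes the value large at [x] does so at each of its points. *)
Lemma open_grand_maximal (U : (V -> R[i]) -> V -> \bar R) g (t : \bar R) :
  open [set x | (t < grand_maximal U g x)%E].
Proof.
rewrite openE => x /= /ereal_sup_gt[_ [c [r [r0 xc ->]]] tx].
have cN : nbhs x (cube c r) by apply: open_nbhs_nbhs; split => //; exact: open_cube.
apply: (filterS _ cN).
move=> y yc /=; apply: lt_le_trans tx _; apply: ereal_sup_ubound; exists c, r.
by split.
Qed.

Theorem grand_maximal_weak (a : R) : 0 < a ->
  (a%:E * mu [set x | (a%:E < grand_maximal sqfun f x)%E] <= (grand_cst * D)%:E *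
    (\int[mu]_x `|f1 x|%:E + \int[mu]_x `|f2 x|%:E))%E.
Proof.
move=> a0; have l1 := locint_integrable S1; have l2 := locint_integrable S2.
have [D00|D1] := eqVneq D 0.
  rewrite (_ : mkset _ = set0); first by rewrite measure0 mule0 D00 mulr0 mul0e.
  apply/seteqP; split => // x /=; rewrite ltNge => /negP; apply.
  apply: ge_ereal_sup => _ [c [r [r0 xc ->]]]; apply/ess_supP/aeW => xi; rewrite /patch.
  case: ifPn => [/set_mem xic|_]; last by rewrite lee_fin ltW.
  have -> : sqfun (coff c r) xi = 0%E.
    rewrite /sqfun /sqfun2 esum1 ?poweR0r ?invr_neq0// => k _.
    have Z (F : V -> R) : (forall y, F y = 0) -> \int[mu]_y F y = 0.
      by move=> F0; rewrite /Rintegral (eq_integral (fun=> 0%E)) ?integral0// => y _; rewrite F0.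
    rewrite /cconv /cintegral /ckernel D00 !Z ?normcE ?expr0n ?addr0// => y; by rewrite !mul0r ?raddf0.
  by rewrite abse0 lee_fin ltW.
have Dp : 0 < D by rewrite lt_neqAle eq_sym D1.
have mabs g : mu.-integrable setT (EFin \o g) -> measurable_fun setT (fun y : V => `|g y|%:E).
  by move=> /locint_integrable[mg _]; exact: measurable_absE.
have mh : measurable_fun setT h.
  apply/measurable_EFinP; apply: measurable_funD; apply: measurableT_comp => //; [exact: l1.1|exact: l2.1].
have h0 y : (0 <= h y)%E by rewrite lee_fin addr_ge0.
have hI : (\int[mu]_y h y = \int[mu]_x `|f1 x|%:E + \int[mu]_x `|f2 x|%:E)%E.
  by rewrite -ge0_integralD//; exact: mabs.
have fin g : mu.-integrable setT (EFin \o g) -> (\int[mu]_x `|g x|%:E < +oo)%E by move=> /integrableP[].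
have hfin : (\int[mu]_y h y < +oo)%E by rewrite hI lte_add_pinfty//; exact: fin.
have u0 : 0 < 64 ^+ n :> R by rewrite exprn_gt0.
(* Makes the error [17 * 64^n * D * b] equal to [a / 2]; with the threshold [a / 4] for the square
   function, [2 (a/4)^2 + (a/2)^2] stays below [a^2]. *)
pose b := a / (34 * 64 ^+ n * D).
have b0 : 0 < b by rewrite divr_gt0// !mulr_gt0.
have [Om [mO muO Ob]] := maximal_weak n0 b0 mh h0 hfin.
have a4 : 0 < a / 4 by rewrite divr_gt0.
pose E := [set x | (((a / 4) ^+ 2)%:E < sqfun2 psi1 psi2 D f x)%E].
have mE : measurable E.
  have := emeasurable_fun_o_infty measurableT (measurable_sqfun2 D LP1 LP2 l1 l2 fE) ((a / 4) ^+ 2)%:E.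
  by rewrite setTI.
have sub : [set x | (a%:E < grand_maximal sqfun f x)%E] `<=` Om `|` E.
  move=> x; apply: contraPP => /not_orP[xO /negP]; rewrite -leNgt => xE; apply/negP; rewrite -leNgt.
  apply: ge_ereal_sup => _ [c [r [r0 xc ->]]]; apply/ess_supP/aeW => xi; rewrite /patch.
  case: ifPn => [/set_mem xic|_]; last by rewrite lee_fin ltW.
  rewrite gee0_abs ?poweR_ge0//.
  have -> : (a%:E = (a ^+ 2)%:E `^ 2^-1)%E.
    by rewrite poweR_EFin -powR_mulrn ?ltW// -powRrM divff// powRr1// ltW.
  apply: le_poweR => //; first by apply: esum_ge0 => k _; rewrite lee_fin sqr_ge0.
  have cv := @cvg_windowed R n psi1 psi2 D (coff c r) xi.
  rewrite -(cvg_lim _ cv)//; apply: lime_le; first by apply/cvg_ex; eexists; exact: cv.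
  apply: nearW => N; rewrite lee_fin.
  apply: le_trans (windowed_off N r0 (ltW b0) xc xic (Ob x xO)) _.
  have WQ : windowed psi1 psi2 D f N x <= (a / 4) ^+ 2.
    rewrite -lee_fin; apply: le_trans xE; rewrite /windowed -sumEFin; apply: esum_int_ge => k.
    by rewrite lee_fin sqr_ge0.
  rewrite (_ : 17 * 64 ^+ n * D * b = a / 2); last first.
    by rewrite /b; move: (64 ^+ n : R) u0 => u u0; field; rewrite !gt_eqF.
  have := sqr_ge0 a; rewrite !expr_div_n in WQ *; lra.
have mM : measurable [set x | (a%:E < grand_maximal sqfun f x)%E].
  by apply: open_rV_measurable; exact: open_grand_maximal.
have B1 : (a%:E * mu Om <= (34 * 64 ^+ n * 6 ^+ n * D)%:E * \int[mu]_y h y)%E.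
  have -> : (a%:E = (34 * 64 ^+ n * D)%:E * b%:E)%E.
    by rewrite -EFinM /b mulrC divfK// gt_eqF// !mulr_gt0.
  rewrite -muleA; apply: le_trans (lee_wpmul2l _ muO) _.
    by rewrite lee_fin ltW// !mulr_gt0.
  by rewrite muleA -EFinM (_ : 34 * 64 ^+ n * D * 6 ^+ n = 34 * 64 ^+ n * 6 ^+ n * D)//; ring.
have B2 : (a%:E * mu E <= (32 * @weak_cst R n * D)%:E * \int[mu]_y h y)%E.
  have -> : (a%:E = 4%:E * (a / 4)%:E)%E by rewrite -EFinM mulrC divfK.
  rewrite -muleA hI; apply: le_trans (lee_wpmul2l _ (sqfun2_weak n0 LP1 LP2 D0 l1.1 l2.1 fE S1 S2 a4)) _.
    by rewrite lee_fin.
  by rewrite muleA -EFinM (_ : 4 * (8 * @weak_cst R n * D) = 32 * @weak_cst R n * D)//; ring.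
apply: (@le_trans _ _ (a%:E * mu Om + a%:E * mu E)%E).
  rewrite -ge0_muleDr//; apply: lee_wpmul2l; first by rewrite lee_fin ltW.
  apply: (@le_trans _ _ (mu (Om `|` E))); last exact: measureU2.
  by apply: le_measure => //; rewrite inE//; exact: measurableU.
apply: le_trans (leeD B1 B2) _; rewrite -hI.
have wc0 : 0 <= @weak_cst R n by rewrite /weak_cst addr_ge0// mulr_ge0// exprn_ge0.
rewrite -ge0_muleDl ?lee_fin ?mulr_ge0 ?exprn_ge0//.
by rewrite -EFinD -mulrDl.
Qed.

End grand_maximal_bound.

(** * Muckenhoupt weights *)

Section Ap_weights.
Context {R : realType} {n : nat}.
Local Notation V := 'rV[R]_n.
Local Notation mu := (rV_lebesgue n).
Implicit Types (x y c : V) (r : R).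

Lemma cube_measure_gt0 c r : 0 < r -> 0 < (2 * r) ^+ n.
Proof. by move=> r0; rewrite exprn_gt0// mulr_gt0. Qed.

Lemma averageE c r (v : V -> \bar R) : 0 < r ->
  average (cube c r) v = ((((2 * r) ^+ n)^-1)%:E * \int[mu]_(x in cube c r) v x)%E.
Proof.
move=> r0; rewrite /average rV_lebesgue_cube ?(ltW r0)// inver ifF//.
by rewrite gt_eqF// (cube_measure_gt0 c).
Qed.

Lemma integral_cube_gt0 (D : set V) (v : V -> \bar R) : measurable D -> measurable_fun setT v ->
  (forall x, (0 <= v x)%E) -> (0 < mu (D `&` [set x | 0 < v x]))%E -> (0 < \int[mu]_(x in D) v x)%E.
Proof.
move=> mD mv v0 mD0; rewrite lt0e integral_ge0// andbT; apply/eqP => I0.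
have mvD := measurable_funS measurableT (@subsetT _ D) mv.
have : (\int[mu]_(x in D) `|v x| = 0)%E.
  by rewrite -I0; apply: eq_integral => x _; rewrite gee0_abs.
move/(ae_eq_integral_abs mu mD mvD) => [N [mN N0 sub]].
have mE : measurable (D `&` [set x | (0 < v x)%E]).
  by have := emeasurable_fun_o_infty mD mvD 0%E.
move: mD0; rewrite ltNge => /negP; apply; rewrite -[X in (_ <= X)%E]N0; apply: le_measure; rewrite ?inE//.
by move=> x [Dx /= vx]; apply: sub => /= H; move: vx; rewrite H// ltxx.
Qed.

Lemma average_ae (D : set V) (v g : V -> \bar R) : measurable D -> measurable_fun setT g ->
  (\forall x \ae mu, v x = g x) -> average D v = average D g.
Proof.
move=> mD mg vg; congr (_ * _)%E; apply: ae_eq_integralT => //; first exact: measurable_funTS.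
by apply: filterS vg => x ->.
Qed.

Lemma HL_max_ae (v g : V -> \bar R) x : measurable_fun setT g -> (\forall x \ae mu, v x = g x) ->
  HL_max v x = HL_max g x.
Proof.
move=> mg vg; rewrite /HL_max; congr ereal_sup; apply/seteqP; split => s [c [r [r0 xc ->]]];
  exists c, r; split => //; [|apply/esym]; apply: average_ae; rewrite ?measurable_cube//;
  [exact: measurable_cube|exact: measurableT_comp|by apply: filterS vg => y ->
  |exact: measurable_cube|exact: measurableT_comp|by apply: filterS vg => y ->].
Qed.

Lemma weight_locfin (w : V -> R) c r : weight w -> (\int[mu]_(x in cube c r) (w x)%:E < +oo)%E.
Proof.
move=> [w0 _ wD].
pose A : set V := [set v | forall i, `[c ord0 i - r, c ord0 i + r]%classic (v ord0 i)].
have cA : compact A.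
  exact: (@rV_compact R n (fun i => `[c ord0 i - r, c ord0 i + r]%classic) (fun i => @segment_compact R _ _)).
apply: le_lt_trans (wD A cA); rewrite integral_mkcond [leRHS]integral_mkcond.
apply: ge0_le_integralT => x _; rewrite /patch; first by case: ifP => // _; rewrite lee_fin.
case: ifPn => [/set_mem xc|_]; last by case: ifP => // _; rewrite lee_fin.
rewrite mem_set// => i /=; rewrite in_itv/=; have := xc i; rewrite ltr_norml => /andP[]; lra.
Qed.

Variables (n0 : (0 < n)%N) (p : R) (p1 : 1 < p) (w : V -> R) (hAp : Ap p w).

Let pp : 0 < p - 1. Proof. by rewrite subr_gt0. Qed.
Let pne : p - 1 != 0. Proof. by rewrite gt_eqF. Qed.
Let w0 x : 0 <= w x. Proof. by have [[]] := hAp. Qed.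

Let borel_w : exists2 w1 : V -> R, measurable_fun setT w1 /\ (forall x, 0 <= w1 x) &
  \forall x \ae mu, w x = w1 x.
Proof.
have [[_ [g mg wg] _] _] := hAp; exists (fun x => Num.max (g x) 0).
  split; first exact: measurable_maxr.
  by move=> x; rewrite le_max lexx orbT.
by apply: filterS wg => x wx; rewrite -wx max_l.
Qed.

Let dual w1 (x : V) : \bar R := if w1 x == 0 then +oo%E else (w1 x `^ (1 - conj_exp p))%:E.

Let mdual w1 : measurable_fun setT w1 -> measurable_fun setT (dual w1).
Proof.
move=> mw1; apply: measurable_fun_ifT => //.
  exact: measurable_fun_eqr.
by apply/measurable_EFinP; apply: (@measurableT_comp _ _ _ _ _ _ ((@powR R)^~ _)) => //; exact: measurable_powR.
Qed.

Let dual_ge0 w1 x : (0 <= dual w1 x)%E.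
Proof. by rewrite /dual; case: ifP => // _; rewrite lee_fin powR_ge0. Qed.

Let Ap_le c r : 0 < r ->
  (average (cube c r) (EFin \o w) * average (cube c r) (dual_weight p w) `^ (p - 1) <= Ap_const p w)%E.
Proof. by move=> r0; apply: ereal_sup_ubound; exists c, r. Qed.

Let mcube1 N : measurable (cube (0 : V) N%:R). Proof. exact: measurable_cube. Qed.

Let cube_meets (E : set V) : measurable E -> (0 < mu E)%E ->
  exists N, forall M, (N <= M)%N -> (0 < mu (E `&` cube (0 : V) M%:R))%E.
Proof.
move=> mE E0; apply: contrapT => H; move: E0; rewrite ltNge => /negP; apply.
have -> : E = \bigcup_N (E `&` cube (0 : V) N%:R).
  rewrite -setI_bigcupr; apply/seteqP; split => [x Ex|x []//]; split => //.
  exists (Num.truncn `|x|).+1 => //; apply/cubeE; first by rewrite ltr0n.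
  by rewrite subr0 truncnS_gt.
have sub N M : (N <= M)%N -> E `&` cube (0 : V) N%:R `<=` E `&` cube (0 : V) M%:R.
  move=> NM x [Ex xN]; split => // i; apply: lt_le_trans (xN i) _; by rewrite ler_nat.
apply: mu_nd_le => [N|N M NM|N]; [exact: measurableI|exact: sub|].
rewrite leNgt; apply/negP => h; apply: H; exists N => M NM; apply: lt_le_trans h _.
by apply: le_measure; rewrite ?inE//; [exact: measurableI|exact: measurableI|exact: sub].
Qed.

(** If the zero set and its complement both had positive measure, a large cube would meet both in
    positive measure: the average of [w] would be positive and that of the dual weight infinite,
    against [Ap]. The zero weight survives because [0 * +oo = 0]. *)
Lemma Ap_weight_pos : (\forall x \ae mu, w x = 0) \/
  exists w2 : V -> R, [/\ measurable_fun setT w2, forall x, 0 < w2 x & \forall x \ae mu, w x = w2 x].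
Proof.
have [w1 [mw1 w1_ge0] ww1] := borel_w.
pose P := [set x | (0 < (w1 x)%:E)%E]; pose Z := ~` P.
have mP : measurable P.
  have := emeasurable_fun_o_infty measurableT ((measurable_EFinP _ _).2 mw1) 0%E.
  by rewrite setTI.
have mZ : measurable Z by exact: measurableC.
have [P0|P1] := eqVneq (mu P) 0%E.
  left; have : \forall x \ae mu, ~ P x by exists P; split => // x /= /contrapT.
  apply: filterS2 ww1 => x -> /negP; rewrite lte_fin -leNgt => h.
  by apply/eqP; rewrite eq_le h w1_ge0.
right; exists (fun x => if 0 < w1 x then w1 x else 1); split.
- by apply: measurable_fun_ifT => //; exact: measurable_fun_ltr.
- by move=> x; case: ifP.
suff Z0 : mu Z = 0%E.
  have : \forall x \ae mu, P x by exists Z; split.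
  by apply: filterS2 ww1 => x -> /=; rewrite /P/= lte_fin => ->.
apply/eqP; apply: contrapT => /negP Z1.
have gt0 (E : set V) : mu E != 0%E -> (0 < mu E)%E by move=> h; rewrite lt0e h/= measure_ge0.
have [N1 H1] := cube_meets mP (gt0 _ P1); have [N2 H2] := cube_meets mZ (gt0 _ Z1).
pose M := (maxn N1 N2).+1; pose Q := cube (0 : V) M%:R.
have M0 : 0 < M%:R :> R by rewrite ltr0n.
have HP : (0 < mu (P `&` Q))%E by apply: H1; rewrite /M; exact: leq_trans (leq_maxl _ _) (leqnSn _).
have HZ : (0 < mu (Z `&` Q))%E by apply: H2; rewrite /M; exact: leq_trans (leq_maxr _ _) (leqnSn _).
have iM : (0 < (((2 * M%:R) ^+ n)^-1 : R)%:E)%E by rewrite lte_fin invr_gt0 (cube_measure_gt0 0).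
have mQ : measurable Q by exact: measurable_cube.
have A1 : (0 < average Q (EFin \o w))%E.
  rewrite (average_ae (g := EFin \o w1) mQ); last 2 first.
  - exact/measurable_EFinP.
  - by apply: filterS ww1 => x /= ->.
  rewrite averageE// mule_gt0//; apply: integral_cube_gt0 => //; first exact/measurable_EFinP.
  by rewrite setIC.
have A2 : average Q (dual_weight p w) = +oo%E.
  rewrite (average_ae (g := dual w1) mQ); last 2 first.
  - exact: mdual.
  - by apply: filterS ww1 => x /= wx; rewrite /dual_weight/= wx.
  have I : (\int[mu]_(x in Q) dual w1 x = +oo)%E.
    apply/eqP; rewrite -leye_eq.
    apply: (@le_trans _ _ (\int[mu]_(x in Z `&` Q) (cst +oo%E) x)%E).
      by rewrite integral_cst; [rewrite gt0_mulye|exact: measurableI].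
    rewrite integral_mkcond [leRHS]integral_mkcond; apply: ge0_le_integralT => x _; rewrite /patch.
      by case: ifP => _; rewrite ?leey.
    case: ifPn => [/set_mem[Zx Qx]|_]; last by case: ifP.
    rewrite mem_set// /dual ifT//; move: Zx; rewrite /Z/P/= lte_fin => /negP; rewrite -leNgt => h.
    by rewrite eq_le h w1_ge0.
  by rewrite averageE// I gt0_muley.
have := Ap_le 0 M0; rewrite -/Q A2 poweRyr// gt0_muley// leye_eq => /eqP Ainf.
by have [_] := hAp; rewrite Ainf.
Qed.

Variable w2 : V -> R.
Hypotheses (mw2 : measurable_fun setT w2) (w2_gt0 : forall x, 0 < w2 x).
Hypothesis ww2 : \forall x \ae mu, w x = w2 x.

(** A finite positive Borel function, a.e. equal to [dual_weight]; its power [1 - p] gives back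
    [w2]. *)
Definition dual2 x : R := w2 x `^ (1 - conj_exp p).
Local Notation sg := dual2.

Let expE : (1 - conj_exp p) * (1 - p) = 1.
Proof. by rewrite /conj_exp; field; exact: pne. Qed.

Lemma dual2_gt0 x : 0 < sg x. Proof. by rewrite powR_gt0. Qed.
Lemma measurable_dual2 : measurable_fun setT sg.
Proof. by apply: (@measurableT_comp _ _ _ _ _ _ ((@powR R)^~ _)) => //; exact: measurable_powR. Qed.

Lemma dual2_powR x : w2 x = sg x `^ (1 - p).
Proof. by rewrite -powRrM expE powRr1// ltW. Qed.

Lemma dual_weight_ae : \forall x \ae mu, dual_weight p w x = (sg x)%:E.
Proof. by apply: filterS ww2 => x wx; rewrite /dual_weight wx gt_eqF. Qed.

Let w_ae : \forall x \ae mu, (EFin \o w) x = (w2 x)%:E.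
Proof. by apply: filterS ww2 => x /= ->. Qed.

Let mE (v : V -> R) : measurable_fun setT v -> measurable_fun setT (EFin \o v).
Proof. by move=> mv; exact/measurable_EFinP. Qed.

Let cube_int_gt0 (v : V -> R) c r : 0 < r -> measurable_fun setT v -> (forall x, 0 < v x) ->
  (0 < \int[mu]_(x in cube c r) (v x)%:E)%E.
Proof.
move=> r0 mv v0; apply: integral_cube_gt0; [exact: measurable_cube|exact: mE|by move=> x; rewrite lee_fin ltW|].
rewrite (_ : _ `&` _ = cube c r).
  by change (0 < mu (cube c r))%E; rewrite rV_lebesgue_cube ?ltW// lte_fin (cube_measure_gt0 c).
by apply/seteqP; split => [x []//|x xc]; split => //=; rewrite lte_fin.
Qed.

Let Wfin c r : (\int[mu]_(x in cube c r) (w2 x)%:E < +oo)%E.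
Proof.
have [hw _] := hAp; have := weight_locfin c r hw; congr (_ < _)%E.
apply: ae_eq_integralT; [exact: measurable_cube|by apply: measurable_funTS; exact: mE|].
by apply: filterS w_ae => x /= ->.
Qed.

Let avw c r : 0 < r -> average (cube c r) (EFin \o w) =
  ((((2 * r) ^+ n)^-1)%:E * \int[mu]_(x in cube c r) (w2 x)%:E)%E.
Proof.
by move=> r0; rewrite (average_ae (measurable_cube c r) (mE mw2) w_ae) averageE.
Qed.

Let avd c r : 0 < r -> average (cube c r) (dual_weight p w) =
  ((((2 * r) ^+ n)^-1)%:E * \int[mu]_(x in cube c r) (sg x)%:E)%E.
Proof.
by move=> r0; rewrite (average_ae (measurable_cube c r) (mE measurable_dual2) dual_weight_ae) averageE.
Qed.

(** An infinite integral of the dual weight, multiplied by the positive average of [w], would make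
    the A_p constant infinite. *)
Let Sfin c r : 0 < r -> (\int[mu]_(x in cube c r) (sg x)%:E < +oo)%E.
Proof.
move=> r0; have [_ Afin] := hAp; rewrite ltey; apply/eqP => Sinf.
have m0 : (0 < (((2 * r) ^+ n)^-1)%:E)%E by rewrite lte_fin invr_gt0 (cube_measure_gt0 c).
have := Ap_le c r0; rewrite avw// avd// Sinf gt0_muley// poweRyr// gt0_muley.
  by rewrite leye_eq => /eqP Ainf; move: Afin; rewrite Ainf.
by rewrite mule_gt0//; exact: cube_int_gt0.
Qed.

Let locint_pos (v : V -> R) : measurable_fun setT v -> (forall x, 0 < v x) ->
  (forall c r, 0 < r -> (\int[mu]_(x in cube c r) (v x)%:E < +oo)%E) -> locint v.
Proof.
move=> mv v0 vfin; split => // c r; have [r0|r0] := ltP 0 r.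
  by rewrite /cubeint; under eq_integral do rewrite gtr0_norm//; exact: vfin.
rewrite /cubeint (_ : cube c r = set0) ?integral_set0//; apply/seteqP; split => // z.
by move/(_ (Ordinal n0)); rewrite ltNge (le_trans r0).
Qed.

Lemma locint_w2 : locint w2. Proof. by apply: locint_pos => // c r _; exact: Wfin. Qed.
Lemma locint_sg : locint sg.
Proof. by apply: locint_pos; [exact: measurable_dual2|exact: dual2_gt0|exact: Sfin]. Qed.

Let EFfine (v : V -> R) c r : (0 < \int[mu]_(x in cube c r) (v x)%:E < +oo)%E ->
  exists2 t, 0 < t & (\int[mu]_(x in cube c r) (v x)%:E = t%:E)%E.
Proof.
move=> /andP[]; case: (\int[mu]_(x in cube c r) (v x)%:E)%E => // t t0 _.
by exists t; rewrite -?lte_fin.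
Qed.

(** Positivity, read off one cube, makes the constant a positive real; the two normalisations by
    volume combine to the power [p]. *)
Lemma Ap_const_fin : exists2 a, 0 < a & Ap_const p w = a%:E /\
  forall c r, 0 < r -> fine (cubeint r (fun y => (w2 y)%:E) c) * fine (cubeint r (fun y => (sg y)%:E) c) `^ (p - 1) <=
  a * ((2 * r) ^+ n) `^ p.
Proof.
have [_ Afin] := hAp.
have key c r : 0 < r -> exists2 t : R * R, 0 < t.1 /\ 0 < t.2 &
   [/\ cubeint r (fun y => (w2 y)%:E) c = t.1%:E, cubeint r (fun y => (sg y)%:E) c = t.2%:E &
   ((((2 * r) ^+ n)^-1 * t.1 * (((2 * r) ^+ n)^-1 * t.2) `^ (p - 1))%:E <= Ap_const p w)%E].
  move=> r0; have [t t0 tE] := @EFfine w2 c r (introT andP (conj (cube_int_gt0 c r0 mw2 w2_gt0) (Wfin c r))).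
  have [u u0 uE] := @EFfine sg c r (introT andP (conj (cube_int_gt0 c r0 measurable_dual2 dual2_gt0) (Sfin c r0))).
  exists (t, u) => //; split => //; have := Ap_le c r0.
  by rewrite avw// avd// tE uE -!EFinM.
have [t [t1 t2] [_ _ h]] := key 0 1 ltr01.
have Apos : (0 < Ap_const p w)%E.
  apply: lt_le_trans h; rewrite lte_fin.
  have m0 : 0 < ((2 * 1) ^+ n)^-1 :> R by rewrite invr_gt0 exprn_gt0// mulr1.
  by apply: mulr_gt0; [exact: mulr_gt0|apply: powR_gt0; exact: mulr_gt0].
move: Apos Afin key; case: (Ap_const p w) => // a; rewrite lte_fin => a0 _ key; exists a => //; split => // c r r0.
have [[u v] /= [u0 v0] [-> -> /=]] := key c r r0; rewrite lee_fin.
have := cube_measure_gt0 c r0; move: ((2 * r) ^+ n) => m m0.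
rewrite powRM ?invr_ge0 ?(ltW m0) ?(ltW v0)// => H.
have mp : 0 < m `^ (p - 1) by exact: powR_gt0.
have mV : m^-1 `^ (p - 1) = (m `^ (p - 1))^-1 by rewrite -powR_inv1 ?(ltW m0)// -powRrM mulN1r powRN.
have mm : m `^ p = m * m `^ (p - 1).
  by rewrite -[X in X * _]powRr1 ?(ltW m0)// -powRD ?(gt_eqF m0) ?implybT// addrC subrK.
move: H; rewrite mV mm -(ler_pM2l (mulr_gt0 m0 mp)) => H.
rewrite [leRHS]mulrC; apply: le_trans H; rewrite le_eqVlt; apply/orP; left; apply/eqP.
by move: (m `^ (p - 1)) mp (v `^ (p - 1)) => z z0 zz; field; rewrite !gt_eqF.
Qed.

(** Positivity comes from one cube, on which [HL_max] is at least the average over that cube. *)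
Lemma Ainfty_fin (v : V -> \bar R) (g : V -> R) : measurable_fun setT g -> (forall x, 0 < g x) -> locint g ->
  (\forall x \ae mu, v x = (g x)%:E) -> (Ainfty_const v < +oo)%E ->
  exists2 A, 0 < A & Ainfty_const v = A%:E /\ forall c r, 0 < r ->
   (\int[mu]_(x in cube c r) HL_max (patch (fun=> 0%E) (cube c r) (EFin \o g)) x <=
    A%:E * \int[mu]_(x in cube c r) (g x)%:E)%E.
Proof.
move=> mg g0 [_ Lg] vg Afin.
have mQ c r := measurable_cube (R := R) (n := n) c r.
have HLE c r x : HL_max (patch (fun=> 0%E) (cube c r) v) x = HL_max (patch (fun=> 0%E) (cube c r) (EFin \o g)) x.
  apply: HL_max_ae; first by apply/(measurable_restrictT _ _).1 => //; by apply: measurable_funTS; exact: mE.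
  by apply: filterS vg => y e; rewrite /patch; case: ifP.
have key c r : 0 < r -> exists2 t, 0 < t & (\int[mu]_(x in cube c r) (g x)%:E = t%:E)%E /\
    ((t^-1)%:E * \int[mu]_(x in cube c r) HL_max (patch (fun=> 0%E) (cube c r) (EFin \o g)) x <= Ainfty_const v)%E.
  move=> r0; have gfin : (\int[mu]_(x in cube c r) (g x)%:E < +oo)%E.
    have := Lg c r; rewrite /cubeint; under eq_integral do rewrite gtr0_norm//; exact.
  have [t t0 tE] := @EFfine g c r (introT andP (conj (cube_int_gt0 c r0 mg g0) gfin)).
  exists t; first exact: t0.
  split; first exact: tE.
  apply: ereal_sup_ubound; exists c, r; split; first exact: r0.
  have -> : (\int[mu]_(x in cube c r) v x = t%:E)%E.
    rewrite -tE; apply: ae_eq_integralT; [exact: mQ|by apply: measurable_funTS; exact: mE|].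
    by apply: filterS vg => x ->.
  have -> : (t%:E^-1 = (t^-1)%:E)%E by rewrite inver gt_eqF.
  by rewrite (eq_integral _ _ (fun x _ => HLE c r x)).
have [t t0 [tE h]] := key 0 1 ltr01.
have Apos : (0 < Ainfty_const v)%E.
  apply: lt_le_trans h; rewrite mule_gt0 ?lte_fin ?invr_gt0//.
  pose m : R := ((2 * 1) ^+ n)^-1 * t.
  have m0 : 0 < m by rewrite mulr_gt0 ?invr_gt0 ?exprn_gt0 ?mulr1.
  apply: (@lt_le_trans _ _ (\int[mu]_(x in cube 0%R 1%R) (cst m%:E) x)%E).
    rewrite integral_cst//; change (0 < m%:E * mu (cube (0 : V) 1))%E.
    by rewrite rV_lebesgue_cube// -EFinM lte_fin mulr_gt0// exprn_gt0// mulr1.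
  apply: ge0_le_integralT => x xQ; first by rewrite lee_fin ltW.
  have H : (_ <= HL_max (patch (fun=> 0%E) (cube 0%R 1%R) (EFin \o g)) x)%E :=
    ereal_sup_ubound (ex_intro _ 0 (ex_intro _ 1 (And3 ltr01 xQ erefl))).
  apply: le_trans H; rewrite averageE// /m EFinM -tE; apply: lee_wpmul2l.
    by rewrite lee_fin invr_ge0 exprn_ge0// mulr1.
  apply: ge0_le_integralT => y yQ; first by rewrite lee_fin ltW.
  by rewrite /patch mem_set//= lee_fin ler_norm.
move: Apos Afin key; case: (Ainfty_const v) => // A; rewrite lte_fin => A0 _ key; exists A => //; split => // c r r0.
have [u u0 [-> H]] := key c r r0; rewrite muleC -lee_pdivrMl//.
Qed.

End Ap_weights.

(** * Norm inequalities *)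

Section borel_versions.
Context {R : realType} {n : nat}.
Local Notation V := 'rV[R]_n.
Local Notation mu := (rV_lebesgue n).
Implicit Types (x y : V) (k : int) (N : nat).

Lemma borel_parts (f : V -> R[i]) : clebesgue_measurable f ->
  exists f1 f2 : V -> R, [/\ measurable_fun setT f1, measurable_fun setT f2 &
    \forall x \ae mu, complex.Re (f x) = f1 x /\ complex.Im (f x) = f2 x].
Proof.
move=> [[g1 m1 e1] [g2 m2 e2]]; exists g1, g2; split => //.
by apply: filterS2 e1 e2 => x.
Qed.

Variables (f : V -> R[i]) (f1 f2 : V -> R).
Hypotheses (mf1 : measurable_fun setT f1) (mf2 : measurable_fun setT f2).
Hypothesis fE : \forall x \ae mu, complex.Re (f x) = f1 x /\ complex.Im (f x) = f2 x.

Definition modulus x : R := Num.sqrt (f1 x ^+ 2 + f2 x ^+ 2).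

Lemma modulus_ge0 x : 0 <= modulus x. Proof. exact: sqrtr_ge0. Qed.

Lemma measurable_modulus : measurable_fun setT modulus.
Proof.
apply: measurableT_comp; first by apply: continuous_measurable_fun; exact: sqrt_continuous.
by apply: measurable_funD; exact: measurable_funX.
Qed.

Lemma cabs_ae : \forall x \ae mu, cabs f x = (modulus x)%:E.
Proof. by apply: filterS fE => x; rewrite /cabs /modulus => -[<- <-]; case: (f x). Qed.

Lemma part1_le x : `|f1 x| <= modulus x.
Proof. by rewrite /modulus -sqrtr_sqr ler_wsqrtr// lerDl sqr_ge0. Qed.

Lemma part2_le x : `|f2 x| <= modulus x.
Proof. by rewrite /modulus -sqrtr_sqr ler_wsqrtr// lerDr sqr_ge0. Qed.

Lemma integral_cabs (p : R) (w w2 : V -> R) : measurable_fun setT w2 ->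
  (\forall x \ae mu, w x = w2 x) ->
  (\int[mu]_x (`|cabs f x| `^ p * (w x)%:E) = \int[mu]_x (modulus x `^ p * w2 x)%:E)%E.
Proof.
move=> mw2 ww2; apply: ae_eq_integralT => //.
  apply/measurable_EFinP; apply: measurable_funM => //.
  apply: (@measurableT_comp _ _ _ _ _ _ ((@powR R)^~ p)) => //.
  exact: measurable_modulus.
apply: filterS2 cabs_ae ww2 => x -> -> _.
by rewrite gee0_abs ?lee_fin ?modulus_ge0// poweR_EFin -EFinM.
Qed.

Lemma L2norm_cabs : 'N[mu]_2%:E[cabs f]%E =
  ((\int[mu]_x (f1 x ^+ 2)%:E + \int[mu]_x (f2 x ^+ 2)%:E) `^ 2^-1)%E.
Proof.
rewrite unlock; congr (_ `^ _)%E.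
rewrite -ge0_integralD//; last 4 first.
- by move=> x _; rewrite lee_fin sqr_ge0.
- exact: measurable_sqE.
- by move=> x _; rewrite lee_fin sqr_ge0.
- exact: measurable_sqE.
apply: ae_eq_integralT => //.
  by apply: emeasurable_funD; exact: measurable_sqE.
apply: filterS cabs_ae => x -> _.
rewrite gee0_abs ?lee_fin ?modulus_ge0// poweR_EFin -EFinD powR_mulrn ?modulus_ge0//.
by rewrite sqr_sqrtr// addr_ge0 ?sqr_ge0.
Qed.

Lemma L1norm_cabs : 'N[mu]_1[cabs f]%E = (\int[mu]_x (modulus x)%:E)%E.
Proof.
rewrite Lnorm1; apply: ae_eq_integralT => //; first by apply/measurable_EFinP; exact: measurable_modulus.
by apply: filterS cabs_ae => x -> _; rewrite gee0_abs ?lee_fin ?modulus_ge0.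
Qed.

Lemma parts_integrable : ('N[mu]_1[cabs f] < +oo)%E ->
  [/\ mu.-integrable setT (EFin \o f1), mu.-integrable setT (EFin \o f2) &
   (\int[mu]_x `|f1 x|%:E + \int[mu]_x `|f2 x|%:E <= 2%:E * 'N[mu]_1[cabs f])%E].
Proof.
rewrite L1norm_cabs => fin.
have i1 : (\int[mu]_x `|f1 x|%:E <= \int[mu]_x (modulus x)%:E)%E.
  by apply: ge0_le_integralT => // x _; rewrite lee_fin part1_le.
have i2 : (\int[mu]_x `|f2 x|%:E <= \int[mu]_x (modulus x)%:E)%E.
  by apply: ge0_le_integralT => // x _; rewrite lee_fin part2_le.
split.
- by apply/integrableP; split; [exact/measurable_EFinP|exact: le_lt_trans fin].
- by apply/integrableP; split; [exact/measurable_EFinP|exact: le_lt_trans fin].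
- rewrite (_ : 2%:E = 1 + 1 :> \bar R)%E// ge0_muleDl// !mul1e; exact: leeD.
Qed.

End borel_versions.

(** * Unweighted norm inequalities *)

Section norm_bounds.
Context {R : realType} {n : nat}.
Local Notation V := 'rV[R]_n.
Local Notation mu := (rV_lebesgue n).
Implicit Types (x y : V) (k : int) (N : nat).
Variables (n0 : (0 < n)%N) (psi1 psi2 : int -> V -> R) (D : R).
Hypotheses (LP1 : forall k : int, LPker (2 ^ k) (psi1 k)) (LP2 : forall k : int, LPker (2 ^ k) (psi2 k)).
Hypothesis D0 : 0 <= D.
Local Notation Q := (sqfun2 psi1 psi2 D).
Local Notation U := (sqfun psi1 psi2 D).

Lemma sqfun2_ge0 f x : (0 <= Q f x)%E.
Proof. by apply: esum_ge0 => k _; rewrite lee_fin sqr_ge0. Qed.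

Lemma sqfun_powR f x (p : R) : (`|U f x| `^ p = Q f x `^ (p / 2))%E.
Proof. by rewrite gee0_abs ?poweR_ge0// /sqfun -poweRrM mulrC. Qed.

Lemma sqfun_gt f x (a : R) : 0 < a -> (a%:E < `|U f x|)%E = ((a ^+ 2)%:E < Q f x)%E.
Proof.
move=> a0; rewrite gee0_abs ?poweR_ge0//; have a2 : (0 <= (a ^+ 2)%:E :> \bar R)%E by rewrite lee_fin sqr_ge0.
have aE : (a%:E = (a ^+ 2)%:E `^ 2^-1)%E.
  by rewrite poweR_EFin -powR_mulrn ?ltW// -powRrM divff// powRr1// ltW.
have i2 : 0 <= 2^-1 :> R by rewrite invr_ge0.
apply/idP/idP; rewrite !ltNge; apply: contra => h.
  by rewrite aE; apply: le_poweR => //; exact: sqfun2_ge0.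
have n2 : 2 != 0 :> R by [].
rewrite -(poweRVK n2 (sqfun2_ge0 f x)) -(poweRVK n2 a2) -aE; apply: le_poweR => //; exact: poweR_ge0.
Qed.

Definition cst_L2 : R := (32 * 32 ^+ n) `^ 2^-1.

Theorem sqfun_L2 f : clebesgue_measurable f -> ('N[mu]_2%:E[cabs f] < +oo)%E ->
  ('N[mu]_2%:E[U f] <= (cst_L2 * D)%:E * 'N[mu]_2%:E[cabs f])%E.
Proof.
move=> /borel_parts[f1 [f2 [m1 m2 fE]]]; rewrite (L2norm_cabs m1 m2 fE).
set I1 := (\int[mu]_x (f1 x ^+ 2)%:E)%E; set I2 := (\int[mu]_x (f2 x ^+ 2)%:E)%E.
have i1 : (0 <= I1)%E by apply: integral_ge0 => x _; rewrite lee_fin sqr_ge0.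
have i2 : (0 <= I2)%E by apply: integral_ge0 => x _; rewrite lee_fin sqr_ge0.
move=> fin; have h2 : 2^-1 != 0 :> R by rewrite invr_neq0.
have {}fin := lty_poweRy h2 fin.
have S1 : sqint f1 by split => //; apply: le_lt_trans fin; exact: leeDl.
have S2 : sqint f2 by split => //; apply: le_lt_trans fin; exact: leeDr.
have B := sqfun2_L2 D LP1 LP2 m1 m2 fE S1 S2; rewrite -/I1 -/I2 in B.
have c0 : 0 <= 32 * 32 ^+ n :> R by rewrite mulr_ge0// exprn_ge0.
have -> : 'N[mu]_2%:E[U f]%E = ((\int[mu]_x Q f x) `^ 2^-1)%E.
  rewrite unlock; congr (_ `^ _)%E; apply: eq_integral => x _.
  by rewrite sqfun_powR divff// poweRe1// sqfun2_ge0.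
have QI : (0 <= \int[mu]_x Q f x)%E by apply: integral_ge0 => x _; exact: sqfun2_ge0.
have h2' : 0 <= 2^-1 :> R by rewrite invr_ge0.
apply: le_trans (le_poweR h2' QI B) _.
have K0 : (0 <= (32 * 32 ^+ n * D ^+ 2)%:E)%E by rewrite lee_fin mulr_ge0 ?sqr_ge0.
rewrite (poweRM _ K0 (adde_ge0 i1 i2)); apply: lee_wpmul2r; first exact: poweR_ge0.
rewrite poweR_EFin powRM ?sqr_ge0// lee_fin /cst_L2 -[D ^+ 2]powR_mulrn// -powRrM divff//.
by rewrite powRr1.
Qed.

Theorem sqfun_weak f : clebesgue_measurable f -> ('N[mu]_1[cabs f] < +oo)%E ->
  (weakL1_norm (U f) <= (16 * @weak_cst R n * D)%:E * 'N[mu]_1[cabs f])%E.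
Proof.
move=> /borel_parts[f1 [f2 [m1 m2 fE]]] fin.
have [S1 S2 fle] := parts_integrable m1 m2 fE fin.
have wc0 : 0 <= @weak_cst R n by rewrite /weak_cst addr_ge0// mulr_ge0// exprn_ge0.
apply: ge_ereal_sup => _ [a /= a0 <-].
have -> : [set x | (a%:E < `|U f x|)%E] = [set x | ((a ^+ 2)%:E < Q f x)%E].
  by apply/seteqP; split => x /=; rewrite sqfun_gt.
apply: le_trans (sqfun2_weak n0 LP1 LP2 D0 m1 m2 fE S1 S2 a0) _.
have K0 : (0 <= (8 * @weak_cst R n * D)%:E)%E by rewrite lee_fin !mulr_ge0.
apply: le_trans (lee_wpmul2l K0 fle) _.
by rewrite muleA -EFinM (_ : 8 * @weak_cst R n * D * 2 = 16 * @weak_cst R n * D)//; ring.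
Qed.

Theorem grand_maximal_sqfun_weak f : clebesgue_measurable f -> ('N[mu]_1[cabs f] < +oo)%E ->
  (weakL1_norm (grand_maximal U f) <= (2 * @grand_cst R n * D)%:E * 'N[mu]_1[cabs f])%E.
Proof.
move=> /borel_parts[f1 [f2 [m1 m2 fE]]] fin.
have [S1 S2 fle] := parts_integrable m1 m2 fE fin.
have wc0 : 0 <= @grand_cst R n.
  by rewrite /grand_cst /weak_cst !(addr_ge0, mulr_ge0, exprn_ge0).
apply: ge_ereal_sup => _ [a /= a0 <-].
have -> : [set x | (a%:E < `|grand_maximal U f x|)%E] = [set x | (a%:E < grand_maximal U f x)%E].
  by apply/seteqP; split => x /=; rewrite gee0_abs// grand_maximal_ge0.
apply: le_trans (grand_maximal_weak n0 LP1 LP2 D0 S1 S2 fE a0) _.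
have K0 : (0 <= (@grand_cst R n * D)%:E)%E by rewrite lee_fin mulr_ge0.
apply: le_trans (lee_wpmul2l K0 fle) _.
by rewrite muleA -EFinM (_ : @grand_cst R n * D * 2 = 2 * @grand_cst R n * D)//; ring.
Qed.

End norm_bounds.

(** * The weighted norm inequality *)

Section weighted_norm_bound.
Context {R : realType} {n : nat}.
Local Notation V := 'rV[R]_n.
Local Notation mu := (rV_lebesgue n).
Implicit Types (x y : V) (k : int) (N : nat).
Variables (n0 : (0 < n)%N) (psi1 psi2 : int -> V -> R) (D : R).
Hypotheses (LP1 : forall k : int, LPker (2 ^ k) (psi1 k)) (LP2 : forall k : int, LPker (2 ^ k) (psi2 k)).
Hypothesis D0 : 0 <= D.
Local Notation Q := (sqfun2 psi1 psi2 D).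
Local Notation U := (sqfun psi1 psi2 D).

Lemma locint0 : locint (fun _ : V => 0 : R).
Proof.
split => // c r; rewrite /cubeint (eq_integral (fun=> 0%E)) ?integral0// => y _; by rewrite normr0.
Qed.

Lemma sqfun2_eq0 f f1 f2 x : locint f1 -> locint f2 ->
  (\forall x \ae mu, complex.Re (f x) = f1 x /\ complex.Im (f x) = f2 x) -> D = 0 -> Q f x = 0%E.
Proof.
move=> l1 l2 fE D00; rewrite /sqfun2 esum1// => k _.
by rewrite (cconvE D LP1 LP2 l1 l2 fE) normcE D00 !mul0r expr0n/= addr0.
Qed.

Lemma sqfun2_ae0 f x : (\forall x \ae mu, f x = 0) -> Q f x = 0%E.
Proof.
move=> f0; rewrite /sqfun2 esum1// => k _.
have fE : \forall x \ae mu, complex.Re (f x) = (fun _ : V => 0 : R) x /\ complex.Im (f x) = (fun _ : V => 0 : R) x.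
  by apply: filterS f0 => y ->.
have c0 psi : conv psi (fun _ : V => 0 : R) x = 0.
  by rewrite /conv /Rintegral (eq_integral (fun=> 0%E)) ?integral0// => y _; rewrite mulr0.
by rewrite (cconvE D LP1 LP2 locint0 locint0 fE) normcE !c0 subr0 addr0 mulr0 expr0n/= addr0.
Qed.

Lemma weighted_norm_eq0 p w f : 0 < p -> (forall x, Q f x = 0%E) -> weighted_norm p w (U f) = 0%E.
Proof.
move=> p0 Q0; rewrite /weighted_norm (eq_integral (fun=> 0%E)).
  by rewrite integral0 poweR0r// invr_neq0// gt_eqF.
by move=> x _; rewrite sqfun_powR Q0 poweR0r ?mul0e// mulf_neq0 ?invr_neq0// gt_eqF.
Qed.

Lemma mixed_Ap_ge0 p (w : V -> R) : (0 <= mixed_Ap_const p w)%E.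
Proof. by rewrite mule_ge0 ?poweR_ge0// le_max poweR_ge0. Qed.

(** The absolute value and the added one guarantee positivity without inspecting [cst_weighted]. *)
Definition cst_mixed p : R := (8 * 8 `^ (p / 2) * (`|@cst_weighted R n p| + 1)) `^ p^-1.

Lemma cst_mixed_gt0 p : 0 < cst_mixed p.
Proof. by rewrite powR_gt0// !mulr_gt0 ?powR_gt0// ltr_wpDl. Qed.

(** With [m] the maximum on the right, both [B] and [A^(p-1)] are at most [m^p], the second because
    [p / p' = p - 1]. *)
Lemma mixed_power (p a A B : R) : 1 < p -> 0 < a -> 0 < A -> 0 < B ->
  (4 * (8 `^ (p / 2) * D `^ p) * (`|@cst_weighted R n p| * (a * (B + A `^ (p - 1))))) `^ p^-1 <=
  cst_mixed p * D * (a `^ p^-1 * Num.max (A `^ (conj_exp p)^-1) (B `^ p^-1)).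
Proof.
move=> p1 a0 A0 B0; have p0 : 0 < p by exact: lt_trans p1.
have pn : p != 0 by rewrite gt_eqF.
have pm : p - 1 != 0 by rewrite subr_eq0 gt_eqF.
set m := Num.max _ _; set Cw := `|@cst_weighted R n p|.
have Cw0 : 0 <= Cw by exact: normr_ge0.
have m0 : 0 <= m by rewrite le_max powR_ge0.
have rp (t : R) : 0 <= t -> (t `^ p^-1) `^ p = t by move=> t0; rewrite -powRrM mulVf// powRr1.
have pr (t : R) : 0 <= t -> (t `^ p) `^ p^-1 = t by move=> t0; rewrite -powRrM mulfV// powRr1.
have mA : A `^ (p - 1) <= m `^ p.
  have -> : A `^ (p - 1) = (A `^ (conj_exp p)^-1) `^ p.
    by rewrite -powRrM; congr (_ `^ _); rewrite /conj_exp; field; rewrite pm pn.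
  by apply: ge0_ler_powR; rewrite ?nnegrE ?powR_ge0 ?(ltW p0)// le_max lexx.
have mB : B <= m `^ p.
  rewrite -[leLHS](rp B) ?(ltW B0)//.
  by apply: ge0_ler_powR; rewrite ?nnegrE ?powR_ge0 ?(ltW p0)// le_max lexx orbT.
rewrite -[leRHS]pr; last by rewrite !mulr_ge0 ?powR_ge0.
apply: ge0_ler_powR; rewrite ?nnegrE ?powR_ge0 ?invr_ge0 ?(ltW p0)//.
  by rewrite !mulr_ge0 ?powR_ge0 ?addr_ge0 ?powR_ge0// ltW.
rewrite !powRM ?mulr_ge0 ?powR_ge0//.
rewrite /cst_mixed !rp ?(ltW a0) ?mulr_ge0 ?powR_ge0 ?addr_ge0//.
have E0 : 0 <= 8 `^ (p / 2) by exact: powR_ge0.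
have D0' : 0 <= D `^ p by exact: powR_ge0.
move: (8 `^ (p / 2)) (D `^ p) (m `^ p) E0 D0' mA mB => e d mp e0 d0 mA mB.
have mp0 : 0 <= mp by exact: le_trans (ltW B0) mB.
apply: (@le_trans _ _ (4 * (e * d) * ((Cw + 1) * (a * (mp + mp))))).
  apply: ler_wpM2l; first by rewrite !mulr_ge0.
  apply: ler_pM => //; rewrite ?mulr_ge0 ?addr_ge0 ?powR_ge0 ?(ltW a0) ?(ltW B0) ?lerDl//.
  by apply: ler_wpM2l; [exact: ltW|exact: lerD].
by rewrite le_eqVlt; apply/orP; left; apply/eqP; rewrite -/Cw; ring.
Qed.

(** The cases where the weight, the kernel constant or the function vanishes are set apart. Outside
    them the A_p constant and the norm of [f] are positive, so an infinite A_infinity constant makes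
    the right side infinite; otherwise all constants are real numbers and the finite-window bound
    applies. *)
Theorem sqfun_weighted (p : R) (w : V -> R) (f : V -> R[i]) : 1 < p -> Ap p w ->
  clebesgue_measurable f -> (weighted_norm p w (cabs f) < +oo)%E ->
  (weighted_norm p w (U f) <=
   (cst_mixed p * D)%:E * mixed_Ap_const p w * weighted_norm p w (cabs f))%E.
Proof.
move=> p1 hAp mf fin; have p0 : 0 < p by exact: lt_trans p1.
have pV : p^-1 != 0 by rewrite invr_neq0// gt_eqF.
have cD0 : 0 <= cst_mixed p * D by rewrite mulr_ge0// ltW// cst_mixed_gt0.
have rhs0 : (0 <= (cst_mixed p * D)%:E * mixed_Ap_const p w * weighted_norm p w (cabs f))%E.
  by rewrite mule_ge0 ?poweR_ge0// mule_ge0 ?mixed_Ap_ge0// lee_fin.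
have [w0|[w2 [mw2 w2_gt0 ww2]]] := Ap_weight_pos p1 hAp.
  rewrite {1}/weighted_norm (ae_eq_integralT (g := fun=> 0%E))//.
    by rewrite integral0 poweR0r.
  by apply: filterS w0 => x -> _; rewrite mule0.
have [f1 [f2 [m1 m2 fE]]] := borel_parts mf.
set I := (\int[mu]_y (modulus f1 f2 y `^ p * w2 y)%:E)%E.
have nE : weighted_norm p w (cabs f) = (I `^ p^-1)%E.
  by rewrite /weighted_norm (integral_cabs m1 m2 fE p mw2 ww2).
have I0 : (0 <= I)%E by apply: integral_ge0 => x _; rewrite lee_fin mulr_ge0 ?powR_ge0// ltW.
have Ifin : (I < +oo)%E by apply: (lty_poweRy pV); rewrite -nE.
have part (g : V -> R) : (forall x, `|g x| <= modulus f1 f2 x) -> (\int[mu]_y (`|g y| `^ p * w2 y)%:E <= I)%E.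
  move=> gm; apply: ge0_le_integralT => x _; first by rewrite lee_fin mulr_ge0 ?powR_ge0// ltW.
  rewrite lee_fin ler_wpM2r ?(ltW (w2_gt0 x))//.
  by apply: ge0_ler_powR; rewrite ?nnegrE ?modulus_ge0 ?(ltW p0).
have i1 := part f1 (fun x => part1_le f1 f2 x).
have i2 := part f2 (fun x => part2_le f1 f2 x).
have Lw := locint_w2 n0 hAp mw2 w2_gt0 ww2.
have Ls := locint_sg n0 p1 hAp mw2 w2_gt0 ww2.
have sg0 := dual2_gt0 p w2_gt0; have wsg := dual2_powR p1 w2_gt0.
have l1 := locint_weighted p1 Lw Ls w2_gt0 sg0 wsg m1 (le_lt_trans i1 Ifin).
have l2 := locint_weighted p1 Lw Ls w2_gt0 sg0 wsg m2 (le_lt_trans i2 Ifin).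
have [D00|D1] := eqVneq D 0.
  have Q0 x : Q f x = 0%E by apply: (sqfun2_eq0 x l1 l2 fE D00).
  by rewrite (weighted_norm_eq0 w p0 Q0).
have [I00|I1] := eqVneq I 0%E.
  suff f0 : \forall x \ae mu, f x = 0.
    by rewrite (weighted_norm_eq0 w p0 (fun x => sqfun2_ae0 x f0)).
  have mI : measurable_fun setT (fun y => (modulus f1 f2 y `^ p * w2 y)%:E).
    apply/measurable_EFinP; apply: measurable_funM => //.
    apply: (@measurableT_comp _ _ _ _ _ _ ((@powR R)^~ p)) => //; exact: measurable_modulus.
  have : (\int[mu]_y `|(modulus f1 f2 y `^ p * w2 y)%:E| = 0)%E.
    rewrite -I00; apply: eq_integral => y _.
    by rewrite gee0_abs// lee_fin mulr_ge0 ?powR_ge0// ltW.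
  move/(ae_eq_integral_abs mu measurableT mI); apply: filterS2 fE => y [e1 e2] /(_ Logic.I) [].
  move=> /eqP; rewrite mulf_eq0 [w2 y == 0]gt_eqF// orbF powR_eq0 => /andP[/eqP my _].
  have := part1_le f1 f2 y; have := part2_le f1 f2 y; rewrite my !normr_le0 => /eqP f20 /eqP f10.
  by move: e1 e2; rewrite f10 f20; case: (f y) => u v /= -> ->.
have Dp : 0 < D by rewrite lt_neqAle eq_sym D1.
have cDp : 0 < cst_mixed p * D by rewrite mulr_gt0// cst_mixed_gt0.
have [a a0 [aE joint]] := Ap_const_fin p1 hAp mw2 w2_gt0 ww2.
have apos : (0 < Ap_const p w `^ p^-1)%E by rewrite aE poweR_gt0.
have Npos : (0 < weighted_norm p w (cabs f))%E by rewrite nE poweR_gt0// lt0e I1.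
have inf_case (t : \bar R) : t = +oo%E ->
    (weighted_norm p w (U f) <= (cst_mixed p * D)%:E * (Ap_const p w `^ p^-1 * t) * weighted_norm p w (cabs f))%E.
  by move=> ->; rewrite gt0_muley// gt0_muley// gt0_mulye// leey.
have cV : 0 < (conj_exp p)^-1 by rewrite invr_gt0 /conj_exp divr_gt0// subr_gt0.
have [Ainf|Afin] := eqVneq (Ainfty_const (EFin \o w)) +oo%E.
  by apply: inf_case; rewrite Ainf poweRyr ?gt_eqF// maxye.
have [Binf|Bfin] := eqVneq (Ainfty_const (dual_weight p w)) +oo%E.
  by apply: inf_case; rewrite Binf poweRyr// maxey.
rewrite -ltey in Afin; rewrite -ltey in Bfin.
have ww : \forall x \ae mu, (EFin \o w) x = (w2 x)%:E by apply: filterS ww2 => x /= ->.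
have [A A0 [AE HLw]] := Ainfty_fin mw2 w2_gt0 Lw ww Afin.
have [B B0 [BE HLs]] := Ainfty_fin (measurable_dual2 p mw2) sg0 Ls
  (dual_weight_ae p w2_gt0 ww2) Bfin.
pose Z := `|@cst_weighted R n p| * (a * (B + A `^ (p - 1))).
have Zc0 : 0 <= a * (B + A `^ (p - 1)) by rewrite mulr_ge0 ?addr_ge0 ?powR_ge0 ?(ltW a0) ?(ltW B0).
have Z0 : 0 <= Z by rewrite mulr_ge0.
have wt (psi : int -> V -> R) (g : V -> R) N : (forall k : int, LPker (2 ^ k) (psi k)) ->
    measurable_fun setT g -> (\int[mu]_y (`|g y| `^ p * w2 y)%:E < +oo)%E ->
    (\int[mu]_y (winsq psi N g y `^ (p / 2) * w2 y)%:E <= Z%:E * \int[mu]_y (`|g y| `^ p * w2 y)%:E)%E.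
  move=> LP mg gfin; have s0 : 0 < 2 ^- N :> R by rewrite invr_gt0 exprn_gt0.
  have H := sqsum_weighted n0 p1 Lw Ls w2_gt0 sg0 wsg a0 A0 B0 joint HLw HLs s0 (LPker_window LP (N := N)) mg gfin.
  apply: le_trans H _; apply: lee_wpmul2r.
    by apply: integral_ge0 => y _; rewrite lee_fin mulr_ge0 ?powR_ge0// ltW.
  by rewrite lee_fin; apply: ler_wpM2r => //; exact: ler_norm.
have key := sqfun2_weighted LP1 LP2 D0 m1 m2 fE p1 mw2 w2_gt0 Z0 wt l1 l2 (le_lt_trans i1 Ifin) (le_lt_trans i2 Ifin).
have nU : weighted_norm p w (U f) = ((\int[mu]_x (Q f x `^ (p / 2) * (w2 x)%:E)) `^ p^-1)%E.
  rewrite /weighted_norm; congr (_ `^ _)%E; apply: ae_eq_integralT => //.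
    apply: emeasurable_funM; last exact/measurable_EFinP.
    apply: (measurableT_comp (measurable_poweR _)).
    exact: (measurable_sqfun2 D LP1 LP2 l1 l2 fE).
  by apply: filterS ww2 => x -> _; rewrite sqfun_powR.
rewrite nU.
have c0 : 0 <= 8 `^ (p / 2) * D `^ p by rewrite mulr_ge0 ?powR_ge0.
have K0 : 0 <= 2 * (8 `^ (p / 2) * D `^ p) * Z := mulr_ge0 (mulr_ge0 (ler0n _ 2) c0) Z0.
have iV : 0 <= p^-1 by rewrite invr_ge0 ltW.
apply: (@le_trans _ _ (((4 * (8 `^ (p / 2) * D `^ p) * Z)%:E * I) `^ p^-1)%E).
  apply: le_poweR => //.
    by apply: integral_ge0 => x _; rewrite mule_ge0 ?poweR_ge0// lee_fin ltW.
  apply: le_trans key _; apply: (@le_trans _ _ ((2 * (8 `^ (p / 2) * D `^ p) * Z)%:E * (I + I))%E).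
    by apply: lee_wpmul2l; [rewrite lee_fin|exact: (leeD i1 i2)].
  rewrite ge0_muleDr// -ge0_muleDl ?lee_fin// -EFinD.
  by rewrite (_ : _ + _ = 4 * (8 `^ (p / 2) * D `^ p) * Z)//; ring.
have K1 : (0 <= (4 * (8 `^ (p / 2) * D `^ p) * Z)%:E)%E.
  by rewrite lee_fin; exact: (mulr_ge0 (mulr_ge0 (ler0n _ 4) c0) Z0).
rewrite (poweRM _ K1 I0) nE; apply: lee_wpmul2r; first exact: poweR_ge0.
rewrite /mixed_Ap_const aE AE BE !poweR_EFin -EFin_max -!EFinM lee_fin.
exact: mixed_power.
Qed.

End weighted_norm_bound.

Lemma absorb_cst (R : realType) (a c C D t : R) : 0 <= a -> 0 <= C -> D = a * C -> t <= c ->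
  t * D <= a * c * C.
Proof.
move=> a0 C0 -> tc; rewrite mulrCA mulrA; apply: ler_wpM2r => //.
exact: ler_wpM2l.
Qed.

Lemma absorb_cste (R : realType) (a c C D t : R) (N : \bar R) : 0 <= a -> 0 <= C -> D = a * C ->
  t <= c -> (0 <= N)%E -> ((t * D)%:E * N <= (a * c * C)%:E * N)%E.
Proof. by move=> a0 C0 DE tc N0; apply: lee_wpmul2r => //; rewrite lee_fin absorb_cst. Qed.

Theorem proposition1p8 (R : realType) (n : nat) (n_gt0 : (0 < n)%N)
    (phi : 'rV[R]_n -> R)
    (phi_smooth : smooth phi)
    (phi_ge0 : forall x, 0 <= phi x)
    (phi_radial : radial phi)
    (phi_supp : forall x, 4^-1 < enorm x -> phi x = 0)
    (phi_int : (\int[rV_lebesgue n]_x (phi x)%:E)%E = 1%E) :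
  exists (gamma c : R) (cp : R -> R),
    [/\ 0 < gamma <= 1, 0 < c, forall p, 1 < p -> 0 < cp p &
    forall (K : 'rV[R]_n -> R[i]) (CK : R),
      clebesgue_measurable K ->
      (forall e r : R, 0 < e -> e < r ->
        cintegral [set x | e < enorm x < r] K = 0) ->
      (forall x, x != 0 -> Normc.normc (K x) <= CK * enorm x ^- n) ->
      let U := square_fun phi K in
      [/\
        [/\ forall k x, pv_conv_exists phi K k x,
            forall k x, x != 0 ->
              Normc.normc (pv_conv phi K k x) <= c * CK / 2 ^ (k * n%:Z)
          & forall x y, 0 < 2 * enorm y <= enorm x ->
              (\esum_(k in [set: int])
                 (Normc.normc (pv_conv phi K k (x - y) - pv_conv phi K k x))%:E
               <= (c * CK * (enorm y `^ gamma / enorm x `^ (n%:R + gamma)))%:E)%E],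
        [/\ forall f, clebesgue_measurable f ->
              ('N[rV_lebesgue n]_2%:E[cabs f] < +oo)%E ->
              ('N[rV_lebesgue n]_2%:E[U f]
                 <= (c * CK)%:E * 'N[rV_lebesgue n]_2%:E[cabs f])%E,
            forall f, clebesgue_measurable f ->
              ('N[rV_lebesgue n]_1[cabs f] < +oo)%E ->
              (weakL1_norm (U f)
                 <= (c * CK)%:E * 'N[rV_lebesgue n]_1[cabs f])%E
          & forall f, clebesgue_measurable f ->
              ('N[rV_lebesgue n]_1[cabs f] < +oo)%E ->
              (weakL1_norm (grand_maximal U f)
                 <= (c * CK)%:E * 'N[rV_lebesgue n]_1[cabs f])%E]
      & forall (p : R) (w : 'rV[R]_n -> R) f, 1 < p -> Ap p w ->
          clebesgue_measurable f -> (weighted_norm p w (cabs f) < +oo)%E ->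
          (weighted_norm p w (U f)
             <= (cp p * CK)%:E * mixed_Ap_const p w
                * weighted_norm p w (cabs f))%E]].

Proof.
have cphi : continuous phi by have [] := phi_smooth [::].
have [Lam [Lam0 phi_le phi_lip phi_lip2]] := smooth_bounds phi_smooth phi_supp.
have [kp kpE kp0] : exists2 kp, kp = @cst_k R n Lam & 0 < kp.
  by eexists; [reflexivity|rewrite /cst_k !mulr_gt0 ?exprn_gt0// ltr_wpDl// ltW].
have wc0 : 0 <= @weak_cst R n by rewrite /weak_cst !(addr_ge0, mulr_ge0, exprn_ge0).
have gc0 : 0 <= @grand_cst R n by rewrite /grand_cst !(addr_ge0, mulr_ge0, exprn_ge0).
have L20 : 0 <= @cst_L2 R n by exact: powR_ge0.
have c10 : 0 <= 4 * (4 * n%:R) ^+ n.+1 :> R by rewrite mulr_ge0// exprn_ge0// mulr_ge0.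
(* One constant for the size, regularity and unweighted bounds: the sum of their individual
   constants. *)
have [c2 [c2_2 c2_lip c2_L2 c2_weak c2_grand]] : exists c2 : R, [/\ 2 <= c2, 4 * (4 * n%:R) ^+ n.+1 <= c2,
    @cst_L2 R n <= c2, 16 * @weak_cst R n <= c2 & 2 * @grand_cst R n <= c2].
  exists (2 + 4 * (4 * n%:R) ^+ n.+1 + @cst_L2 R n + 16 * @weak_cst R n + 2 * @grand_cst R n).
  move: (4 * _ ^+ _) (@cst_L2 R n) (@weak_cst R n) (@grand_cst R n) c10 L20 wc0 gc0 => t1 t2 t3 t4.
  by move=> h1 h2 h3 h4; split; lra.
have c20 : 0 < c2 by apply: lt_le_trans c2_2.
(* The regularity exponent is one; the factor [kp] carries the dependence on [phi] through [Lam]. *)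
exists 1, (kp * c2), (fun p => kp * @cst_mixed R n p); split.
- by rewrite ltr01 lexx.
- by rewrite mulr_gt0.
- by move=> p _; rewrite mulr_gt0// cst_mixed_gt0.
move=> K CK mK K_int K_le.
have CK0 : 0 <= CK by exact: (kernel_cst_ge0 n_gt0 K_le).
have [psi1 [psi2 [LP1 LP2 KE]]] :=
  kernel_parts n_gt0 cphi phi_ge0 phi_supp Lam0 phi_le phi_lip phi_lip2 mK K_int K_le.
rewrite -kpE in KE.
have [D DE] : exists D, D = kp * CK by eexists.
have D0 : 0 <= D by rewrite DE mulr_ge0// ltW.
have pvE k x : pv_conv phi K k x = ckernel psi1 psi2 D k x by have [_ ->] := KE k x; rewrite /ckernel DE.
have UE : square_fun phi K = sqfun psi1 psi2 D.
  apply/funext => f; apply/funext => x; rewrite /square_fun /sqfun /sqfun2; congr (_ `^ _)%E.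
  apply: eq_esum => k _; congr (Normc.normc _ ^+ 2)%:E; rewrite /conv_op /cconv.
  by congr cintegral; apply/funext => y; rewrite pvE.
have cD t := @absorb_cst R kp c2 CK D t (ltW kp0) CK0 DE.
have cDe t N := @absorb_cste R kp c2 CK D t N (ltW kp0) CK0 DE.
move=> U; rewrite /U UE; split; [split|split|].
- by move=> k x; have [] := KE k x.
- move=> k x _; rewrite pvE; apply: le_trans (ckernel_size LP1 LP2 D0 k x) _.
  by apply: ler_wpM2r; [rewrite invr_ge0 exprz_ge0|exact: (cD _ c2_2)].
- move=> x y xy; under eq_esum do rewrite !pvE.
  apply: le_trans (ckernel_lip_sum n_gt0 LP1 LP2 D0 xy) _.
  have x0 := enorm_ge0 x; have y0 := enorm_ge0 y.
  have -> : enorm x `^ (n%:R + 1) = enorm x ^+ n.+1 by rewrite natr1; exact: (powR_mulrn _ x0).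
  rewrite (powRr1 y0) lee_fin [4 * D * _]mulrAC.
  exact: (ler_wpM2r (divr_ge0 y0 (exprn_ge0 _ x0)) (cD _ c2_lip)).
- move=> f mf fin; apply: le_trans (sqfun_L2 LP1 LP2 D0 mf fin) _.
  exact: (cDe _ _ c2_L2 (Lnorm_ge0 _ _ _)).
- move=> f mf fin; apply: le_trans (sqfun_weak n_gt0 LP1 LP2 D0 mf fin) _.
  exact: (cDe _ _ c2_weak (Lnorm_ge0 _ _ _)).
- move=> f mf fin; apply: le_trans (grand_maximal_sqfun_weak n_gt0 LP1 LP2 D0 mf fin) _.
  exact: (cDe _ _ c2_grand (Lnorm_ge0 _ _ _)).
- move=> p w f p1 hAp mf fin; apply: le_trans (sqfun_weighted n_gt0 LP1 LP2 D0 p1 hAp mf fin) _.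
  by rewrite DE mulrA [_ * kp]mulrC.
Qed.
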